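(* Let $u\in Y$ be the weak solution of the heat equation, $u_{h\tau}\in V_{h\tau}$ the numerical solution and $\mathcal Iu_{h\tau}$ its reconstruction, as defined in the context. For each $1\le n\le N$ let the coarsening error indicator $\eta_{\mathrm C}^n$ and temporal data oscillation $\eta_{\mathrm{osc},\tau}^n$ be $$\eta_{\mathrm C}^n:=\sqrt{\tfrac{\tau_n(q_n+1)}{(2q_n+1)(2q_n+3)}}\;\big\|\nabla\{u_{h\tau}(t_{n-1})-P_h^n[u_{h\tau}(t_{n-1})]\}\big\|,\qquad [\eta_{\mathrm{osc},\tau}^n]^2:=\int_{I_n}\|f(t)-f_\tau(t)\|_{H^{-1}(\Omega)}^2\,dt,$$ where $P_h^n:H^1_0(\Omega)\to V_h^n$ is the elliptic projection defined by $(\nabla P_h^nw,\nabla v_h)=(\nabla w,\nabla v_h)$ for all $v_h\in V_h^n$. Then, for each $1\le n\le N$, $$\int_{I_n}\|\nabla(u_{h\tau}-\mathcal Iu_{h\tau})\|^2\,dt\le 8\,\|\mathcal R_Y(\mathcal Iu_{h\tau})|_{I_n}\|_{X'}^2+\min\{[\eta_{\mathrm C}^n]^2,\,8[\eta_{\mathrm{osc},\tau}^n]^2\}.$$ Furthermore, $$\|u-\mathcal Iu_{h\tau}\|_Y^2\le\|u-u_{h\tau}\|_{\mathcal E_Y}^2\le 9\,\|u-\mathcal Iu_{h\tau}\|_Y^2+\sum_{n=1}^N\min\{[\eta_{\mathrm C}^n]^2,\,8[\eta_{\mathrm{osc},\tau}^n]^2\}.$$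
   Context: **Problem.** $\Omega\subset\mathbb R^d$, $1\le d\le3$, is a bounded, connected, polyhedral open set with Lipschitz boundary; $T>0$; $f\in L^2(0,T;L^2(\Omega))$; $u_0\in L^2(\Omega)$. $(\cdot,\cdot)$, $\|\cdot\|$ are the $L^2(\Omega)$ inner product and norm. $H^1_0(\Omega)$ is normed by $\|\nabla\cdot\|$, $\|\cdot\|_{H^{-1}(\Omega)}$ is the dual norm, $\langle\cdot,\cdot\rangle$ the duality pairing. $X:=L^2(0,T;H^1_0(\Omega))$, $Y:=L^2(0,T;H^1_0(\Omega))\cap H^1(0,T;H^{-1}(\Omega))$, $$\|v\|_X^2:=\int_0^T\|\nabla v\|^2dt,\qquad\|\varphi\|_Y^2:=\int_0^T\|\partial_t\varphi\|_{H^{-1}(\Omega)}^2+\|\nabla\varphi\|^2dt+\|\varphi(T)\|^2.$$ The weak solution $u\in Y$ of $\partial_tu-\Delta u=f$ (homogeneous Dirichlet conditions) satisfies $u(0)=u_0$ and $\int_0^T\langle\partial_tu,v\rangle+(\nabla u,\nabla v)\,dt=\int_0^T(f,v)\,dt$ for all $v\in X$. **Time partition.** $0=t_0<\dots<t_N=T$, $I_n:=(t_{n-1},t_n)$, $\tau_n:=t_n-t_{n-1}$, temporal degrees $q_n\ge0$. $\mathcal Q_q(I_n;V)$ is the space of $V$-valued univariate polynomials of degree at most $q$ on $I_n$. **Meshes and spaces.** For $0\le n\le N$, $\mathcal T^n$ is a matching simplicial mesh of $\Omega$ (shape-regular uniformly in $n$) with degrees $p_K\ge1$, $K\in\mathcal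 T^n$, and $V_h^n:=\{v_h\in H^1_0(\Omega):v_h|_K\in\mathcal P_{p_K}(K)\ \forall K\in\mathcal T^n\}$ ($\mathcal P_p$: total degree at most $p$). For $1\le n\le N$, there is a common refinement matching simplicial mesh $\widetilde{\mathcal T^n}$ of $\mathcal T^{n-1}$ and $\mathcal T^n$ (same shape-regularity, each element contained in a single element of each of the two meshes), with degrees $p_{\widetilde K}$, such that $V_h^{n-1}+V_h^n\subset\widetilde{V_h^n}$, the corresponding $H^1_0$-conforming space. $V_{h\tau}$ is the set of $v_{h\tau}$ with $v_{h\tau}|_{(0,T)}\in X$, $v_{h\tau}|_{I_n}\in\mathcal Q_{q_n}(I_n;V_h^n)$ for all $n$, $v_{h\tau}(0)\in V_h^0$; functions are left-continuous at each $t_n$, $n\ge1$; $v_{h\tau}(t_n^+)$ is the right limit; $[\![v]\!]_n:=v(t_n)-v(t_n^+)$, $0\le n\le N-1$. **Scheme.** $\Pi_hu_0\in V_h^0$ is a given approximation of $u_0$; $u_{h\tau}\in V_{h\tau}$ satisfies $u_{h\tau}(0)=\Pi_hu_0$ and, for each $n$ and all $v_{h\tau}\in\mathcal Q_{q_n}(I_n;V_h^n)$, $$\int_{I_n}(\partial_tu_{h\tau},v_{h\tau})+(\nabla u_{h\tau},\nabla v_{h\tau})\,dt-([\![u_{h\tau}]\!]_{n-1},v_{h\tau}(t_{n-1}^+))=\int_{I_n}(f,v_{h\tau})\,dt.$$ **Reconstruction.** $L_q^n$ is the $q$-th Legendre polynomial mapped affinely from $(-1,1)$ to $I_n$ ($L^n_q(t_n)=1$).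 On $Y+V_{h\tau}$ (where jumps are defined by the same formula, and vanish on $Y$), $(\mathcal Iv)|_{I_n}:=v|_{I_n}+\frac{(-1)^{q_n}}2(L^n_{q_n}-L^n_{q_n+1})[\![v]\!]_{n-1}$. This is a linear map $\mathcal I:Y+V_{h\tau}\to Y$, with $\mathcal Iv=v$ iff $v\in Y$. **Composite norm.** $\|v\|_{\mathcal E_Y}^2:=\|\mathcal Iv\|_Y^2+\|v-\mathcal Iv\|_X^2$ for $v\in Y+V_{h\tau}$; hence $\|u-u_{h\tau}\|_{\mathcal E_Y}^2=\|u-\mathcal Iu_{h\tau}\|_Y^2+\|u_{h\tau}-\mathcal Iu_{h\tau}\|_X^2$. **Time-localized residual norm.** $$\|\mathcal R_Y(\mathcal Iu_{h\tau})|_{I_n}\|_{X'}:=\sup_{v\in X,\ \|v\|_X=1}\int_{I_n}(f,v)-\langle\partial_t\mathcal Iu_{h\tau},v\rangle-(\nabla\mathcal Iu_{h\tau},\nabla v)\,dt.$$ **Temporal data approximation.** $f_\tau|_{I_n}\in\mathcal Q_{q_n}(I_n;L^2(\Omega))$ is defined on each $I_n$ by $\int_{I_n}(f-f_\tau,v)\,dt=0$ for all $v\in\mathcal Q_{q_n}(I_n;L^2(\Omega))$. *)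

(* Defs.v *)
From HB Require Import structures.
From mathcomp Require Import all_boot all_order all_algebra.
From mathcomp Require Import all_classical all_reals all_analysis.

Set Implicit Arguments.
Unset Strict Implicit.
Unset Printing Implicit Defensive.

Import Order.TTheory GRing.Theory Num.Theory.
Import numFieldNormedType.Exports.

Local Open Scope classical_set_scope.
Local Open Scope ring_scope.

Definition rV_display : measure_display. Proof. exact: default_measure_display. Qed.

Section rV_measurable.
Context (R : realType) (d : nat).

Definition rV_coord (i : 'I_d) (x : 'rV[R]_d) : R := x ord0 i.

Let rV_set0 : g_sigma_preimage rV_coord set0.
Proof. exact: sigma_algebra0. Qed.

Let rV_setC A : g_sigma_preimage rV_coord A -> g_sigma_preimage rV_coord (~` A).
Proof. exact: sigma_algebraC. Qed.

Let rV_bigcup (F : (set 'rV[R]_d)^nat) :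
  (forall i, g_sigma_preimage rV_coord (F i)) ->
  g_sigma_preimage rV_coord (\bigcup_i (F i)).
Proof. exact: sigma_algebra_bigcup. Qed.

(* The product sigma-algebra, i.e. the Borel sets of R^d. *)
HB.instance Definition _ := @isMeasurable.Build rV_display
  'rV[R]_d (g_sigma_preimage rV_coord) rV_set0 rV_setC rV_bigcup.

Lemma measurable_rV_coord (i : 'I_d) :
  measurable_fun [set: 'rV[R]_d] (fun x : 'rV[R]_d => x ord0 i).
Proof.
move=> _ Y mY; rewrite setTI; apply: sub_sigma_algebra => /=.
rewrite -bigcup_seq/=; exists i => /=; first by rewrite mem_index_enum.
by exists Y => //; rewrite setTI.
Qed.

Lemma measurable_fun_rV d1 (T1 : measurableType d1) (f : T1 -> 'rV[R]_d) :
  (forall i, measurable_fun [set: T1] (fun x => f x ord0 i)) ->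
  measurable_fun [set: T1] f.
Proof.
move=> mf.
have sub : g_sigma_preimage (fun i => rV_coord i \o f) `<=` measurable.
  apply: smallest_sub; first exact: sigma_algebra_measurable.
  move=> A; rewrite -bigcup_seq/= => -[i _ [B mB <-]].
  exact: mf.
move=> _ A mA; rewrite g_sigma_preimage_comp in sub.
by apply: sub; exists A.
Qed.

End rV_measurable.

Lemma product_sigma_finite (R : realType) d1 d2 (T1 : measurableType d1)
    (T2 : measurableType d2) (m1 : {sigma_finite_measure set T1 -> \bar R})
    (m2 : {sigma_finite_measure set T2 -> \bar R}) :
  sigma_finite setT (m1 \x m2)%E.
Proof.
have /sigma_finiteP[F [TF ndF Foo]] := sigma_finiteT m1.
have /sigma_finiteP[G [TG ndG Goo]] := sigma_finiteT m2.
exists (fun n => F n `*` G n).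
  rewrite -setXTT TF TG predeqE => -[x y]; split.
    move=> [/= [n _ Fnx] [k _ Gky]]; exists (maxn n k) => //; split.
    - by move: x Fnx; exact/subsetPset/ndF/leq_maxl.
    - by move: y Gky; exact/subsetPset/ndG/leq_maxr.
  by move=> [n _ []/= ? ?]; split; exists n.
move=> k; have [? ?] := Foo k; have [? ?] := Goo k.
split; first exact: measurableX.
by rewrite product_measure1E// lte_mul_pinfty// ge0_fin_numE.
Qed.

Section lebesgue_rV.
Context (R : realType).

Definition rV_cons (d : nat) (p : R * 'rV[R]_d) : 'rV[R]_d.+1 :=
  \row_i (if unlift ord0 i is Some j then p.2 ord0 j else p.1).

Definition rV_uncons (d : nat) (x : 'rV[R]_d.+1) : R * 'rV[R]_d :=
  (x ord0 ord0, \row_j x ord0 (lift ord0 j)).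

Lemma rV_consK (d : nat) : cancel (@rV_cons d) (@rV_uncons d).
Proof.
move=> [a y]; rewrite /rV_uncons mxE unlift_none; congr pair.
by apply/rowP => j; rewrite !mxE liftK.
Qed.

Lemma measurable_rV_cons (d : nat) : measurable_fun setT (@rV_cons d).
Proof.
apply: measurable_fun_rV => i; case: (unliftP ord0 i) => [j|] ->.
  rewrite (_ : (fun _ => _) = fun p : R * 'rV[R]_d => p.2 ord0 j); last first.
    by apply/funext => p; rewrite mxE liftK.
  by apply: (measurableT_comp (measurable_rV_coord j)).
rewrite (_ : (fun _ => _) = fst)//.
by apply/funext => p; rewrite mxE unlift_none.
Qed.

Lemma measurable_rV_uncons (d : nat) : measurable_fun setT (@rV_uncons d).
Proof.
apply/measurable_fun_pairP; split; first exact: measurable_rV_coord.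
apply: measurable_fun_rV => j.
rewrite (_ : (fun _ => _) = fun x : 'rV[R]_d.+1 => x ord0 (lift ord0 j)).
  exact: measurable_rV_coord.
by apply/funext => x; rewrite /= mxE.
Qed.

Section step.
Context (d : nat) (mu : {sigma_finite_measure set 'rV[R]_d -> \bar R}).

Definition lebesgue_rV_step : set 'rV[R]_d.+1 -> \bar R :=
  pushforward (lebesgue_measure \x mu)%E (@rV_cons d).

Let step0 : lebesgue_rV_step set0 = 0%E.
Proof. by rewrite /lebesgue_rV_step /pushforward preimage_set0 measure0. Qed.

Let step_ge0 A : (0 <= lebesgue_rV_step A)%E.
Proof. by rewrite /lebesgue_rV_step /pushforward; apply: measure_ge0. Qed.

Let step_sigma_additive : semi_sigma_additive lebesgue_rV_step.
Proof.
move=> F mF tF mUF; rewrite /lebesgue_rV_step /pushforward preimage_bigcup.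
have mpre A : measurable A -> measurable (@rV_cons d @^-1` A).
  by move=> mA; rewrite -[X in measurable X]setTI; exact: measurable_rV_cons.
apply: measure_semi_sigma_additive.
- by move=> n; exact: mpre.
- apply/trivIsetP => /= i j _ _ ij; rewrite -preimage_setI.
  by move/trivIsetP : tF => /(_ _ _ _ _ ij) ->//; rewrite preimage_set0.
- by rewrite -preimage_bigcup; exact: mpre.
Qed.

HB.instance Definition _ := isMeasure.Build _ _ _
  lebesgue_rV_step step0 step_ge0 step_sigma_additive.

Lemma lebesgue_rV_step_sigma_finite : sigma_finite setT lebesgue_rV_step.
Proof.
have [F FT Ffin] := product_sigma_finite lebesgue_measure mu.
exists (fun i => @rV_uncons d @^-1` F i).
  by rewrite -preimage_bigcup -FT preimage_setT.
move=> i; have [mF Foo] := Ffin i; split.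
  by rewrite -[_ @^-1` _]setTI; exact: measurable_rV_uncons.
rewrite /lebesgue_rV_step /pushforward -comp_preimage.
by rewrite (_ : _ \o _ = id)//; apply/funext => p; exact: rV_consK.
Qed.

HB.instance Definition _ :=
  Measure_isSigmaFinite.Build _ _ _ lebesgue_rV_step lebesgue_rV_step_sigma_finite.

End step.

(* The d-dimensional Lebesgue measure, as an iterated product of
   one-dimensional ones; R^0 is a single point of mass one. *)
Fixpoint lebesgue_rV (d : nat) : {sigma_finite_measure set 'rV[R]_d -> \bar R} :=
  match d with
  | 0 => \d_(0 : 'rV[R]_0)
  | d'.+1 => lebesgue_rV_step (lebesgue_rV d')
  end.

End lebesgue_rV.

Section geometry.
Context (R : realType) (d : nat).
Implicit Types (Omega : set 'rV[R]_d) (x y e c : 'rV[R]_d).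

(* The library norm on row vectors is the sup norm; enorm is the Euclidean
   one. *)
Definition dotp x y : R := \sum_(i < d) x ord0 i * y ord0 i.
Definition enorm x : R := Num.sqrt (dotp x x).

(* Near each boundary point, in the direction of a unit vector e, Omega is the
   strict epigraph of a Lipschitz function of the component orthogonal to e. *)
Definition lipschitz_boundary Omega :=
  forall x, (closure Omega `\` Omega) x ->
  exists e (g : 'rV[R]_d -> R) (L r : R),
    [/\ enorm e = 1, 0 < r,
        forall y z, `|g y - g z| <= L * enorm (y - z) &
        forall y, enorm (y - x) < r ->
          (Omega y <-> g (y - dotp y e *: e) < dotp y e)].

(* The closure is a finite union of convex polyhedra, i.e. of finite
   intersections of half-spaces. *)
Definition polyhedral Omega :=
  exists (m k : nat) (a : 'I_m -> 'I_k -> 'rV[R]_d) (b : 'I_m -> 'I_k -> R),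
    closure Omega = [set x | exists i, forall j, dotp (a i j) x <= b i j].

Definition polyhedral_lipschitz_domain Omega :=
  [/\ Omega !=set0, open Omega, connected Omega, bounded_set Omega &
      polyhedral Omega /\ lipschitz_boundary Omega].

(* A simplex is given by its d+1 vertices. *)
Definition nondegenerate (K : 'I_d.+1 -> 'rV[R]_d) :=
  forall l : 'I_d.+1 -> R,
    \sum_i l i = 0 -> \sum_i l i *: K i = 0 -> forall i, l i = 0.

Definition simplex (K : 'I_d.+1 -> 'rV[R]_d) : set 'rV[R]_d :=
  [set x | exists l : 'I_d.+1 -> R,
     [/\ forall i, 0 <= l i, \sum_i l i = 1 & x = \sum_i l i *: K i]].

(* The face of K spanned by the vertices that K shares with K'
   (empty if there is none). *)
Definition common_face (K K' : 'I_d.+1 -> 'rV[R]_d) : set 'rV[R]_d :=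
  [set x | exists l : 'I_d.+1 -> R,
     [/\ forall i, 0 <= l i, \sum_i l i = 1, x = \sum_i l i *: K i &
         forall i, l i != 0 -> exists j, K i = K' j]].

Record mesh := Mesh {
  ncell : nat;
  cell : 'I_ncell -> 'I_d.+1 -> 'rV[R]_d;
  mdeg : 'I_ncell -> nat }.

Definition matching_simplicial Omega (M : mesh) :=
  [/\ forall K, nondegenerate (@cell M K),
      closure Omega = [set x | exists K, simplex (@cell M K) x],
      forall K K', K != K' -> simplex (@cell M K) <> simplex (@cell M K') &
      forall K K', simplex (@cell M K) `&` simplex (@cell M K') =
                   common_face (@cell M K) (@cell M K')].

(* The ratio of the diameter of each element to the diameter 2 r of an
   inscribed ball is at most kappa. *)
Definition shape_regular (kappa : R) (M : mesh) :=
  forall K, exists c r,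
    [/\ 0 < r, forall x, enorm (x - c) <= r -> simplex (@cell M K) x &
        forall x y, simplex (@cell M K) x -> simplex (@cell M K) y ->
          enorm (x - y) <= kappa * (2 * r)].

Definition refines (M' M : mesh) :=
  forall K', exists K, simplex (@cell M' K') `<=` simplex (@cell M K).

Definition mpolynomial (p : nat) (v : 'rV[R]_d -> R) :=
  exists c : {ffun 'I_d -> 'I_p.+1} -> R,
    forall x, v x = \sum_(al : {ffun 'I_d -> 'I_p.+1} | (\sum_i al i <= p)%N)
                      c al * \prod_(i < d) x ord0 i ^+ al i.

End geometry.

Section bochner.
Context (R : realType).

Definition time_int (a b : R) (F : R -> R) : R :=
  \int[lebesgue_measure]_(t in `]a, b[) F t.

Definition time_ae (a b : R) (P : R -> Prop) :=
  {ae lebesgue_measure, forall t, `]a, b[%classic t -> P t}.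

(* Here S is a subspace of W and N is a seminorm on S: elements of the
   function spaces below are represented by functions and are identified when
   the seminorm of their difference vanishes. *)
Context (W : lmodType R) (S : set W) (N : W -> R).

Definition time_simple (s : R -> W) :=
  exists (m : nat) (A : 'I_m -> set R) (e : 'I_m -> W),
    [/\ forall i, measurable (A i), forall i, S (e i) &
        s = fun t => \sum_(i < m) (\1_(A i) t : R) *: e i].

Definition strongly_measurable (a b : R) (v : R -> W) :=
  exists s : nat -> R -> W, (forall k, time_simple (s k)) /\
    time_ae a b (fun t => N (v t - s k t) @[k --> \oo] --> (0 : R)).

(* The space L^2(a, b; S). *)
Definition bochner2 (a b : R) : set (R -> W) :=
  [set v | [/\ time_ae a b (fun t => S (v t)), strongly_measurable a b v &
     (\int[lebesgue_measure]_(t in `]a, b[) (N (v t) ^+ 2)%:E < +oo)%E]].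

End bochner.

Section spaces.
Context (R : realType) (d : nat) (Omega : set 'rV[R]_d).

Notation pt := 'rV[R]_d.
Notation fct := (pt -> R).

Implicit Types (v w z phi : fct).

Definition L2 : set fct :=
  [set v : fct | measurable_fun Omega v /\
     (\int[lebesgue_rV R d]_(x in Omega) (v x ^+ 2)%:E < +oo)%E].

Definition ip v w : R := \int[lebesgue_rV R d]_(x in Omega) (v x * w x).
Definition nrm v : R := Num.sqrt (ip v v).

Definition eqae v w := ae_eq (lebesgue_rV R d) Omega v w.

Definition partial (i : 'I_d) (phi : fct) : fct :=
  fun x => 'D_(delta_mx ord0 i) phi x.

Definition partials (s : seq 'I_d) (phi : fct) : fct := foldr partial phi s.

Definition smooth (phi : fct) :=
  forall s, continuous (partials s phi) /\
    forall i x, derivable (partials s phi) x (delta_mx ord0 i).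

(* C_c^oo(Omega) *)
Definition test_function : set fct :=
  [set phi | [/\ smooth phi, compact (closure [set x | phi x != 0]) &
                 closure [set x | phi x != 0] `<=` Omega]].

Definition is_weak_grad v (G : 'I_d -> fct) :=
  (forall i, L2 (G i)) /\
  forall phi, test_function phi -> forall i, ip v (partial i phi) = - ip (G i) phi.

(* The weak gradient, which is unique almost everywhere in Omega when it
   exists. *)
Definition grad v : 'I_d -> fct := xget (fun _ => 0) [set G | is_weak_grad v G].

Definition H1 : set fct := [set v | L2 v /\ exists G, is_weak_grad v G].

Definition gip v w : R := \sum_(i < d) ip (grad v i) (grad w i).
Definition gnrm v : R := Num.sqrt (gip v v).

(* The closure of C_c^oo(Omega) in H^1(Omega). *)
Definition H10 : set fct :=
  [set v | H1 v /\ forall eps : R, 0 < eps -> exists phi, test_function phi /\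
     nrm (v - phi) ^+ 2 + gnrm (v - phi) ^+ 2 < eps ^+ 2].

(* A functional is a function on all of fct; its values outside H10 are
   irrelevant. *)
Definition Hm1 : set (fct -> R) :=
  [set g | (forall a v w, H10 v -> H10 w -> g (a *: v + w) = a * g v + g w) /\
           exists C : R, forall v, H10 v -> `|g v| <= C * gnrm v].

Definition dual_nrm (g : fct -> R) : R :=
  sup [set `|g v| | v in [set v | H10 v /\ gnrm v <= 1]].

Definition Vh (M : mesh R d) : set fct :=
  [set v | H10 v /\ forall K : 'I_(ncell M), exists2 p, mpolynomial (mdeg K) p &
     ae_eq (lebesgue_rV R d) (Omega `&` simplex (cell K)) v p].

Definition elliptic_projection (V : set fct) (P : fct -> fct) :=
  forall w, H10 w -> V (P w) /\ forall v, V v -> gip (P w) v = gip w v.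

Section space_time.
Context (T : R).
Implicit Types (u : R -> fct).

Definition Xspace : set (R -> fct) := bochner2 H10 gnrm 0 T.
Definition Xnrm u : R := Num.sqrt (time_int 0 T (fun t => gnrm (u t) ^+ 2)).

(* C_c^oo(0, T) *)
Definition time_test : set (R -> R) :=
  [set psi | [/\ forall k t, derivable (derive1n k psi) t 1,
                 compact (closure [set t | psi t != 0]) &
                 closure [set t | psi t != 0] `<=` `]0, T[ ]].

(* g, in L^2(0,T;H^-1), is the weak time derivative of u; the identity in H^-1
   is tested against the elements of H10. *)
Definition is_weak_dt u (g : R -> fct -> R) :=
  bochner2 Hm1 dual_nrm 0 T g /\
  forall psi w, time_test psi -> H10 w ->
    time_int 0 T (fun t => derive1 psi t * ip (u t) w) =
    - time_int 0 T (fun t => psi t * g t w).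

(* The weak time derivative, unique almost everywhere when it exists. *)
Definition weak_dt u : R -> fct -> R :=
  xget (fun _ _ => 0) [set g | is_weak_dt u g].

Definition L2_cvg (F : set_system R) u w := nrm (u s - w) @[s --> F] --> (0 : R).

Definition L2_continuous u :=
  forall t, 0 <= t <= T -> L2 (u t) /\ L2_cvg (within `[0, T] (nbhs t)) u (u t).

(* An element of Y is represented by its continuous representative
   [0, T] -> L^2(Omega), so that u 0 and u T are meaningful. *)
Definition Yspace : set (R -> fct) :=
  [set u | [/\ Xspace u, L2_continuous u & exists g, is_weak_dt u g]].

Definition Ynrm u : R :=
  Num.sqrt (time_int 0 T (fun t => dual_nrm (weak_dt u t) ^+ 2 + gnrm (u t) ^+ 2)
            + nrm (u T) ^+ 2).

Definition weak_solution (f : R -> fct) (u0 : fct) u :=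
  [/\ Yspace u, eqae (u 0) u0 &
      forall v : R -> fct, Xspace v ->
        time_int 0 T (fun t => weak_dt u t (v t) + gip (u t) (v t)) =
        time_int 0 T (fun t => ip (f t) (v t))].

(* The restriction of v to (a, b) is a V-valued polynomial of degree at most
   q in time. *)
Definition Qspace (q : nat) (a b : R) (V : set fct) : set (R -> fct) :=
  [set v | exists c : 'I_q.+1 -> fct, (forall k, V (c k)) /\
     forall t, a < t < b -> V (v t) /\ eqae (v t) (\sum_(k < q.+1) t ^+ k *: c k)].

(* Strong derivative in L^2(Omega), used for functions that are polynomial in
   time. *)
Definition strong_dt u (t : R) : fct :=
  xget 0 [set w | L2 w /\
    nrm (h^-1 *: (u (t + h) - u t) - w) @[h --> 0^'] --> (0 : R)].

Definition right_limit u (t : R) : fct := xget 0 [set w | L2 w /\ L2_cvg t^'+ u w].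

(* Time partition 0 = ts 0 < ... < ts N = T with degrees q n on
   (ts n.-1, ts n), and meshes TT n. *)
Section discretization.
Context (N : nat) (ts : nat -> R) (q : nat -> nat) (TT : nat -> mesh R d).

Definition time_partition :=
  [/\ ts 0%N = 0, ts N = T & forall n, (n < N)%N -> ts n < ts n.+1].

Definition intI (n : nat) (F : R -> R) : R := time_int (ts n.-1) (ts n) F.

Definition Vht : set (R -> fct) :=
  [set v | [/\ Xspace v,
     forall n, (1 <= n <= N)%N -> Qspace (q n) (ts n.-1) (ts n) (Vh (TT n)) v,
     Vh (TT 0%N) (v 0) &
     forall n, (1 <= n <= N)%N -> L2 (v (ts n)) /\ L2_cvg (ts n)^'- v (v (ts n))]].

Definition jump u (n : nat) : fct := u (ts n) - right_limit u (ts n).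

Definition numerical_solution (f : R -> fct) (piu0 : fct) u :=
  [/\ Vht u, eqae (u 0) piu0 &
      forall n (v : R -> fct), (1 <= n <= N)%N ->
        Qspace (q n) (ts n.-1) (ts n) (Vh (TT n)) v ->
        intI n (fun t => ip (strong_dt u t) (v t) + gip (u t) (v t))
          - ip (jump u n.-1) (right_limit v (ts n.-1)) =
        intI n (fun t => ip (f t) (v t))].

(* Rodrigues' formula on (-1, 1). *)
Definition legendre (k : nat) : {poly R} :=
  ((2 ^+ k * k`!%:R)^-1) *: (('X ^+ 2 - 1) ^+ k)^`(k).

Definition legendreI (n k : nat) (t : R) : R :=
  (legendre k).[(2 * t - ts n.-1 - ts n) / (ts n - ts n.-1)].

(* The value at the right end point of each interval is the limit from the
   left, and the value at 0 is u 0; this is the continuous representative. *)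
Definition reconstruction u : R -> fct := fun t =>
  u t + \sum_(1 <= n < N.+1)
    ((\1_(`]ts n.-1, ts n]%classic) t : R) * ((-1) ^+ q n / 2)
       * (legendreI n (q n) t - legendreI n (q n).+1 t)) *: jump u n.-1.

Definition EYnrm u : R :=
  Num.sqrt (Ynrm (reconstruction u) ^+ 2 + Xnrm (u - reconstruction u) ^+ 2).

Definition residual_nrm (f w : R -> fct) (n : nat) : R :=
  sup [set intI n (fun t => ip (f t) (v t) - weak_dt w t (v t) - gip (w t) (v t))
      | v in [set v | Xspace v /\ Xnrm v = 1]].

Definition temporal_data_approx (f ftau : R -> fct) :=
  forall n, (1 <= n <= N)%N ->
    Qspace (q n) (ts n.-1) (ts n) L2 ftau /\
    forall v : R -> fct, Qspace (q n) (ts n.-1) (ts n) L2 v ->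
      intI n (fun t => ip (f t - ftau t) (v t)) = 0.

Definition eta_C (P : nat -> fct -> fct) u (n : nat) : R :=
  Num.sqrt ((ts n - ts n.-1) * (q n).+1%:R
            / ((2 * q n + 1)%N%:R * (2 * q n + 3)%N%:R))
  * gnrm (u (ts n.-1) - P n (u (ts n.-1))).

(* ip w is the functional (w, .). *)
Definition eta_osc (f ftau : R -> fct) (n : nat) : R :=
  Num.sqrt (intI n (fun t => dual_nrm (ip (f t - ftau t)) ^+ 2)).

End discretization.
End space_time.
End spaces.

(* Main.v *)
Require Import Defs.
From HB Require Import structures.
From mathcomp Require Import all_boot all_order all_algebra.
From mathcomp Require Import all_classical all_reals all_analysis.
From mathcomp Require Import measurable_realfun.
From mathcomp Require Import zify ring lra.

Set Implicit Arguments.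
Unset Strict Implicit.
Unset Printing Implicit Defensive.

Import Order.TTheory GRing.Theory Num.Theory.
Import numFieldNormedType.Exports.

Local Open Scope classical_set_scope.
Local Open Scope ring_scope.

(** On the interval (t_(n-1), t_n) the reconstruction differs from the discrete
    solution by a scalar polynomial in time, the correction, times the jump of
    the discrete solution at t_(n-1).  The quantity to bound is therefore a
    known factor times the squared Dirichlet norm of the jump, and the first
    estimate comes from testing the residual with a Legendre polynomial in time
    times an element of H^1_0.

    With degree q and a discrete function z, the scheme and the derivative of
    the correction cancel each other up to the elliptic term, so the residual
    controls the Dirichlet product of the jump with z.  Taking for z the
    elliptic projection of u_h(t_(n-1)) minus the limit of u_h from the right
    gives the discrete part of the jump; the rest of the jump is the coarsening
    error, orthogonal to the discrete part (jump_split, coarsening_branch).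
    With degree q + 1 and the jump itself, all discrete terms vanish by
    orthogonality and the data enter only through f - f_tau
    (oscillation_branch).

    For the second estimate, u has no jumps, so the reconstruction of u - u_h
    is e = u - I u_h almost everywhere, and the composite norm is the Y norm of
    e plus the local quantities just bounded (EYnrm_sqr).  What remains is that
    the squares of the local residual norms add up to at most the squared Y
    norm of e (residual_sum).  By the weak formulation the residual on an
    interval is v |-> <e', v> + (grad e, grad v).  Multiples r_n of local test
    functions of unit norm are glued into one function V, and the expansion of
    0 <= |e'|^2 + 2 <e', e - V> + |grad (e - V)|^2, where the first norm is that
    of H^-1, gives after integration that the sum of the r_n^2 is at most the
    integral of |e'|^2 + |grad e|^2 + 2 <e', e>.  The integral of 2 <e', e> is
    at most |e(T)|^2 (error_energy).

    This last bound is a product rule.  Against the reconstruction, a continuous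
    piecewise polynomial in time, the product rule follows from the definition
    of the weak derivative applied to scalar functions (pw_cross).  For u with
    itself an inequality suffices, and is obtained from the equation along
    partitions of the time interval (energy_inequality): telescoping differences
    of |u|^2 are pairings of u' with step functions, the equation trades them
    for the data and the Dirichlet form, and the latter is bounded by Riemann
    sums that do not exceed the integral for a well chosen offset of the
    partition (riemann_offset).

    Elements of the function spaces are functions modulo null sets.  The
    integrals over time that occur are those of scalar functions with an
    integrable representative (aeint); norms and pairings of elements of Bochner
    spaces are of this kind (bochner2_pairing).  In space, uniqueness of weak
    gradients makes the Dirichlet form bilinear (weak_grad_unique), and the
    Poincare inequality embeds L^2 into H^-1 (poincare, ip_Hm1). *)

(** * Integrals of classes of functions modulo null sets *)

Import HBNNSimple.

Section ae_integral.
Context d (T : measurableType d) (R : realType) (mu : {measure set T -> \bar R}).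
Implicit Types (D A : set T) (F G : T -> R).

(** A simple function below [f], once set to zero on the null set [N], lies
    below [g] and has the same integral. *)
Lemma ge0_le_integral_off (D N : set T) (f g : T -> \bar R) :
  measurable D -> measurable N -> mu N = 0%E ->
  (forall x, D x -> 0 <= f x)%E -> (forall x, D x -> 0 <= g x)%E ->
  (forall x, D x -> ~ N x -> f x = g x) ->
  (\int[mu]_(x in D) f x <= \int[mu]_(x in D) g x)%E.
Proof.
move=> mD mN N0 f0 g0 fg.
rewrite ge0_integralE// [leRHS]ge0_integralE//.
apply: ge_ereal_sup => _ /= [h hf <-].
pose h' : {nnsfun T >-> R} :=
  mul_nnsfun h (indic_nnsfun R (measurableC mN)).
apply: ereal_sup_ubound; exists h' => /=.
  move=> x; rewrite /= mindicE; have [xN|xN] := boolP (x \in ~` N); last first.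
    by rewrite mulr0 patchE; case: ifPn => // /set_mem /g0.
  rewrite mulr1; move: (hf x); rewrite !patchE; case: ifPn => // /set_mem Dx.
  by rewrite fg//; move/set_mem: xN.
rewrite -!integralT_nnsfun; apply: ge0_ae_eq_integral => //.
- exact/measurable_EFinP.
- exact/measurable_EFinP.
- by move=> x _; rewrite lee_fin.
- by move=> x _; rewrite lee_fin.
exists N; split => // x /= hx; apply: contrapT => Nx; apply: hx => _.
by rewrite /= mindicE mem_set// mulr1.
Qed.

(** An element of a Bochner space is a class of functions up to null sets, and
    Borel measurability does not survive a change on a null set; scalar
    functions of time have to be compared as they are, through
    [ge0_le_integral_off] in both directions. *)
Lemma integral_ae_congr D (f g : T -> \bar R) : measurable D ->
  ae_eq mu D f g -> (\int[mu]_(x in D) f x = \int[mu]_(x in D) g x)%E.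
Proof.
move=> mD [N [mN N0 sN]].
have fg x : D x -> ~ N x -> f x = g x.
  move=> Dx Nx; apply: contrapT => fgx; apply: Nx; apply: sN => /=.
  by move=> /(_ Dx).
have pos (h : T -> \bar R) x : D x -> (0 <= h^\+ x)%E by [].
have neg (h : T -> \bar R) x : D x -> (0 <= h^\- x)%E by [].
rewrite integralE [RHS]integralE; congr (_ - _)%E;
  apply/eqP; rewrite eq_le; apply/andP; split;
  apply: (ge0_le_integral_off mD mN N0) => // x Dx Nx;
  by rewrite ?funeposE ?funenegE fg.
Qed.

Lemma Rintegral_ae_congr D F G : measurable D -> ae_eq mu D F G ->
  \int[mu]_(x in D) F x = \int[mu]_(x in D) G x.
Proof.
move=> mD FG; congr fine; apply: integral_ae_congr => //.
by apply: filterS FG => x FG Dx; rewrite FG.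
Qed.

(** What a Bochner space guarantees for the scalar functions of time formed
    from its elements is measurability, or integrability, of a representative. *)
Definition aemeas D F := exists2 G : T -> R, measurable_fun D G & ae_eq mu D F G.
Definition aeint D F :=
  exists2 G : T -> R, mu.-integrable D (EFin \o G) & ae_eq mu D F G.

Lemma ae_and D (P Q : T -> Prop) :
  {ae mu, forall x, D x -> P x} -> {ae mu, forall x, D x -> Q x} ->
  {ae mu, forall x, D x -> P x /\ Q x}.
Proof. by move=> hP hQ; apply: filterS2 hP hQ => x + + Dx => /(_ Dx) ? /(_ Dx). Qed.

Lemma ae_mono D (P Q : T -> Prop) : (forall x, D x -> P x -> Q x) ->
  {ae mu, forall x, D x -> P x} -> {ae mu, forall x, D x -> Q x}.
Proof. by move=> PQ; apply: filterS => x Px Dx; apply: PQ => //; exact: Px. Qed.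

Lemma ae_sub D D' (P : T -> Prop) : D' `<=` D ->
  {ae mu, forall x, D x -> P x} -> {ae mu, forall x, D' x -> P x}.
Proof. by move=> sD; apply: filterS => x Px /sD. Qed.

Lemma ae_forall_ord D n (P : 'I_n -> T -> Prop) :
  (forall i, {ae mu, forall x, D x -> P i x}) ->
  {ae mu, forall x, D x -> forall i, P i x}.
Proof.
move=> h; have : {ae mu, forall x k (kn : (k < n)%N), D x -> P (Ordinal kn) x}.
  apply: (ae_foralln (P := fun k x => forall kn : (k < n)%N, D x -> P (Ordinal kn) x)) => k.
  case/orP: (orbN (k < n)%N) => [kn|nk].
    by apply: filterS (h (Ordinal kn)) => x + kn'; rewrite (bool_irrelevance kn' kn).
  by apply: aeW => /= x kn; exfalso; rewrite kn in nk.
by apply: filterS => x hx Dx [k kn]; exact: hx.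
Qed.

Lemma aemeas_aeint D F : aeint D F -> aemeas D F.
Proof. by move=> [G iG FG]; exists G => //; apply/measurable_EFinP/(measurable_int mu). Qed.

Lemma integrable_aeint D F : mu.-integrable D (EFin \o F) -> aeint D F.
Proof. by move=> iF; exists F => //; exact: aeW. Qed.

Lemma measurable_aemeas D F : measurable_fun D F -> aemeas D F.
Proof. by move=> iF; exists F => //; exact: aeW. Qed.

Lemma aeint_congr D F G : ae_eq mu D F G -> aeint D F -> aeint D G.
Proof.
move=> FG [H iH FH]; exists H => //.
by apply: ae_eq_trans FH; exact: ae_eq_sym.
Qed.

Section fixed_domain.
Variable D : set T.
Hypothesis mD : measurable D.

Lemma aemeasD F G : aemeas D F -> aemeas D G -> aemeas D (fun x => F x + G x).
Proof.
move=> [F' iF FF'] [G' iG GG']; exists (F' \+ G'); first exact: measurable_funD.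
by apply: filterS2 FF' GG' => x + + Dx => /(_ Dx) -> /(_ Dx) ->.
Qed.

Lemma aemeasM F G : aemeas D F -> aemeas D G -> aemeas D (fun x => F x * G x).
Proof.
move=> [F' iF FF'] [G' iG GG']; exists (F' \* G'); first exact: measurable_funM.
by apply: filterS2 FF' GG' => x + + Dx => /(_ Dx) -> /(_ Dx) ->.
Qed.

Lemma aemeas_cvg (h : nat -> T -> R) F : (forall n, aemeas D (h n)) ->
  {ae mu, forall x, D x -> h n x @[n --> \oo] --> F x} -> aemeas D F.
Proof.
move=> mh cF.
have /choice[g hg] : forall n, exists g : T -> R, measurable_fun D g /\ ae_eq mu D (h n) g.
  by move=> n; have [g ? ?] := mh n; exists g.
have : {ae mu, forall x, D x -> (forall n, h n x = g n x) /\
                                h n x @[n --> \oo] --> F x}.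
  apply: ae_and cF.
  have := ae_foralln (fun n => (hg n).2); apply: filterS => x hx Dx n.
  exact: hx.
move=> [N [mN N0 sN]].
have good x : D x -> ~ N x -> (forall n, h n x = g n x) /\
                              h n x @[n --> \oo] --> F x.
  move=> Dx Nx; apply: contrapT => fgx; apply: Nx; apply: sN => /=.
  by move=> /(_ Dx).
exists (fun x => F x * \1_(~` N) x).
  apply: (@measurable_fun_cvg _ _ _ _ (fun n => g n \* \1_(~` N))).
    move=> n; apply: measurable_funM; first exact: (hg n).1.
    by apply: measurable_indic; exact: measurableC.
  move=> x Dx /=; rewrite indicE; have [xN|xN] := boolP (x \in ~` N).
    have [hgx cx] := good x Dx (set_mem xN).
    under eq_fun do rewrite mulr1 -hgx.
    by rewrite mulr1.
  under eq_fun do rewrite mulr0.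
  by rewrite mulr0; exact: cvg_cst.
exists N; split => // x /= hx; apply: contrapT => Nx; apply: hx => _.
by rewrite indicE mem_set// mulr1.
Qed.

Lemma aeint0 : aeint D (fun=> 0).
Proof. by exists (fun=> 0) => //; [exact: integrable0|exact: aeW]. Qed.

Lemma aeintD F G : aeint D F -> aeint D G -> aeint D (fun x => F x + G x).
Proof.
move=> [F' iF FF'] [G' iG GG']; exists (F' \+ G'); first exact: (integrableD mD iF iG).
by apply: filterS2 FF' GG' => x + + Dx => /(_ Dx) -> /(_ Dx) ->.
Qed.

Lemma aeintZ k F : aeint D F -> aeint D (fun x => k * F x).
Proof.
move=> [F' iF FF']; exists (fun x => k * F' x); first exact: (integrableZl mD k iF).
by apply: filterS FF' => x + Dx => /(_ Dx) ->.
Qed.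

Lemma aeintN F : aeint D F -> aeint D (fun x => - F x).
Proof.
move=> /(aeintZ (-1)); apply: aeint_congr.
by apply: aeW => x _; rewrite mulN1r.
Qed.

Lemma aeintB F G : aeint D F -> aeint D G -> aeint D (fun x => F x - G x).
Proof. by move=> iF iG; apply: aeintD => //; exact: aeintN. Qed.

Lemma aeint_sum I (r : seq I) (P : pred I) (F : I -> T -> R) :
  (forall i, P i -> aeint D (F i)) -> aeint D (fun x => \sum_(i <- r | P i) F i x).
Proof.
move=> iF; elim: r => [|i r ih].
  by under eq_fun do rewrite big_nil; exact: aeint0.
under eq_fun do rewrite big_cons.
have [Pi|_] := boolP (P i); last exact: ih.
by apply: aeintD => //; exact: iF.
Qed.

Lemma aeint_abs F : aeint D F -> aeint D (fun x => `|F x|).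
Proof.
move=> [F' iF FF']; exists (fun x => `|F' x|); first exact: integrable_norm.
by apply: filterS FF' => x + Dx => /(_ Dx) ->.
Qed.

Lemma aeint_le F G : aemeas D F -> aeint D G ->
  {ae mu, forall x, D x -> `|F x| <= G x} -> aeint D F.
Proof.
move=> [F' mF FF'] [G' iG GG'] FG.
pose H x := Num.min `|G' x| (Num.max (F' x) (- `|G' x|)).
have mG : measurable_fun D G' by apply/measurable_EFinP/(measurable_int mu).
have mH : measurable_fun D H.
  apply: measurable_minr; first exact: measurableT_comp.
  by apply: measurable_maxr => //; do 2 apply: measurableT_comp => //.
exists H.
  apply: (@le_integrable _ _ _ mu D mD _ (EFin \o (fun x => `|G' x|))).
  - exact/measurable_EFinP.
  - move=> x Dx /=; rewrite lee_fin normr_id ler_norml /H; have := normr_ge0 (G' x).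
    by rewrite /Num.min /Num.max; (repeat case: ifPn); rewrite -?leNgt => *; lra.
  - exact: integrable_norm.
apply: filterS3 FF' GG' FG => x + + + Dx => /(_ Dx) FF /(_ Dx) GG /(_ Dx).
rewrite FF GG ler_norml /H => /andP[h1 h2].
have := ler_norm (G' x) => h3.
rewrite (max_idPl _); last by lra.
by rewrite (min_idPr _)//; lra.
Qed.

Lemma aeint_mul_bounded (K : R) F G : aemeas D F -> (forall x, D x -> `|F x| <= K) ->
  aeint D G -> aeint D (fun x => F x * G x).
Proof.
move=> mF FK iG; apply: (@aeint_le _ (fun x => K * `|G x|)).
- by apply: aemeasM => //; exact: aemeas_aeint.
- by apply: aeintZ; exact: aeint_abs.
- by apply: aeW => x Dx; rewrite normrM ler_wpM2r// FK.
Qed.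

Lemma RintD F G : aeint D F -> aeint D G ->
  \int[mu]_(x in D) (F x + G x) = \int[mu]_(x in D) F x + \int[mu]_(x in D) G x.
Proof.
move=> [F' iF FF'] [G' iG GG'].
rewrite (Rintegral_ae_congr mD FF') (Rintegral_ae_congr mD GG') -RintegralD//.
apply: Rintegral_ae_congr => //.
by apply: filterS2 FF' GG' => x + + Dx => /(_ Dx) -> /(_ Dx) ->.
Qed.

Lemma RintZ k F : aeint D F ->
  \int[mu]_(x in D) (k * F x) = k * \int[mu]_(x in D) F x.
Proof.
move=> [F' iF FF']; rewrite (Rintegral_ae_congr mD FF') -RintegralZl//.
by apply: Rintegral_ae_congr => //; apply: filterS FF' => x + Dx => /(_ Dx) ->.
Qed.

Lemma RintN F : aeint D F ->
  \int[mu]_(x in D) (- F x) = - \int[mu]_(x in D) F x.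
Proof.
move=> iF; rewrite -mulN1r -RintZ//; apply: eq_Rintegral => x _.
by rewrite mulN1r.
Qed.

Lemma RintB F G : aeint D F -> aeint D G ->
  \int[mu]_(x in D) (F x - G x) = \int[mu]_(x in D) F x - \int[mu]_(x in D) G x.
Proof. by move=> iF iG; rewrite RintD// ?RintN//; exact: aeintN. Qed.

Lemma Rint_sum I (r : seq I) (P : pred I) (F : I -> T -> R) :
  (forall i, P i -> aeint D (F i)) ->
  \int[mu]_(x in D) (\sum_(i <- r | P i) F i x) =
  \sum_(i <- r | P i) \int[mu]_(x in D) F i x.
Proof.
move=> iF; elim: r => [|i r ih].
  rewrite big_nil (_ : (fun _ => _) = fun=> 0)//.
    by rewrite Rintegral_cst// mul0r.
  by apply/funext => x; rewrite big_nil.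
under eq_fun do rewrite big_cons.
rewrite big_cons; have [Pi|_] := boolP (P i); last exact: ih.
by rewrite RintD// ?ih//; [exact: iF|exact: aeint_sum].
Qed.

Lemma Rint_le F G : aeint D F -> aeint D G ->
  {ae mu, forall x, D x -> F x <= G x} ->
  \int[mu]_(x in D) F x <= \int[mu]_(x in D) G x.
Proof.
move=> [F' iF FF'] [G' iG GG'] FG.
rewrite (Rintegral_ae_congr mD FF') (Rintegral_ae_congr mD GG').
have mF : measurable_fun D F' by apply/measurable_EFinP/(measurable_int mu).
have mG : measurable_fun D G' by apply/measurable_EFinP/(measurable_int mu).
have -> : \int[mu]_(x in D) F' x = \int[mu]_(x in D) Num.min (F' x) (G' x).
  apply: Rintegral_ae_congr => //.
  apply: filterS3 FF' GG' FG => x + + + Dx => /(_ Dx) -> /(_ Dx) -> /(_ Dx) h.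
  by rewrite (min_idPl _).
apply: le_Rintegral => //.
  apply: (@le_integrable _ _ _ mu D mD _ (EFin \o (fun x => `|F' x| + `|G' x|))).
  - by apply/measurable_EFinP; exact: measurable_minr.
  - move=> x Dx /=; rewrite lee_fin [leRHS]ger0_norm ?addr_ge0//.
    by rewrite minElt; case: ifPn => _; rewrite ?lerDl ?lerDr.
  - exact: (integrableD mD (integrable_norm iF) (integrable_norm iG)).
by move=> x Dx; rewrite ge_min lexx orbT.
Qed.

Lemma Rint_ge0_ae F : {ae mu, forall x, D x -> 0 <= F x} ->
  0 <= \int[mu]_(x in D) F x.
Proof.
move=> F0; rewrite (@Rintegral_ae_congr _ _ (fun x => `|F x|))//.
  by apply: Rintegral_ge0.
by apply: filterS F0 => x h Dx; rewrite ger0_norm// h.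
Qed.

Lemma Rint_norm F : aeint D F ->
  `|\int[mu]_(x in D) F x| <= \int[mu]_(x in D) `|F x|.
Proof.
move=> iF; have aF := aeint_abs iF.
rewrite ler_norml -RintN//; apply/andP; split; apply: Rint_le => //.
- exact: aeintN.
- by apply: aeW => x Dx; rewrite lerNl; have := ler_norm (- F x); rewrite normrN.
- by apply: aeW => x Dx; exact: ler_norm.
Qed.

Lemma aeint_sqr_mul F G : aemeas D F -> aemeas D G ->
  aeint D (fun x => F x ^+ 2) -> aeint D (fun x => G x ^+ 2) ->
  aeint D (fun x => F x * G x).
Proof.
move=> mF mG iF iG.
apply: (@aeint_le _ (fun x => F x ^+ 2 + G x ^+ 2)).
- exact: aemeasM.
- exact: aeintD.
apply: aeW => x Dx; rewrite normrM -(real_normK (num_real (F x))) -(real_normK (num_real (G x))).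
have := sqr_ge0 (`|F x| - `|G x|); have := sqr_ge0 (`|F x| + `|G x|).
by move=> *; nra.
Qed.

Lemma aeint_sqr_lty F : aemeas D F ->
  (\int[mu]_(x in D) (F x ^+ 2)%:E < +oo)%E -> aeint D (fun x => F x ^+ 2).
Proof.
move=> [G mG FG] ioo; exists (fun x => G x ^+ 2).
  apply/integrableP; split.
    by apply/measurable_EFinP; exact: measurable_funX.
  rewrite (integral_ae_congr _ (g := fun x => (F x ^+ 2)%:E))//.
  apply: filterS FG => x h Dx; rewrite /= h// ger0_norm//.
  exact: sqr_ge0.
by apply: filterS FG => x h Dx; rewrite h.
Qed.

Lemma aeint_ge0_lty F : aeint D F -> (\int[mu]_(x in D) (F x)%:E < +oo)%E.
Proof.
move=> [G iG FG].
rewrite (integral_ae_congr _ (g := fun x => (G x)%:E))//.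
  by have := integrable_lty mD iG.
by apply: filterS FG => x h Dx; rewrite /= h.
Qed.

Lemma Rint_eq0_ae F : aeint D F -> {ae mu, forall x, D x -> 0 <= F x} ->
  \int[mu]_(x in D) F x <= 0 -> ae_eq mu D F (fun=> 0).
Proof.
move=> [G iG FG] F0 i0.
have mG : measurable_fun D G by apply/measurable_EFinP/(measurable_int mu).
have GG : ae_eq mu D G (fun x => `|G x|).
  by apply: filterS2 FG F0 => x + + Dx => /(_ Dx) <- /(_ Dx) h; rewrite ger0_norm.
have z : (\int[mu]_(x in D) `|(G x)%:E| = 0)%E.
  apply/eqP; rewrite eq_le integral_ge0// andbT.
  move: i0; rewrite (Rintegral_ae_congr mD FG) (Rintegral_ae_congr mD GG).
  rewrite -lee_fin fineK//.
  apply: integrable_fin_num => //; exact: integrable_norm iG.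
have /ae_eq_integral_abs := z.
move=> /(_ mD); rewrite measurable_EFinP => /(_ mG) h.
by apply: filterS2 h FG => x + + Dx => /(_ Dx) [] + /(_ Dx) ->.
Qed.

End fixed_domain.

Lemma aeint_subset D A F : measurable D -> measurable A -> A `<=` D ->
  aeint D F -> aeint A F.
Proof.
move=> mD mA AD [G iG FG]; exists G; first exact: integrableS iG.
exact: ae_sub FG.
Qed.

Lemma Rint_indic D A F : measurable D -> measurable A -> A `<=` D ->
  \int[mu]_(x in D) (\1_A x * F x) = \int[mu]_(x in A) F x.
Proof.
move=> mD mA AD; rewrite Rintegral_mkcond [RHS]Rintegral_mkcond.
apply: eq_Rintegral => x _; rewrite !patchE indicE.
have [xA|xA] := boolP (x \in A); last by rewrite mul0r if_same.
by rewrite mul1r ifT//; apply/mem_set/AD/set_mem.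
Qed.

Lemma aeint_indic D A F : measurable D -> measurable A -> A `<=` D ->
  aeint A F -> aeint D (fun x => \1_A x * F x).
Proof.
move=> mD mA AD [G iG FG]; exists (G \_ A).
  rewrite (_ : EFin \o _ = (EFin \o G) \_ A).
    by rewrite -integrable_restrict// setIidr.
  by apply/funext => x /=; rewrite !patchE; case: ifP.
apply: filterS FG => x FGx Dx; rewrite patchE indicE; case: ifPn => xA.
  by rewrite mul1r FGx//; exact/set_mem.
by rewrite mul0r.
Qed.

(** A pi-lambda argument: the sets on which [F] has integral zero form a
    lambda-system. *)
Lemma ae0_of_pi_system D F (G : set (set T)) : measurable D ->
  mu.-integrable D (EFin \o F) -> setI_closed G -> G `<=` measurable ->
  measurable `<=` <<s G >> ->
  \int[mu]_(x in D) F x = 0 ->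
  (forall A, G A -> \int[mu]_(x in D `&` A) F x = 0) ->
  ae_eq mu D F (fun=> 0).
Proof.
move=> mD iF GI Gm mG D0 GA0.
have mF : measurable_fun D F by apply/measurable_EFinP/(measurable_int mu).
have iS A : measurable A -> mu.-integrable (D `&` A) (EFin \o F).
  by move=> mA; apply: integrableS iF => //; exact: measurableI.
pose H := [set A | measurable A /\ (\int[mu]_(x in D `&` A) (F x)%:E = 0)%E].
have fin0 A : measurable A -> \int[mu]_(x in D `&` A) F x = 0 ->
    (\int[mu]_(x in D `&` A) (F x)%:E = 0)%E.
  move=> mA A0; rewrite -[LHS]fineK; last first.
    by apply: integrable_fin_num; [exact: measurableI|exact: iS].
  by rewrite [fine _]A0.
have DT : (\int[mu]_(x in D `&` setT) (F x)%:E = 0)%E.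
  by apply: fin0 => //; rewrite setIT.
have lH : lambda_system setT H.
  split => //.
  - move=> B A AB [mB B0] [mA A0]; split; first exact: measurableD.
    have : (\int[mu]_(x in (D `&` (B `\` A)) `|` (D `&` A)) (F x)%:E = 0)%E.
      by rewrite -setIUr setUC setDUK.
    rewrite integral_setU_EFin//.
    + by rewrite A0 adde0.
    + by apply: measurableI => //; exact: measurableD.
    + exact: measurableI.
    + apply: (measurable_funS mD) => //; first by move=> x [[]|[]].
    + rewrite disj_set2E; apply/eqP; rewrite -subset0 => x.
      by move=> [[_ [_ nA]] [_ /nA]].
  - move=> A ndA HA; split; first by apply: bigcup_measurable => n _; exact: (HA n).1.
    have mA n : measurable (A n) := (HA n).1.
    have mDA n : measurable (D `&` A n) by exact: measurableI.
    have ndDA : nondecreasing_seq (fun n => D `&` A n).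
      by move=> m n mn; apply/subsetPset; apply: setIS; apply/subsetPset/ndA.
    rewrite integralE setI_bigcupr.
    have pos := ge0_nondecreasing_set_cvg_integral.
    have cv (h : T -> \bar R) : (measurable_fun D h) -> (forall x, 0 <= h x)%E ->
        (\int[mu]_(x in D `&` A n) h x @[n --> \oo] -->
         \int[mu]_(x in \bigcup_n (D `&` A n)) h x)%E.
      move=> mh h0; apply: ge0_nondecreasing_set_cvg_integral => //.
      by move=> n; apply: measurable_funS mh.
    have iU : mu.-integrable (\bigcup_n (D `&` A n)) (EFin \o F).
      apply: integrableS iF => //; first exact: bigcup_measurable.
      by move=> x [n _ []].
    have c1 := cv _ (measurable_funepos (measurable_int _ iF)) (fun=> funepos_ge0 _ _).
    have c2 := cv _ (measurable_funeneg (measurable_int _ iF)) (fun=> funeneg_ge0 _ _).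
    have e12 n : (\int[mu]_(x in D `&` A n) ((EFin \o F)^\+ x) =
                 \int[mu]_(x in D `&` A n) ((EFin \o F)^\- x))%E.
      have := (HA n).2; rewrite integralE => /eqP; rewrite sube_eq ?add0e.
      - by move=> /eqP.
      - apply: integrable_pos_fin_num; [exact: mDA|exact: iS].
      - rewrite fin_num_adde_defl//; apply: integrable_neg_fin_num; [exact: mDA|exact: iS].
    have -> : (\int[mu]_(x in \bigcup_n (D `&` A n)) ((EFin \o F)^\+ x) =
            \int[mu]_(x in \bigcup_n (D `&` A n)) ((EFin \o F)^\- x))%E.
      apply: cvg_unique c1 _ => //; rewrite (_ : (fun _ => _) = (fun n =>
        \int[mu]_(x in D `&` A n) ((EFin \o F)^\- x))%E)//.
      by apply/funext => n; exact: e12.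
    rewrite subee//; apply: integrable_neg_fin_num iU.
    exact: bigcup_measurable.
have GH : G `<=` H by move=> A GA; split; [exact: Gm|apply: fin0; [exact: Gm|exact: GA0]].
have all0 A : measurable A -> (\int[mu]_(x in D `&` A) (F x)%:E = 0)%E.
  move=> mA; have := @lambda_system_subset _ G GI setT H lH GH (fun _ _ _ _ => I).
  by move=> /(_ A (mG _ mA)) [].
have := @integral_ae_eq _ _ _ mu D mD (EFin \o fun=> 0) (EFin \o F) iF.
move=> /(_ (measurable_cst _)) h.
have {}h : ae_eq mu D (EFin \o F) (EFin \o fun=> 0).
  apply: h => E ED mE; rewrite [RHS]integral0_eq// -(setIidr ED).
  exact: all0.
by apply: filterS h => x h Dx; have [] := h Dx.
Qed.

End ae_integral.

(** * Polynomials in time and Legendre polynomials *)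

Section time_calculus.
Context (R : realType).
Implicit Types (a b t : R) (F : R -> R) (p : {poly R}).
Notation mu := (@lebesgue_measure R).

Lemma measurable_ioo a b : measurable (`]a, b[%classic : set (measurableTypeR R)).
Proof. exact: measurable_itv. Qed.

Lemma continuous_itv_integrable a b (A : set (measurableTypeR R)) F : continuous F ->
  measurable A -> A `<=` `[a, b]%classic -> mu.-integrable A (EFin \o F).
Proof.
move=> cF mA sA.
have iF : mu.-integrable (`[a, b]%classic : set (measurableTypeR R)) (EFin \o F).
  apply: continuous_compact_integrable; first exact: segment_compact.
  exact: continuous_subspaceT.
by apply: integrableS iF => //; exact: measurable_itv.
Qed.

Lemma continuous_aeint a b F : continuous F -> aeint mu `]a, b[ F.
Proof.
move=> cF; apply: integrable_aeint.
by apply: continuous_itv_integrable => //; exact: subset_itv_oo_cc.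
Qed.

Lemma time_int_FTC a b (F f : R -> R) : a <= b ->
  (forall t, is_derive t (1 : R) F (f t)) -> continuous f ->
  time_int a b f = F b - F a.
Proof.
rewrite le_eqVlt => /predU1P[->|ab] dF cf.
  by rewrite /time_int set_itv_ge ?bnd_simp ?ltxx// Rintegral_set0 subrr.
have dF1 t : derivable F t 1 by have [] := dF t.
have cF : continuous F.
  by move=> t; apply: differentiable_continuous; apply/derivable1_diffP.
rewrite /time_int Rintegral_itv_bndo_bndc; last first.
  by apply: continuous_itv_integrable => //; exact: subset_itv_oo_cc.
rewrite Rintegral_itv_obnd_cbnd; last first.
  apply: (@continuous_itv_integrable a b) => //.
  by move=> x /=; rewrite !in_itv/= => /andP[/ltW -> ->].
rewrite /Rintegral (continuous_FTC2 ab _ (F := F))//.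
- exact: continuous_subspaceT.
- split => //; first by apply: cvg_at_right_filter; exact: cF.
  by apply: cvg_at_left_filter; exact: cF.
- by move=> t _; rewrite derive1E; have [] := dF t.
Qed.

Lemma is_derive_horner p t : is_derive t (1 : R) (horner p) p^`().[t].
Proof.
split; first exact: derivable_horner.
by rewrite -derive1E derivE.
Qed.

Lemma continuous_poly p : continuous (horner p).
Proof. exact: continuous_horner. Qed.

Lemma aeint_poly a b p : aeint mu `]a, b[ (horner p).
Proof. by apply: continuous_aeint; exact: continuous_poly. Qed.

Lemma time_int_deriv a b p : a <= b -> time_int a b (horner p^`()) = p.[b] - p.[a].
Proof.
move=> ab; apply: time_int_FTC => //; last exact: continuous_poly.
Qed.

Lemma time_int_polyD a b p q :
  time_int a b (horner (p + q)) = time_int a b (horner p) + time_int a b (horner q).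
Proof.
rewrite /time_int -RintD//; try exact: aeint_poly.
by apply: eq_Rintegral => t _; rewrite hornerD.
Qed.

Lemma time_int_polyZ a b c p :
  time_int a b (horner (c *: p)) = c * time_int a b (horner p).
Proof.
rewrite /time_int -RintZ//; try exact: aeint_poly.
by apply: eq_Rintegral => t _; rewrite hornerZ.
Qed.

Lemma time_int_polyB a b p q :
  time_int a b (horner (p - q)) = time_int a b (horner p) - time_int a b (horner q).
Proof.
by rewrite -scaleN1r time_int_polyD time_int_polyZ mulN1r.
Qed.

Lemma time_int_poly0 a b : time_int a b (horner (0 : {poly R})) = 0.
Proof. by rewrite -(scale0r 0) time_int_polyZ mul0r. Qed.

Definition poly_prim p : {poly R} := \poly_(i < (size p).+1) (p`_i.-1 / i%:R).

Lemma poly_primK p : (poly_prim p)^`() = p.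
Proof.
apply/polyP => i; rewrite coef_deriv coef_poly ltnS.
case: ltnP => [ip|pi]; last by rewrite nth_default ?mul0rn.
by rewrite /= -[LHS]mulr_natr divfK// pnatr_eq0.
Qed.

(** By the fundamental theorem of calculus for a primitive of [p], composed
    with the affine map. *)
Lemma time_int_affine a b p : a < b ->
  time_int a b (fun t => p.[(2 * t - a - b) / (b - a)]) =
  (b - a) / 2 * time_int (-1) 1 (horner p).
Proof.
move=> ab; have ba0 : b - a != 0 by rewrite subr_eq0 gt_eqF.
rewrite -{2}(poly_primK p) time_int_deriv; last by lra.
set P := poly_prim p.
pose A : {poly R} := (2 / (b - a)) *: 'X - ((a + b) / (b - a))%:P.
have hA t : A.[t] = (2 * t - a - b) / (b - a) by rewrite !hornerE; field.
have dA : A^`() = (2 / (b - a))%:P.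
  by rewrite derivB derivZ derivX derivC subr0 alg_polyC.
transitivity (time_int a b (horner (((b - a) / 2) *: (P \Po A)^`()))).
  apply: eq_Rintegral => t _; rewrite deriv_comp dA poly_primK !hornerE/=.
  rewrite horner_comp hA -[RHS]mulrA -[RHS]mulrA mulrCA mulrA -mulrA.
  by rewrite [X in _ = _ * X](_ : _ = 1) ?mulr1//; field.
rewrite time_int_polyZ time_int_deriv; last exact: ltW.
rewrite !horner_comp !hA; congr (_ * (_ - _)); congr horner; by field.
Qed.

End time_calculus.

Lemma ring_eq_rec (A : comNzRingType) (x z : A) k :
  1 * ((x * x - 1) * z) + x * (x *+ 2 * z *+ k.+1) =
  (x * x - 1) * z *+ (2 * k + 3) + z *+ (2 * k + 2).
Proof.
rewrite -[x *+ 2]mulr_natr -[_ *+ k.+1]mulr_natr.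
rewrite -[_ *+ (2 * k + 3)]mulr_natr -[_ *+ (2 * k + 2)]mulr_natr.
by ring.
Qed.

Lemma ring_eq_leibniz (A : comNzRingType) (x z g h : A) k :
  z *+ k.+1 * g + x * z * h = z * (g *+ k.+1 + x * h).
Proof. by rewrite -[z *+ _]mulr_natr -[g *+ _]mulr_natr; ring. Qed.

Section legendre_theory.
Context (R : realType).
Implicit Types (p g : {poly R}) (k j : nat) (c : R).

Local Notation J p := (time_int (-1) 1 (horner (p : {poly R}))).
Local Notation W := ('X ^+ 2 - 1 : {poly R}).

Let le11 : (-1 : R) <= 1. Proof. by lra. Qed.

Lemma ref_int_parts p g :
  J (p^`() * g) = (p * g).[1] - (p * g).[-1] - J (p * g^`()).
Proof. by rewrite -time_int_deriv// derivM time_int_polyD addrK. Qed.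

Lemma derivn_power_multiple p j k : (j <= k)%N ->
  exists g, (p ^+ k)^`(j) = p ^+ (k - j) * g.
Proof.
elim: j => [_|j ih jk]; first by exists 1; rewrite subn0 mulr1.
have [g hg] := ih (ltnW jk).
rewrite derivnS hg -[(k - j)%N]prednK ?subn_gt0// -subnS.
set m := (k - j.+1)%N; exists ((m.+1%:R *: p^`()) * g + p * g^`()).
rewrite derivM deriv_exp/= exprS.
by rewrite mulrDr scaler_nat; ring.
Qed.

(** Each derivative lowers the multiplicity of the roots [1] and [-1] by at
    most one. *)
Lemma derivn_W_bnd j k : (j < k)%N ->
  (W ^+ k)^`(j).[1] = 0 /\ (W ^+ k)^`(j).[-1] = 0.
Proof.
move=> jk; have [g ->] := @derivn_power_multiple W j k (ltnW jk).
have W1 : W.[1] = 0 by rewrite !hornerE expr1n subrr.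
have WN1 : W.[-1] = 0 by rewrite !hornerE sqrrN expr1n subrr.
by rewrite !hornerM !horner_exp W1 WN1 expr0n subn_eq0 leqNgt jk !mul0r.
Qed.

(** Repeated integration by parts; [derivn_W_bnd] removes the boundary terms. *)
Lemma ref_int_rodrigues k p j : (j <= k)%N ->
  J ((W ^+ k)^`(k) * p) = (-1) ^+ j * J ((W ^+ k)^`(k - j) * p^`(j)).
Proof.
elim: j => [_|j ih jk]; first by rewrite subn0 expr0 mul1r derivn0.
rewrite ih ?(ltnW jk)// -[(k - j)%N]prednK ?subn_gt0// -subnS derivnS.
have [w1 wm1] : (W ^+ k)^`(k - j.+1).[1] = 0 /\ (W ^+ k)^`(k - j.+1).[-1] = 0.
  by apply: derivn_W_bnd; rewrite ltn_subrL/= (leq_ltn_trans _ jk).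
rewrite ref_int_parts !hornerM w1 wm1 !mul0r subrr add0r.
by rewrite [in RHS]exprSr -[RHS]mulrA mulN1r.
Qed.

Lemma derivn_add p m k : p^`(m)^`(k) = p^`(k + m).
Proof. by elim: k => [|k ih]; rewrite ?derivn0// addSn !derivnS ih. Qed.

Lemma derivn_gt_size p k : (size p <= k)%N -> p^`(k) = 0.
Proof.
by move=> pk; apply/polyP => i; rewrite coef_derivn coef0 nth_default ?mul0rn//
  (leq_trans pk)// leq_addr.
Qed.

Lemma size_W_exp k : size (W ^+ k) = (2 * k).+1.
Proof.
have := size_exp W k; rewrite size_Xn_sub_1//= => <-.
by rewrite prednK// size_poly_gt0 expf_neq0// -size_poly_gt0 size_Xn_sub_1.
Qed.

Lemma derivn_W_top k : (W ^+ k)^`(2 * k) = ((2 * k)`!%:R)%:P.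
Proof.
have mW : W ^+ k \is monic.
  by apply: monic_exp; exact: monic_Xn_sub_1.
apply/polyP => -[|i]; rewrite coef_derivn coefC/=.
  rewrite addn0 ffactnn; have := monicP mW; rewrite lead_coefE size_W_exp/= => ->.
  by [].
by rewrite nth_default ?mul0rn// size_W_exp addnS ltnS leq_addr.
Qed.

(** The derivative of [X (X^2 - 1)^(k + 1)] integrates to zero. *)
Lemma ref_int_W_rec k : J (W ^+ k.+1) * (2 * k + 3)%:R = - J (W ^+ k) * (2 * k + 2)%:R.
Proof.
have : J (('X * W ^+ k.+1)^`()) = 0.
  rewrite time_int_deriv// !hornerM !horner_exp !hornerE.
  by rewrite sqrrN expr1n subrr exprS mul0r !mulr0 subrr.
have -> : ('X * W ^+ k.+1)^`() =
    ((2 * k + 3)%:R : R) *: W ^+ k.+1 + ((2 * k + 2)%:R : R) *: W ^+ k.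
  rewrite derivM derivX deriv_exp derivB derivXn derivC subr0 /=.
  by rewrite !scaler_nat exprS; exact: ring_eq_rec.
rewrite time_int_polyD !time_int_polyZ => h; lra.
Qed.

Lemma legendre_orth k p : (size p <= k)%N -> J (legendre R k * p) = 0.
Proof.
move=> pk; rewrite /legendre -scalerAl time_int_polyZ (@ref_int_rodrigues _ _ k)//.
by rewrite (derivn_gt_size pk) mulr0 time_int_poly0 !mulr0.
Qed.

(** All [k] derivatives are moved to one factor, where they leave the constant
    [(2k)!] times the integral of [(X^2 - 1)^k], known by recurrence. *)
Lemma legendre_norm k : J (legendre R k * legendre R k) = 2 / (2 * k + 1)%:R.
Proof.
rewrite /legendre -scalerAl -scalerAr !time_int_polyZ (@ref_int_rodrigues _ _ k)//.
rewrite subnn derivn0 derivn_add addnn -mul2n derivn_W_top [W ^+ k * _]mulrC mul_polyC.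
rewrite time_int_polyZ.
elim: k => [|k ih].
  rewrite muln0 !expr0 fact0 !mulr1 invr1 !mul1r -[1 : {poly R}]derivX.
  by rewrite time_int_deriv// !hornerE; lra.
have rec : J (W ^+ k.+1) = - J (W ^+ k) * (2 * k + 2)%:R / (2 * k + 3)%:R.
  by rewrite -ref_int_W_rec mulfK// pnatr_eq0.
rewrite rec.
have -> : ((2 * k.+1)`!%:R : R) = (2 * k + 2)%:R * (2 * k + 1)%:R * (2 * k)`!%:R.
  by rewrite -!natrM mulnS !addSn !factS add0n mulnA !addn1 !addn2.
rewrite factS.
have hk : (k.+1%:R : R) != 0 by rewrite pnatr_eq0.
have hf : (k`!%:R : R) != 0 by rewrite pnatr_eq0 -lt0n fact_gt0.
have h2 : (2 ^+ k : R) != 0 by rewrite expf_neq0.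
have h1 : ((2 * k + 1)%:R : R) != 0 by rewrite pnatr_eq0 addn1.
have h3 : ((2 * k + 3)%:R : R) != 0 by rewrite pnatr_eq0 addn3.
have ih' : J (W ^+ k) * (-1) ^+ k * (2 * k)`!%:R = 2 / (2 * k + 1)%:R * (2 ^+ k * k`!%:R) ^+ 2.
  by rewrite -ih; field; apply/andP; split.
have -> : (2 * k.+1 + 1)%N = (2 * k + 3)%N by lia.
have -> : ((2 * k + 2)%:R : R) = 2 * k.+1%:R by rewrite -natrM; congr _%:R; lia.
rewrite natrM (exprS 2) (exprS (-1)); move: ih' {ih rec}; move: (J _) => j ih'.
transitivity ((2 ^+ k * k`!%:R) ^- 2 * (j * (-1) ^+ k * (2 * k)`!%:R)
  * ((2 * k + 1)%:R / (2 * k + 3)%:R)); first by field; do !(apply/andP; split).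
by rewrite ih'; field; do !(apply/andP; split).
Qed.

Lemma derivn_XsubC_pow c k g : (('X - c%:P) ^+ k * g)^`(k).[c] = k`!%:R * g.[c].
Proof.
elim: k g => [|k ih] g; first by rewrite derivn0 expr0 !mul1r.
have -> : (('X - c%:P) ^+ k.+1 * g)^`(k.+1) =
  (('X - c%:P) ^+ k * (k.+1%:R *: g + ('X - c%:P) * g^`()))^`(k).
  rewrite derivSn; congr derivn; rewrite derivM deriv_exp derivXsubC /= mul1r.
  by rewrite exprS scaler_nat; exact: ring_eq_leibniz.
rewrite ih !hornerE subrr mul0r addr0 factS natrM; ring.
Qed.

Lemma legendre_at1 k : (legendre R k).[1] = 1.
Proof.
have h2 : (2 ^+ k : R) != 0 by rewrite expf_neq0.
have hf : (k`!%:R : R) != 0 by rewrite pnatr_eq0 -lt0n fact_gt0.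
rewrite /legendre hornerZ (_ : W = ('X - 1%:P) * ('X + 1%:P)); last by ring.
rewrite exprMn derivn_XsubC_pow horner_exp hornerD hornerX hornerC.
by rewrite (_ : 1 + 1 = 2 :> R)//; field; apply/andP; split.
Qed.

Lemma legendre_atN1 k : (legendre R k).[-1] = (-1) ^+ k.
Proof.
have h2 : (2 ^+ k : R) != 0 by rewrite expf_neq0.
have hf : (k`!%:R : R) != 0 by rewrite pnatr_eq0 -lt0n fact_gt0.
rewrite /legendre hornerZ (_ : W = ('X - (-1)%:P) * ('X - 1%:P)); last first.
  by rewrite polyCN; ring.
rewrite exprMn derivn_XsubC_pow horner_exp hornerD hornerX hornerN hornerC.
rewrite (_ : -1 - 1 = - (2 : R)); last by lra.
by rewrite [(- 2) ^+ k]exprNn; field; apply/andP; split.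
Qed.

Lemma size_legendre k : (size (legendre R k) <= k.+1)%N.
Proof.
apply: leq_trans (size_scale_leq _ _) _; apply/leq_sizeP => j kj.
rewrite coef_derivn nth_default ?mul0rn// size_W_exp; lia.
Qed.

Section on_interval.
Context (ts : nat -> R) (n : nat).
Hypothesis ab : ts n.-1 < ts n.
Local Notation a := (ts n.-1).
Local Notation b := (ts n).
Local Notation ell := (legendreI ts n).

Let ba0 : b - a != 0. Proof. by rewrite subr_eq0 gt_eqF. Qed.

Lemma legendreI_right k : ell k b = 1.
Proof. by rewrite /legendreI (_ : _ / _ = 1) ?legendre_at1//; field. Qed.

Lemma legendreI_left k : ell k a = (-1) ^+ k.
Proof. by rewrite /legendreI (_ : _ / _ = -1) ?legendre_atN1//; field. Qed.

Definition legendreP k : {poly R} :=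
  legendre R k \Po ((2 / (b - a)) *: 'X - ((a + b) / (b - a))%:P).

Lemma horner_legendreP k t : (legendreP k).[t] = ell k t.
Proof. by rewrite /legendreP horner_comp /legendreI; congr horner; rewrite !hornerE; field. Qed.

Lemma size_legendreP k : (size (legendreP k) <= k.+1)%N.
Proof.
have h1 : (size ((2 / (b - a)) *: 'X - ((a + b) / (b - a))%:P : {poly R})%R <= 2)%N.
  rewrite (leq_trans (size_polyD _ _))// geq_max size_polyN.
  rewrite (leq_trans (size_scale_leq _ _)) ?size_polyX//=.
  by rewrite (leq_trans (size_polyC_leq1 _)).
apply: leq_trans (size_comp_poly_leq _ _) _; rewrite ltnS.
have := size_legendre k; move: (size (legendre R k)) (size _) h1 => m [|[|[|l]]]//= _ h.
- by rewrite muln0.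
- by rewrite muln0.
- by rewrite muln1; case: m h.
Qed.

Lemma int_legendre_sqr k :
  time_int a b (fun t => ell k t * ell k t) = (b - a) / (2 * k + 1)%:R.
Proof.
rewrite (_ : (fun _ => _) = fun t => (legendre R k * legendre R k).[(2 * t - a - b) / (b - a)]).
  rewrite time_int_affine// legendre_norm.
  by rewrite mulrA divfK.
by apply/funext => t; rewrite hornerM.
Qed.

Lemma int_legendre_poly k p : (size p <= k)%N ->
  time_int a b (fun t => p.[t] * ell k t) = 0.
Proof.
move=> pk.
pose r : {poly R} := p \Po (((b - a) / 2) *: 'X + ((a + b) / 2)%:P).
have sr : (size r <= k)%N.
  have [p0|p0] := eqVneq p 0; first by rewrite /r p0 comp_poly0 size_poly0.
  apply: leq_trans (size_comp_poly_leq _ _) _.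
  have h1 : (size (((b - a) / 2) *: 'X + ((a + b) / 2)%:P : {poly R})%R <= 2)%N.
    rewrite (leq_trans (size_polyD _ _))// geq_max.
    rewrite (leq_trans (size_scale_leq _ _)) ?size_polyX//=.
    by rewrite (leq_trans (size_polyC_leq1 _)).
  have := pk; have : (0 < size p)%N by rewrite lt0n size_poly_eq0.
  move: (size p) (size _) h1 => m [|[|[|l]]]//= _ m0 h; rewrite ?muln0 ?muln1; lia.
rewrite (_ : (fun _ => _) = fun t => (legendre R k * r).[(2 * t - a - b) / (b - a)]).
  by rewrite time_int_affine// legendre_orth// mulr0.
apply/funext => t; rewrite hornerM mulrC; congr (_ * _).
by rewrite horner_comp; congr horner; rewrite !(hornerD, hornerZ, hornerX, hornerC); field.
Qed.

Lemma int_legendreP_poly k p : (size p <= k)%N ->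
  time_int a b (horner (p * legendreP k)) = 0.
Proof.
move=> pk; rewrite -[RHS](int_legendre_poly pk); apply: eq_Rintegral => t _.
by rewrite hornerM horner_legendreP.
Qed.

(** Up to the factor [(-1)^q / 2] this is the derivative of the correction of
    the reconstruction; paired with [L_q] it contributes exactly the jump term
    of the discontinuous Galerkin scheme. *)
Lemma int_legendre_deriv k :
  time_int a b (horner ((legendreP k - legendreP k.+1)^`() * legendreP k)) = -2.
Proof.
have : time_int a b (horner ((legendreP k - legendreP k.+1) * legendreP k)^`()) =
    - (((-1) ^+ k - (-1) ^+ k.+1) * (-1) ^+ k).
  rewrite time_int_deriv; last exact: ltW.
  rewrite !hornerE !horner_legendreP !legendreI_right !legendreI_left.
  by rewrite subrr mul0r sub0r.
rewrite derivM time_int_polyD => h.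
have sd : (size (legendreP k)^`() <= k)%N.
  have [->|p0] := eqVneq (legendreP k) 0; first by rewrite deriv0 size_poly0.
  by have := lt_size_deriv p0; have := size_legendreP k; lia.
have z : time_int a b (horner ((legendreP k - legendreP k.+1) * (legendreP k)^`())) = 0.
  rewrite mulrBl time_int_polyB ![_ * (legendreP k)^`()]mulrC.
  by rewrite !int_legendreP_poly ?subrr// (leq_trans sd).
move: h; rewrite z addr0 => ->; rewrite exprS mulrBl.
have -> : (-1) ^+ k * (-1) ^+ k = 1 :> R by rewrite -exprMn mulrNN mulr1 expr1n.
by rewrite mulN1r mulNr -exprMn mulrNN mulr1 expr1n; lra.
Qed.

End on_interval.
End legendre_theory.

(** * Smooth cutoffs on the line *)

Section smooth_functions.
Context (R : realType).
Implicit Types (f g : R -> R) (p : {poly R}) (x t : R).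

(** Successive derivatives are exhibited one by one: stability under sums,
    products and compositions is then an induction on [k]. *)
Fixpoint smoothn k f : Prop :=
  if k is k'.+1 then
    exists2 f' : R -> R, forall t, is_derive t (1 : R) f (f' t) & smoothn k' f'
  else True.

Definition smooth1 f := forall k, smoothn k f.

Lemma smoothnW k f : smoothn k.+1 f -> smoothn k f.
Proof.
elim: k f => // k ih f [f' df sf']; exists f' => //; exact: ih.
Qed.

Lemma smoothn_cst k (c : R) : smoothn k (fun=> c).
Proof.
elim: k c => // k ih c; exists (fun=> 0) => // t; exact: is_derive_cst.
Qed.

Lemma smoothnD k f g : smoothn k f -> smoothn k g -> smoothn k (fun t => f t + g t).
Proof.
elim: k f g => // k ih f g [f' df sf] [g' dg sg].
by exists (fun t => f' t + g' t) => [t|]; [exact: is_deriveD|exact: ih].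
Qed.

Lemma smoothnM k f g : smoothn k f -> smoothn k g -> smoothn k (fun t => f t * g t).
Proof.
elim: k f g => // k ih f g hf hg.
have [f' df sf] := hf; have [g' dg sg] := hg.
exists (fun t => f' t * g t + f t * g' t).
  move=> t; apply: (is_derive_eq (is_deriveM (df t) (dg t))).
  by rewrite /GRing.scale/= addrC [g t * _]mulrC.
by apply: smoothnD; apply: ih => //; exact: smoothnW.
Qed.

Lemma is_derive1_comp_eq (f g h : R -> R) (x a b c : R) :
  is_derive x (1 : R) g b -> is_derive (g x) (1 : R) f a ->
  (forall y, f (g y) = h y) -> a * b = c -> is_derive x (1 : R) h c.
Proof.
move=> dg df fg <-; rewrite (_ : h = f \o g); last first.
  by apply/funext => y; rewrite /= fg.
exact: is_derive1_comp.
Qed.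

Lemma smoothn_affine k f (c e : R) : smoothn k f -> smoothn k (fun t => f (c * t + e)).
Proof.
elim: k f => // k ih f [f' df sf].
exists (fun t => f' (c * t + e) * c); last first.
  by apply: smoothnM; [exact: ih|exact: smoothn_cst].
move=> t; apply: (is_derive1_comp (df _)).
have := is_deriveD (is_deriveZ c (is_derive_id t (1 : R))) (is_derive_cst e t (1 : R)).
by rewrite addr0 [_ *: 1]mulr1.
Qed.

Lemma smoothn_exp k f : smoothn k f -> smoothn k (fun t => expR (f t)).
Proof.
elim: k f => // k ih f hf; have [f' df sf] := hf.
exists (fun t => expR (f t) * f' t).
  by move=> t; apply: (is_derive1_comp (is_derive_expR _) (df t)).
by apply: smoothnM => //; apply: ih; exact: smoothnW.
Qed.

Lemma smoothn_poly k p : smoothn k (horner p).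
Proof. elim: k p => // k ih p; exists (horner p^`()) => [t|]; last exact: ih.
exact: is_derive_horner. Qed.

Lemma smooth1_derivable f : smooth1 f -> forall k t, derivable (derive1n k f) t 1.
Proof.
move=> sf k t; have := sf k.+1; elim: k f {sf} => [|k ih] f [f' df sf].
  by rewrite derive1n0; have [] := df t.
rewrite /derive1n iterSr; apply: ih.
rewrite (_ : f^`()%classic = f')//; apply/funext => s; rewrite derive1E.
by have [] := df s.
Qed.

Lemma smooth1_deriv f : smooth1 f ->
  exists2 f' : R -> R, forall t, is_derive t (1 : R) f (f' t) & smooth1 f'.
Proof.
move=> sf; exists f^`()%classic => [t|k].
  by split; [have [f' /(_ t)[]] := sf 1%N|rewrite derive1E].
have [f' df sf'] := sf k.+1; rewrite (_ : f^`()%classic = f')//.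
by apply/funext => s; rewrite derive1E; have [] := df s.
Qed.

Lemma is_derive_continuous f f' : (forall t, is_derive t (1 : R) f (f' t)) ->
  continuous f.
Proof.
move=> df t; apply: differentiable_continuous; apply/derivable1_diffP.
by have [] := df t.
Qed.

Lemma smooth1_continuous f : smooth1 f -> continuous f.
Proof. by move=> /smooth1_deriv[f' df _]; exact: is_derive_continuous df. Qed.

(** All derivatives of the flat function [exp(-1/x)] have this form, which
    makes the family closed under differentiation. *)
Definition flat p x : R := if 0 < x then p.[x^-1] * expR (- x^-1) else 0.

Lemma poly_bound p : exists2 C : R, 0 <= C &
  forall y, 1 <= y -> `|p.[y]| <= C * y ^+ size p.
Proof.
exists (\sum_(i < size p) `|p`_i|); first by apply: sumr_ge0.
move=> y y1; rewrite horner_coef (le_trans (ler_norm_sum _ _ _))// mulr_suml.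
apply: ler_sum => i _; rewrite normrM ler_wpM2l// ger0_norm; last first.
  by rewrite exprn_ge0// (le_trans ler01).
by apply: ler_weXn2l => //; exact: ltnW.
Qed.

Lemma flat_decay p : exists2 C : R, 0 <= C & forall x, x <= 1 -> `|flat p x| <= C * x ^+ 2.
Proof.
have [C C0 hC] := poly_bound p; pose m := (size p).+2.
exists (C * m`!%:R); first by rewrite mulr_ge0.
move=> x x1; rewrite /flat; case: ifPn => [x0|_]; last first.
  by rewrite normr0 mulr_ge0 ?sqr_ge0// mulr_ge0.
have y1 : 1 <= x^-1 by rewrite invf_ge1.
have y0 : 0 < x^-1 by rewrite invr_gt0.
rewrite normrM [X in _ * X]ger0_norm ?expR_ge0//.
apply: (@le_trans _ _ (C * x^-1 ^+ size p * (m`!%:R * x ^+ m))).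
  apply: ler_pM => //; [exact: hC|].
  rewrite expRN -[leRHS]invrK lef_pV2 ?posrE ?expR_gt0//; last first.
    by rewrite invr_gt0 mulr_gt0 ?exprn_gt0// ltr0n fact_gt0.
  rewrite invfM -exprVn mulrC.
  by have := @expR_ge1Dxn R x^-1 (size p).+1 (ltW y0); apply: le_trans; rewrite lerDr.
rewrite -!mulrA ler_wpM2l// mulrCA ler_wpM2l// /m -[(size p).+2]addn2 exprD mulrA.
by rewrite -exprMn mulVf ?gt_eqF// expr1n mul1r.
Qed.

(** At the origin the quadratic bound [flat_decay] makes the difference
    quotient vanish. *)
Lemma is_derive_flat p x : is_derive x (1 : R) (flat p) (flat ('X ^+ 2 * (p - p^`())) x).
Proof.
have [x0|x0|->] := ltgtP x 0.
- have -> : flat ('X ^+ 2 * (p - p^`())) x = 0 by rewrite /flat ltNge (ltW x0).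
  apply: (@near_eq_is_derive _ _ _ (cst (0 : R))).
  - near=> y; rewrite /flat ifF//; apply/negbTE; rewrite -leNgt ltW//.
    by near: y; exact: lt_nbhsl.
- pose h y : R := p.[y^-1] * expR (- y^-1).
  apply: (@near_eq_is_derive _ _ _ h).
  - near=> y; rewrite /flat ifT//.
    by near: y; exact: lt_nbhsr.
  - have dinv : is_derive x (1 : R) (fun y => y^-1) (- x^-1 ^+ 2).
      have x0' : x != 0 by rewrite gt_eqF.
      split; first by apply: (@derivableV _ _ id).
      by rewrite (@deriveV _ _ id)// derive_id [_ *: _]mulr1 exprVn.
    have d1 := is_derive1_comp (is_derive_poly p x^-1) dinv.
    have d2 : is_derive x (1 : R) (fun y => expR (- y^-1)) (expR (- x^-1) * x^-1 ^+ 2).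
      apply: (is_derive1_comp_eq (is_deriveN dinv) (is_derive_expR _)) => //.
      by rewrite opprK.
    apply: (is_derive_eq (is_deriveM d1 d2)); rewrite /flat x0.
    rewrite /GRing.scale/= !hornerE/=; ring.
- rewrite {2}/flat ltxx.
  have [C C0 hC] := flat_decay p.
  have c0 : h^-1 *: (flat p (h + 0) - flat p 0) @[h --> (0 : R)^'] --> (0 : R).
    apply/cvgrPdist_le => /= e e0; near=> h.
    have h0 : h != 0 by near: h; exact: nbhs_dnbhs_neq.
    rewrite sub0r normrN addr0 {2}/flat ltxx subr0 normrM normfV.
    have h1 : h <= 1.
      near: h; apply: nbhs_dnbhs; near=> h; apply: ltW; near: h; exact: lt_nbhsl.
    rewrite ler_pdivrMl ?normr_gt0//; apply: le_trans (hC _ h1) _.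
    rewrite -(real_normK (num_real h)) mulrA [leRHS]mulrC ler_pM2r ?normr_gt0//.
    have : `|h| <= e / (C + 1).
      near: h; apply: nbhs_dnbhs; apply/nbhs_normP.
      exists (e / (C + 1)) => /=; first by rewrite divr_gt0// ltr_wpDl.
      by move=> y /=; rewrite sub0r normrN => /ltW.
    rewrite ler_pdivlMr ?ltr_wpDl//; have := normr_ge0 h; nra.
  have e : (fun h : R => h^-1 *: (flat p (h *: (1 : R) + 0) - flat p 0)) =
           (fun h : R => h^-1 *: (flat p (h + 0) - flat p 0)).
    by apply/funext => h; rewrite [h *: _]mulr1.
  split; first by apply/cvg_ex; exists 0; rewrite e.
  by rewrite /derive; apply: cvg_lim => //; rewrite e.
Unshelve. all: by end_near.
Qed.

Lemma smoothn_flat k p : smoothn k (flat p).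
Proof.
elim: k p => // k ih p; exists (flat ('X ^+ 2 * (p - p^`()))) => // t.
exact: is_derive_flat.
Qed.

Definition flat0 : R -> R := flat 1.

Lemma flat0_ge0 x : 0 <= flat0 x.
Proof. by rewrite /flat0 /flat; case: ifP => // _; rewrite hornerE mul1r expR_ge0. Qed.

Lemma flat0_gt0 x : 0 < x -> 0 < flat0 x.
Proof. by move=> x0; rewrite /flat0 /flat x0 hornerE mul1r expR_gt0. Qed.

Lemma flat0_le0 x : x <= 0 -> flat0 x = 0.
Proof. by move=> x0; rewrite /flat0 /flat ltNge x0. Qed.

Lemma flat0_mono x y : x <= y -> flat0 x <= flat0 y.
Proof.
move=> xy; have [x0|x0] := leP x 0; first by rewrite (flat0_le0 x0) flat0_ge0.
have y0 := lt_le_trans x0 xy.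
rewrite /flat0 /flat x0 y0 !hornerC !mul1r ler_expR lerN2.
by rewrite lef_pV2 ?posrE.
Qed.

(** A smooth approximation of the indicator of ]0, +oo[; the shift by
    [n.+1%:R^-1] keeps its support away from the origin, so that cutoffs of an
    interval have compact support inside it. *)
Definition smooth_step (n : nat) x : R := 1 - expR (- (n%:R * flat0 (x - n.+1%:R^-1))).

Lemma smooth_step_smooth n : smooth1 (smooth_step n).
Proof.
move=> k; apply: smoothnD; first exact: smoothn_cst.
have h : smoothn k (fun x : R => (-1) * expR ((- n%:R) * flat0 (1 * x + - n.+1%:R^-1))).
  apply: smoothnM; first exact: smoothn_cst.
  apply: smoothn_exp; apply: smoothnM; first exact: smoothn_cst.
  by apply: smoothn_affine; exact: smoothn_flat.
move: h; congr (smoothn _ _); apply/funext => x.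
by rewrite mulNr !mul1r mulNr.
Qed.

Lemma smooth_step_mono n x y : x <= y -> smooth_step n x <= smooth_step n y.
Proof.
move=> xy; rewrite /smooth_step lerD2l lerN2 ler_expR lerN2 ler_wpM2l//.
by rewrite flat0_mono// lerD2r.
Qed.

Lemma smooth_step_ge0 n x : 0 <= smooth_step n x.
Proof. by rewrite /smooth_step subr_ge0 expR_le1 oppr_le0 mulr_ge0// flat0_ge0. Qed.

Lemma smooth_step_le1 n x : smooth_step n x <= 1.
Proof. by rewrite /smooth_step gerDl oppr_le0 expR_ge0. Qed.

Lemma smooth_step_eq0 n x : x <= n.+1%:R^-1 -> smooth_step n x = 0.
Proof.
by move=> xn; rewrite /smooth_step flat0_le0 ?mulr0 ?oppr0 ?expR0 ?subrr// subr_le0.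
Qed.

Lemma smooth_step_cvg x : 0 < x -> smooth_step n x @[n --> \oo] --> (1 : R).
Proof.
move=> x0; rewrite -[X in _ --> X]subr0; apply: cvgB; first exact: cvg_cst.
have f0 : 0 < flat0 (x / 2) by apply: flat0_gt0; rewrite divr_gt0.
apply/cvgrPdist_le => /= e e0; near=> n.
rewrite sub0r normrN ger0_norm ?expR_ge0// expRN -[leRHS]invrK lef_pV2 ?posrE ?expR_gt0 ?invr_gt0//.
apply: le_trans (expR_ge1Dx _); rewrite -lerBlDl.
have h1 : n.+1%:R^-1 <= x / 2.
  near: n; exists (Num.truncn (x / 2)^-1) => // m /= hm.
  rewrite -[leRHS]invrK lef_pV2 ?posrE ?invr_gt0 ?divr_gt0//.
  apply: ltW; apply: lt_le_trans (truncnS_gt _) _.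
  by rewrite ler_nat.
apply: (@le_trans _ _ (n%:R * flat0 (x / 2))); last first.
  rewrite ler_wpM2l// flat0_mono//.
  by move: h1; move: (n.+1%:R^-1) => z; lra.
rewrite -ler_pdivrMr//.
near: n; exists (Num.truncn ((e^-1 - 1) / flat0 (x / 2))).+1 => // m /= hm.
apply: ltW; apply: lt_le_trans (truncnS_gt _) _.
by rewrite ler_nat.
Unshelve. all: by end_near.
Qed.

Lemma smooth_step_deriv n : exists2 s' : R -> R,
  forall t, is_derive t (1 : R) (smooth_step n) (s' t) &
  continuous s' /\ forall t, 0 <= s' t.
Proof.
pose c : R := n.+1%:R^-1; pose f1 := flat ('X ^+ 2 * (1 - 1^`())).
exists (fun t => expR (- (n%:R * flat0 (t - c))) * (n%:R * f1 (t - c))); last first.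
  split; last first.
    move=> t; rewrite mulr_ge0 ?expR_ge0// mulr_ge0// /f1 /flat; case: ifP => // _.
    by rewrite -polyC1 derivC subr0 polyC1 mulr1 hornerXn mulr_ge0 ?expR_ge0// sqr_ge0.
  apply: smooth1_continuous => k; apply: smoothnM.
    apply: smoothn_exp.
    have := @smoothnM k (fun=> - n%:R) (fun t => flat0 (1 * t + - c)) (smoothn_cst _ _)
      (smoothn_affine 1 (- c) (smoothn_flat k _)).
    by congr (smoothn _ _); apply/funext => t; rewrite mulNr mul1r.
  apply: smoothnM; first exact: smoothn_cst.
  have := smoothn_affine 1 (- c) (smoothn_flat k ('X ^+ 2 * (1 - 1^`()))).
  by congr (smoothn _ _); apply/funext => t; rewrite mul1r.
move=> t.
have d1 : is_derive t (1 : R) (fun t => flat0 (t - c)) (f1 (t - c)).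
  have dc : is_derive t (1 : R) (fun t => t - c) 1.
    apply: (is_derive_eq (is_deriveB (is_derive_id t (1 : R)) (is_derive_cst c t (1 : R)))).
    exact: subr0.
  by apply: (is_derive1_comp_eq dc (is_derive_flat 1 (t - c))) => //; rewrite mulr1.
have d2 : is_derive t (1 : R) (fun t => expR (- (n%:R * flat0 (t - c))))
    (expR (- (n%:R * flat0 (t - c))) * - (n%:R * f1 (t - c))).
  by apply: (is_derive1_comp_eq (is_deriveN (is_deriveZ n%:R d1)) (is_derive_expR _)).
apply: (is_derive_eq (is_deriveB (is_derive_cst (1 : R) t (1 : R)) d2)).
by rewrite sub0r mulrN opprK.
Qed.

End smooth_functions.

#[local] Opaque smooth_step.

Section cutoffs.
Context (R : realType).
Implicit Types (a b c x : R) (y : R -> R).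
Notation mu := (@lebesgue_measure R).

Lemma time_int_split a c b (F : R -> R) : a <= c -> c <= b ->
  aeint mu `]a, b[ F -> time_int a b F = time_int a c F + time_int c b F.
Proof.
rewrite le_eqVlt => /predU1P[-> _ _|ac].
  by rewrite /time_int [in X in _ = X + _]set_itv_ge ?bnd_simp ?ltxx// Rintegral_set0 add0r.
rewrite le_eqVlt => /predU1P[->|cb] [G iG FG].
  by rewrite /time_int [in X in _ = _ + X]set_itv_ge ?bnd_simp ?ltxx// Rintegral_set0 addr0.
have s1 : `]a, c[%classic `<=` `]a, b[%classic.
  by move=> x /=; rewrite !in_itv/= => /andP[-> /lt_trans]; exact.
have s1' : `]a, c]%classic `<=` `]a, b[%classic.
  by move=> x /=; rewrite !in_itv/= => /andP[-> /le_lt_trans]; exact.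
have s2 : `]c, b[%classic `<=` `]a, b[%classic.
  by move=> x /=; rewrite !in_itv/= => /andP[/(lt_trans ac) -> ->].
rewrite /time_int (Rintegral_ae_congr _ FG); last exact: measurable_itv.
have FG1 : ae_eq mu `]a, c[%classic F G by exact: ae_sub FG.
have FG2 : ae_eq mu `]c, b[%classic F G by exact: ae_sub FG.
rewrite (Rintegral_ae_congr _ FG1); last exact: measurable_itv.
rewrite (Rintegral_ae_congr _ FG2); last exact: measurable_itv.
rewrite [X in _ = X + _]Rintegral_itv_bndo_bndc; last first.
  by apply: integrableS iG => //; exact: measurable_itv.
rewrite -Rintegral_setU//.
- congr (Rintegral _ _ _); rewrite -itv_bndbnd_setU// ?bnd_simp//; exact: ltW.
- rewrite -itv_bndbnd_setU// ?bnd_simp//; exact: ltW.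
- apply/disj_setPS => x [/=]; rewrite !in_itv/= => /andP[_ h1] /andP[h2 _].
  by move: (le_lt_trans h1 h2); rewrite ltxx.
Qed.

Lemma itv_oo_sub a b c d' : c <= a -> b <= d' -> `]a, b[%classic `<=` (`]c, d'[%classic : set R).
Proof.
move=> ca bd x /=; rewrite !in_itv/= => /andP[ax xb].
by rewrite (le_lt_trans ca)// (lt_le_trans xb).
Qed.

Lemma time_int_sub a b c d' (F : R -> R) : c <= a -> b <= d' ->
  (forall x, c < x < d' -> ~~ (a < x < b) -> F x = 0) ->
  time_int c d' F = time_int a b F.
Proof.
move=> ca bd F0; rewrite /time_int Rintegral_mkcond [RHS]Rintegral_mkcond.
apply: eq_Rintegral => x _; rewrite !patchE.
have [xab|xab] := boolP (x \in `]a, b[%classic); last first.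
  case: ifPn => // xcd; apply: F0; first by move: xcd; rewrite inE/= in_itv.
  by move: xab; rewrite notin_setE/= in_itv/= => /negP.
by rewrite ifT// inE; apply: itv_oo_sub ca bd _ _; move: xab; rewrite inE.
Qed.

Definition cutoff (n : nat) a b x := smooth_step n (x - a) * smooth_step n (b - x).

Lemma smooth_step_shift n a k : smoothn k (fun x => smooth_step n (x - a)).
Proof.
have := smoothn_affine 1 (- a) (smooth_step_smooth R n k).
by under eq_fun do rewrite mul1r.
Qed.

Lemma smooth_step_flip n b k : smoothn k (fun x => smooth_step n (b - x)).
Proof.
have := smoothn_affine (-1) b (smooth_step_smooth R n k).
by under eq_fun do rewrite mulN1r addrC.
Qed.

Lemma cutoff_smooth n a b : smooth1 (cutoff n a b).
Proof.
by move=> k; apply: smoothnM; [exact: smooth_step_shift|exact: smooth_step_flip].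
Qed.

Lemma cutoff_ge0 n a b x : 0 <= cutoff n a b x.
Proof. by rewrite mulr_ge0// smooth_step_ge0. Qed.

Lemma cutoff_le1 n a b x : cutoff n a b x <= 1.
Proof. by rewrite mulr_ile1// ?smooth_step_ge0// smooth_step_le1. Qed.

Lemma cutoff_support n a b x : cutoff n a b x != 0 ->
  a + n.+1%:R^-1 <= x <= b - n.+1%:R^-1.
Proof.
rewrite mulf_eq0 negb_or => /andP[h1 h2]; apply/andP; split.
  rewrite -lerBrDl leNgt; apply: contraNN h1 => /ltW h.
  by rewrite smooth_step_eq0.
rewrite lerBrDl -lerBrDr leNgt; apply: contraNN h2 => /ltW h.
by rewrite smooth_step_eq0.
Qed.

Lemma cutoff_out n a b x : ~~ (a < x < b) -> cutoff n a b x = 0.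
Proof.
move=> xab; apply/eqP; apply: contraNT xab => /cutoff_support /andP[h1 h2].
have n0 : 0 < n.+1%:R^-1 :> R by rewrite invr_gt0.
by move: n0 h1 h2; move: (n.+1%:R^-1) => z *; apply/andP; split; lra.
Qed.

Lemma cutoff_cvg a b x : a < x < b -> cutoff n a b x @[n --> \oo] --> (1 : R).
Proof.
move=> /andP[ax xb]; rewrite -[X in _ --> X]mulr1.
by apply: cvgM; apply: smooth_step_cvg; rewrite subr_gt0.
Qed.

Lemma cutoff_test n a b d' (p : {poly R}) : 0 <= a -> b <= d' ->
  time_test d' (fun x => p.[x] * cutoff n a b x).
Proof.
move=> a0 bd; split.
- apply: smooth1_derivable => k; apply: smoothnM; first exact: smoothn_poly.
  exact: cutoff_smooth.
- apply: (@subclosed_compact _ _ `[a, b]); [exact: closed_closure|exact: segment_compact|].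
  rewrite [X in _ `<=` X](closure_id _).1; last exact: itv_closed.
  apply: closureS => x /=; rewrite mulf_eq0 negb_or => /andP[_ /cutoff_support].
  rewrite in_itv/= => /andP[h1 h2].
  have n0 : 0 < n.+1%:R^-1 :> R by rewrite invr_gt0.
  by move: n0 h1 h2; move: (n.+1%:R^-1) => z *; apply/andP; split; lra.
- have n0 : 0 < n.+1%:R^-1 :> R by rewrite invr_gt0.
  apply: (@subset_trans _ `[a + n.+1%:R^-1, b - n.+1%:R^-1]%classic).
    rewrite [X in _ `<=` X](closure_id _).1; last exact: itv_closed.
    apply: closureS => x /=; rewrite mulf_eq0 negb_or => /andP[_ /cutoff_support].
    by rewrite in_itv/=.
  move=> x /=; rewrite !in_itv/= => /andP[h1 h2].
  by move: n0 h1 h2; move: (n.+1%:R^-1) => z *; apply/andP; split; lra.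
Qed.

(** The weight has mass almost one, and almost all of it lies where [g] is
    within [e] of [yc]. *)
Lemma weighted_average a b c1 d1 (w g : R -> R) (yc e K eta : R) :
  a <= c1 -> d1 <= b -> continuous w -> (forall x, 0 <= w x) ->
  aeint mu `]a, b[ g -> 0 <= e -> 0 <= K ->
  (forall x, a < x < b -> ~~ (c1 < x < d1) -> `|g x - yc| <= e) ->
  (forall x, a < x < b -> `|g x - yc| <= e + K) ->
  1 - eta <= time_int a b w <= 1 -> time_int c1 d1 w <= eta ->
  `|time_int a b (fun x => w x * g x) - yc| <= e + K * eta + `|yc| * eta.
Proof.
move=> ac db cw w0 ig e0 K0 g1 g2 /andP[w1 w2] w3.
have mI := measurable_ioo a b.
have mJ := measurable_ioo c1 d1.
have iw := continuous_aeint a b cw.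
have JI := itv_oo_sub ac db.
have iJ : aeint mu `]a, b[ (fun x => \1_(`]c1, d1[%classic) x * w x).
  by apply: aeint_indic => //; exact: continuous_aeint.
have ib : aeint mu `]a, b[ (fun x => e * w x + K * (\1_(`]c1, d1[%classic) x * w x)).
  by apply: aeintD => //; exact: aeintZ.
have bnd x : `]a, b[%classic x ->
    `|w x * (g x - yc)| <= e * w x + K * (\1_(`]c1, d1[%classic) x * w x).
  rewrite /= in_itv/= => xab; rewrite normrM ger0_norm// indicE.
  have [xJ|xJ] := boolP (x \in _); rewrite ?mul1r ?mul0r ?mulr0 ?addr0.
    by rewrite -mulrDl mulrC ler_wpM2r// g2.
  rewrite mulrC ler_wpM2r// g1//; move: xJ; rewrite notin_setE/= in_itv/=.
  by move=> /negP.
have id : aeint mu `]a, b[ (fun x => w x * (g x - yc)).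
  apply: (aeint_le mI _ ib); last by apply: aeW => x; exact: bnd.
  apply: aemeasM; first exact: aemeas_aeint.
  apply: aemeasD; first exact: aemeas_aeint.
  exact: measurable_aemeas.
have -> : time_int a b (fun x => w x * g x) =
    time_int a b (fun x => w x * (g x - yc)) + yc * time_int a b w.
  rewrite /time_int -RintZ// -RintD//; last exact: aeintZ.
  by apply: eq_Rintegral => x _; ring.
have h : `|time_int a b (fun x => w x * (g x - yc))| <= e * time_int a b w + K * time_int c1 d1 w.
  apply: le_trans (Rint_norm mI id) _.
  rewrite /time_int -(Rint_indic mu w mI mJ JI) -!RintZ// -RintD//; try exact: aeintZ.
  by apply: Rint_le => //; [exact: aeint_abs|apply: aeW => x; exact: bnd].
rewrite -addrA -[X in _ + (_ - X)]mulr1 -mulrBr (le_trans (ler_normD _ _))// normrM.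
have h1 : `|time_int a b w - 1| <= eta by rewrite ler_norml; apply/andP; split; lra.
have h2 : 0 <= time_int a b w by apply: Rintegral_ge0.
have := normr_ge0 yc; have := normr_ge0 (time_int a b w - 1).
by move: h h1 h2 w1 w2 w3; nra.
Qed.

Lemma within_continuous_aeint a b y : {within `[a, b], continuous y} ->
  aeint mu `]a, b[ y.
Proof.
move=> cy; apply: integrable_aeint.
have iF : mu.-integrable (`[a, b]%classic : set R) (EFin \o y).
  by apply: continuous_compact_integrable => //; exact: segment_compact.
apply: integrableS iF => //; try exact: measurable_itv.
exact: subset_itv_oo_cc.
Qed.

Lemma within_continuous_bounded a b y : {within `[a, b], continuous y} ->
  exists2 K : R, 0 <= K & forall x, a <= x <= b -> `|y x| <= K.
Proof.
move=> cy; have := continuous_compact cy (@segment_compact _ a b).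
move=> /compact_bounded[M [_ hM]]; exists (`|M| + 1); first by rewrite addr_ge0.
move=> x xab; apply: hM; first by rewrite (le_lt_trans (ler_norm _))// ltrDl.
by exists x => //=; rewrite in_itv.
Qed.

Let step_left n a b y : {within `[a, b], continuous y} -> a < b ->
  aeint mu `]a, b[ (fun x => smooth_step n (b - x) * y x).
Proof.
move=> cy ab; have mI := measurable_ioo a b; have iy := within_continuous_aeint cy.
apply: (aeint_mul_bounded mI (K := 1)) => //.
  apply: aemeas_aeint; apply: continuous_aeint; apply: smooth1_continuous.
  by move=> k; exact: smooth_step_flip.
by move=> x _; rewrite ger0_norm ?smooth_step_ge0// smooth_step_le1.
Qed.

Let step_right n a b y : {within `[a, b], continuous y} -> a < b ->
  aeint mu `]a, b[ (fun x => smooth_step n (x - a) * y x).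
Proof.
move=> cy ab; have mI := measurable_ioo a b; have iy := within_continuous_aeint cy.
apply: (aeint_mul_bounded mI (K := 1)) => //.
  apply: aemeas_aeint; apply: continuous_aeint; apply: smooth1_continuous.
  by move=> k; exact: smooth_step_shift.
by move=> x _; rewrite ger0_norm ?smooth_step_ge0// smooth_step_le1.
Qed.

Let damp_bound (M yc z s : R) : `|yc| <= M -> `|z| <= M -> 0 <= s <= 1 ->
  `|s * z - yc| <= 2 * M.
Proof.
move=> hyc hz /andP[s1 s2]; apply: le_trans (ler_normB _ _) _.
by rewrite normrM (ger0_norm s1); have := normr_ge0 z; nra.
Qed.

Let damp_near (M e eta yc z s : R) : `|yc| <= M -> `|z - yc| <= e -> 1 - s <= eta ->
  0 <= s <= 1 -> `|s * z - yc| <= e + M * eta.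
Proof.
move=> hyc hz h /andP[s1 s2].
rewrite (_ : s * z - yc = s * (z - yc) - (1 - s) * yc); last by ring.
have s3 : 0 <= 1 - s by lra.
apply: le_trans (ler_normB _ _) _; rewrite !normrM (ger0_norm s1) (ger0_norm s3).
by have := normr_ge0 (z - yc); have := normr_ge0 yc; nra.
Qed.

Let gather_bound (M e eta v yc : R) : 0 <= eta -> `|yc| <= M ->
  v <= (e + M * eta) + (2 * M) * eta + `|yc| * eta -> v <= e + 4 * M * eta.
Proof. by have := normr_ge0 yc; nra. Qed.

(** The derivative of a cutoff approximates the difference of the Dirac masses
    at the two end points. *)
Lemma cutoff_deriv_cvg a b y : a < b -> {within `[a, b], continuous y} ->
  exists2 D : nat -> R -> R,
    (forall n x, is_derive x (1 : R) (cutoff n a b) (D n x)) &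
    time_int a b (fun x => D n x * y x) @[n --> \oo] --> y a - y b.
Proof.
move=> ab cy.
have /choice[s' hs'] : forall n, exists s' : R -> R,
    (forall t, is_derive t (1 : R) (smooth_step n) (s' t)) /\
    continuous s' /\ forall t, 0 <= s' t.
  by move=> n; have [s' h1 h2] := smooth_step_deriv R n; exists s'.
have ds n : forall t, is_derive t (1 : R) (smooth_step n) (s' n t) := (hs' n).1.
have cs n : continuous (s' n) := (hs' n).2.1.
have s0 n : forall t, 0 <= s' n t := (hs' n).2.2.
pose wl n x := s' n (x - a); pose wr n x := s' n (b - x).
have dl n x : is_derive x (1 : R) (fun x => smooth_step n (x - a)) (wl n x).
  have dc : is_derive x (1 : R) (fun x => x - a) 1.
    apply: (is_derive_eq (is_deriveB (is_derive_id x (1 : R)) (is_derive_cst a x (1 : R)))).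
    exact: subr0.
  by apply: (is_derive1_comp_eq dc (ds n (x - a))) => //; rewrite mulr1.
have dr n x : is_derive x (1 : R) (fun x => smooth_step n (b - x)) (- wr n x).
  have dc : is_derive x (1 : R) (fun x => b - x) (-1).
    apply: (is_derive_eq (is_deriveB (is_derive_cst b x (1 : R)) (is_derive_id x (1 : R)))).
    exact: sub0r.
  by apply: (is_derive1_comp_eq dc (ds n (b - x))) => //; rewrite mulrN1.
have cwl n : continuous (wl n).
  move=> x; apply: continuous_comp; last exact: cs.
  by apply: cvgB; [exact: cvg_id|exact: cvg_cst].
have cwr n : continuous (wr n).
  move=> x; apply: continuous_comp; last exact: cs.
  by apply: cvgB; [exact: cvg_cst|exact: cvg_id].
have Il n c d' : c <= d' -> time_int c d' (wl n) = smooth_step n (d' - a) - smooth_step n (c - a).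
  by move=> cd; apply: (time_int_FTC cd (dl n)).
have Ir n c d' : c <= d' -> time_int c d' (wr n) = smooth_step n (b - c) - smooth_step n (b - d').
  move=> cd.
  have dN x : is_derive x (1 : R) (fun x => - smooth_step n (b - x)) (wr n x).
    by apply: (is_derive_eq (is_deriveN (dr n x))); rewrite opprK.
  by rewrite (time_int_FTC cd dN)// opprK addrC.
exists (fun n x => wl n x * smooth_step n (b - x) - smooth_step n (x - a) * wr n x).
  move=> n x; apply: (is_derive_eq (is_deriveM (dl n x) (dr n x))).
  by rewrite /GRing.scale/= mulrN addrC [_ * wl n x]mulrC.
have [M M0 hM] := within_continuous_bounded cy.
have mI := measurable_ioo a b.
have Ml n : aeint mu `]a, b[ (fun x => wl n x * (smooth_step n (b - x) * y x)).
  have [K K0 hK] := within_continuous_bounded (continuous_subspaceT (cwl n) (A := `[a, b])).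
  apply: (aeint_mul_bounded mI (K := K)) => //.
  - by apply: aemeas_aeint; exact: continuous_aeint.
  - by move=> x; rewrite /= in_itv/= => /andP[/ltW ? /ltW ?]; apply: hK; apply/andP.
  - exact: step_left.
have Mr n : aeint mu `]a, b[ (fun x => wr n x * (smooth_step n (x - a) * y x)).
  have [K K0 hK] := within_continuous_bounded (continuous_subspaceT (cwr n) (A := `[a, b])).
  apply: (aeint_mul_bounded mI (K := K)) => //.
  - by apply: aemeas_aeint; exact: continuous_aeint.
  - by move=> x; rewrite /= in_itv/= => /andP[/ltW ? /ltW ?]; apply: hK; apply/andP.
  - exact: step_right.
have -> : (fun n => time_int a b (fun x =>
     (wl n x * smooth_step n (b - x) - smooth_step n (x - a) * wr n x) * y x)) =
   (fun n => time_int a b (fun x => wl n x * (smooth_step n (b - x) * y x)) -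
     time_int a b (fun x => wr n x * (smooth_step n (x - a) * y x))).
  apply/funext => n; rewrite /time_int -RintB//.
  by apply: eq_Rintegral => x _; rewrite mulrBl [_ * wr n x]mulrC !mulrA.
have ya : `|y a| <= M by apply: hM; rewrite lexx ltW.
have yb : `|y b| <= M by apply: hM; rewrite lexx ltW.
have [_ cya cyb] := (continuous_within_itvP y ab).1 cy.
have err (e : R) : 0 < e -> exists2 de : R, 0 < de & forall n,
    `|time_int a b (fun x => wl n x * (smooth_step n (b - x) * y x)) - y a| <=
      e + 4 * M * (1 - smooth_step n de) /\
    `|time_int a b (fun x => wr n x * (smooth_step n (x - a) * y x)) - y b| <=
      e + 4 * M * (1 - smooth_step n de).
  move=> e0.
  have [r1 r10 h1] : exists2 r : R, 0 < r & forall x, a < x < a + r -> `|y x - y a| <= e.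
    move/cvgrPdist_le : cya => /(_ e e0) [r r0 hr]; exists r => // x /andP[ax xr].
    rewrite distrC; apply: hr => //=.
    by rewrite distrC ger0_norm ?subr_ge0 ?ltW// ltrBlDl.
  have [r2 r20 h2] : exists2 r : R, 0 < r & forall x, b - r < x < b -> `|y x - y b| <= e.
    move/cvgrPdist_le : cyb => /(_ e e0) [r r0 hr]; exists r => // x /andP[xr xb].
    rewrite distrC; apply: hr => //=.
    by rewrite ger0_norm ?subr_ge0 ?ltW// ltrBlDl -ltrBlDr.
  have [de [de0 de1 de2 de3]] : exists de : R,
      [/\ 0 < de, de <= r1 / 2, de <= r2 / 2 & de <= (b - a) / 2].
    exists (Num.min (Num.min (r1 / 2) (r2 / 2)) ((b - a) / 2)).
    by rewrite !lt_min !ge_min !lexx !divr_gt0 ?subr_gt0 ?orbT.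
  have [da1 da2 da3 da4 da5] : [/\ a <= a + de, a + de <= b, de <= b - a, a <= b - de & b - de <= b].
    by clear -ab de0 de3; split; lra.
  exists de => // n.
  set st := smooth_step n; have [eta etaE] : exists eta : R, eta = 1 - st de by eexists.
  have eta0 : 0 <= eta by rewrite etaE subr_ge0 smooth_step_le1.
  have sde (x : R) : de <= x -> 1 - st x <= eta.
    by move=> dx; rewrite etaE lerD2l lerN2; exact: smooth_step_mono.
  have st0 : st 0 = 0 by rewrite /st smooth_step_eq0// invr_ge0.
  have st01 x : 0 <= st x <= 1 by rewrite smooth_step_ge0 smooth_step_le1.
  rewrite -etaE; split.
    apply: (gather_bound eta0 ya).
    apply: (@weighted_average a b (a + de) b) => //.
    - by move=> x; exact: s0.
    - exact: step_left.
    - by rewrite addr_ge0 ?mulr_ge0// ltW.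
    - by rewrite mulr_ge0.
    - move=> x /andP[ax xb]; rewrite xb andbT -leNgt => xd.
      apply: damp_near => //; last by apply: sde; clear -xd da2 de3; lra.
      by apply: h1; apply/andP; split => //; clear -xd de1 r10; lra.
    - move=> x /andP[ax xb]; apply: (@le_trans _ _ (2 * M)).
        by apply: damp_bound => //; apply: hM; rewrite !ltW.
      by rewrite lerDr addr_ge0 ?mulr_ge0// ltW.
    - rewrite Il ?(ltW ab)// subrr -/st st0 subr0; have /andP[_ ->] := st01 (b - a).
      by rewrite andbT lerBlDr -lerBlDl; exact: sde.
    - rewrite Il//.
      rewrite (_ : a + de - a = de); last by ring.
      rewrite etaE /st lerD2r; exact: smooth_step_le1.
  apply: (gather_bound eta0 yb).
  apply: (@weighted_average a b a (b - de)) => //.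
  - by move=> x; exact: s0.
  - exact: step_right.
  - by rewrite addr_ge0 ?mulr_ge0// ltW.
  - by rewrite mulr_ge0.
  - move=> x /andP[ax xb]; rewrite ax/= -leNgt => xd.
    apply: damp_near => //; last by apply: sde; clear -xd de3; lra.
    by apply: h2; apply/andP; split => //; clear -xd de2 r20; lra.
  - move=> x /andP[ax xb]; apply: (@le_trans _ _ (2 * M)).
      by apply: damp_bound => //; apply: hM; rewrite !ltW.
    by rewrite lerDr addr_ge0 ?mulr_ge0// ltW.
  - rewrite Ir ?(ltW ab)// subrr -/st st0 subr0; have /andP[_ ->] := st01 (b - a).
    by rewrite andbT lerBlDr -lerBlDl; exact: sde.
  - rewrite Ir//.
    rewrite (_ : b - (b - de) = de); last by ring.
    rewrite etaE /st lerD2r; exact: smooth_step_le1.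
have lim2 (e d : R) : 0 < e -> 0 < d -> \forall n \near \oo, 4 * M * (1 - smooth_step n d) <= e.
  move=> e0 d0; have := smooth_step_cvg d0 => /cvgrPdist_le /(_ (e / (4 * M + 1))).
  rewrite divr_gt0 ?ltr_wpDl ?mulr_ge0// => /(_ isT); apply: filterS => n.
  rewrite ger0_norm ?subr_ge0 ?smooth_step_le1// ler_pdivlMr ?ltr_wpDl ?mulr_ge0//.
  have : 0 <= 1 - smooth_step n d by rewrite subr_ge0 smooth_step_le1.
  by move: (1 - _) => z h1 h2; nra.
apply: cvgB; apply/cvgrPdist_le => /= e e0.
  have e20 : 0 < e / 2 by rewrite divr_gt0.
  have [d d0 hd] := err _ e20; apply: filterS (lim2 _ _ e20 d0) => n h.
  by rewrite distrC (le_trans (hd n).1)//; lra.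
have e20 : 0 < e / 2 by rewrite divr_gt0.
have [d d0 hd] := err _ e20; apply: filterS (lim2 _ _ e20 d0) => n h.
by rewrite distrC (le_trans (hd n).2)//; lra.
Qed.

End cutoffs.

(** * Seminorms and semi-inner products *)

Section semi_inner_products.
Context (R : realType) (W : lmodType R).
Implicit Types (S : set W) (N : W -> R) (b : W -> W -> R).

Definition subspace_set S :=
  S 0 /\ forall a v w, S v -> S w -> S (a *: v + w).

Lemma ssZ S a v : subspace_set S -> S v -> S (a *: v).
Proof. by move=> [S0 SP] Sv; rewrite -[_ *: _]addr0; exact: SP. Qed.

Lemma ssD S v w : subspace_set S -> S v -> S w -> S (v + w).
Proof. by move=> [S0 SP] Sv Sw; rewrite -[v]scale1r; exact: SP. Qed.

Lemma ssN S v : subspace_set S -> S v -> S (- v).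
Proof. by move=> sS Sv; rewrite -scaleN1r; exact: ssZ. Qed.

Lemma ssB S v w : subspace_set S -> S v -> S w -> S (v - w).
Proof. by move=> sS Sv Sw; apply: ssD => //; exact: ssN. Qed.

Lemma ss_sum S I (r : seq I) (P : pred I) (F : I -> W) : subspace_set S ->
  (forall i, P i -> S (F i)) -> S (\sum_(i <- r | P i) F i).
Proof.
move=> sS SF; apply: (big_ind S) => //; first exact: sS.1.
by move=> v w; exact: ssD.
Qed.

(** The conditions are restricted to the subspace [S]: the norms of function
    spaces are given by formulas that make sense, but have no properties,
    outside these spaces. *)
Definition seminormed S N :=
  [/\ subspace_set S, forall a v, S v -> N (a *: v) = `|a| * N v &
      forall v w, S v -> S w -> N (v + w) <= N v + N w].

Section seminorm_theory.
Variables (S : set W) (N : W -> R).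
Hypothesis hN : seminormed S N.
Let sS : subspace_set S. Proof. by case: hN. Qed.

Lemma sn0 : N 0 = 0.
Proof.
by have [_ h _] := hN; rewrite -(scale0r 0) h ?normr0 ?mul0r//; exact: sS.1.
Qed.

Lemma snZ a v : S v -> N (a *: v) = `|a| * N v. Proof. by case: hN => _ h _; exact: h. Qed.

Lemma snN v : S v -> N (- v) = N v.
Proof. by move=> Sv; rewrite -scaleN1r snZ// normrN1 mul1r. Qed.

Lemma snD v w : S v -> S w -> N (v + w) <= N v + N w.
Proof. by case: hN => _ _ h; exact: h. Qed.

Lemma snB v w : S v -> S w -> N (v - w) <= N v + N w.
Proof. by move=> Sv Sw; rewrite -(snN Sw); apply: snD => //; exact: ssN. Qed.

Lemma sn_ge0 v : S v -> 0 <= N v.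
Proof.
move=> Sv; have := snB Sv Sv; rewrite subrr sn0; lra.
Qed.

Lemma sn_dist v w : S v -> S w -> `|N v - N w| <= N (v - w).
Proof.
move=> Sv Sw; have h1 : N v <= N (v - w) + N w.
  by rewrite -{1}(subrK w v); apply: snD => //; exact: ssB.
have h2 : N w <= N (v - w) + N v.
  rewrite -[N (v - w)](@snN (v - w)); last exact: ssB.
  by rewrite opprB -{1}(subrK v w); apply: snD => //; exact: ssB.
by rewrite ler_norml; apply/andP; split; lra.
Qed.

End seminorm_theory.

Definition semi_inner S b :=
  [/\ subspace_set S,
      forall a u v w, S u -> S v -> S w -> b (a *: u + v) w = a * b u w + b v w,
      forall v w, S v -> S w -> b v w = b w v &
      forall v, S v -> 0 <= b v v].

Section semi_inner_theory.
Variables (S : set W) (b : W -> W -> R).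
Hypothesis hb : semi_inner S b.
Let sS : subspace_set S. Proof. by case: hb. Qed.
Implicit Types (v w : W).

Lemma siC v w : S v -> S w -> b v w = b w v. Proof. by case: hb => _ _ h _; exact: h. Qed.
Lemma si_ge0 v : S v -> 0 <= b v v. Proof. by case: hb => _ _ _; exact. Qed.

Lemma siP a u v w : S u -> S v -> S w -> b (a *: u + v) w = a * b u w + b v w.
Proof. by case: hb => _ h _ _; exact: h. Qed.

Lemma si0l w : S w -> b 0 w = 0.
Proof.
move=> Sw; have := siP (- 1) Sw Sw Sw; rewrite scaleN1r addNr => ->.
by rewrite mulN1r addNr.
Qed.

Lemma siDl u v w : S u -> S v -> S w -> b (u + v) w = b u w + b v w.
Proof. by move=> Su Sv Sw; rewrite -[u]scale1r siP// scale1r mul1r. Qed.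

Lemma siZl a v w : S v -> S w -> b (a *: v) w = a * b v w.
Proof.
by move=> Sv Sw; rewrite -[_ *: _]addr0 siP// ?si0l ?addr0//; exact: sS.1.
Qed.

Lemma siNl v w : S v -> S w -> b (- v) w = - b v w.
Proof. by move=> Sv Sw; rewrite -scaleN1r siZl// mulN1r. Qed.

Lemma siBl u v w : S u -> S v -> S w -> b (u - v) w = b u w - b v w.
Proof. by move=> Su Sv Sw; rewrite siDl// ?siNl//; exact: ssN. Qed.

Lemma siDr u v w : S u -> S v -> S w -> b w (u + v) = b w u + b w v.
Proof. by move=> Su Sv Sw; rewrite siC// ?siDl// 1?(siC Su)// 1?(siC Sv)//; exact: ssD. Qed.

Lemma siZr a v w : S v -> S w -> b w (a *: v) = a * b w v.
Proof. by move=> Sv Sw; rewrite siC// ?siZl// 1?(siC Sv)//; exact: ssZ. Qed.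

Lemma siNr v w : S v -> S w -> b w (- v) = - b w v.
Proof. by move=> Sv Sw; rewrite -scaleN1r siZr// mulN1r. Qed.

Lemma siBr u v w : S u -> S v -> S w -> b w (u - v) = b w u - b w v.
Proof. by move=> Su Sv Sw; rewrite siDr// ?siNr//; exact: ssN. Qed.

Lemma si_suml I (r : seq I) (P : pred I) (F : I -> W) w :
  (forall i, P i -> S (F i)) -> S w ->
  b (\sum_(i <- r | P i) F i) w = \sum_(i <- r | P i) b (F i) w.
Proof.
move=> SF Sw; elim: r => [|i r ih]; first by rewrite !big_nil si0l.
rewrite !big_cons; case: ifP => // Pi; rewrite siDl// ?ih//; first exact: SF.
exact: ss_sum.
Qed.

Lemma siDD v w : S v -> S w -> b (v + w) (v + w) = b v v + 2 * b v w + b w w.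
Proof.
move=> Sv Sw; have Svw := ssD sS Sv Sw.
rewrite siDl// !siDr// (siC Sw Sv); ring.
Qed.

Lemma siBB v w : S v -> S w -> b (v - w) (v - w) = b v v - 2 * b v w + b w w.
Proof.
move=> Sv Sw; have Svw := ssB sS Sv Sw.
rewrite siBl// !siBr// (siC Sw Sv); ring.
Qed.

(** The form is only semidefinite: when [b v v] vanishes, the polynomial [l
    |-> b (l v + w) (l v + w)] is affine and nonnegative, hence constant. *)
Lemma cauchy_schwarz_sqr v w : S v -> S w -> b v w ^+ 2 <= b v v * b w w.
Proof.
move=> Sv Sw; have key l : 0 <= l ^+ 2 * b v v + 2 * l * b v w + b w w.
  have Sl := ssZ l sS Sv; have := si_ge0 (ssD sS Sl Sw).
  by rewrite siDD// !siZl// siZr//; rewrite !mulrA -expr2.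
have v0 := si_ge0 Sv; have w0 := si_ge0 Sw.
have [vz|vnz] := eqVneq (b v v) 0; last first.
  have := key (- (b v w) / b v v).
  have vp : 0 < b v v by rewrite lt_neqAle eq_sym vnz.
  rewrite (_ : _ + _ = (b v v * b w w - b v w ^+ 2) / b v v); last by field.
  by rewrite pmulr_lge0 ?invr_gt0// subr_ge0.
rewrite vz mul0r; suff -> : b v w = 0 by rewrite expr0n.
apply/eqP/negP => /negP nz.
have := key (- (b w w + 1) / (2 * b v w)).
rewrite vz mulr0 add0r (_ : 2 * _ * _ = - (b w w + 1)); last by field.
by lra.
Qed.

Lemma cauchy_schwarz v w : S v -> S w ->
  `|b v w| <= Num.sqrt (b v v) * Num.sqrt (b w w).
Proof.
move=> Sv Sw; rewrite -sqrtrM ?si_ge0// -sqrtr_sqr ler_wsqrtr//.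
exact: cauchy_schwarz_sqr.
Qed.

Lemma semi_inner_seminormed : seminormed S (fun v => Num.sqrt (b v v)).
Proof.
split => //.
  move=> a v Sv; rewrite siZl// ?siZr//; last exact: ssZ.
  by rewrite mulrA -expr2 sqrtrM ?sqr_ge0// sqrtr_sqr.
move=> v w Sv Sw; rewrite -(@ler_pXn2r _ 2)// ?nnegrE ?addr_ge0 ?sqrtr_ge0//.
rewrite sqr_sqrtr; last by apply: si_ge0; exact: ssD.
rewrite siDD// sqrrD !sqr_sqrtr ?si_ge0//.
have := le_trans (ler_norm _) (cauchy_schwarz Sv Sw).
by rewrite mulrnAl -mulr_natl => h; lra.
Qed.

End semi_inner_theory.
End semi_inner_products.

(** * Lebesgue measure on R^d *)

Section euclidean_measure.
Context (R : realType).
Implicit Types (d : nat).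

Definition obox d (a b : 'rV[R]_d) : set 'rV[R]_d :=
  [set x | forall i, a ord0 i < x ord0 i < b ord0 i].

Definition cbox d (M : R) : set 'rV[R]_d := [set x | forall i, `|x ord0 i| <= M].

Lemma measurable_coord_preimage d (A : 'I_d -> set R) :
  (forall i, measurable (A i)) ->
  measurable [set x : 'rV[R]_d | forall i, A i (x ord0 i)].
Proof.
move=> mA.
have -> : [set x : 'rV[R]_d | forall i, A i (x ord0 i)] =
    \bigcap_(i in [set: 'I_d]) ((fun x : 'rV[R]_d => x ord0 i) @^-1` A i).
  by apply/seteqP; split => x /= h i => [_|]; apply: h.
apply: fin_bigcap_measurable; first exact: finite_finset.
move=> i _; rewrite -[X in measurable X]setTI; exact: measurable_rV_coord.
Qed.

Lemma measurable_obox d (a b : 'rV[R]_d) : measurable (obox a b).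
Proof.
exact: (@measurable_coord_preimage d (fun i => `]a ord0 i, b ord0 i[%classic)
          (fun i => measurable_itv _)).
Qed.

Lemma measurable_cbox d M : measurable (@cbox d M).
Proof.
have := @measurable_coord_preimage d (fun i => `[- M, M]%classic).
move=> /(_ (fun i => measurable_itv _)); congr measurable.
by apply/seteqP; split => x /= h i; have := h i; rewrite in_itv/= ler_norml.
Qed.

Lemma nbhs_rVP d (x : 'rV[R]_d) (A : set 'rV[R]_d) :
  nbhs x A <-> exists2 e : R, 0 < e &
    forall y : 'rV[R]_d, (forall i, `|x ord0 i - y ord0 i| < e) -> A y.
Proof.
split=> [/nbhs_ballP[e /= e0 h]|[e e0 h]].
  by exists e => // y hy; apply: h; split => // i j; rewrite (ord1 i); exact: hy.
by apply/nbhs_ballP; exists e => //= y [_ hy]; apply: h => i; exact: hy.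
Qed.

(** Boxes with rational data form a countable base. *)
Lemma open_box_cover d (O : set 'rV[R]_d) : open O ->
  exists F : nat -> set 'rV[R]_d,
    (forall n, F n = set0 \/ exists a b, F n = obox a b /\ obox a b `<=` O) /\
    O = \bigcup_n F n.
Proof.
move=> oO.
pose I : countType := ('rV[rat]_d * 'rV[rat]_d)%type.
pose B (i : I) := obox (map_mx (@ratr R) i.1) (map_mx (@ratr R) i.2).
pose F n := if unpickle n is Some i then (if `[< B i `<=` O >] then B i else set0) else set0.
have hF n : F n = set0 \/ exists a b, F n = obox a b /\ obox a b `<=` O.
  rewrite /F; case: (unpickle n) => [i|]; last by left.
  case: asboolP => h; last by left.
  by right; exists (map_mx (@ratr R) i.1), (map_mx (@ratr R) i.2).
exists F; split => //; apply/seteqP; split; last first.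
  by move=> x [n _]; have [->//|[a [b [-> h]]]] := hF n; exact: h.
move=> x Ox; have /nbhs_rVP[e e0 he] : nbhs x O by exact: open_nbhs_nbhs.
have /choice[q hq] : forall i : 'I_d, exists q : rat * rat,
    x ord0 i - e < ratr q.1 < x ord0 i /\ x ord0 i < ratr q.2 < x ord0 i + e.
  move=> i; have h1 : x ord0 i - e < x ord0 i by rewrite ltrBlDr ltrDl.
  have h2 : x ord0 i < x ord0 i + e by rewrite ltrDl.
  have [q1] := rat_in_itvoo h1; rewrite in_itv/= => hq1.
  have [q2] := rat_in_itvoo h2; rewrite in_itv/= => hq2.
  by exists (q1, q2).
pose i : I := (\row_j (q j).1, \row_j (q j).2).
have Bi y : B i y <-> forall j, ratr (q j).1 < y ord0 j < ratr (q j).2.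
  by split=> h j; have := h j; rewrite !mxE.
exists (pickle i) => //; rewrite /F pickleK ifT.
  by apply/Bi => j; have [/andP[_ ->] /andP[-> _]] := hq j.
apply/asboolP => y /Bi hy; apply: he => j.
have [/andP[h1 h2] /andP[h3 h4]] := hq j; have /andP[h5 h6] := hy j.
by rewrite ltr_norml; apply/andP; split; lra.
Qed.

Lemma open_measurable_rV d (O : set 'rV[R]_d) : open O -> measurable O.
Proof.
move=> /open_box_cover[F [hF ->]]; apply: bigcupT_measurable => n.
have [->|[a [b [-> _]]]] := hF n; first exact: measurable0.
exact: measurable_obox.
Qed.

Lemma continuous_measurable_rV d (f : 'rV[R]_d -> R) : continuous f ->
  measurable_fun setT f.
Proof.
move=> /continuousP cf; apply: (measurability _ (RGenOpens.measurableE R)).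
move=> _ [_ [a [b ->] <-]]; rewrite setTI; apply: open_measurable_rV.
exact/cf/interval_open.
Qed.

Lemma compact_cbox d M : compact (@cbox d M).
Proof.
have := @rV_compact _ d (fun=> `[- M, M]%classic : set R).
move=> /(_ (fun=> @segment_compact _ _ _)); congr compact.
by apply/seteqP; split => x /= h i; have := h i; rewrite in_itv/= ler_norml.
Qed.

Lemma bounded_set_cbox d (A : set 'rV[R]_d) : bounded_set A ->
  exists2 M, 0 <= M & A `<=` cbox M.
Proof.
move=> [M [_ hM]]; exists (`|M| + 1); first by rewrite addr_ge0.
move=> x Ax i; apply: le_trans (hM (`|M| + 1) _ x Ax); last first.
  by rewrite (le_lt_trans (ler_norm _))// ltrDl.
by rewrite [leRHS]mx_normrE; exact: (le_bigmax _ (fun i => `|x i.1 i.2|) (ord0, i)).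
Qed.

Lemma lebesgue_rVS d (A : set 'rV[R]_d.+1) :
  lebesgue_rV R d.+1 A = (lebesgue_measure \x lebesgue_rV R d)%E (@rV_cons R d @^-1` A).
Proof. by []. Qed.

Lemma cbox_finite d M : (lebesgue_rV R d (@cbox d M) < +oo)%E.
Proof.
elim: d => [|d ih].
  by rewrite /= diracE; case: (_ \in _); rewrite ltry.
rewrite lebesgue_rVS (_ : _ @^-1` _ = `[- M, M]%classic `*` @cbox d M).
  rewrite product_measure1E//; last exact: measurable_cbox.
  have h : (lebesgue_measure (`[(- M)%R, M]%classic : set R) < +oo)%E.
    by rewrite lebesgue_measure_itv/=; case: ifP; rewrite ?ltry// -EFinB ltry.
  by rewrite lte_mul_pinfty// ge0_fin_numE.
apply/seteqP; split => [[a y] h|[a y] [h1 h2] i]; rewrite /=.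
  split; first by have := h ord0; rewrite mxE unlift_none/= in_itv/= ler_norml.
  by move=> i; have := h (lift ord0 i); rewrite mxE liftK.
rewrite mxE; case: (unliftP ord0 i) => [j _|_] /=; first exact: h2.
by move: h1; rewrite /= in_itv/= ler_norml.
Qed.

Lemma bounded_support_integrable d (f : 'rV[R]_d -> R) M : continuous f ->
  (forall x, f x != 0 -> cbox M x) -> (lebesgue_rV R d).-integrable setT (EFin \o f).
Proof.
move=> cf sf.
have mf := continuous_measurable_rV cf.
have i1 : (lebesgue_rV R d).-integrable (cbox M) (EFin \o f).
  apply: measurable_bounded_integrable => //.
  - exact: measurable_cbox.
  - exact: cbox_finite.
  - exact: measurable_funTS.
  - have := continuous_compact (continuous_subspaceT cf) (@compact_cbox d M).
    move=> /compact_bounded[K [Kr hK]]; exists K; split => // k Kk x Mx.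
    by apply: hK => //; exists x.
rewrite (_ : f = f \_ (cbox M)).
  have := integrable_mkcond (EFin \o f) (@measurable_cbox d M).
  move=> /(_ (lebesgue_rV R d)) /iffLR /(_ i1); congr (integrable _ _ _).
  by apply/funext => x; rewrite /= !patchE; case: ifP.
apply/funext => x; rewrite patchE; case: ifPn => //; rewrite notin_setE => nx.
by apply/eqP; apply: contrapT => /negP /sf.
Qed.

Lemma rV_lineE d (x : 'rV[R]_d) (i j : 'I_d) h :
  (h *: delta_mx ord0 i + x) ord0 j = (if j == i then h else 0) + x ord0 j.
Proof. by rewrite !mxE/=; case: (j == i); rewrite ?mulr1 ?mulr0. Qed.

Lemma partial0_off d (i : 'I_d) (f : 'rV[R]_d -> R) x :
  (\forall y \near x, f y = 0) -> partial i f x = 0.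
Proof.
move=> h; rewrite /partial (@near_eq_derive _ _ _ f (cst 0))//.
exact: derive_cst.
Qed.

Lemma partial_support d (i : 'I_d) (f : 'rV[R]_d -> R) M :
  (forall x, f x != 0 -> cbox M x) -> forall x, partial i f x != 0 -> cbox M x.
Proof.
move=> sf x; apply: contraPP => /existsNP[j /negP]; rewrite -ltNge => hj.
apply/negP; rewrite negbK; apply/eqP; apply: partial0_off; apply/nbhs_rVP.
exists (`|x ord0 j| - M); first by rewrite subr_gt0.
move=> y hy; apply/eqP; apply: contrapT => /negP /sf /(_ j) h.
have := hy j; have := lerB_dist (x ord0 j) (y ord0 j); lra.
Qed.

Definition c1_compact d (i : 'I_d) (f : 'rV[R]_d -> R) (M : R) :=
  [/\ continuous f, forall x, derivable f x (delta_mx ord0 i),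
      continuous (partial i f) & forall x, f x != 0 -> cbox M x].

Lemma rV_cons_continuousl d (y : 'rV[R]_d) : continuous (fun a : R => rV_cons (a, y)).
Proof.
move=> a A /nbhs_rVP[e e0 h]; apply/nbhs_normP; exists e => //= b hb; apply: h => i.
rewrite !mxE; case: (unlift ord0 i) => //= j; by rewrite subrr normr0.
Qed.

Lemma rV_cons_continuousr d (a : R) : continuous (fun y : 'rV[R]_d => rV_cons (a, y)).
Proof.
move=> y A /nbhs_rVP[e e0 h]; apply/nbhs_rVP; exists e => //= z hz; apply: h => i.
rewrite !mxE; case: (unlift ord0 i) => //=; by rewrite subrr normr0.
Qed.

Lemma rV_cons_line0 d h a (y : 'rV[R]_d) :
  h *: delta_mx ord0 ord0 + rV_cons (a, y) = rV_cons (h + a, y).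
Proof.
apply/rowP => i; rewrite rV_lineE !mxE; case: (unliftP ord0 i) => [j ->|->] //=.
by rewrite add0r.
Qed.

Lemma rV_cons_lineS d h a (y : 'rV[R]_d) j :
  h *: delta_mx ord0 (lift ord0 j) + rV_cons (a, y) =
  rV_cons (a, h *: delta_mx ord0 j + y).
Proof.
apply/rowP => i; rewrite rV_lineE !mxE; case: (unliftP ord0 i) => [k ->|->] /=.
  by rewrite !mxE eqxx/= (inj_eq lift_inj); case: eqP => _; rewrite ?mulr1 ?mulr0.
by rewrite add0r.
Qed.

Lemma rV_cons_quot0 d (f : 'rV[R]_d.+1 -> R) a (y : 'rV[R]_d) :
  (fun h : R => h^-1 *: ((f \o shift (rV_cons (a, y))) (h *: delta_mx ord0 ord0) -
                         f (rV_cons (a, y)))) =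
  (fun h : R => h^-1 *: (((fun a => f (rV_cons (a, y))) \o shift a) (h *: (1 : R)) -
                         f (rV_cons (a, y)))).
Proof. by apply/funext => h; rewrite /= rV_cons_line0 [h *: 1]mulr1. Qed.

Lemma rV_cons_quotS d (f : 'rV[R]_d.+1 -> R) a (y : 'rV[R]_d) j :
  (fun h : R => h^-1 *: ((f \o shift (rV_cons (a, y))) (h *: delta_mx ord0 (lift ord0 j)) -
                         f (rV_cons (a, y)))) =
  (fun h : R => h^-1 *: (((fun y => f (rV_cons (a, y))) \o shift y) (h *: delta_mx ord0 j) -
                         f (rV_cons (a, y)))).
Proof. by apply/funext => h; rewrite /= rV_cons_lineS. Qed.

Lemma int_deriv_bounded_support (g g' : R -> R) (M : R) :
  (forall t, is_derive t (1 : R) g (g' t)) -> continuous g' ->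
  (forall t, g t != 0 -> `|t| <= M) -> (forall t, g' t != 0 -> `|t| <= M) ->
  (\int[lebesgue_measure]_t (g' t)%:E = 0)%E.
Proof.
move=> dg cg sg sg'.
pose K : R := `|M| + 1; have KM (t : R) : K <= `|t| -> ~ `|t| <= M.
  by move=> h1 h2; have := ler_norm M; rewrite /K in h1; lra.
have K0 : 0 < K by rewrite /K ltr_wpDl.
have -> : (\int[lebesgue_measure]_t (g' t)%:E =
           \int[lebesgue_measure]_(t in `](- K)%R, K[) (g' t)%:E)%E.
  rewrite [RHS]integral_mkcond; apply: eq_integral => t _; rewrite patchE.
  case: ifPn => //; rewrite notin_setE/= in_itv/= -ltr_norml => /negP; rewrite -leNgt => h.
  by have [->//|/sg'/(KM _ h)] := eqVneq (g' t) 0.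
have mI := measurable_ioo (- K) K.
have : time_int (- K) K g' = g K - g (- K) by apply: time_int_FTC => //; lra.
have -> : g K = 0.
  by apply/eqP; apply: contrapT => /negP /sg; apply: KM; rewrite gtr0_norm.
have -> : g (- K) = 0.
  by apply/eqP; apply: contrapT => /negP /sg; apply: KM; rewrite normrN gtr0_norm.
rewrite subrr => h; rewrite -[LHS]fineK ?[fine _]h//.
apply: integrable_fin_num => //.
apply: (@continuous_itv_integrable _ (- K) K) => //; exact: subset_itv_oo_cc.
Qed.

(** Integration over one coordinate at a time: the fundamental theorem of
    calculus in the outermost coordinate, induction in the others. *)
Lemma int_partial_eq0 d (i : 'I_d) (f : 'rV[R]_d -> R) M : c1_compact i f M ->
  (\int[lebesgue_rV R d]_x (partial i f x)%:E = 0)%E.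
Proof.
elim: d i f => [[]//|d ih] i f [cf df cdf sf].
have mD := continuous_measurable_rV cdf.
have spf := partial_support sf.
have iD := bounded_support_integrable cdf (spf i).
pose P : set (R * 'rV[R]_d) -> \bar R := (lebesgue_measure \x lebesgue_rV R d)%E.
have mc := @measurable_rV_cons R d.
have iF : ((lebesgue_measure \x lebesgue_rV R d)%E).-integrable setT
    ((EFin \o partial i f) \o @rV_cons R d).
  apply/integrableP; split.
    by apply: measurableT_comp => //; exact/measurable_EFinP.
  move/integrableP : iD => [_]; apply: le_lt_trans.
  rewrite (@eq_measure_integral _ _ _ _
    (pushforward (lebesgue_measure \x lebesgue_rV R d)%E (@rV_cons R d)))//.
  rewrite ge0_integral_pushforward//.
  by apply: measurableT_comp => //; exact/measurable_EFinP.
rewrite (@eq_measure_integral _ _ _ _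
    (pushforward (lebesgue_measure \x lebesgue_rV R d)%E (@rV_cons R d)))//.
transitivity (\int[(lebesgue_measure \x lebesgue_rV R d)%E]_x
    ((EFin \o partial i f) \o @rV_cons R d) x)%E.
  by rewrite -[in RHS](preimage_setT (@rV_cons R d)); apply: integral_pushforward => //;
    exact/measurable_EFinP.
case: (unliftP ord0 i) => [j|] iE.
  rewrite -(integral12_prod_meas1 iF); apply: integral0_eq => a _ /=.
  pose g := fun y => f (rV_cons (a, y)).
  have dgE y : partial j g y = partial i f (rV_cons (a, y)).
    by rewrite /partial /derive iE rV_cons_quotS.
  have := ih j g; under eq_integral do rewrite dgE; apply; split.
  - by move=> y; apply: continuous_comp; [exact: rV_cons_continuousr|exact: cf].
  - move=> y; by have := df (rV_cons (a, y)); rewrite /derivable iE rV_cons_quotS.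
  - rewrite (_ : partial j g = partial i f \o (fun y => rV_cons (a, y))).
      by move=> y; apply: continuous_comp; [exact: rV_cons_continuousr|exact: cdf].
    by apply/funext => y; rewrite dgE.
  - by move=> y /sf h k; have := h (lift ord0 k); rewrite mxE liftK.
rewrite -(integral21_prod_meas1 iF); apply: integral0_eq => y _ /=.
apply: (@int_deriv_bounded_support (fun a => f (rV_cons (a, y))) _ M).
- move=> a; split.
    by have := df (rV_cons (a, y)); rewrite /derivable iE rV_cons_quot0.
  by rewrite /partial /derive iE rV_cons_quot0.
- by move=> a; apply: continuous_comp; [exact: rV_cons_continuousl|exact: cdf].
- by move=> a /sf /(_ ord0); rewrite mxE unlift_none.
- by move=> a /spf /(_ ord0); rewrite mxE unlift_none.
Qed.

End euclidean_measure.

(** * Test functions *)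

Section test_functions.
Context (R : realType) (d : nat).
Notation pt := 'rV[R]_d.
Notation fct := (pt -> R).
Notation mu := (lebesgue_rV R d).
Implicit Types (v w phi psi : fct) (g : 'I_d -> R -> R).

Lemma continuous_mul (f h : fct) : continuous f -> continuous h ->
  continuous (fun x => f x * h x).
Proof. by move=> cf ch x; apply: continuousM; [exact: cf|exact: ch]. Qed.

Lemma continuous_add (f h : fct) : continuous f -> continuous h ->
  continuous (fun x => f x + h x).
Proof. by move=> cf ch x; apply: continuousD; [exact: cf|exact: ch]. Qed.

Lemma continuous_prod (I : Type) (r : seq I) (h : I -> pt -> R) :
  (forall i, continuous (h i)) -> continuous (fun x => \prod_(i <- r) h i x).
Proof.
move=> ch; elim: r => [|i r ih].
  rewrite (_ : (fun _ => _) = fun=> 1); first exact: cst_continuous.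
  by apply/funext => x; rewrite big_nil.
rewrite (_ : (fun _ => _) = fun x => h i x * \prod_(j <- r) h j x).
  exact: continuous_mul.
by apply/funext => x; rewrite big_cons.
Qed.

Definition tensor g : fct := fun x => \prod_i g i (x ord0 i).

Lemma coord_continuous_rV (i : 'I_d) : continuous (fun x : pt => x ord0 i).
Proof. exact: coord_continuous. Qed.

Lemma tensor_continuous g : (forall i, continuous (g i)) -> continuous (tensor g).
Proof.
move=> cg; apply: continuous_prod => i x; apply: continuous_comp; last exact: cg.
exact: coord_continuous_rV.
Qed.

Lemma tensor_derive g (i : 'I_d) (g' : R -> R) x :
  (forall t, is_derive t (1 : R) (g i) (g' t)) ->
  is_derive x (delta_mx ord0 i) (tensor g) (tensor (fun j => if j == i then g' else g j) x).
Proof.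
move=> dg; pose c := \prod_(j | j != i) g j (x ord0 j).
have [dG eG] := is_deriveZ c (dg (x ord0 i)).
have E : (fun h : R => h^-1 *: ((tensor g \o shift x) (h *: delta_mx ord0 i) - tensor g x)) =
   (fun h : R => h^-1 *: (((c \*: g i) \o shift (x ord0 i)) (h *: (1 : R)) - (c \*: g i) (x ord0 i))).
  apply/funext => h; congr (_ *: _); rewrite /tensor /= (bigD1 i)//= [X in _ - X](bigD1 i)//=.
  rewrite rV_lineE eqxx [h *: 1]mulr1 -/c; rewrite [X in _ * X - _](_ : _ = c).
    by rewrite [_ * c]mulrC [X in _ - X]mulrC.
  by apply: eq_bigr => j ji; rewrite rV_lineE (negbTE ji) add0r.
split; first by rewrite /derivable E.
rewrite /derive E; transitivity (c *: g' (x ord0 i)); first exact: eG.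
rewrite /tensor (bigD1 i)//= eqxx [RHS]mulrC; congr (_ * _).
by apply: eq_bigr => j /negbTE ->.
Qed.

Lemma tensor_smooth g : (forall i, smooth1 (g i)) -> smooth (tensor g).
Proof.
move=> sg s.
have [g' sg' ->] : exists2 g', (forall i, smooth1 (g' i)) & partials s (tensor g) = tensor g'.
  elim: s => [|i s [g' sg' e]]; first by exists g.
  have [h dh sh] := smooth1_deriv (sg' i).
  exists (fun j => if j == i then h else g' j) => [j|]; first by case: ifP.
  rewrite /partials/= -/(partials s _) e; apply/funext => x.
  by have [] := tensor_derive x dh.
split; first by apply: tensor_continuous => i; exact: smooth1_continuous.
move=> i x; have [h dh _] := smooth1_deriv (sg' i).
by have [] := tensor_derive x dh.
Qed.

Lemma partials_linear (a : R) phi psi s : smooth phi -> smooth psi ->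
  partials s (a *: phi + psi) = a *: partials s phi + partials s psi.
Proof.
move=> sphi spsi; elim: s => // i s ih.
rewrite /partials/= -!/(partials s _) ih; apply/funext => x.
have d1 := (sphi s).2 i x; have d2 := (spsi s).2 i x.
have d3 : derivable (a *: partials s phi) x (delta_mx ord0 i) by exact: derivableZ.
by rewrite /partial (deriveD d3 d2) (deriveZ _ d1).
Qed.

Lemma smooth_linear (a : R) phi psi : smooth phi -> smooth psi -> smooth (a *: phi + psi).
Proof.
move=> sphi spsi s; rewrite partials_linear//; split.
  apply: continuous_add; last exact: (spsi s).1.
  by apply: (@continuous_mul (fun=> a)); [exact: cst_continuous|exact: (sphi s).1].
move=> i x; apply: derivableD; last exact: (spsi s).2.
by apply: derivableZ; exact: (sphi s).2.
Qed.

Section domain.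
Variable Omega : set pt.
Hypothesis oO : open Omega.
Hypothesis bO : bounded_set Omega.
Notation test := (@test_function R d Omega).

Lemma measurable_Omega : measurable Omega.
Proof. exact: open_measurable_rV. Qed.

Lemma test_linear (a : R) phi psi : test phi -> test psi -> test (a *: phi + psi).
Proof.
move=> [s1 c1 k1] [s2 c2 k2].
have sub : closure [set x | (a *: phi + psi) x != 0] `<=`
    closure [set x | phi x != 0] `|` closure [set x | psi x != 0].
  rewrite -closureU; apply: closureS => x /=.
  have [p0|p0] := eqVneq (phi x) 0; last by left.
  move=> h; right; apply: contraNN h => /eqP q0.
  have -> : (a *: phi + psi) x = a * phi x + psi x by [].
  by rewrite p0 q0 mulr0 addr0.
split; first exact: smooth_linear.
- apply: subclosed_compact sub; first exact: closed_closure.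
  exact: compactU.
- by move=> x /sub [/k1|/k2].
Qed.

Lemma test0 : test 0.
Proof.
have e : [set x : pt | (0 : fct) x != 0] = set0 by apply/seteqP; split => x //=; rewrite eqxx.
split; rewrite ?e ?closure0; [|exact: compact0|exact: sub0set].
have z t : partials t (0 : fct) = 0.
  elim: t => // i t ih; rewrite /partials/= -/(partials t _) ih.
  by apply/funext => x; rewrite /partial derive_cst.
move=> t; rewrite z; split => [|i x]; [exact: cst_continuous|exact: derivable_cst].
Qed.

Lemma test_continuous phi : test phi -> continuous phi.
Proof. by case=> s _ _; exact: (s [::]).1. Qed.

Lemma test_derivable phi i x : test phi -> derivable phi x (delta_mx ord0 i).
Proof. by case=> s _ _; exact: (s [::]).2. Qed.

Lemma test_partial_continuous phi i : test phi -> continuous (partial i phi).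
Proof. by case=> s _ _; exact: (s [:: i]).1. Qed.

Lemma test_out phi x : test phi -> ~ Omega x -> phi x = 0.
Proof.
move=> [_ _ k] nO; apply/eqP; apply: contrapT => /negP h; apply: nO; apply: k.
exact: subset_closure.
Qed.

Lemma test_support phi : test phi -> exists2 M, 0 <= M & forall x, phi x != 0 -> cbox M x.
Proof.
move=> tp; have [M M0 hM] := bounded_set_cbox bO; exists M => // x h; apply: hM.
by apply: contrapT => /(test_out tp) e; rewrite e eqxx in h.
Qed.

Lemma Rintegral_Omega (f : fct) : (forall x, ~ Omega x -> f x = 0) ->
  \int[mu]_(x in Omega) f x = \int[mu]_x f x.
Proof.
move=> f0; rewrite Rintegral_mkcond; apply: eq_Rintegral => x _.
by rewrite patchE; case: ifPn => //; rewrite notin_setE => /f0.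
Qed.

Lemma continuous_L2 (f : fct) M : continuous f -> (forall x, f x != 0 -> cbox M x) ->
  L2 Omega f.
Proof.
move=> cf sf; split.
  by apply: measurable_funTS; exact: continuous_measurable_rV.
have i2 : mu.-integrable setT (EFin \o (fun x => f x ^+ 2)).
  apply: (@bounded_support_integrable _ _ _ M).
    exact: continuous_mul.
  by move=> x; rewrite expf_eq0/=; exact: sf.
have : mu.-integrable Omega (EFin \o (fun x => f x ^+ 2)).
  by apply: integrableS i2 => //; exact: measurable_Omega.
exact: (integrable_lty measurable_Omega).
Qed.

Lemma test_L2 phi : test phi -> L2 Omega phi.
Proof.
move=> tp; have [M _ hM] := test_support tp.
by apply: (@continuous_L2 _ M) => //; exact: test_continuous.
Qed.

Lemma test_partial_L2 phi i : test phi -> L2 Omega (partial i phi).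
Proof.
move=> tp; have [M _ hM] := test_support tp.
apply: (@continuous_L2 _ M); first exact: test_partial_continuous.
exact: partial_support.
Qed.

Lemma partialM i phi psi x : derivable phi x (delta_mx ord0 i) ->
  derivable psi x (delta_mx ord0 i) ->
  partial i (fun x => phi x * psi x) x = phi x * partial i psi x + psi x * partial i phi x.
Proof. by move=> d1 d2; exact: (deriveM d1 d2). Qed.

Lemma c1_compactM i phi psi M :
  continuous phi -> (forall x, derivable phi x (delta_mx ord0 i)) ->
  continuous (partial i phi) -> c1_compact i psi M ->
  c1_compact i (fun x => phi x * psi x) M.
Proof.
move=> c1 d1 p1 [c2 d2 p2 s2]; split.
- exact: continuous_mul.
- by move=> x; apply: (@derivableM _ _ phi psi).
- rewrite (_ : partial i _ = fun x => phi x * partial i psi x + psi x * partial i phi x).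
    by apply: continuous_add; exact: continuous_mul.
  by apply/funext => x; exact: partialM.
- by move=> x; rewrite mulf_eq0 negb_or => /andP[_]; exact: s2.
Qed.

Lemma test_c1_compact i phi : test phi -> exists2 M, 0 <= M & c1_compact i phi M.
Proof.
move=> tp; have [M M0 hM] := test_support tp; exists M => //; split => //.
- exact: test_continuous.
- by move=> x; exact: test_derivable.
- exact: test_partial_continuous.
Qed.

Lemma c1_compact_int0 i f M : c1_compact i f M ->
  \int[mu]_x partial i f x = 0.
Proof. by move=> h; rewrite /Rintegral (int_partial_eq0 h). Qed.

Lemma bounded_support_Rint (f g : fct) M : continuous f -> continuous g ->
  (forall x, f x != 0 -> cbox M x) -> (forall x, g x != 0 -> cbox M x) ->
  \int[mu]_x (f x + g x) = \int[mu]_x f x + \int[mu]_x g x.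
Proof.
move=> cf cg sf sg; rewrite RintegralD//.
- exact: bounded_support_integrable sf.
- exact: bounded_support_integrable sg.
Qed.

(** The partial derivative of the product of two test functions has integral
    zero. *)
Lemma test_by_parts i phi psi : test phi -> test psi ->
  ip Omega phi (partial i psi) = - ip Omega (partial i phi) psi.
Proof.
move=> tp tq; have [M M0 cq] := test_c1_compact i tq.
have cpq := c1_compactM (test_continuous tp) (fun x => @test_derivable _ i x tp)
  (@test_partial_continuous _ i tp) cq.
have [_ _ _ sq] := cq.
have := c1_compact_int0 cpq.
rewrite (_ : (fun x => partial i _ x) = (fun x => phi x * partial i psi x + partial i phi x * psi x)).
  rewrite (@bounded_support_Rint _ _ M).
  - rewrite /ip !Rintegral_Omega; first by move=> /eqP; rewrite addr_eq0 => /eqP.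
      by move=> x nx; rewrite (test_out tq nx) mulr0.
    by move=> x nx; rewrite (test_out tp nx) mul0r.
  - by apply: continuous_mul; [exact: test_continuous|exact: test_partial_continuous].
  - by apply: continuous_mul; [exact: test_partial_continuous|exact: test_continuous].
  - by move=> x; rewrite mulf_eq0 negb_or => /andP[_]; exact: partial_support.
  - by move=> x; rewrite mulf_eq0 negb_or => /andP[_]; exact: sq.
apply/funext => x; rewrite partialM ?[psi x * _]mulrC//; exact: test_derivable.
Qed.

Lemma test_weak_grad phi : test phi -> is_weak_grad Omega phi (fun i => partial i phi).
Proof.
move=> tp; split=> [i|psi tq i]; first exact: test_partial_L2.
exact: test_by_parts.
Qed.

Lemma bump_test (n : nat) (a b : pt) : obox a b `<=` Omega ->
  test (tensor (fun i => cutoff n (a ord0 i) (b ord0 i))).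
Proof.
move=> sO.
pose K := [set x : pt | forall i, `[a ord0 i + n.+1%:R^-1, b ord0 i - n.+1%:R^-1]%classic (x ord0 i)].
have cK : compact K.
  apply: (@rV_compact _ _ (fun i => `[a ord0 i + n.+1%:R^-1, b ord0 i - n.+1%:R^-1]%classic)).
  by move=> i; exact: segment_compact.
have KO : K `<=` Omega.
  move=> x hx; apply: sO => i; have := hx i; rewrite /= in_itv/= => /andP[h1 h2].
  have n0 : 0 < n.+1%:R^-1 :> R by rewrite invr_gt0.
  by move: n0 h1 h2; move: (n.+1%:R^-1) => z *; apply/andP; split; lra.
have sub : closure [set x | tensor (fun i => cutoff n (a ord0 i) (b ord0 i)) x != 0] `<=` K.
  have cl : closed K by apply: compact_closed => //; exact: norm_hausdorff.
  rewrite [X in _ `<=` X](closure_id _).1//; apply: closureS => x /= + i.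
  rewrite /tensor (bigD1 i)//= mulf_eq0 negb_or => /andP[/cutoff_support h _].
  by rewrite in_itv.
split.
- by apply: tensor_smooth => i; exact: cutoff_smooth.
- apply: subclosed_compact sub => //; exact: closed_closure.
- exact: subset_trans KO.
Qed.

Lemma tensor_cutoff_ge0 n (a b : pt) x :
  0 <= tensor (fun i => cutoff n (a ord0 i) (b ord0 i)) x.
Proof. by apply: prodr_ge0 => i _; exact: cutoff_ge0. Qed.

Lemma tensor_cutoff_le1 n (a b : pt) x :
  tensor (fun i => cutoff n (a ord0 i) (b ord0 i)) x <= 1.
Proof. by apply: prodr_ile1 => i _; rewrite cutoff_ge0 cutoff_le1. Qed.

Lemma tensor_cutoff_cvg (a b : pt) x :
  tensor (fun i => cutoff n (a ord0 i) (b ord0 i)) x @[n --> \oo] --> (\1_(obox a b) x : R).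
Proof.
rewrite indicE; have [xI|xI] := boolP (x \in obox a b).
  have h : forall i, cutoff n (a ord0 i) (b ord0 i) (x ord0 i) @[n --> \oo] --> (1 : R).
    by move=> i; apply: cutoff_cvg; move: xI; rewrite inE => /(_ i).
  have : forall r : seq 'I_d, \prod_(i <- r) cutoff n (a ord0 i) (b ord0 i) (x ord0 i)
      @[n --> \oo] --> (1 : R).
    elim=> [|i r ih]; first by under eq_fun do rewrite big_nil; exact: cvg_cst.
    rewrite (_ : (fun n => _) = fun n => cutoff n (a ord0 i) (b ord0 i) (x ord0 i) *
        \prod_(j <- r) cutoff n (a ord0 j) (b ord0 j) (x ord0 j)).
      have -> : nbhs (1 : R) = nbhs (1 * 1 : R) by rewrite mulr1.
      exact: (cvgM (h i) ih).
    by apply/funext => n; rewrite big_cons.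
  by apply.
move: xI; rewrite notin_setE => /existsNP[i /negP hi].
rewrite (_ : (fun n => _) = fun=> 0); first exact: cvg_cst.
by apply/funext => n; rewrite /tensor (bigD1 i)//= cutoff_out// mul0r.
Qed.

End domain.

(** Each strip [a < x_i < b] is a countable union of boxes. *)
Lemma obox_generates : (measurable : set (set pt)) `<=` <<s [set A | exists a b, A = obox a b] >>.
Proof.
set G := [set A | exists a b, A = obox a b].
apply: smallest_sub; first exact: smallest_sigma_algebra.
move=> A; rewrite -bigcup_seq => -[i _ [B mB <-]]; rewrite setTI.
have mc : measurable_fun (setT : set (g_sigma_algebraType G)) (fun x : pt => x ord0 i).
  apply: (measurability _ (RGenOpens.measurableE R)) => _ [_ [a [b ->] <-]].
  rewrite setTI.
  pose A' n : pt := \row_j (if j == i then a else - n%:R).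
  pose B' n : pt := \row_j (if j == i then b else n%:R).
  have -> : (fun x : pt => x ord0 i) @^-1` `]a, b[%classic = \bigcup_n obox (A' n) (B' n).
    apply/seteqP; split => [x|x [n _ /(_ i)]]; last by rewrite !mxE eqxx/= in_itv.
    rewrite /= in_itv/= => xi.
    exists (\sum_j Num.truncn `|x ord0 j|).+1%N => // j; rewrite !mxE.
    case: eqP => [->//|_]; rewrite -ltr_norml; apply: lt_le_trans (truncnS_gt _) _.
    by rewrite ler_nat ltnS (bigD1 j)//= leq_addr.
  apply: bigcupT_measurable => n; apply: sub_sigma_algebra; by exists (A' n), (B' n).
by have := mc measurableT B mB; rewrite setTI.
Qed.

Lemma oboxI (a b a' b' : pt) : obox a b `&` obox a' b' =
  obox (\row_i Num.max (a ord0 i) (a' ord0 i)) (\row_i Num.min (b ord0 i) (b' ord0 i)).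
Proof.
apply/seteqP; split => [x [h1 h2] i|x h]; rewrite ?mxE.
  by have /andP[? ?] := h1 i; have /andP[? ?] := h2 i; rewrite gt_max lt_min; do 2 (apply/andP; split).
by split=> i; have := h i; rewrite !mxE gt_max lt_min => /andP[/andP[? ?] /andP[? ?]]; apply/andP.
Qed.

(** Inside one box of [Omega], boxes form a pi-system that generates the Borel
    sets; [Omega] is a countable union of such boxes. *)
Lemma vanish_on_boxes (Omega : set pt) (v : fct) : open Omega ->
  mu.-integrable Omega (EFin \o v) ->
  (forall a b, obox a b `<=` Omega -> \int[mu]_(x in obox a b) v x = 0) ->
  eqae Omega v 0.
Proof.
move=> oO iv v0; have mO := open_measurable_rV oO.
have [F [hF OF]] := open_box_cover oO.
have box0 a b : obox a b `<=` Omega -> ae_eq mu (obox a b) v (fun=> 0).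
  move=> sO; apply: (@ae0_of_pi_system _ _ _ _ _ _ [set A | exists a b, A = obox a b]).
  - exact: measurable_obox.
  - by apply: integrableS iv => //; exact: measurable_obox.
  - by move=> A B [a1 [b1 ->]] [a2 [b2 ->]]; rewrite oboxI; eexists; eexists.
  - by move=> A [a1 [b1 ->]]; exact: measurable_obox.
  - exact: obox_generates.
  - exact: v0.
  - move=> A [a1 [b1 ->]]; rewrite oboxI; apply: v0; rewrite -oboxI.
    by move=> x [/sO].
have all n : {ae mu, forall x, F n x -> v x = 0}.
  have [->|[a [b [-> h]]]] := hF n; first by apply: aeW.
  exact: box0.
have := ae_foralln all; rewrite /eqae /ae_eq OF; apply: filterS => x h [n _ Fx].
exact: h Fx.
Qed.

End test_functions.

(** * Dominated convergence *)

Section dominated.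
Context d (T : measurableType d) (R : realType) (mu : {measure set T -> \bar R}).

Lemma Rint_dominated (D : set T) (h : nat -> T -> R) (F G : T -> R) : measurable D ->
  (forall n, aemeas mu D (h n)) -> aeint mu D G ->
  (forall n, {ae mu, forall x, D x -> `|h n x| <= G x}) ->
  {ae mu, forall x, D x -> h n x @[n --> \oo] --> F x} ->
  aeint mu D F /\ (\int[mu]_(x in D) h n x) @[n --> \oo] --> \int[mu]_(x in D) F x.
Proof.
move=> mD mh [G' iG' GG'] hG hF.
have [F' mF' FF'] := aemeas_cvg mh hF.
have /choice[g hg] : forall n, exists g : T -> R, measurable_fun D g /\ ae_eq mu D (h n) g.
  by move=> n; have [g ? ?] := mh n; exists g.
have hg2 : {ae mu, forall x n, D x -> h n x = g n x}.
  by have := ae_foralln (fun n => (hg n).2); apply: filterS => x hx n Dx; exact: hx.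
have hG2 : {ae mu, forall x n, D x -> `|h n x| <= G x}.
  by have := ae_foralln hG; apply: filterS => x hx n Dx; exact: hx.
have [i1 _ c] : [/\ mu.-integrable D (EFin \o F'),
  [sequence (\int[mu]_(x in D) `|(g n x)%:E - (F' x)%:E|)%E]_n @ \oo --> 0%E &
  [sequence (\int[mu]_(x in D) (g n x)%:E)%E]_n @ \oo --> (\int[mu]_(x in D) (F' x)%:E)%E].
  apply: (@dominated_convergence _ _ _ mu D mD (fun n x => (g n x)%:E)
    (EFin \o F') (EFin \o G')) => //.
  - by move=> n; apply/measurable_EFinP; exact: (hg n).1.
  - exact/measurable_EFinP.
  - apply: filterS3 hg2 hF FF' => x a b c Dx /=; rewrite -(c Dx).
    apply: cvg_EFin; first by apply: nearW.
    rewrite (_ : _ \o _ = (fun n => h n x)); first exact: b.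
    by apply/funext => n /=; rewrite a.
  - apply: filterS3 hg2 hG2 GG' => x a b c n Dx /=.
    by rewrite lee_fin -(c Dx) -(a n Dx); exact: b.
split; first by exists F' => //; exact: ae_eq_sym.
rewrite (Rintegral_ae_congr mD FF').
have /fine_cvg : (\int[mu]_(x in D) (g n x)%:E)%E @[n --> \oo] -->
    (fine (\int[mu]_(x in D) (F' x)%:E))%:E.
  by rewrite fineK; [exact: c|exact: (integrable_fin_num mD i1)].
apply: cvg_trans; apply: near_eq_cvg.
apply: nearW => n /=; congr fine; apply: integral_ae_congr => //.
by apply: filterS (hg n).2 => x + Dx => /(_ Dx) /= ->.
Qed.

End dominated.

(** * The spaces L^2, H^1_0 and H^-1 *)

Section sobolev_spaces.
Context (R : realType) (d : nat).
Notation pt := 'rV[R]_d.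
Notation fct := (pt -> R).
Notation mu := (lebesgue_rV R d).
Variable Omega : set pt.
Hypothesis oO : open Omega.
Hypothesis bO : bounded_set Omega.
Notation test := (@test_function R d Omega).
Notation L2 := (L2 Omega).
Notation H1 := (H1 Omega).
Notation H10 := (H10 Omega).
Notation Hm1 := (Hm1 Omega).
Notation ip := (ip Omega).
Notation nrm := (nrm Omega).
Notation gip := (gip Omega).
Notation gnrm := (gnrm Omega).
Notation grad := (grad Omega).
Notation eqae := (eqae Omega).
Notation dual_nrm := (dual_nrm Omega).
Implicit Types (v w z phi psi : fct) (G H : 'I_d -> fct) (g : fct -> R).

Let mO : measurable Omega. Proof. exact: measurable_Omega. Qed.

Lemma eqae_refl v : eqae v v. Proof. exact: aeW. Qed.
Lemma eqae_sym v w : eqae v w -> eqae w v. Proof. exact: ae_eq_sym. Qed.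
Lemma eqae_lin (a : R) v v' w w' : eqae v v' -> eqae w w' ->
  eqae (a *: v + w) (a *: v' + w').
Proof.
move=> h1 h2; apply: filterS2 h1 h2 => x h1 h2 Ox.
have E (p q : fct) : (a *: p + q) x = a * p x + q x by [].
by rewrite !E h1// h2.
Qed.

Lemma eqaeD v v' w w' : eqae v v' -> eqae w w' -> eqae (v + w) (v' + w').
Proof. by move=> h1 h2; have := eqae_lin 1 h1 h2; rewrite !scale1r. Qed.

Lemma eqaeZ (a : R) v v' : eqae v v' -> eqae (a *: v) (a *: v').
Proof. by move=> h1; have := eqae_lin a h1 (eqae_refl 0); rewrite !addr0. Qed.

Lemma eqaeN v v' : eqae v v' -> eqae (- v) (- v').
Proof. by move=> h; rewrite -[- v]scaleN1r -[- v']scaleN1r; exact: eqaeZ. Qed.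

Lemma eqaeB v v' w w' : eqae v v' -> eqae w w' -> eqae (v - w) (v' - w').
Proof. by move=> h1 h2; apply: eqaeD => //; exact: eqaeN. Qed.

Lemma ip_eqae v v' w w' : eqae v v' -> eqae w w' -> ip v w = ip v' w'.
Proof.
move=> h1 h2; apply: Rintegral_ae_congr => //.
by apply: filterS2 h1 h2 => x h1 h2 Ox; rewrite h1// h2.
Qed.

Lemma nrm_eqae v w : eqae v w -> nrm v = nrm w.
Proof. by move=> h; rewrite /nrm (ip_eqae h h). Qed.

Lemma L2_sqr v : L2 v -> aeint mu Omega (fun x => v x ^+ 2).
Proof. by move=> [mv iv]; apply: aeint_sqr_lty => //; exact: measurable_aemeas. Qed.

Lemma L2_mul v w : L2 v -> L2 w -> aeint mu Omega (fun x => v x * w x).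
Proof.
move=> Lv Lw; apply: aeint_sqr_mul => //; try exact: L2_sqr.
- by apply: measurable_aemeas; case: Lv.
- by apply: measurable_aemeas; case: Lw.
Qed.

Lemma L2_subspace : subspace_set L2.
Proof.
split.
  split; first exact: measurable_cst.
  rewrite integral0_eq ?ltry// => x _.
  by congr EFin; rewrite [X in X ^+ 2](_ : _ = 0)// expr0n.
move=> a v w Lv Lw; have [mv _] := Lv; have [mw _] := Lw; split.
  by apply: (@measurable_funD _ _ _ _ (fun x => a * v x) w) => //; exact: measurable_funM.
apply: aeint_ge0_lty => //.
have -> : (fun x => (a *: v + w) x ^+ 2) =
    (fun x => a ^+ 2 * v x ^+ 2 + (2 * a) * (v x * w x) + w x ^+ 2).
  apply/funext => x; have -> : (a *: v + w) x = a * v x + w x by [].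
  by ring.
apply: aeintD => //; last exact: L2_sqr.
by apply: aeintD => //; apply: aeintZ => //; [exact: L2_sqr|exact: L2_mul].
Qed.

Lemma ip_semi_inner : semi_inner L2 ip.
Proof.
split; first exact: L2_subspace.
- move=> a u v w Lu Lv Lw; rewrite /ip -RintZ//; last exact: L2_mul.
  rewrite -RintD//; [|by apply: aeintZ => //; exact: L2_mul|exact: L2_mul].
  apply: eq_Rintegral => x _; have -> : (a *: u + v) x = a * u x + v x by [].
  by rewrite mulrDl mulrA.
- by move=> v w _ _; apply: eq_Rintegral => x _; rewrite mulrC.
- by move=> v _; apply: Rintegral_ge0 => x _; rewrite -expr2 sqr_ge0.
Qed.

Lemma nrm_seminormed : seminormed L2 nrm.
Proof. exact: semi_inner_seminormed ip_semi_inner. Qed.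

Lemma nrm_sqr v : L2 v -> nrm v ^+ 2 = ip v v.
Proof. by move=> Lv; rewrite sqr_sqrtr//; exact: (si_ge0 ip_semi_inner). Qed.

Lemma nrm_eq0 v : L2 v -> nrm v = 0 -> eqae v 0.
Proof.
move=> Lv n0; have := nrm_sqr Lv; rewrite n0 expr0n/= => i0.
have : ae_eq mu Omega (fun x => v x * v x) (fun=> 0).
  apply: Rint_eq0_ae => //; first exact: L2_mul.
  - by apply: aeW => x _; rewrite -expr2 sqr_ge0.
  - by move: i0; rewrite /ip => <-.
apply: filterS => x h Ox; have /eqP := h Ox; rewrite mulf_eq0 orbb => /eqP ->.
by [].
Qed.

Lemma Omega_finite : (mu Omega < +oo)%E.
Proof.
have [M _ sM] := bounded_set_cbox bO; apply: le_lt_trans (cbox_finite d M).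
by apply: le_measure; rewrite ?inE//; exact: measurable_cbox.
Qed.

Lemma cst_integrable (c : R) : mu.-integrable Omega (EFin \o (fun=> c)).
Proof.
apply: measurable_bounded_integrable => //; first exact: Omega_finite.
by exists `|c|; split => // M cM x _ /=; exact: ltW.
Qed.

Lemma L2_integrable v : L2 v -> mu.-integrable Omega (EFin \o v).
Proof.
move=> Lv; have [mv iv] := Lv.
have [G iG vG] := L2_sqr Lv.
have i1 : aeint mu Omega v.
  apply: (@aeint_le _ _ _ _ _ mO v (fun x => 1 + v x ^+ 2)).
  - exact: measurable_aemeas.
  - apply: aeintD => //; last exact: L2_sqr.
    by apply: integrable_aeint; exact: cst_integrable.
  - apply: aeW => x _; rewrite ler_norml; apply/andP; split; nra.
have {}i1 := aeint_ge0_lty mO (aeint_abs i1).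
apply/integrableP; split; first exact/measurable_EFinP.
exact: i1.
Qed.

(** Smooth bumps converge to indicators of boxes, so [v] integrates to zero
    over boxes. *)
Lemma L2_eq0_test v : L2 v -> (forall phi, test phi -> ip v phi = 0) -> eqae v 0.
Proof.
move=> Lv v0; apply: vanish_on_boxes => //; first exact: L2_integrable.
move=> a b ab; have mB := measurable_obox a b.
rewrite -(Rint_indic mu v mO mB ab).
set F : nat -> fct := fun n => tensor (fun i => cutoff n (a ord0 i) (b ord0 i)).
have tF n : test (F n) by exact: bump_test.
have [_ c] : aeint mu Omega (fun x => \1_(obox a b) x * v x) /\
    (\int[mu]_(x in Omega) (v x * F n x)) @[n --> \oo] -->
    \int[mu]_(x in Omega) (\1_(obox a b) x * v x).
  apply: (@Rint_dominated _ _ _ mu Omega _ _ (fun x => `|v x|)) => //.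
  - move=> n; apply: aemeasM => //; apply: measurable_aemeas; first by case: Lv.
    by case: (test_L2 oO bO (tF n)).
  - by apply: aeint_abs => //; apply: integrable_aeint; exact: L2_integrable.
  - move=> n; apply: aeW => x _; rewrite normrM ler_piMr// ger0_norm ?tensor_cutoff_le1//.
    exact: tensor_cutoff_ge0.
  - apply: aeW => x _; rewrite mulrC; apply: cvgMr; exact: tensor_cutoff_cvg.
move: c; rewrite (_ : (fun n => _) = fun=> 0); last first.
  by apply/funext => n; exact: v0.
by move=> /cvg_lim <- //; rewrite lim_cst.
Qed.

Lemma weak_grad_unique v G H : is_weak_grad Omega v G -> is_weak_grad Omega v H ->
  forall i, eqae (G i) (H i).
Proof.
move=> [LG hG] [LH hH] i.
have LD : L2 (G i - H i) by exact: ssB L2_subspace _ _.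
have : eqae (G i - H i) 0.
  apply: L2_eq0_test => // phi tp.
  rewrite (siBl ip_semi_inner)//; last exact: test_L2.
  by apply/eqP; rewrite subr_eq0 -eqr_opp -hG// -hH.
apply: filterS => x h Ox; have := h Ox.
have -> : (G i - H i) x = G i x - H i x by [].
by move/eqP; rewrite subr_eq0 => /eqP.
Qed.

Lemma weak_grad_eqae v w G : eqae v w -> is_weak_grad Omega v G -> is_weak_grad Omega w G.
Proof.
move=> vw [LG hG]; split => // phi tp i; rewrite -hG//.
by apply: ip_eqae; [exact: eqae_sym|exact: eqae_refl].
Qed.

Lemma grad_eqae v w : eqae v w -> grad v = grad w.
Proof.
move=> vw; congr (xget _ _); apply/seteqP; split => G /=; apply: weak_grad_eqae => //.
exact: eqae_sym.
Qed.

Lemma weak_grad_linear (a : R) v w G H : L2 v -> L2 w ->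
  is_weak_grad Omega v G -> is_weak_grad Omega w H ->
  is_weak_grad Omega (a *: v + w) (fun i => a *: G i + H i).
Proof.
move=> Lv Lw [LG hG] [LH hH]; split => [i|phi tp i]; first exact: L2_subspace.2.
rewrite !(siP ip_semi_inner)//; [|exact: test_L2|exact: test_partial_L2].
by rewrite hG// hH//; ring.
Qed.

Lemma H1_subspace : subspace_set H1.
Proof.
split.
  split; first exact: L2_subspace.1.
  exists (fun=> 0); split=> [i|phi tp i]; first exact: L2_subspace.1.
  by rewrite !(si0l ip_semi_inner) ?oppr0//; [exact: test_L2|exact: test_partial_L2].
move=> a v w [Lv [G hG]] [Lw [H hH]]; split; first exact: L2_subspace.2.
by exists (fun i => a *: G i + H i); exact: weak_grad_linear.
Qed.

Lemma gradP v : H1 v -> is_weak_grad Omega v (grad v).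
Proof. by case=> _ [G hG]; apply: xgetI hG. Qed.

Lemma gipE v w G H : is_weak_grad Omega v G -> is_weak_grad Omega w H ->
  gip v w = \sum_(i < d) ip (G i) (H i).
Proof.
move=> hG hH; apply: eq_bigr => i _; apply: ip_eqae.
- by apply: weak_grad_unique i; last exact: hG; apply: xgetI hG.
- by apply: weak_grad_unique i; last exact: hH; apply: xgetI hH.
Qed.

Lemma gip_semi_inner1 : semi_inner H1 gip.
Proof.
split; first exact: H1_subspace.
- move=> a u v w hu hv hw.
  have [Lu _] := hu; have [Lv _] := hv.
  have gu := gradP hu; have gv := gradP hv; have gw := gradP hw.
  rewrite (gipE (weak_grad_linear a Lu Lv gu gv) gw).
  rewrite /gip mulr_sumr -big_split/=; apply: eq_bigr => i _.
  by rewrite (siP ip_semi_inner)//; [apply gu.1|apply gv.1|apply gw.1].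
- move=> v w hv hw; apply: eq_bigr => i _.
  by rewrite (siC ip_semi_inner)//; [apply (gradP hv).1|apply (gradP hw).1].
- move=> v hv; apply: sumr_ge0 => i _; apply: (si_ge0 ip_semi_inner).
  exact: (gradP hv).1.
Qed.

Lemma test_H1 phi : test phi -> H1 phi.
Proof.
move=> tp; split; first exact: test_L2.
by exists (fun i => partial i phi); exact: test_weak_grad.
Qed.

Lemma H10_H1 v : H10 v -> H1 v. Proof. by case. Qed.
Lemma H10_L2 v : H10 v -> L2 v. Proof. by case; case. Qed.

Lemma gip_eqae v v' w w' : eqae v v' -> eqae w w' -> gip v w = gip v' w'.
Proof. by move=> h1 h2; rewrite /gip (grad_eqae h1) (grad_eqae h2). Qed.

Lemma gnrm_eqae v w : eqae v w -> gnrm v = gnrm w.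
Proof. by move=> h; rewrite /gnrm (gip_eqae h h). Qed.

Let gn1 : seminormed H1 gnrm. Proof. exact: semi_inner_seminormed gip_semi_inner1. Qed.

(** Separate bounds on the two norms combine linearly, unlike the bound on the
    sum of squares. *)
Lemma H10P v : H10 v <-> H1 v /\ forall e : R, 0 < e -> exists phi, test phi /\
  nrm (v - phi) <= e /\ gnrm (v - phi) <= e.
Proof.
split=> -[hv h]; split => // e e0.
  have [phi [tp hp]] := h _ e0; exists phi; split; first exact: tp.
  have h1 : L2 (v - phi) by apply: ssB L2_subspace _ _; [case: hv|exact: test_L2].
  have h2 : H1 (v - phi) by apply: ssB H1_subspace _ _ => //; exact: test_H1.
  have n1 := sn_ge0 nrm_seminormed h1; have n2 := sn_ge0 gn1 h2.
  by move: (nrm _) (gnrm _) n1 n2 hp => x y; clear -e0; split; nra.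
have [phi [tp [h1 h2]]] := h (e / 2) (divr_gt0 e0 (ltr0Sn _ _)).
exists phi; split => //.
have i1 : L2 (v - phi) by apply: ssB L2_subspace _ _; [case: hv|exact: test_L2].
have i2 : H1 (v - phi) by apply: ssB H1_subspace _ _ => //; exact: test_H1.
have n1 := sn_ge0 nrm_seminormed i1; have n2 := sn_ge0 gn1 i2.
by move: (nrm _) (gnrm _) n1 n2 h1 h2 => x y *; nra.
Qed.

Lemma H10_subspace : subspace_set H10.
Proof.
split.
  apply/H10P; split; first exact: H1_subspace.1.
  move=> e e0; exists 0; split; first exact: test0.
  by rewrite subrr (sn0 nrm_seminormed) (sn0 gn1); split; exact: ltW.
move=> a v w /H10P[hv Av] /H10P[hw Aw]; apply/H10P; split; first exact: H1_subspace.2.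
move=> e e0; have k0 : 0 < `|a| + 1 by rewrite ltr_wpDl.
have [phi [tp [p1 p2]]] := Av (e / 2 / (`|a| + 1)) (divr_gt0 (divr_gt0 e0 (ltr0Sn _ _)) k0).
have [psi [tq [q1 q2]]] := Aw (e / 2) (divr_gt0 e0 (ltr0Sn _ _)).
exists (a *: phi + psi); split; first exact: test_linear.
have -> : a *: v + w - (a *: phi + psi) = a *: (v - phi) + (w - psi).
  by rewrite scalerBr opprD addrACA.
have i1 : L2 (v - phi) by apply: ssB L2_subspace _ _; [case: hv|exact: test_L2].
have i2 : H1 (v - phi) by apply: ssB H1_subspace _ _ => //; exact: test_H1.
have j1 : L2 (w - psi) by apply: ssB L2_subspace _ _; [case: hw|exact: test_L2].
have j2 : H1 (w - psi) by apply: ssB H1_subspace _ _ => //; exact: test_H1.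
have aux x y : 0 <= x -> x <= e / 2 / (`|a| + 1) -> y <= e / 2 -> `|a| * x + y <= e.
  move=> x0; rewrite ler_pdivlMr// => hx hy.
  have : `|a| * x <= x * (`|a| + 1) by rewrite mulrDr mulr1 mulrC lerDl.
  by clear -hx hy; lra.
split.
  apply: le_trans (snD nrm_seminormed _ _) _ => //; first exact: ssZ L2_subspace _.
  by rewrite (snZ nrm_seminormed)//; apply: aux => //; exact: (sn_ge0 nrm_seminormed).
apply: le_trans (snD gn1 _ _) _ => //; first exact: ssZ H1_subspace _.
by rewrite (snZ gn1)//; apply: aux => //; exact: (sn_ge0 gn1).
Qed.

Lemma H10_eqae v w : L2 w -> eqae v w -> H10 v -> H10 w.
Proof.
move=> Lw vw [[Lv [G hG]] h]; split.
  by split => //; exists G; exact: weak_grad_eqae hG.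
move=> e e0; have [phi [tp hp]] := h _ e0; exists phi; split; first exact: tp.
have E : eqae (w - phi) (v - phi) by apply: eqaeB; [exact: eqae_sym|exact: eqae_refl].
by rewrite (nrm_eqae E) (gnrm_eqae E).
Qed.

Lemma gip_semi_inner : semi_inner H10 gip.
Proof.
have [_ h1 h2 h3] := gip_semi_inner1; split; first exact: H10_subspace.
- by move=> a u v w /H10_H1 ? /H10_H1 ? /H10_H1 ?; exact: h1.
- by move=> u v /H10_H1 ? /H10_H1 ?; exact: h2.
- by move=> u /H10_H1 ?; exact: h3.
Qed.

Lemma gnrm_seminormed : seminormed H10 gnrm.
Proof. exact: semi_inner_seminormed gip_semi_inner. Qed.

Lemma gnrm_sqr v : H10 v -> gnrm v ^+ 2 = gip v v.
Proof. by move=> Lv; rewrite sqr_sqrtr//; exact: (si_ge0 gip_semi_inner). Qed.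

Lemma partial_le_gnrm phi i : test phi -> nrm (partial i phi) <= gnrm phi.
Proof.
move=> tp; rewrite /nrm /gnrm ler_sqrt; last first.
  by apply: (si_ge0 gip_semi_inner1); exact: test_H1.
rewrite (gipE (test_weak_grad oO bO tp) (test_weak_grad oO bO tp)) (bigD1 i)//= lerDl.
by apply: sumr_ge0 => j _; apply: (si_ge0 ip_semi_inner); exact: test_partial_L2.
Qed.

Hypothesis d0 : (0 < d)%N.

(** The partial derivative of [x_i phi^2] integrates to zero; expanding it
    bounds the integral of [phi^2] by that of the product of [x_i phi] with
    the partial derivative of [phi]. Density extends the bound to [H10]. *)
Lemma poincare : exists2 C : R, 0 <= C & forall v, H10 v -> nrm v <= C * gnrm v.
Proof.
have [M M0 sM] := bounded_set_cbox bO; pose i := Ordinal d0.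
exists (2 * M); first by rewrite mulr_ge0.
have key phi : test phi -> nrm phi <= 2 * M * gnrm phi.
  move=> tp; have [K K0 cK] := test_c1_compact bO i tp.
  have [pc pd pdc ps] := cK.
  pose g (j : 'I_d) : R -> R := if j == i then id else (fun=> 1).
  pose X : fct := tensor g.
  have XE x : X x = x ord0 i.
    rewrite /X /tensor (bigD1 i)//= /g eqxx big1 ?mulr1// => j /negbTE ->.
    by [].
  have sX : smooth X.
    apply: tensor_smooth => j k; rewrite /g; case: ifP => _; last exact: smoothn_cst.
    rewrite (_ : id = horner ('X : {poly R})); first exact: smoothn_poly.
    by apply/funext => x; rewrite hornerX.
  have dX x : partial i X x = 1.
    have di (t : R) : is_derive t (1 : R) (g i) 1 by rewrite /g eqxx; exact: is_derive_id.
    have [_] := tensor_derive x di; rewrite -/X -/(partial i X x) => ->.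
    by rewrite /tensor; apply: big1 => j _; rewrite /g; case: (j == i).
  have cpp := c1_compactM pc pd pdc cK.
  have cX : c1_compact i (fun x => X x * (phi x * phi x)) K := c1_compactM (sX [::]).1 (fun x => (sX [::]).2 i x) (sX [:: i]).1 cpp.
  have I0 := c1_compact_int0 cX.
  have LXp : L2 (fun x => X x * phi x).
    apply: (@continuous_L2 _ _ _ oO _ K).
      by apply: continuous_mul; [exact: (sX [::]).1|].
    by move=> x; rewrite mulf_eq0 negb_or => /andP[_]; exact: ps.
  have Lp := test_L2 oO bO tp; have Ldp := test_partial_L2 oO bO i tp.
  have E : ip phi phi = - (2 * ip (fun x => X x * phi x) (partial i phi)).
    have a1 := L2_mul Lp Lp; have a2 := L2_mul LXp Ldp.
    rewrite -(RintZ mO 2 a2).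
    apply/eqP; rewrite -addr_eq0 -(RintD mO a1 (aeintZ mO 2 a2)).
    rewrite -[X in _ == X]I0 -(@Rintegral_Omega _ _ Omega); last first.
      move=> x Ox; rewrite partialM; [|exact: (sX [::]).2|].
        by rewrite partialM// (test_out tp Ox) !(mul0r, mulr0, addr0).
      by case: cpp.
    apply/eqP; apply: eq_Rintegral => x _; rewrite partialM; [|exact: (sX [::]).2|by case: cpp].
    by rewrite partialM// dX; ring.
  have n1 := sn_ge0 nrm_seminormed Lp; have n2 := sn_ge0 nrm_seminormed Ldp.
  have XM : nrm (fun x => X x * phi x) <= M * nrm phi.
    rewrite -(ler_sqr _ _) ?nnegrE ?mulr_ge0 ?(sn_ge0 nrm_seminormed)//.
    have a1 := L2_mul Lp Lp; have a2 := L2_mul LXp LXp.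
    rewrite exprMn (nrm_sqr LXp) (nrm_sqr Lp) -(RintZ mO _ a1).
    apply: (Rint_le mO a2 (aeintZ mO _ a1)).
    apply: aeW => x Ox; rewrite XE mulrACA -!expr2 ler_wpM2r ?sqr_ge0//.
    by rewrite -ler_sqrt ?sqr_ge0// !sqrtr_sqr (ger0_norm M0); exact: sM.
  have cs := cauchy_schwarz ip_semi_inner LXp Ldp.
  have sq : nrm phi ^+ 2 <= 2 * M * nrm phi * nrm (partial i phi).
    rewrite nrm_sqr// E -mulrN -!mulrA ler_wpM2l//.
    apply: le_trans (ler_norm _) _; rewrite normrN; apply: le_trans cs _.
    by rewrite mulrA ler_wpM2r.
  apply: (@le_trans _ _ (2 * M * nrm (partial i phi))); last first.
    by rewrite ler_wpM2l ?mulr_ge0//; exact: partial_le_gnrm.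
  have [->|nz] := eqVneq (nrm phi) 0; first by rewrite !mulr_ge0.
  have np : 0 < nrm phi by rewrite lt_neqAle eq_sym nz.
  by rewrite -(ler_pM2r np) -expr2 mulrAC.
move=> v /H10P[hv Av]; apply/ler_addgt0Pr => e e0.
have k0 : 0 < 1 + 2 * M by rewrite ltr_pwDl// mulr_ge0.
have [phi [tp [p1 p2]]] := Av (e / (1 + 2 * M)) (divr_gt0 e0 k0).
have Lv : L2 v by case: hv.
have Lp := test_L2 oO bO tp; have Hp := test_H1 tp.
have t1 : nrm v <= nrm (v - phi) + nrm phi.
  by rewrite -[X in nrm X <= _](subrK phi) (snD nrm_seminormed)//; exact: ssB L2_subspace _ _.
have t2 : gnrm phi <= gnrm v + gnrm (v - phi).
  by rewrite -[X in gnrm X <= _](subKr v) (snB gn1)//; exact: ssB H1_subspace _ _.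
have t3 := key _ tp.
move: p1 p2; rewrite !ler_pdivlMr//; move: (nrm v) (nrm _) (nrm _) (gnrm v) (gnrm _) (gnrm _) t1 t2 t3.
move=> x1 x2 x3 y1 y2 y3; clear -M0 k0 => *; nra.
Qed.

Lemma Hm1_subspace : subspace_set Hm1.
Proof.
split.
  split=> [a v w _ _|]; first by rewrite [X in X = _](_ : _ = 0)// [X in _ = _ * X + X](_ : _ = 0) ?mulr0 ?addr0//.
  by exists 0 => v _; rewrite [X in `|X|](_ : _ = 0)// normr0 mul0r.
move=> a g h [lg [C hC]] [lh [D hD]]; split.
  move=> b v w hv hw; have E z : (a *: g + h) z = a * g z + h z by [].
  by rewrite !E lg// lh//; ring.
exists (`|a| * C + D) => v hv; have -> : (a *: g + h) v = a * g v + h v by [].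
apply: le_trans (ler_normD _ _) _; rewrite normrM mulrDl lerD ?hD//.
by rewrite -mulrA ler_wpM2l// hC.
Qed.

Lemma Hm1_0 g : Hm1 g -> g 0 = 0.
Proof.
move=> [lg _]; have [z0 _] := H10_subspace; have := lg 1 0 0 z0 z0.
by rewrite scale1r addr0 mul1r => /eqP; rewrite -subr_eq0 opprD addNKr oppr_eq0 => /eqP.
Qed.

Lemma Hm1Z g a v : Hm1 g -> H10 v -> g (a *: v) = a * g v.
Proof.
move=> hg hv; have [lg _] := hg; have := lg a v 0 hv H10_subspace.1.
by rewrite Hm1_0// !addr0.
Qed.

Lemma Hm1D g v w : Hm1 g -> H10 v -> H10 w -> g (v + w) = g v + g w.
Proof. by move=> [lg _] hv hw; rewrite -[v]scale1r lg// mul1r scale1r. Qed.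

Lemma Hm1B g v w : Hm1 g -> H10 v -> H10 w -> g (v - w) = g v - g w.
Proof.
move=> hg hv hw; rewrite (Hm1D hg hv (ssN H10_subspace hw)).
by rewrite -scaleN1r (Hm1Z _ hg hw) mulN1r.
Qed.

Lemma Hm1_sum g I (r : seq I) (P : pred I) (F : I -> fct) : Hm1 g ->
  (forall i, P i -> H10 (F i)) -> g (\sum_(i <- r | P i) F i) = \sum_(i <- r | P i) g (F i).
Proof.
move=> hg hF; suff [] : H10 (\sum_(i <- r | P i) F i) /\
  g (\sum_(i <- r | P i) F i) = \sum_(i <- r | P i) g (F i) by [].
elim/big_ind2 : _ => [|x1 x2 y1 y2 [h1 e1] [h2 e2]|i Pi].
- by split; [exact: H10_subspace.1|exact: Hm1_0].
- by split; [exact: ssD H10_subspace _ _|rewrite Hm1D// e1 e2].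
- by split => //; exact: hF.
Qed.

Lemma dual_nrm_has_sup g : Hm1 g ->
  has_sup [set `|g v| | v in [set v | H10 v /\ gnrm v <= 1]].
Proof.
move=> [lg [C hC]]; split.
  exists `|g 0|; exists 0 => //; split; first exact: H10_subspace.1.
  by rewrite (sn0 gnrm_seminormed).
exists `|C| => _ [v [hv v1] <-]; apply: le_trans (hC _ hv) _.
have := sn_ge0 gnrm_seminormed hv; have := ler_norm C; have := normr_ge0 C.
by move: (gnrm v) v1 `|C| => x ? y *; nra.
Qed.

Lemma dual_nrm_ge0 g : Hm1 g -> 0 <= dual_nrm g.
Proof.
move=> hg; apply: le_trans (normr_ge0 (g 0)) _.
apply: sup_upper_bound; first exact: dual_nrm_has_sup.
by exists 0 => //; split; [exact: H10_subspace.1|rewrite (sn0 gnrm_seminormed)].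
Qed.

Lemma dual_nrm_le g (C : R) : Hm1 g -> (forall v, H10 v -> `|g v| <= C * gnrm v) ->
  0 <= C -> dual_nrm g <= C.
Proof.
move=> hg hC C0; apply: ge_sup; first by case: (dual_nrm_has_sup hg).
move=> _ [v [hv v1] <-]; apply: le_trans (hC _ hv) _.
by rewrite -[leRHS]mulr1 ler_wpM2l.
Qed.

Lemma dual_nrmP g v : Hm1 g -> H10 v -> `|g v| <= dual_nrm g * gnrm v.
Proof.
move=> hg hv; have n0 := sn_ge0 gnrm_seminormed hv.
have [e|e] := eqVneq (gnrm v) 0.
  by rewrite e mulr0; have [_ [C /(_ _ hv)]] := hg; rewrite e mulr0.
have np : 0 < gnrm v by rewrite lt_neqAle eq_sym e.
rewrite -ler_pdivrMr//; apply: sup_upper_bound; first exact: dual_nrm_has_sup.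
exists ((gnrm v)^-1 *: v); last first.
  by rewrite Hm1Z// normrM mulrC normfV (ger0_norm n0).
split; first exact: ssZ H10_subspace _.
by rewrite (snZ gnrm_seminormed)// ger0_norm ?invr_ge0// mulVf.
Qed.

Lemma dual_nrm_seminormed : seminormed Hm1 dual_nrm.
Proof.
split; first exact: Hm1_subspace.
- have le a g : Hm1 g -> dual_nrm (a *: g) <= `|a| * dual_nrm g.
    move=> hg; apply: dual_nrm_le; first exact: ssZ Hm1_subspace _.
    - move=> v hv; have -> : (a *: g) v = a * g v by [].
      by rewrite normrM -mulrA ler_wpM2l// dual_nrmP.
    - by rewrite mulr_ge0// dual_nrm_ge0.
  move=> a g hg; apply/eqP; rewrite eq_le le//=.
  have [->|a0] := eqVneq a 0.
    by rewrite normr0 mul0r dual_nrm_ge0//; exact: ssZ Hm1_subspace _.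
  rewrite -ler_pdivlMl ?normr_gt0//; have := le a^-1 (a *: g) (ssZ _ Hm1_subspace hg).
  by rewrite scalerA mulVf// scale1r normfV.
- move=> g h hg hh; apply: dual_nrm_le; first exact: ssD Hm1_subspace _ _.
  + move=> v hv; have -> : (g + h) v = g v + h v by [].
    by apply: le_trans (ler_normD _ _) _; rewrite mulrDl lerD// dual_nrmP.
  + by rewrite addr_ge0// dual_nrm_ge0.
Qed.

(** The embedding of L^2 into H^-1 is continuous by the Poincare inequality. *)
Lemma ip_Hm1 : exists2 C : R, 0 <= C & forall w, L2 w ->
  Hm1 (ip w) /\ dual_nrm (ip w) <= C * nrm w.
Proof.
have [C C0 hC] := poincare; exists C; first exact: C0.
move=> w Lw.
have b v : H10 v -> `|ip w v| <= C * nrm w * gnrm v.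
  move=> hv; apply: le_trans (cauchy_schwarz ip_semi_inner Lw (H10_L2 hv)) _.
  by rewrite mulrAC -/(nrm w) mulrC ler_wpM2r ?(sn_ge0 nrm_seminormed)// hC.
have h : Hm1 (ip w).
  split; last by exists (C * nrm w).
  move=> a v z /H10_L2 hv /H10_L2 hz.
  by rewrite (siDr ip_semi_inner)//; [rewrite (siZr ip_semi_inner)|exact: ssZ L2_subspace _].
by split => //; apply: dual_nrm_le => //; rewrite mulr_ge0// (sn_ge0 nrm_seminormed).
Qed.

Lemma Vh_H10 M v : Vh Omega M v -> H10 v. Proof. by case. Qed.

Lemma mpolynomial_linear (k : nat) a (p q : fct) : mpolynomial k p -> mpolynomial k q ->
  mpolynomial k (a *: p + q).
Proof.
move=> [c hc] [e he]; exists (fun al => a * c al + e al) => x.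
have -> : (a *: p + q) x = a * p x + q x by [].
rewrite hc he mulr_sumr -big_split/=; apply: eq_bigr => al _.
by rewrite mulrDl mulrA.
Qed.

Lemma Vh_subspace M : subspace_set (Vh Omega M).
Proof.
split.
  split; first exact: H10_subspace.1.
  move=> K; exists 0; last exact: aeW.
  by exists (fun=> 0) => x; rewrite big1// => al _; rewrite mul0r.
move=> a v w [hv pv] [hw pw]; split; first exact: H10_subspace.2.
move=> K; have [p hp vp] := pv K; have [r hr wr] := pw K.
exists (a *: p + r); first exact: mpolynomial_linear.
apply: filterS2 vp wr => x h1 h2 Ox.
have E (f g : fct) : (a *: f + g) x = a * f x + g x by [].
by rewrite !E h1// h2.
Qed.

Lemma Vh_eqae M v w : L2 w -> eqae v w -> Vh Omega M v -> Vh Omega M w.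
Proof.
move=> Lw vw [hv pv]; split; first exact: H10_eqae hv.
move=> K; have [p hp vp] := pv K; exists p => //.
by apply: filterS2 vw vp => x h1 h2 Ox; rewrite -h2// h1//; case: Ox.
Qed.

Lemma eqae_nrm0 v w : L2 v -> L2 w -> nrm (v - w) = 0 -> eqae v w.
Proof.
move=> Lv Lw e; have : eqae (v - w) 0 by apply: nrm_eq0 => //; exact: ssB L2_subspace _ _.
apply: filterS => x h Ox; have := h Ox; have -> : (v - w) x = v x - w x by [].
by move/eqP; rewrite subr_eq0 => /eqP.
Qed.

End sobolev_spaces.

(** * Bochner spaces *)

Section pairings.
Context (R : realType).

(** One notion for the inner product of L^2, the Dirichlet form and the
    duality between H^-1 and H^1_0. *)
Definition bounded_pairing (W1 W2 : lmodType R) (S1 : set W1) (N1 : W1 -> R)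
    (S2 : set W2) (N2 : W2 -> R) (b : W1 -> W2 -> R) (C : R) :=
  [/\ 0 <= C,
      forall a u v w, S1 u -> S1 v -> S2 w -> b (a *: u + v) w = a * b u w + b v w,
      forall a u v w, S1 w -> S2 u -> S2 v -> b w (a *: u + v) = a * b w u + b w v &
      forall v w, S1 v -> S2 w -> `|b v w| <= C * N1 v * N2 w].

Lemma cvg_dist_le (x y : nat -> R) (l : R) : (forall k, `|x k - l| <= y k) ->
  y k @[k --> \oo] --> (0 : R) -> x k @[k --> \oo] --> l.
Proof.
move=> h hy; apply/cvgrPdist_le => e e0; move/cvgrPdist_le : hy => /(_ _ e0).
apply: filterS => k; rewrite sub0r normrN => hk; rewrite distrC.
by apply: le_trans (h k) (le_trans (ler_norm _) hk).
Qed.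

(** For functionals of simple functions: the value at [t] only depends on
    which of the finitely many sets contain [t]. *)
Lemma measurable_finite_code m (A : 'I_m -> set (measurableTypeR R)) (h : {ffun 'I_m -> bool} -> R) :
  (forall i, measurable (A i)) ->
  measurable_fun [set: measurableTypeR R] (fun t => h [ffun i => t \in A i]).
Proof.
move=> mA; pose P (b : {ffun 'I_m -> bool}) : set (measurableTypeR R) :=
  \bigcap_(i in [set: 'I_m]) (if b i then A i else ~` A i).
have mP b : measurable (P b).
  apply: fin_bigcap_measurable => // i _; case: ifP => _ //; exact: measurableC.
have PE b t : (t \in P b) = ([ffun i => t \in A i] == b).
  apply/idP/eqP => [/set_mem h0|<-].
    apply/ffunP => i; rewrite ffunE; have := h0 i I; case: (b i) => h1; first exact/mem_set.
    by apply/negbTE/negP => /set_mem.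
  apply/mem_set => i _; rewrite ffunE; case: ifPn; first exact: set_mem.
  by move=> /negP h1 h2; apply: h1; exact/mem_set.
rewrite (_ : (fun t => _) = fun t => \sum_b h b * \1_(P b) t).
  by apply: measurable_sum => b; apply: measurable_funM => //; exact: measurable_indic.
apply/funext => t; rewrite (bigD1 [ffun i => t \in A i])//= indicE PE eqxx mulr1.
rewrite big1 ?addr0// => b bt; rewrite indicE PE eq_sym (negbTE bt) mulr0.
by [].
Qed.

End pairings.

Section bochner_theory.
Context (R : realType) (W : lmodType R) (S : set W) (N : W -> R).
Hypothesis hN : seminormed S N.
Notation mu := (@lebesgue_measure R).
Notation bochner2 := (bochner2 S N).
Notation simple := (time_simple S).
Implicit Types (a b : R) (v w s : R -> W).

Let sS : subspace_set S. Proof. by case: hN. Qed.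

Lemma bochner2_mem a b v : bochner2 a b v ->
  {ae mu, forall t, `]a, b[%classic t -> S (v t)}.
Proof. by move=> [h _ _]; exact: h. Qed.

Lemma bochner2_approx a b v : bochner2 a b v -> exists s : nat -> R -> W,
  (forall k, simple (s k)) /\ {ae mu, forall t, `]a, b[%classic t -> N (v t - s k t) @[k --> \oo] --> (0 : R)}.
Proof. by move=> [_ h _]; exact: h. Qed.

Lemma simple_mem s t : simple s -> S (s t).
Proof.
by move=> [m [A [e [_ he ->]]]]; apply: ss_sum => // i _; exact: ssZ.
Qed.

Lemma simple_comp (Phi : W -> R) s : simple s ->
  measurable_fun [set: measurableTypeR R] (fun t => Phi (s t)).
Proof.
move=> [m [A [e [mA he ->]]]].
rewrite (_ : (fun t => _) = fun t =>
  (fun h : {ffun 'I_m -> bool} => Phi (\sum_i (h i)%:R *: e i)) [ffun i => t \in A i]).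
  exact: (measurable_finite_code
    (fun h : {ffun 'I_m -> bool} => Phi (\sum_i (h i)%:R *: e i)) mA).
by apply/funext => t; congr Phi; apply: eq_bigr => i _; rewrite ffunE indicE.
Qed.

Lemma simple_linear (c : R) s s' : simple s -> simple s' -> simple (fun t => c *: s t + s' t).
Proof.
move=> [m [A [e [mA he ->]]]] [m' [A' [e' [mA' he' ->]]]].
exists (m + m')%N, (fun i => match fintype.split i with inl j => A j | inr j => A' j end),
  (fun i => match fintype.split i with inl j => c *: e j | inr j => e' j end); split.
- by move=> i; case: (fintype.split i).
- by move=> i; case: (fintype.split i) => // j; exact: ssZ.
apply/funext => t; rewrite big_split_ord/= scaler_sumr; congr (_ + _); apply: eq_bigr => i _.
  by rewrite (unsplitK (inl i)) !scalerA mulrC.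
by rewrite (unsplitK (inr i)).
Qed.

Lemma simple_indic (B : set (measurableTypeR R)) s : measurable B -> simple s ->
  simple (fun t => (\1_B t : R) *: s t).
Proof.
move=> mB [m [A [e [mA he ->]]]]; exists m, (fun i => B `&` A i), e; split => //.
  move=> i; have mi : measurable (A i : set (measurableTypeR R)) by exact: mA.
  exact: (measurableI _ _ mB mi).
apply/funext => t; rewrite scaler_sumr; apply: eq_bigr => i _.
by rewrite scalerA indicI.
Qed.

(** [Phi] of a simple function is measurable, and the Lipschitz bound
    transfers the almost everywhere convergence. *)
Lemma bochner2_comp (Phi : W -> R) (C : R) a b v : 
  (forall x y, S x -> S y -> `|Phi x - Phi y| <= C * N (x - y)) ->
  bochner2 a b v -> aemeas mu `]a, b[ (fun t => Phi (v t)).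
Proof.
move=> hPhi bv; have Sv := bochner2_mem bv; have [s [ss cs]] := bochner2_approx bv.
apply: (@aemeas_cvg _ _ _ mu `]a, b[%classic (fun k t => Phi (s k t))).
  move=> k; apply: measurable_aemeas; apply: measurable_funTS; exact: simple_comp.
apply: (ae_mono _ (ae_and Sv cs)) => t tab [Svt cst].
apply: (@cvg_dist_le _ _ (fun k => C * N (v t - s k t))).
  by move=> k; rewrite distrC; apply: hPhi; [exact: Svt|exact: simple_mem].
by rewrite -[X in _ --> X](mulr0 C); apply: cvgMr; exact: cst.
Qed.

Lemma bochner2_nrm a b v : bochner2 a b v -> aemeas mu `]a, b[ (fun t => N (v t)).
Proof.
by apply: (@bochner2_comp _ 1) => x y Sx Sy; rewrite mul1r; exact: (sn_dist hN).
Qed.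

Lemma bochner2_sqr a b v : bochner2 a b v -> aeint mu `]a, b[ (fun t => N (v t) ^+ 2).
Proof.
move=> bv; apply: aeint_sqr_lty; [exact: measurable_ioo|exact: bochner2_nrm|].
by case: bv.
Qed.

Lemma bochner2_linear (c : R) a b v w : bochner2 a b v -> bochner2 a b w ->
  bochner2 a b (fun t => c *: v t + w t).
Proof.
move=> bv bw; have Sv := bochner2_mem bv; have [s [ss cs]] := bochner2_approx bv.
have Sw := bochner2_mem bw; have [r [rr cr]] := bochner2_approx bw.
have Svw : {ae mu, forall t, `]a, b[%classic t -> S (c *: v t + w t)}.
  by apply: (ae_mono _ (ae_and Sv Sw)) => t tab [h1 h2]; apply: sS.2; [exact: h1|exact: h2].
have smvw : strongly_measurable S N a b (fun t => c *: v t + w t).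
  exists (fun k t => c *: s k t + r k t); split; first by move=> k; exact: simple_linear.
  rewrite /time_ae; move: (ae_and Sv Sw) (ae_and cs cr); apply: filterS2 => t h1 h2 tab.
  have [Svt Swt] := h1 tab; have [c1 c2] := h2 tab.
  apply: (@cvg_dist_le _ _ (fun k => `|c| * N (v t - s k t) + N (w t - r k t))); last first.
    rewrite -[X in _ --> X](addr0 0) -[X in _ --> X + _](mulr0 `|c|).
    by apply: cvgD => //; exact: cvgMr.
  move=> k; have d1 : S (v t - s k t) by apply: ssB sS Svt _; exact: simple_mem.
  have d2 : S (w t - r k t) by apply: ssB sS Swt _; exact: simple_mem.
  have -> : c *: v t + w t - (c *: s k t + r k t) = c *: (v t - s k t) + (w t - r k t).
    by rewrite scalerBr opprD addrACA.
  have d3 := ssZ c sS d1.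
  rewrite subr0 ger0_norm; last exact: (sn_ge0 hN (ssD sS d3 d2)).
  by apply: le_trans (snD hN d3 d2) _; rewrite (snZ hN _ d1).
split => //; apply: aeint_ge0_lty; first exact: measurable_ioo.
have m1 := bochner2_nrm bv; have m2 := bochner2_nrm bw.
have i1 := bochner2_sqr bv; have i2 := bochner2_sqr bw.
have mI := measurable_ioo a b.
apply: (@aeint_le _ _ _ mu _ mI _
  (fun t => 2 * `|c| ^+ 2 * N (v t) ^+ 2 + 2 * N (w t) ^+ 2)).
- have bvw : aemeas mu `]a, b[ (fun t => N (c *: v t + w t)).
    have [q [qq]] := smvw; rewrite /time_ae => cq.
    apply: (@aemeas_cvg _ _ _ mu `]a, b[%classic (fun k t => N (q k t))).
      by move=> k; apply: measurable_aemeas; apply: measurable_funTS; exact: simple_comp.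
    apply: (ae_mono _ (ae_and Svw cq)) => t tab [Svt cst].
    apply: (@cvg_dist_le _ _ (fun k => N (c *: v t + w t - q k t))) => [k|]; last exact: cst.
    by rewrite distrC; apply: (sn_dist hN); [exact: Svt|exact: simple_mem].
  exact: (aemeasM bvw bvw).
- by apply: aeintD => //; exact: aeintZ.
- apply: (ae_mono _ (ae_and Sv Sw)) => t tab [h1 h2].
  have d3 := ssZ c sS h1; have d4 := ssD sS d3 h2.
  rewrite ger0_norm ?sqr_ge0//.
  have := snD hN d3 h2; rewrite (snZ hN _ h1).
  have := sn_ge0 hN h1; have := sn_ge0 hN h2; have := sn_ge0 hN d4; have := normr_ge0 c.
  move: (N _) (N _) (N _) `|c| => x y z e; clear => *.
  have : z ^+ 2 <= (e * x + y) ^+ 2 by rewrite ler_sqr ?nnegrE// addr_ge0// mulr_ge0.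
  by have := sqr_ge0 (e * x - y); rewrite !expr2 => *; lra.
Qed.

Lemma bochner2_0 a b : bochner2 a b (fun=> 0).
Proof.
split; first by apply: aeW => t _; exact: sS.1.
  exists (fun k t => 0); split.
    move=> k; exists 0%N, (fun=> set0), (fun=> 0); split => //; first by move=> i; exact: sS.1.
    by apply/funext => t; rewrite big_ord0.
  by apply: aeW => t _; under eq_fun do rewrite subr0 (sn0 hN); exact: cvg_cst.
by rewrite integral0_eq ?ltry// => t _; rewrite (sn0 hN) expr0n.
Qed.

Lemma bochner2D a b v w : bochner2 a b v -> bochner2 a b w ->
  bochner2 a b (fun t => v t + w t).
Proof. by move=> h1 h2; have := bochner2_linear 1 h1 h2; under eq_fun do rewrite scale1r. Qed.

Lemma bochner2Z (c : R) a b v : bochner2 a b v -> bochner2 a b (fun t => c *: v t).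
Proof.
by move=> h1; have := bochner2_linear c h1 (bochner2_0 a b); under eq_fun do rewrite addr0.
Qed.

Lemma bochner2B a b v w : bochner2 a b v -> bochner2 a b w ->
  bochner2 a b (fun t => v t - w t).
Proof.
move=> h1 h2; have := bochner2_linear (-1) h2 h1.
by under eq_fun do rewrite scaleN1r addrC.
Qed.

Lemma bochner2_sum a b I (r : seq I) (P : pred I) (F : I -> R -> W) :
  (forall i, P i -> bochner2 a b (F i)) ->
  bochner2 a b (fun t => \sum_(i <- r | P i) F i t).
Proof.
move=> h; elim: r => [|i r ih]; first by under eq_fun do rewrite big_nil; exact: bochner2_0.
under eq_fun do rewrite big_cons; have [Pi|//] := boolP (P i).
by apply: bochner2D => //; exact: h.
Qed.

Lemma bochner2_indic a b (B : set (measurableTypeR R)) v : measurable B -> bochner2 a b v ->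
  bochner2 a b (fun t => (\1_B t : R) *: v t).
Proof.
move=> mB bv; have Sv := bochner2_mem bv; have [s [ss cs]] := bochner2_approx bv; split.
- by rewrite /time_ae; apply: (ae_mono _ Sv) => t tab h; exact: ssZ.
- exists (fun k t => (\1_B t : R) *: s k t); split; first by move=> k; exact: simple_indic.
  rewrite /time_ae; apply: (ae_mono _ (ae_and Sv cs)) => t tab [h hc].
  apply: (@cvg_dist_le _ _ (fun k => N (v t - s k t))) => [k|]; last exact: hc.
  have d : S (v t - s k t) by apply: ssB sS h _; exact: simple_mem.
  rewrite -scalerBr (snZ hN _ d) subr0 normrM normr_id (ger0_norm (sn_ge0 hN d)).
  by rewrite ler_piMl ?(sn_ge0 hN d)// indicE; case: (t \in B); rewrite ?normr1 ?normr0.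
- apply: aeint_ge0_lty; first exact: measurable_ioo.
  have mI := measurable_ioo a b.
  apply: (@aeint_congr _ _ _ mu _ (fun t => \1_B t * N (v t) ^+ 2)).
    apply: (ae_mono _ Sv) => t tab h; rewrite (snZ hN _ h) exprMn; congr (_ * _).
    by rewrite indicE; case: (t \in B); rewrite ?normr1 ?normr0 ?expr1n ?expr0n.
  apply: (aeint_mul_bounded mI (K := 1)) (bochner2_sqr bv).
    by apply: measurable_aemeas; exact: measurable_indic.
  by move=> t _; rewrite indicE; case: (t \in B); rewrite ?normr1 ?normr0.
Qed.

Lemma bochner2_sub a b a' b' v : a <= a' -> b' <= b -> bochner2 a b v -> bochner2 a' b' v.
Proof.
move=> aa bb bv; have Sv := bochner2_mem bv; have [s [ss cs]] := bochner2_approx bv.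
have sub : `]a', b'[%classic `<=` (`]a, b[%classic : set R) by exact: itv_oo_sub.
split; first exact: ae_sub Sv.
  by exists s; split => //; exact: ae_sub cs.
apply: aeint_ge0_lty; first exact: measurable_ioo.
by apply: (@aeint_subset _ _ _ mu `]a, b[%classic) (bochner2_sqr bv) => //; exact: measurable_ioo.
Qed.

Lemma bochner2_congr a b v w : {ae mu, forall t, `]a, b[%classic t -> S (w t)} ->
  {ae mu, forall t, `]a, b[%classic t -> N (v t - w t) = 0} ->
  bochner2 a b v -> bochner2 a b w.
Proof.
move=> Sw vw bv; have Sv := bochner2_mem bv; have [s [ss cs]] := bochner2_approx bv.
have e t : S (v t) -> S (w t) -> N (v t - w t) = 0 -> forall z, S z -> N (v t - z) = N (w t - z).
  move=> h1 h2 h3 z hz.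
  have h4 := ssB sS h1 hz; have h5 := ssB sS h2 hz.
  have := sn_dist hN h4 h5; rewrite opprB addrA subrK h3.
  by rewrite normr_le0 subr_eq0 => /eqP.
split => //.
  exists s; split => //; rewrite /time_ae; move: (ae_and Sv Sw) (ae_and vw cs).
  apply: filterS2 => t h1 h2 tab; have [? ?] := h1 tab; have [? c] := h2 tab.
  rewrite (_ : (fun k => _) = (fun k => N (v t - s k t))); first exact: c.
  by apply/funext => k; rewrite (e t)//; exact: simple_mem.
apply: aeint_ge0_lty; first exact: measurable_ioo.
apply: aeint_congr (bochner2_sqr bv); move: (ae_and Sv Sw) vw.
apply: filterS2 => t h1 h2 tab; have [? ?] := h1 tab.
have := e t _ _ (h2 tab) 0 sS.1; rewrite !subr0 => -> //.
Qed.

(** The level sets of [phi] at mesh width [1 / k] give the simple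
    approximants. *)
Lemma bochner2_cst (phi : R -> R) (K : R) a b e : 
  measurable_fun [set: measurableTypeR R] phi ->
  (forall t, a < t < b -> `|phi t| <= K) -> S e -> bochner2 a b (fun t => phi t *: e).
Proof.
move=> mphi hK Se; split; first by apply: aeW => t _; exact: ssZ.
- pose y k j : R := j%:R / k.+1%:R - k%:R.
  pose B k (j : nat) : set (measurableTypeR R) := phi @^-1` `[y k j, y k j.+1[%classic.
  exists (fun k t => \sum_(j < (2 * k * k.+1)%N) (\1_(B k j) t : R) *: (y k j *: e)); split.
    move=> k; exists (2 * k * k.+1)%N, (fun j => B k j), (fun j => y k j *: e); split => //.
      by move=> j; rewrite -[B k j]setTI; apply: mphi.
    by move=> j; exact: ssZ.
  apply: aeW => t _.
  suff h k : `|phi t| < k%:R ->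
      N (phi t *: e - \sum_(j < (2 * k * k.+1)%N) (\1_(B k j) t : R) *: (y k j *: e))
        <= k.+1%:R^-1 * N e.
    apply/cvgrPdist_le => eps eps0.
    have c0 : k.+1%:R^-1 * N e @[k --> \oo] --> (0 : R).
      by rewrite -[X in _ --> X](mul0r (N e)); apply: cvgMl; exact: cvg_harmonic.
    move/cvgrPdist_le : c0 => /(_ _ eps0) c0.
    near=> k; rewrite sub0r normrN ger0_norm; last first.
      by apply: (sn_ge0 hN); apply: ssB sS _ _; [exact: ssZ|apply: ss_sum => // j _; do 2 apply: ssZ => //].
    apply: (@le_trans _ _ (k.+1%:R^-1 * N e)); last first.
      apply: le_trans (ler_norm _) _; rewrite -normrN -sub0r.
      by near: k.
    apply: h; near: k; exact: nbhs_infty_gtr.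
  move=> hk; have k0 : (0 : R) < k.+1%:R by rewrite ltr0n.
  have p0 : 0 <= (phi t + k%:R) * k.+1%:R.
    by rewrite mulr_ge0//; move: hk; rewrite ltr_norml => /andP[]; lra.
  pose j0 := Num.truncn ((phi t + k%:R) * k.+1%:R).
  have /andP[t1 t2] : j0%:R <= (phi t + k%:R) * k.+1%:R < j0.+1%:R by exact: truncn_itv.
  have j0k : (j0 < 2 * k * k.+1)%N.
    rewrite -(ltr_nat R); apply: le_lt_trans t1 _; rewrite natrM ltr_pM2r// natrM.
    by move: hk; rewrite ltr_norml => /andP[]; lra.
  have yE j : (t \in B k j) = (j%:R <= (phi t + k%:R) * k.+1%:R < j.+1%:R).
    rewrite /B /y; apply/idP/idP => [/set_mem|h].
      by rewrite /= in_itv/= lerBlDr ltrBrDr ler_pdivrMr// ltr_pdivlMr.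
    by apply/mem_set; rewrite /= in_itv/= lerBlDr ltrBrDr ler_pdivrMr// ltr_pdivlMr.
  rewrite (bigD1 (Ordinal j0k))//= big1 => [|j jj]; last first.
    rewrite indicE yE; have [/andP[u1 u2]|_] := boolP (_ <= _ < _); last by rewrite scale0r.
    have e1 : (j0 < j.+1)%N by rewrite -(ltr_nat R); apply: le_lt_trans u2.
    have e2 : (j < j0.+1)%N by rewrite -(ltr_nat R); apply: le_lt_trans t2.
    by case/eqP: jj; apply: val_inj => /=; apply/eqP; rewrite eqn_leq -ltnS e2 -ltnS.
  rewrite addr0 indicE yE t1 t2 scale1r -scalerBl (snZ hN _ Se) ler_wpM2r ?(sn_ge0 hN)//.
  rewrite /y ger0_norm.
    rewrite -(ler_pM2r k0) mulVf ?gt_eqF// opprB addrA mulrBl divfK ?gt_eqF//.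
    by move: t2; rewrite -natr1; lra.
  by rewrite subr_ge0 lerBlDr ler_pdivrMr.
- have mI := measurable_ioo a b.
  apply: aeint_ge0_lty => //.
  have sqE t : N (phi t *: e) ^+ 2 = phi t ^+ 2 * N e ^+ 2.
    by rewrite (snZ hN _ Se) exprMn real_normK ?num_real.
  rewrite (_ : (fun t => _) = (fun t => phi t ^+ 2 * N e ^+ 2)); last first.
    by apply/funext => t; exact: sqE.
  apply: (aeint_mul_bounded mI (K := K ^+ 2)).
  + apply: measurable_aemeas; apply: measurable_funTS; exact: measurable_funX.
  + move=> t tab; have tK : `|phi t| <= K by apply: hK; move: tab; rewrite /= in_itv.
    by rewrite normrX ler_sqr ?nnegrE//; apply: le_trans tK.
  + by apply: (@continuous_aeint R a b (fun=> N e ^+ 2)); exact: cst_continuous.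
Unshelve. all: by end_near. Qed.

End bochner_theory.

Section bochner_pairing.
Context (R : realType) (W1 W2 : lmodType R) (S1 : set W1) (N1 : W1 -> R)
  (S2 : set W2) (N2 : W2 -> R) (beta : W1 -> W2 -> R) (C : R).
Hypotheses (h1 : seminormed S1 N1) (h2 : seminormed S2 N2).
Hypothesis hb : bounded_pairing S1 N1 S2 N2 beta C.
Notation mu := (@lebesgue_measure R).

Let s1 : subspace_set S1. Proof. by case: h1. Qed.
Let s2 : subspace_set S2. Proof. by case: h2. Qed.

Lemma pairing0l w : S2 w -> beta 0 w = 0.
Proof.
move=> Sw; have [_ l _ _] := hb; have := l 1 0 0 w s1.1 s1.1 Sw.
by rewrite scale1r addr0 mul1r => /eqP; rewrite -subr_eq0 opprD addNKr oppr_eq0 => /eqP.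
Qed.

Lemma pairing0r v : S1 v -> beta v 0 = 0.
Proof.
move=> Sv; have [_ _ l _] := hb; have := l 1 0 0 v Sv s2.1 s2.1.
by rewrite scale1r addr0 mul1r => /eqP; rewrite -subr_eq0 opprD addNKr oppr_eq0 => /eqP.
Qed.

Lemma pairingBl u v w : S1 u -> S1 v -> S2 w -> beta (u - v) w = beta u w - beta v w.
Proof.
move=> Su Sv Sw; have [_ l _ _] := hb.
by rewrite addrC -scaleN1r (l _ _ _ _ Sv Su Sw) mulN1r addrC.
Qed.

Lemma pairingBr u v w : S2 u -> S2 v -> S1 w -> beta w (u - v) = beta w u - beta w v.
Proof.
move=> Su Sv Sw; have [_ _ l _] := hb.
by rewrite addrC -scaleN1r (l _ _ _ _ Sw Sv Su) mulN1r addrC.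
Qed.

Lemma pairing_suml m (x : 'I_m -> R) (e : 'I_m -> W1) w : (forall i, S1 (e i)) -> S2 w ->
  beta (\sum_i x i *: e i) w = \sum_i x i * beta (e i) w.
Proof.
move=> he Sw; have [_ l _ _] := hb.
suff [] : S1 (\sum_i x i *: e i) /\
  beta (\sum_i x i *: e i) w = \sum_i x i * beta (e i) w by [].
elim: (index_enum _) => [|i r [ih1 ih2]]; first by rewrite !big_nil; split; [exact: s1.1|exact: pairing0l].
rewrite !big_cons; split; first exact: s1.2.
by rewrite (l _ _ _ _ (he i) ih1 Sw) ih2.
Qed.

Lemma pairing_sumr m (x : 'I_m -> R) (e : 'I_m -> W2) v : (forall i, S2 (e i)) -> S1 v ->
  beta v (\sum_i x i *: e i) = \sum_i x i * beta v (e i).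
Proof.
move=> he Sv; have [_ _ l _] := hb.
suff [] : S2 (\sum_i x i *: e i) /\
  beta v (\sum_i x i *: e i) = \sum_i x i * beta v (e i) by [].
elim: (index_enum _) => [|i r [ih1 ih2]]; first by rewrite !big_nil; split; [exact: s2.1|exact: pairing0r].
rewrite !big_cons; split; first exact: s2.2.
by rewrite (l _ _ _ _ Sv (he i) ih1) ih2.
Qed.

Lemma simple_pairing s r : time_simple S1 s -> time_simple S2 r ->
  measurable_fun [set: measurableTypeR R] (fun t => beta (s t) (r t)).
Proof.
move=> [m [A [e [mA he ->]]]] [m' [A' [e' [mA' he' ->]]]].
rewrite (_ : (fun t => _) = fun t =>
  \sum_i \sum_j (\1_(A i) t : R) * ((\1_(A' j) t : R) * beta (e i) (e' j))).
  apply: measurable_sum => i; apply: measurable_sum => j.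
  have mi : measurable (A i : set (measurableTypeR R)) by exact: mA.
  have mj : measurable (A' j : set (measurableTypeR R)) by exact: mA'.
  apply: measurable_funM; first exact: (@measurable_indic _ (measurableTypeR R) R _ _ mi).
  apply: measurable_funM; last exact: measurable_cst.
  exact: (@measurable_indic _ (measurableTypeR R) R _ _ mj).
apply/funext => t; rewrite pairing_suml//; last by apply: ss_sum => // j _; exact: ssZ.
by apply: eq_bigr => i _; rewrite pairing_sumr// mulr_sumr.
Qed.

(** Measurable as a limit of pairings of simple functions, and dominated by
    the product of the two square integrable norms. *)
Lemma bochner2_pairing a b v w : bochner2 S1 N1 a b v -> bochner2 S2 N2 a b w ->
  aeint mu `]a, b[ (fun t => beta (v t) (w t)).
Proof.
move=> bv bw; have Sv := bochner2_mem bv; have [s [ss cs]] := bochner2_approx bv.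
have Sw := bochner2_mem bw; have [r [rr cr]] := bochner2_approx bw.
have [C0 _ _ bd] := hb; have mI := measurable_ioo a b.
have Svw := ae_and Sv Sw.
apply: (@aeint_le _ _ _ mu _ mI _
  (fun t => C * (N1 (v t) ^+ 2 + N2 (w t) ^+ 2))).
- apply: (@aemeas_cvg _ _ _ mu `]a, b[%classic (fun k t => beta (s k t) (r k t))).
    by move=> k; apply: measurable_aemeas; apply: measurable_funTS; exact: simple_pairing.
  move: Svw (ae_and cs cr); apply: filterS2 => t p1 p2 tab.
  have [Svt Swt] := p1 tab; have [c1 c2] := p2 tab.
  apply: (@cvg_dist_le _ _ (fun k => C * N1 (v t - s k t) * (N2 (w t) + N2 (w t - r k t)) +
    C * N1 (v t) * N2 (w t - r k t))) => [k|]; last first.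
    rewrite -[X in _ --> X](addr0 0); apply: cvgD; last first.
      by rewrite -[X in _ --> X](mulr0 (C * N1 (v t))); exact: cvgMr.
    rewrite -[X in _ --> X](mul0r (N2 (w t) + 0)); apply: cvgM.
      by rewrite -[X in _ --> X](mulr0 C); exact: cvgMr.
    by apply: cvgD => //; exact: cvg_cst.
  have sk : S1 (s k t) by apply: (simple_mem h1).
  have rk : S2 (r k t) by apply: (simple_mem h2).
  have -> : beta (s k t) (r k t) - beta (v t) (w t) =
      - beta (v t - s k t) (r k t) - beta (v t) (w t - r k t).
    by rewrite pairingBl// pairingBr//; lra.
  have d1 := ssB s1 Svt sk; have d2 := ssB s2 Swt rk.
  apply: le_trans (ler_normB _ _) _; rewrite normrN lerD//; last exact: bd.
  apply: le_trans (bd _ _ d1 rk) _; rewrite ler_wpM2l ?mulr_ge0 ?(sn_ge0 h1 d1)//.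
  by rewrite -[X in N2 X <= _](subKr (w t)); apply: (snB h2).
- apply: aeintZ => //; apply: aeintD => //.
    exact: (bochner2_sqr h1 bv).
  exact: (bochner2_sqr h2 bw).
- apply: filterS Svw => t p tab; have [Svt Swt] := p tab; apply: le_trans (bd _ _ Svt Swt) _.
  rewrite -mulrA ler_wpM2l//; have := sn_ge0 h1 Svt; have := sn_ge0 h2 Swt.
  by move: (N1 _) (N2 _) => x y *; have := sqr_ge0 (x - y); rewrite !expr2; nra.
Qed.

End bochner_pairing.

(** * Weak time derivatives *)

Lemma si_pairing (R : realType) (W : lmodType R) (S : set W) b : semi_inner S b ->
  bounded_pairing S (fun v => Num.sqrt (b v v)) S (fun v => Num.sqrt (b v v)) b 1.
Proof.
move=> hb; have [sS _ _ _] := hb; split=> // [a u v w Su Sv Sw|a u v w Sw Su Sv|v w Sv Sw].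
- exact: (siP hb).
- by rewrite (siDr hb)//; [rewrite (siZr hb)|exact: ssZ].
- by rewrite mul1r; exact: (cauchy_schwarz hb).
Qed.

Section time_localization.
Context (R : realType).
Notation mu := (@lebesgue_measure R).
Implicit Types (a b T : R) (F G y : R -> R) (p : {poly R}).

Lemma cutoff_test1 n a b T : 0 <= a -> b <= T -> time_test T (cutoff n a b).
Proof.
move=> a0 bT; have := @cutoff_test R n a b T 1 a0 bT.
by rewrite (_ : (fun x => _) = cutoff n a b)//; apply/funext => x; rewrite hornerC mul1r.
Qed.

Lemma cutoff_aemeas n a b c d : aemeas mu `]c, d[ (cutoff n a b).
Proof.
by apply: aemeas_aeint; apply: continuous_aeint; apply: smooth1_continuous; exact: cutoff_smooth.
Qed.

Lemma cutoff_int_cvg a b c d G : c <= a -> b <= d -> aeint mu `]c, d[ G ->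
  (time_int c d (fun t => cutoff n a b t * G t)) @[n --> \oo] --> time_int a b G.
Proof.
move=> ca bd iG; have mI := measurable_ioo c d; have mJ := measurable_ioo a b.
have JI := @itv_oo_sub R a b c d ca bd.
rewrite /time_int -(Rint_indic mu G mI mJ JI).
apply: (@Rint_dominated _ _ _ mu `]c, d[%classic (fun n t => cutoff n a b t * G t)
  (fun t => \1_(`]a, b[%classic) t * G t) (fun t => `|G t|) mI _ _ _ _).2.
- by move=> n; apply: aemeasM; [exact: cutoff_aemeas|exact: aemeas_aeint].
- exact: aeint_abs.
- move=> n; apply: aeW => t _; rewrite normrM ler_piMl// ger0_norm ?cutoff_le1//.
  exact: cutoff_ge0.
- apply: aeW => t _; apply: cvgMl; rewrite indicE; have [tab|tab] := boolP (t \in _).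
    by apply: cutoff_cvg; move: tab; rewrite inE/= in_itv.
  rewrite (_ : (fun n => _) = fun=> 0); first exact: cvg_cst.
  apply/funext => n; apply: cutoff_out; apply: contra tab => h; apply/mem_set.
  by rewrite /= in_itv.
Qed.

(** Cutoffs converge to indicators, so the integral over every subinterval
    vanishes; intervals form a pi-system that generates the Borel sets. *)
Lemma cutoff_eq0 T G : aeint mu `]0, T[ G ->
  (forall n a b, 0 <= a -> b <= T -> time_int 0 T (fun t => cutoff n a b t * G t) = 0) ->
  ae_eq mu `]0, T[%classic G (fun=> 0).
Proof.
move=> iG h; have mI := measurable_ioo 0 T.
have z a b : 0 <= a -> b <= T -> time_int a b G = 0.
  move=> a0 bT; have := @cutoff_int_cvg a b 0 T G a0 bT iG.
  rewrite (_ : (fun n => _) = fun=> 0); last by apply/funext => n; exact: h.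
  by move=> /cvg_lim <- //; rewrite lim_cst.
have [G' iG' GG'] := iG.
have GG : ae_eq mu `]0, T[%classic G' (fun=> 0).
  apply: (@ae0_of_pi_system _ _ _ mu `]0, T[%classic G' (@RGenOInfty.G R) mI iG').
  - move=> _ _ [x ->] [y ->]; exists (Num.max x y).
    apply/seteqP; split => t /=; rewrite !in_itv/= !andbT gt_max; first by move=> [-> ->].
    by move=> /andP[].
  - by move=> _ [x ->]; exact: measurable_itv.
  - move=> A mA; have : (@ocitv R).-sigma.-measurable A by exact: mA.
    by rewrite RGenOInfty.measurableE.
  - by rewrite -(Rintegral_ae_congr mI GG'); exact: (z 0 T (lexx _) (lexx _)).
  - move=> _ [x ->].
    have E : `]0, T[%classic `&` `]x, +oo[%classic = (`]Num.max 0 x, T[%classic : set (measurableTypeR R)).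
      apply/seteqP; split => t /=; rewrite !in_itv/= gt_max !andbT.
        by move=> [/andP[-> ->] ->].
      by move=> /andP[/andP[-> ->] ->].
    rewrite E; rewrite -[RHS](z (Num.max 0 x) T) ?le_max ?lexx//.
    have GG'' : ae_eq mu `]Num.max 0 x, T[%classic G G'.
      by apply: ae_sub GG'; rewrite -E; exact: subIsetl.
    rewrite /time_int (Rintegral_ae_congr _ GG'')//; exact: measurable_ioo.
by apply: ae_eq_trans GG.
Qed.

Lemma cutoff_deriv_out n a b x D : a < b -> is_derive x (1 : R) (cutoff n a b) D ->
  ~~ (a < x < b) -> D = 0.
Proof.
move=> ab [_ <-] xab; rewrite (@near_eq_derive _ _ _ (cutoff n a b) (cst 0)) ?derive_cst//.
have n0 : 0 < n.+1%:R^-1 :> R by rewrite invr_gt0.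
near=> y; apply/eqP; apply: contraNT xab => /cutoff_support.
have : `|x - y| < n.+1%:R^-1 by near: y; exact: cvgr_dist_lt.
by rewrite ltr_norml; move: (n.+1%:R^-1) => z *; apply/andP; split; lra.
Unshelve. all: by end_near. Qed.

Lemma cutoff_deriv_continuous n a b (D : R -> R) :
  (forall x, is_derive x (1 : R) (cutoff n a b) (D x)) -> continuous D.
Proof.
move=> hD; have [f' df' sf'] := smooth1_deriv (@cutoff_smooth R n a b).
have -> : D = f' by apply/funext => x; have [_ <-] := hD x; have [_ <-] := df' x.
exact: smooth1_continuous.
Qed.

Lemma within_continuousMl a b F y : continuous F -> {within `[a, b], continuous y} ->
  {within `[a, b], continuous (fun t => F t * y t)}.
Proof.
move=> cF cy; have cF' : {within `[a, b], continuous F} by exact: continuous_subspaceT.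
by move=> t; apply: cvgM; [exact: cF'|exact: cy].
Qed.

Lemma poly_bounded a b p : exists2 K : R, 0 <= K & forall t, a <= t <= b -> `|p.[t]| <= K.
Proof.
by apply: within_continuous_bounded; apply: continuous_subspaceT; exact: continuous_poly.
Qed.

(** The weak identity is tested with [p] times a cutoff of [a, b]; in the
    limit the derivative of the cutoff produces the boundary terms. *)
Lemma weak_derivative_by_parts T a b p y G : 0 <= a -> a < b -> b <= T ->
  {within `[a, b], continuous y} -> aeint mu `]0, T[ G ->
  (forall psi, time_test T psi ->
     time_int 0 T (fun t => derive1 psi t * y t) = - time_int 0 T (fun t => psi t * G t)) ->
  time_int a b (fun t => p^`().[t] * y t + p.[t] * G t) = p.[b] * y b - p.[a] * y a.
Proof.
move=> a0 ab bT cy iG hG; have mJ := measurable_ioo a b.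
have [D hD cD] := cutoff_deriv_cvg ab (within_continuousMl (@continuous_poly R p) cy).
have iG' : aeint mu `]a, b[ G.
  apply: (aeint_subset (measurable_ioo 0 T)) iG => //; exact: itv_oo_sub.
have [K K0 hK] := poly_bounded a b p.
have ipG : aeint mu `]a, b[ (fun t => p.[t] * G t).
  apply: (aeint_mul_bounded mJ (K := K)) => //.
    by apply: aemeas_aeint; exact: aeint_poly.
  by move=> t; rewrite /= in_itv/= => /andP[h1 h2]; apply: hK; rewrite !ltW.
have ip'y : aeint mu `]a, b[ (fun t => p^`().[t] * y t).
  by apply: within_continuous_aeint; apply: within_continuousMl => //; exact: continuous_poly.
have iF := aeintD mJ ip'y ipG.
have key n : time_int a b (fun t => cutoff n a b t * (p^`().[t] * y t + p.[t] * G t)) =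
    - time_int a b (fun t => D n t * (p.[t] * y t)).
  pose psi x := p.[x] * cutoff n a b x.
  have tpsi : time_test T psi by exact: cutoff_test.
  have dpsi x : derive1 psi x = p^`().[x] * cutoff n a b x + D n x * p.[x].
    have [h1 e1] := is_derive_horner p x; have [h2 e2] := hD n x.
    rewrite derive1E /psi (deriveM h1 h2) e1 e2.
    by rewrite addrC [_ *: _]mulrC [X in _ + X = _]mulrC.
  have := hG _ tpsi.
  rewrite (time_int_sub a0 bT); last first.
    move=> x _ xab; rewrite dpsi cutoff_out// (cutoff_deriv_out ab (hD n x) xab).
    by rewrite mulr0 mul0r addr0 mul0r.
  rewrite [X in _ = - X](time_int_sub a0 bT); last first.
    by move=> x _ xab; rewrite /psi cutoff_out// mulr0 mul0r.
  have i1 : aeint mu `]a, b[ (fun t => cutoff n a b t * (p^`().[t] * y t)).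
    apply: (aeint_mul_bounded mJ (K := 1)) => //; first exact: cutoff_aemeas.
    by move=> t _; rewrite ger0_norm ?cutoff_le1 ?cutoff_ge0.
  have i2 : aeint mu `]a, b[ (fun t => cutoff n a b t * (p.[t] * G t)).
    apply: (aeint_mul_bounded mJ (K := 1)) => //; first exact: cutoff_aemeas.
    by move=> t _; rewrite ger0_norm ?cutoff_le1 ?cutoff_ge0.
  have i3 : aeint mu `]a, b[ (fun t => D n t * (p.[t] * y t)).
    apply: within_continuous_aeint; apply: within_continuousMl.
      exact: cutoff_deriv_continuous (hD n).
    by apply: within_continuousMl => //; exact: continuous_poly.
  rewrite (_ : (fun t => derive1 psi t * y t) = (fun t =>
    cutoff n a b t * (p^`().[t] * y t) + D n t * (p.[t] * y t))); last first.
    by apply/funext => t; rewrite dpsi; ring.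
  rewrite (_ : (fun t => psi t * G t) = (fun t => cutoff n a b t * (p.[t] * G t))); last first.
    by apply/funext => t; rewrite /psi; ring.
  rewrite (_ : (fun t => cutoff n a b t * (p^`().[t] * y t + p.[t] * G t)) =
    (fun t => cutoff n a b t * (p^`().[t] * y t) + cutoff n a b t * (p.[t] * G t))); last first.
    by apply/funext => t; rewrite mulrDr.
  rewrite /time_int (RintD mJ i1 i3) (RintD mJ i1 i2) => /eqP.
  rewrite -subr_eq0 opprK => /eqP h; lra.
have c1 := @cutoff_int_cvg a b a b _ (lexx _) (lexx _) iF.
have c2 : (fun n => time_int a b (fun t => cutoff n a b t * (p^`().[t] * y t + p.[t] * G t)))
    n @[n --> \oo] --> - (p.[a] * y a - p.[b] * y b).
  rewrite (_ : (fun n => _) = (fun n => - time_int a b (fun t => D n t * (p.[t] * y t)))).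
    exact: cvgN.
  by apply/funext => n; exact: key.
have := cvg_unique _ c1 c2 => ->; last by [].
by rewrite opprB.
Qed.

End time_localization.

Section weak_time_derivatives.
Context (R : realType) (d : nat).
Notation fct := ('rV[R]_d -> R).
Notation mu := (@lebesgue_measure R).
Variable Omega : set 'rV[R]_d.
Hypothesis oO : open Omega.
Hypothesis bO : bounded_set Omega.
Variable T : R.
Notation L2 := (L2 Omega).
Notation H10 := (H10 Omega).
Notation Hm1 := (Hm1 Omega).
Notation ip := (ip Omega).
Notation nrm := (nrm Omega).
Notation gip := (gip Omega).
Notation gnrm := (gnrm Omega).
Notation dual_nrm := (dual_nrm Omega).
Notation eqae := (eqae Omega).
Implicit Types (u v : R -> fct) (g h : R -> fct -> R) (w : fct).

Let iS := ip_semi_inner oO.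
Let nS := nrm_seminormed oO.
Let gI := gip_semi_inner oO bO.
Let gS := gnrm_seminormed oO bO.
Let dS := dual_nrm_seminormed oO bO.

Lemma ip_pairing : bounded_pairing L2 nrm L2 nrm ip 1.
Proof. exact: si_pairing iS. Qed.

Lemma gip_pairing : bounded_pairing H10 gnrm H10 gnrm gip 1.
Proof. exact: si_pairing gI. Qed.

Lemma ev_pairing : bounded_pairing Hm1 dual_nrm H10 gnrm (fun (g : fct -> R) (v : fct) => g v) 1.
Proof.
split=> // [a u v w [lw _]|g v hg hv]; first exact: lw.
by rewrite mul1r; exact: (dual_nrmP oO bO).
Qed.

Lemma ip_H10_pairing : (0 < d)%N -> exists C, bounded_pairing L2 nrm H10 gnrm ip C.
Proof.
move=> d0; have [C C0 hC] := poincare oO bO d0; exists C; split => //.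
- move=> a u v w Lu Lv /H10_L2 Lw; have [_ h _ _] := ip_pairing; exact: h.
- move=> a u v w Lw /H10_L2 Lu /H10_L2 Lv; have [_ _ h _] := ip_pairing; exact: h.
- move=> v w Lv hw; apply: le_trans (cauchy_schwarz iS Lv (H10_L2 hw)) _.
  rewrite -/(nrm v) -/(nrm w) [C * _]mulrC -mulrA ler_wpM2l ?(sn_ge0 nS Lv)//.
  exact: hC.
Qed.

Lemma bochner2_const (W : lmodType R) (S : set W) (N : W -> R) a b e : seminormed S N ->
  S e -> bochner2 S N a b (fun=> e).
Proof.
move=> hN Se; have := @bochner2_cst R W S N hN (fun=> 1) 1 a b e.
rewrite (_ : (fun=> 1 *: e) = fun=> e); last by apply/funext => t; rewrite scale1r.
by apply => // t _; rewrite normr1.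
Qed.

Lemma dual_ev_aeint a b g w : bochner2 Hm1 dual_nrm a b g -> H10 w ->
  aeint mu `]a, b[ (fun t => g t w).
Proof.
move=> bg hw; have bw := @bochner2_const _ H10 gnrm a b w gS hw.
exact: (bochner2_pairing dS gS ev_pairing bg bw).
Qed.

(** Two weak derivatives agree almost everywhere when evaluated at a fixed
    element of H^1_0, hence at the countably many values of the simple
    approximants of [v]. *)
Lemma weak_dt_unique u g h v : is_weak_dt Omega T u g -> is_weak_dt Omega T u h ->
  Xspace Omega T v -> {ae mu, forall t, `]0, T[%classic t -> g t (v t) = h t (v t)}.
Proof.
move=> [bg hg] [bh hh] Xv; have mI := measurable_ioo 0 T.
have bD := bochner2B dS bg bh.
have fixed w : H10 w -> {ae mu, forall t, `]0, T[%classic t -> g t w - h t w = 0}.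
  move=> hw; have i1 := dual_ev_aeint bg hw; have i2 := dual_ev_aeint bh hw.
  apply: cutoff_eq0; first exact: aeintB.
  move=> n a b a0 bT; have tt := @cutoff_test1 R n a b T a0 bT.
  have bdd (G : R -> R) : aeint mu `]0, T[ G -> aeint mu `]0, T[ (fun t => cutoff n a b t * G t).
    move=> iG; apply: (aeint_mul_bounded mI (K := 1)) => //; first exact: cutoff_aemeas.
    by move=> t _; rewrite ger0_norm ?cutoff_le1 ?cutoff_ge0.
  rewrite (_ : (fun t => _) = (fun t => cutoff n a b t * g t w - cutoff n a b t * h t w)).
    rewrite /time_int (RintB mI (bdd _ i1) (bdd _ i2)).
    have := hg _ _ tt hw; rewrite (hh _ _ tt hw) /time_int => /oppr_inj ->.
    exact: subrr.
  by apply/funext => t; rewrite mulrBr.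
have [s [ss cs]] := bochner2_approx Xv; have Sv := bochner2_mem Xv; have SD := bochner2_mem bD.
have simp k : {ae mu, forall t, `]0, T[%classic t -> Hm1 (g t - h t) -> (g t - h t) (s k t) = 0}.
  have [m [A [e [_ he ->]]]] := ss k.
  have := ae_forall_ord (fun i => fixed (e i) (he i)).
  apply: (ae_mono _) => t tI z hD.
  rewrite (Hm1_sum oO bO _ hD); last by move=> i _; exact: (ssZ _ (H10_subspace oO bO)).
  apply: big1 => i _; rewrite (Hm1Z oO bO _ hD (he i)).
  have -> : (g t - h t) (e i) = g t (e i) - h t (e i) by [].
  by rewrite z mulr0.
have simp' : {ae mu, forall t, `]0, T[%classic t -> forall k, Hm1 (g t - h t) -> (g t - h t) (s k t) = 0}.
  have := ae_foralln simp; apply: filterS => t z tI k; exact: z.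
apply: (ae_mono _ (ae_and (ae_and Sv SD) (ae_and cs simp'))) => t tI [[Svt SDt] [cst zt]].
have sk k : H10 (s k t) by exact: (simple_mem gS).
have bound k : `|(g t - h t) (v t)| <= dual_nrm (g t - h t) * gnrm (v t - s k t).
  have hvs := ssB (H10_subspace oO bO) Svt (sk k).
  rewrite -[X in `|X|](subr0 _) -(zt k SDt) -(Hm1B oO bO SDt Svt (sk k)).
  exact: dual_nrmP.
have : (g t - h t) (v t) = 0.
  apply/eqP; rewrite -normr_le0.
  have c : dual_nrm (g t - h t) * gnrm (v t - s k t) @[k --> \oo] --> (0 : R).
    by rewrite -[X in _ --> X](mulr0 (dual_nrm (g t - h t))); exact: cvgMr.
  rewrite -(cvg_lim _ c)//; apply: limr_ge; first by apply/cvg_ex; exists 0.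
  by apply: nearW => k; exact: bound.
have -> : (g t - h t) (v t) = g t (v t) - h t (v t) by [].
by move/eqP; rewrite subr_eq0 => /eqP.
Qed.

Lemma ip_within_continuous u w a b : 0 <= a -> b <= T -> L2_continuous Omega T u -> L2 w ->
  {within `[a, b], continuous (fun t => ip (u t) w)}.
Proof.
move=> a0 bT cu Lw; apply/subspace_continuousP => t; rewrite /= in_itv/= => /andP[h1 h2].
have t0T : 0 <= t <= T by rewrite (le_trans a0 h1) (le_trans h2 bT).
have [Lut ct] := cu t t0T.
have sub : within `[a, b]%classic (nbhs t) `=>` within `[0, T]%classic (nbhs t).
  move=> A /=; rewrite /within/=; apply: filterS => x h; rewrite in_itv/= => /andP[xa xb].
  by apply: h; rewrite in_itv/= (le_trans a0 xa) (le_trans xb bT).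
have ct' : nrm (u s - u t) @[s --> within `[a, b]%classic (nbhs t)] --> (0 : R).
  by apply: cvg_trans ct; exact: cvg_app.
apply/cvgrPdist_le => e e0.
have n0 := sn_ge0 nS Lw; have k0 : 0 < nrm w + 1 by rewrite ltr_wpDl.
move/cvgrPdist_le : ct' => /(_ (e / (nrm w + 1)) (divr_gt0 e0 k0)).
have inI : \forall s \near within `[a, b]%classic (nbhs t), a <= s <= b.
  by apply: withinT; rewrite //= => s; rewrite /= in_itv.
apply: filterS2 inI => s /andP[s1 s2]; rewrite sub0r normrN.
have Lus : L2 (u s) by apply: (cu s _).1; rewrite (le_trans a0 s1) (le_trans s2 bT).
have Lst := ssB (L2_subspace oO) Lus Lut.
rewrite (ger0_norm (sn_ge0 nS Lst)) ler_pdivlMr// => hs.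
rewrite distrC -(siBl iS)//; apply: le_trans (cauchy_schwarz iS Lst Lw) _.
by apply: le_trans hs; rewrite -/(nrm w) ler_wpM2l ?(sn_ge0 nS Lst)// lerDl.
Qed.

(** For fixed [w], the scalar function [(u, w)] is continuous and has the weak
    derivative [g(w)]. *)
Lemma weak_dt_by_parts u g w (p : {poly R}) a b : 0 <= a -> a < b -> b <= T ->
  L2_continuous Omega T u -> is_weak_dt Omega T u g -> H10 w ->
  time_int a b (fun t => p^`().[t] * ip (u t) w + p.[t] * g t w) =
  p.[b] * ip (u b) w - p.[a] * ip (u a) w.
Proof.
move=> a0 ab bT cu [bg hg] hw.
apply: (@weak_derivative_by_parts R T a b p (fun t => ip (u t) w) (fun t => g t w)) => //.
- by apply: ip_within_continuous => //; exact: H10_L2 hw.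
- exact: dual_ev_aeint.
- by move=> psi tpsi; exact: hg.
Qed.

End weak_time_derivatives.

(** * Translations and time partitions *)

Section translation.
Context (R : realType).
Notation mu := (@lebesgue_measure R).
Implicit Types (a b c : R) (F : R -> R).

Definition translate (c : R) (x : measurableTypeR R) : measurableTypeR R := (x : R) + c.

Lemma measurable_translate c : measurable_fun [set: measurableTypeR R] (translate c).
Proof. by apply: measurable_funD. Qed.

Lemma translate_measurable c (A : set (measurableTypeR R)) : measurable A ->
  measurable (translate c @^-1` A).
Proof. by move=> mA; rewrite -[X in measurable X]setTI; exact: measurable_translate. Qed.

(** Lebesgue measure is determined by its values on intervals. *)
Lemma lebesgue_translate c (A : set (measurableTypeR R)) : measurable A ->
  mu A = pushforward mu (translate c) A.
Proof.
have mt := measurable_translate c.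
move=> mA; apply: lebesgue_measure_unique => //.
move=> _ [[x y] _ <-].
change (mu `]x, y]%classic = mu (translate c @^-1` `]x, y]%classic)).
rewrite (_ : translate c @^-1` _ = `]x - c, y - c]%classic).
  rewrite !lebesgue_measure_itv/= !lte_fin ltrD2r; case: ifP => // _.
  by rewrite -!EFinB; congr EFin; lra.
by apply/seteqP; split => t; rewrite /= !in_itv/= /translate ltrBlDr lerBrDr.
Qed.

Lemma translate_ioo a b c : translate c @^-1` `]a + c, b + c[%classic = `]a, b[%classic.
Proof. by apply/seteqP; split => t; rewrite /= !in_itv/= /translate !ltrD2r. Qed.

Lemma ae_translate a b c (P : R -> Prop) :
  {ae mu, forall t, `]a + c, b + c[%classic t -> P t} ->
  {ae mu, forall t, `]a, b[%classic t -> P (t + c)}.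
Proof.
move=> [N [mN N0 sN]]; exists (translate c @^-1` N); split.
- exact: translate_measurable.
- by rewrite -N0; symmetry; exact: lebesgue_translate.
- move=> t /= h; apply: sN => /= h'; apply: h => tab; apply: h'.
  by move: tab; rewrite /= !in_itv/= !ltrD2r.
Qed.

Lemma time_int_translate a b c F : aeint mu `]a + c, b + c[ F ->
  aeint mu `]a, b[ (fun t => F (t + c)) /\
  time_int a b (fun t => F (t + c)) = time_int (a + c) (b + c) F.
Proof.
move=> [G iG FG]; have mJ := measurable_ioo (a + c) (b + c); have mI := measurable_ioo a b.
have mt := measurable_translate c.
have FG' : ae_eq mu `]a, b[%classic (fun t => F (t + c)) (fun t => G (t + c)).
  exact: (@ae_translate a b c (fun t => F t = G t) FG).
pose G' : measurableTypeR R -> \bar R := (EFin \o G) \_ `]a + c, b + c[%classic.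
have mG : measurable_fun [set: measurableTypeR R] G'.
  by apply/(measurable_restrictT _ mJ); case/integrableP: iG.
have G'E t : `]a, b[%classic t -> G' (translate c t) = (G (t + c))%:E.
  rewrite -(translate_ioo a b c) => tab; rewrite /G' /patch.
  have tab' : `]a + c, b + c[%classic (translate c t) by exact: tab.
  by rewrite (mem_set tab').
have G'J t : `]a + c, b + c[%classic t -> G' t = (G t)%:E.
  by move=> tab; rewrite /G' /patch (mem_set tab).
have eqm (A : set (measurableTypeR R)) : measurable A -> A `<=` `]a + c, b + c[%classic ->
    mu A = pushforward mu (translate c) A by move=> mA _; exact: lebesgue_translate.
have i1 : mu.-integrable `]a, b[ (G' \o translate c).
  have m1 : measurable_fun `]a, b[%classic (G' \o translate c).
    by apply: measurable_funTS; exact: measurableT_comp.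
  apply/integrableP; split; first exact: m1.
  have E := @ge0_integral_pushforward _ _ (measurableTypeR R) (measurableTypeR R) R _ mt mu
    `]a + c, b + c[%classic (abse \o G') mJ.
  have m2 : measurable_fun `]a + c, b + c[%classic (abse \o G').
    by apply: measurable_funTS; exact: measurableT_comp.
  have {}E := E m2 (fun t _ => abse_ge0 (G' t)); rewrite translate_ioo in E.
  have E2 : (\int[mu]_(x in `]a, b[%classic) `|(G' \o translate c) x| =
      \int[mu]_(t in `](a + c)%R, (b + c)%R[%classic) `|(G t)%:E|)%E.
    rewrite -[LHS]E -(@eq_measure_integral _ _ _ _ (pushforward mu (translate c)) mu _ eqm)//.
    by apply: eq_integral => t; rewrite inE => tJ /=; rewrite G'J.
  by rewrite [ltLHS]E2; case/integrableP: iG.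
have i2 : mu.-integrable `]a, b[ (EFin \o (fun t => G (t + c))).
  by apply: eq_integrable i1 => // t; rewrite inE => tI /=; rewrite G'E.
split; first by exists (fun t => G (t + c)).
rewrite /time_int (Rintegral_ae_congr mI FG') (Rintegral_ae_congr mJ FG) /Rintegral; congr fine.
have := @integral_pushforward _ _ (measurableTypeR R) (measurableTypeR R) R _ mt mu
    `]a + c, b + c[%classic G' mG.
rewrite translate_ioo => /(_ i1 mJ); rewrite -(eq_measure_integral _ eqm)//.
rewrite (eq_integral (fun t => (G t)%:E)); last by move=> t; rewrite inE => tJ; exact: G'J.
move=> ->; apply: eq_integral => t; rewrite inE => tI /=.
by rewrite G'E.
Qed.

End translation.

Section partitions.
Context (R : realType).
Notation mu := (@lebesgue_measure R).
Implicit Types (a b : R) (F : R -> R).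

Lemma ae_neq (c : R) (D : set R) : {ae mu, forall t, D t -> t != c}.
Proof.
exists [set c]; split; [exact: measurable_set1|exact: lebesgue_measure_set1|].
by move=> t /= h; apply: contrapT => tc; apply: h => _; apply/eqP.
Qed.

Lemma ae_ioo_ex a b (P : R -> Prop) : a < b ->
  {ae mu, forall t, `]a, b[%classic t -> P t} -> exists2 t, a < t < b & P t.
Proof.
move=> ab [N [mN N0 sN]]; apply: contrapT => nP.
have : (mu (`]a, b[%classic : set (measurableTypeR R)) <= mu N)%E.
  apply: le_measure; rewrite ?inE; [exact: measurable_ioo|exact: mN|].
  move=> t tab; apply: sN => /= h; apply: nP; exists t; last exact: h.
  by move: tab; rewrite /= in_itv.
rewrite N0 lebesgue_measure_itv/= lte_fin ab -EFinB lee_fin.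
by move: ab; rewrite -subr_gt0 ltNge => /negP.
Qed.

Lemma time_int_sub_le a b c d F : c <= a -> a <= b -> b <= d -> aeint mu `]c, d[ F ->
  {ae mu, forall t, `]c, d[%classic t -> 0 <= F t} -> time_int a b F <= time_int c d F.
Proof.
move=> ca ab bd iF F0; have JI := @itv_oo_sub R a b c d ca bd.
have mI := measurable_ioo c d; have mJ := measurable_ioo a b.
rewrite /time_int -(Rint_indic mu F mI mJ JI); apply: Rint_le => //.
  by apply: aeint_indic => //; exact: aeint_subset iF.
apply: (ae_mono _ F0) => t _ Ft; rewrite indicE; case: (t \in _); first by rewrite mul1r.
by rewrite mul0r.
Qed.

Section fixed_partition.
Variables (s : nat -> R) (K : nat).
Hypothesis hs : forall i, (i < K)%N -> s i < s i.+1.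

Lemma partition_le i j : (i <= j)%N -> (j <= K)%N -> s i <= s j.
Proof.
elim: j => [|j ih]; first by rewrite leqn0 => /eqP ->.
rewrite leq_eqVlt => /orP[/eqP -> //|ij] jK.
by apply: le_trans (ih ij (ltnW jK)) (ltW (hs jK)).
Qed.

Lemma partition_find t : s 0%N < t < s K -> (forall i, (i <= K)%N -> t != s i) ->
  exists2 i, (i < K)%N & s i < t < s i.+1.
Proof.
elim: K => [|k ih] /andP[t1 t2] ht; first by move: (lt_trans t1 t2); rewrite ltxx.
have [tk|] := ltP t (s k).
  have t1k : s 0%N < t < s k by rewrite t1.
  have [i ik ti] := ih t1k (fun i hi => ht i (leqW hi)).
  by exists i => //; exact: ltnW.
rewrite le_eqVlt eq_sym (negbTE (ht k (leqnSn k)))/= => kt.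
by exists k => //; rewrite kt.
Qed.

Lemma partition_unique t i j : (i < K)%N -> (j < K)%N ->
  s i < t < s i.+1 -> s j < t < s j.+1 -> i = j.
Proof.
move=> iK jK /andP[i1 i2] /andP[j1 j2]; apply/eqP; rewrite eqn_leq; apply/andP; split.
- rewrite leqNgt; apply/negP => ji.
  by move: (lt_trans j2 (le_lt_trans (partition_le ji (ltnW iK)) i1)); rewrite ltxx.
- rewrite leqNgt; apply/negP => ij.
  by move: (lt_trans i2 (le_lt_trans (partition_le ij (ltnW jK)) j1)); rewrite ltxx.
Qed.

Definition step (W : lmodType R) (F : nat -> W) (t : R) : W :=
  \sum_(j < K) (\1_(`]s j, s j.+1[%classic) t : R) *: F j.

Lemma step_in (W : lmodType R) (F : nat -> W) t i : (i < K)%N -> s i < t < s i.+1 ->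
  step F t = F i.
Proof.
move=> iK ti; rewrite /step (bigD1 (Ordinal iK))//= indicE mem_set ?scale1r; last first.
  by rewrite /= in_itv.
rewrite big1 ?addr0// => j ji; rewrite indicE memNset ?scale0r//= in_itv/= => tj.
by case/eqP: ji; apply: val_inj; exact: (partition_unique (ltn_ord j) iK tj ti).
Qed.

Lemma step_out (W : lmodType R) (F : nat -> W) t :
  (forall i, (i < K)%N -> ~~ (s i < t < s i.+1)) -> step F t = 0.
Proof.
move=> h; apply: big1 => j _; rewrite indicE memNset ?scale0r//= in_itv/=.
by apply/negP; exact: h.
Qed.

Lemma time_int_partition F : aeint mu `]s 0%N, s K[ F ->
  time_int (s 0%N) (s K) F = \sum_(i < K) time_int (s i) (s i.+1) F.
Proof.
have : forall k, (k <= K)%N -> aeint mu `]s 0%N, s k[ F ->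
    time_int (s 0%N) (s k) F = \sum_(i < k) time_int (s i) (s i.+1) F; last exact.
elim=> [_ _|k ih kK iF]; first by rewrite big_ord0 /time_int set_itvoo0 ?Rintegral_set0.
have k0 := partition_le (leq0n k) (ltnW kK); have k1 := ltW (hs kK).
rewrite (time_int_split k0 k1 iF) big_ord_recr/= ih//; first exact: ltnW.
by apply: (aeint_subset (measurable_ioo _ _)) iF; [exact: measurable_ioo|exact: itv_oo_sub].
Qed.

End fixed_partition.

(** The Riemann sums of step [h] have the integral of [F] as their mean over
    the offset; so they cannot exceed it at almost every offset. *)
Lemma riemann_offset T K F (P : R -> Prop) : 0 < T -> aeint mu `]0, T[ F ->
  {ae mu, forall t, `]0, T[%classic t -> P t} ->
  let h := T / K.+1%:R in exists sigma, [/\ 0 < sigma < h,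
    forall i, (i < K.+1)%N -> P (sigma + i%:R * h) &
    h * \sum_(i < K.+1) F (sigma + i%:R * h) <= time_int 0 T F].
Proof.
move=> T0 iF hP h; have K0 : (0 : R) < K.+1%:R by rewrite ltr0n.
have h0 : 0 < h by rewrite divr_gt0.
have hK : K.+1%:R * h = T by rewrite mulrC divfK// gt_eqF.
pose s i : R := i%:R * h.
have ss i : (i < K.+1)%N -> s i < s i.+1 by move=> _; rewrite ltr_pM2r// ltr_nat.
have s0 : s 0%N = 0 by rewrite /s mul0r.
have sT : s K.+1 = T by [].
have sub i : (i < K.+1)%N -> 0 <= 0 + i%:R * h /\ h + i%:R * h <= T.
  move=> iK; rewrite add0r mulr_ge0 ?(ltW h0)//; split => //.
  have -> : h + i%:R * h = i.+1%:R * h by rewrite -natr1; ring.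
  by rewrite -hK ler_pM2r// ler_nat.
have mI := measurable_ioo 0 h.
have ae i : (i < K.+1)%N -> {ae mu, forall t, `]0, h[%classic t -> P (t + i%:R * h)}.
  move=> iK; apply: ae_translate; apply: ae_sub hP.
  by have [? ?] := sub i iK; exact: itv_oo_sub.
have aeP : {ae mu, forall t, `]0, h[%classic t -> forall i : 'I_K.+1, P (t + i%:R * h)}.
  by apply: ae_forall_ord => i; exact: ae.
have iFi i : (i < K.+1)%N -> aeint mu `]0, h[ (fun t => F (t + i%:R * h)) /\
    time_int 0 h (fun t => F (t + i%:R * h)) = time_int (s i) (s i.+1) F.
  move=> iK; have [h1 h2] := sub i iK.
  have [|i1 i2] := @time_int_translate R 0 h (i%:R * h) F.
    by apply: (aeint_subset (measurable_ioo 0 T)) iF; [exact: measurable_ioo|exact: itv_oo_sub].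
  split => //; rewrite i2 add0r; congr (time_int _ _ _).
  by rewrite /s -natr1; ring.
pose G t := \sum_(i < K.+1) F (t + i%:R * h).
have iG : aeint mu `]0, h[ G by apply: aeint_sum => // i _; exact: (iFi i (ltn_ord i)).1.
have eG : time_int 0 h G = time_int 0 T F.
  rewrite /time_int /G Rint_sum//; last by move=> i _; exact: (iFi i (ltn_ord i)).1.
  have := @time_int_partition s K.+1 ss F; rewrite s0 sT -/(time_int 0 T F) => -> //.
  by apply: eq_bigr => i _; exact: (iFi i (ltn_ord i)).2.
set A := time_int 0 T F in eG *.
apply: contrapT => H.
have HG t : 0 < t < h -> (forall i : 'I_K.+1, P (t + i%:R * h)) -> A < h * G t.
  move=> th hi; rewrite ltNge; apply/negP => le; apply: H; exists t; split => //.
  by move=> i iK; exact: (hi (Ordinal iK)).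
have ic : aeint mu `]0, h[ (fun=> A) by apply: continuous_aeint; exact: cst_continuous.
have ic' : aeint mu `]0, h[ (fun t => h * G t) by apply: aeintZ.
have z : ae_eq mu `]0, h[%classic (fun t => h * G t - A) (fun=> 0).
  apply: Rint_eq0_ae => //; first exact: aeintB.
  - apply: (ae_mono _ aeP) => t; rewrite /= in_itv/= => th hi.
    by rewrite subr_ge0 ltW// HG.
  - rewrite (RintB mI ic' ic) (RintZ mI _ iG).
    have -> : \int[mu]_(x in `]0, h[) A = h * A.
      have := @time_int_deriv R 0 h (A *: 'X) (ltW h0).
      rewrite derivZ derivX alg_polyC !hornerZ !hornerX mulr0 subr0 [A * h]mulrC => <-.
      by apply: eq_Rintegral => t _; rewrite hornerC.
    by rewrite -/(time_int 0 h G) eG subrr.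
have [t th [hi e]] := ae_ioo_ex h0 (ae_and aeP z).
by move: (HG t th hi); rewrite -subr_gt0 e ltxx.
Qed.

End partitions.

(** * The energy inequality *)

Lemma norm_le_1sqr (R : realType) (x : R) : `|x| <= 1 + x ^+ 2.
Proof.
have := sqr_ge0 (`|x| - 1); have := sqr_ge0 `|x|; rewrite -(real_normK (num_real x)).
by move: `|x| => y; rewrite !expr2 => *; lra.
Qed.

Lemma ip_cauchy_schwarz (R : realType) d (Omega : set 'rV[R]_d) v w : open Omega ->
  L2 Omega v -> L2 Omega w -> `|ip Omega v w| <= nrm Omega v * nrm Omega w.
Proof. by move=> oO; exact: (cauchy_schwarz (ip_semi_inner oO)). Qed.

Lemma gip_cauchy_schwarz (R : realType) d (Omega : set 'rV[R]_d) v w : open Omega ->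
  bounded_set Omega -> H10 Omega v -> H10 Omega w ->
  `|gip Omega v w| <= gnrm Omega v * gnrm Omega w.
Proof. by move=> oO bO; exact: (cauchy_schwarz (gip_semi_inner oO bO)). Qed.

Lemma sum_shift_bound (R : realFieldType) (x y z a b : R) : x = a + z -> x = y + b ->
  0 <= a -> 0 <= b -> (y + z) / 2 <= x.
Proof. by move=> *; lra. Qed.

Lemma polarization_bound (R : realFieldType) (x y z a b : R) : 0 <= x - 2 * a + y ->
  0 <= x - 2 * b + z -> a + b <= x + (y + z) / 2.
Proof. by move=> *; lra. Qed.

#[local] Opaque H10 L2 Hm1 ip gip nrm gnrm dual_nrm.

Section energy.
Context (R : realType) (d : nat).
Notation fct := ('rV[R]_d -> R).
Notation mu := (@lebesgue_measure R).
Variable Omega : set 'rV[R]_d.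
Hypothesis oO : open Omega.
Hypothesis bO : bounded_set Omega.
Variable T : R.
Hypothesis T0 : 0 < T.
Notation L2 := (L2 Omega).
Notation H10 := (H10 Omega).
Notation Hm1 := (Hm1 Omega).
Notation ip := (ip Omega).
Notation nrm := (nrm Omega).
Notation gip := (gip Omega).
Notation gnrm := (gnrm Omega).
Notation dual_nrm := (dual_nrm Omega).
Implicit Types (u : R -> fct) (g h : R -> fct -> R) (v w z : fct).

Let iS := ip_semi_inner oO.
Let nS := nrm_seminormed oO.
Let gI := gip_semi_inner oO bO.
Let gS := gnrm_seminormed oO bO.
Let dS := dual_nrm_seminormed oO bO.
Let sL := L2_subspace oO.
Let sH := H10_subspace oO bO.

Lemma time_int_cst a b (c : R) : a <= b -> time_int a b (fun=> c) = (b - a) * c.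
Proof.
move=> ab; have := @time_int_deriv R a b (c *: 'X) ab.
rewrite derivZ derivX alg_polyC !hornerZ !hornerX -mulrBr mulrC => <-.
by apply: eq_Rintegral => t _; rewrite hornerC.
Qed.

Lemma gip_Hm1 w : H10 w -> Hm1 (gip w).
Proof.
move=> hw; split.
  move=> a v z hv hz; rewrite (siDr gI (ssZ _ sH hv) hz hw).
  by rewrite (siZr gI _ hv hw).
by exists (gnrm w) => v hv; exact: gip_cauchy_schwarz.
Qed.

(** Integration by parts with the constant polynomial. *)
Lemma weak_dt_increment u g w a b : 0 <= a -> a < b -> b <= T ->
  L2_continuous Omega T u -> is_weak_dt Omega T u g -> H10 w ->
  time_int a b (fun t => g t w) = ip (u b) w - ip (u a) w.
Proof.
move=> a0 ab bT cu ug hw.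
have := weak_dt_by_parts oO bO (1%:P : {poly R}) a0 ab bT cu ug hw.
rewrite !hornerC !mul1r derivC => <-; apply: eq_Rintegral => t _.
by rewrite horner0 hornerC mul0r mul1r add0r.
Qed.

Lemma nrm_within_continuous u : L2_continuous Omega T u ->
  {within `[0, T], continuous (fun t => nrm (u t))}.
Proof.
move=> cu; apply/subspace_continuousP => t; rewrite /= in_itv/= => t0T.
have [Lut ct] := cu t t0T; apply/cvgrPdist_le => e e0.
move/cvgrPdist_le : ct => /(_ e e0).
have inI : \forall s \near within `[0, T]%classic (nbhs t), 0 <= s <= T.
  by apply: withinT; rewrite //= => s; rewrite /= in_itv.
apply: filterS2 inI => s sT; rewrite sub0r normrN distrC; have [Lus _] := cu s sT.
by apply: le_trans; apply: le_trans (ler_norm _); exact: (sn_dist nS).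
Qed.

Lemma within_seq_cvg (f : R -> R) (x : nat -> R) l a b : {within `[a, b], continuous f} ->
  (forall k, a <= x k <= b) -> a <= l <= b -> x k @[k --> \oo] --> l ->
  f (x k) @[k --> \oo] --> f l.
Proof.
move=> cf xab lab cx.
have lI : `[a, b]%classic l by rewrite /= in_itv.
have cl := (subspace_continuousP _ _).1 cf l lI.
apply/cvgrPdist_lt => e e0; move/cvgrPdist_lt : cl => /(_ e e0).
rewrite near_withinE => h; have : \forall k \near \oo, `[a, b]%classic (x k) -> `|f l - f (x k)| < e.
  exact: (cx _ h).
by apply: filterS => k hk; apply: hk; rewrite /= in_itv/=.
Qed.

Lemma step_int (s : nat -> R) K (F : nat -> fct) (beta : R -> fct -> R) :
  (forall i, (i < K)%N -> s i < s i.+1) -> 0 <= s 0%N -> s K <= T ->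
  (forall i, (i < K)%N -> H10 (F i)) ->
  (forall i, (i < K)%N -> aeint mu `]0, T[ (fun t => beta t (F i))) ->
  {ae mu, forall t, `]0, T[%classic t -> Hm1 (beta t)} ->
  time_int 0 T (fun t => beta t (step s K F t)) =
  \sum_(i < K) time_int (s i) (s i.+1) (fun t => beta t (F i)).
Proof.
move=> hs s0 sT hF iF hb; have mI := measurable_ioo 0 T.
have JI i : (i < K)%N -> `]s i, s i.+1[%classic `<=` (`]0, T[%classic : set R).
  move=> iK; apply: itv_oo_sub.
    by apply: le_trans s0 _; exact: (partition_le hs (leq0n i) (ltnW iK)).
  by apply: le_trans sT; exact: (partition_le hs iK (leqnn K)).
transitivity (time_int 0 T (fun t => \sum_(i < K) \1_(`]s i, s i.+1[%classic) t * beta t (F i))).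
  apply: Rintegral_ae_congr => //; apply: (ae_mono _ hb) => t tI ht.
  rewrite /step (Hm1_sum oO bO _ ht).
    by apply: eq_bigr => i _; rewrite (Hm1Z oO bO _ ht (hF _ (ltn_ord i))).
  by move=> i _; exact: ssZ _ sH (hF _ (ltn_ord i)).
have mJ i := measurable_ioo (s i) (s i.+1).
rewrite /time_int Rint_sum//.
  apply: eq_bigr => i _; exact: (Rint_indic mu _ mI (mJ i) (JI _ (ltn_ord i))).
move=> i _; apply: aeint_indic => //; first exact: JI.
by apply: (aeint_subset mI) (iF _ (ltn_ord i)) => //; exact: JI.
Qed.

Lemma step_bochner2 (W : lmodType R) (S : set W) (N : W -> R) (s : nat -> R) K (F : nat -> W)
    a b : seminormed S N -> (forall i, (i < K)%N -> S (F i)) -> bochner2 S N a b (step s K F).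
Proof.
move=> hN hF; apply: (bochner2_sum hN) => i _.
apply: (bochner2_indic hN); first exact: measurable_ioo.
by apply: bochner2_const => //; exact: hF.
Qed.

Lemma Xspace_sqr u : Xspace Omega T u -> aeint mu `]0, T[ (fun t => gnrm (u t) ^+ 2).
Proof. by move=> Xu; exact: (bochner2_sqr gS Xu). Qed.

Lemma gip_sum_le v w z : H10 v -> H10 w -> H10 z ->
  gip v (w + z) <= gnrm v ^+ 2 + (gnrm w ^+ 2 + gnrm z ^+ 2) / 2.
Proof.
move=> hv hw hz; rewrite (siDr gI hw hz hv).
have e1 := si_ge0 gI (ssB sH hv hw); have e2 := si_ge0 gI (ssB sH hv hz).
rewrite (siBB gI hv hw) in e1; rewrite (siBB gI hv hz) in e2.
rewrite -(gnrm_sqr oO bO hv) -(gnrm_sqr oO bO hw) in e1.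
rewrite -(gnrm_sqr oO bO hv) -(gnrm_sqr oO bO hz) in e2.
exact: polarization_bound e1 e2.
Qed.

(** Young's inequality replaces the values of the Dirichlet form off the
    diagonal by values on the diagonal, which add up to an integral and a
    Riemann sum. *)
Lemma gip_step_le (s : nat -> R) K (h : R) u : Xspace Omega T u ->
  (forall i, (i < K)%N -> s i.+1 - s i = h) -> 0 < h -> 0 <= s 0%N -> s K <= T ->
  (forall i, (i < K.+1)%N -> H10 (u (s i))) ->
  time_int 0 T (fun t => gip (u t) (step s K (fun i => u (s i) + u (s i.+1)) t)) <=
  time_int 0 T (fun t => gnrm (u t) ^+ 2) + h * \sum_(i < K.+1) gnrm (u (s i)) ^+ 2.
Proof.
move=> Xu hs h0 s0 sT hu; have mI := measurable_ioo 0 T.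
have ss i : (i < K)%N -> s i < s i.+1 by move=> iK; rewrite -subr_gt0 hs.
have HF i : (i < K)%N -> H10 (u (s i) + u (s i.+1)).
  by move=> iK; apply: ssD sH _ _; apply: hu => //; exact: ltnW.
have iF i : (i < K)%N -> aeint mu `]0, T[ (fun t => gip (u t) (u (s i) + u (s i.+1))).
  move=> iK; have bw := @bochner2_const _ _ H10 gnrm 0 T _ gS (HF i iK).
  exact: (bochner2_pairing gS gS (gip_pairing oO bO) Xu bw).
rewrite (@step_int s K _ (fun t => gip (u t)) ss s0 sT HF iF); last first.
  by apply: (ae_mono _ (bochner2_mem Xu)) => t _; exact: gip_Hm1.
have iE := Xspace_sqr Xu.
have sub i : (i < K)%N -> 0 <= s i /\ s i.+1 <= T.
  move=> iK; split; first by apply: le_trans s0 _; exact: (partition_le ss (leq0n i) (ltnW iK)).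
  by apply: le_trans sT; exact: (partition_le ss iK (leqnn K)).
have aesub i (G : R -> R) : (i < K)%N -> aeint mu `]0, T[ G -> aeint mu `]s i, s i.+1[ G.
  move=> iK; have [? ?] := sub i iK.
  by apply: (aeint_subset mI); [exact: measurable_ioo|exact: itv_oo_sub].
pose c i := (gnrm (u (s i)) ^+ 2 + gnrm (u (s i.+1)) ^+ 2) / 2.
have each i : (i < K)%N -> time_int (s i) (s i.+1) (fun t => gip (u t) (u (s i) + u (s i.+1))) <=
    time_int (s i) (s i.+1) (fun t => gnrm (u t) ^+ 2) + h * c i.
  move=> iK; have mJ := measurable_ioo (s i) (s i.+1).
  have ic : aeint mu `]s i, s i.+1[ (fun=> c i) by apply: continuous_aeint; exact: cst_continuous.
  rewrite -(hs i iK) -(time_int_cst (c i) (ltW (ss i iK))) /time_int -(RintD mJ (aesub i _ iK iE) ic).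
  apply: (Rint_le mJ); [exact: aesub (iF i iK)|by apply: aeintD => //; exact: aesub|].
  have [a0 bT] := sub i iK.
  have Hj : {ae mu, forall t, `]s i, s i.+1[%classic t -> H10 (u t)}.
    by apply: ae_sub (bochner2_mem Xu); exact: itv_oo_sub.
  apply: (ae_mono _ Hj) => t _ hut.
  exact: (gip_sum_le hut (hu i (ltnW iK)) (hu i.+1 iK)).
have E1 : \sum_(i < K) time_int (s i) (s i.+1) (fun t => gip (u t) (u (s i) + u (s i.+1))) <=
    \sum_(i < K) time_int (s i) (s i.+1) (fun t => gnrm (u t) ^+ 2) + h * \sum_(i < K) c i.
  by rewrite mulr_sumr -big_split/=; apply: ler_sum => i _; exact: each.
apply: le_trans E1 _; apply: lerD.
  have := partition_le ss (leq0n K) (leqnn K) => s0K.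
  rewrite -(time_int_partition ss); last first.
    by apply: (aeint_subset mI) iE; [exact: measurable_ioo|exact: itv_oo_sub].
  by apply: time_int_sub_le => //; apply: aeW => t _; exact: sqr_ge0.
rewrite ler_wpM2l ?(ltW h0)//.
pose e i := gnrm (u (s i)) ^+ 2; have e0 i : 0 <= e i by exact: sqr_ge0.
have -> : \sum_(i < K) c i = (\sum_(i < K) e i + \sum_(i < K) e i.+1) / 2.
  by rewrite -big_split/= mulr_suml.
have h1 : \sum_(i < K.+1) e i = e 0%N + \sum_(i < K) e i.+1 by rewrite big_ord_recl.
have h2 : \sum_(i < K.+1) e i = \sum_(i < K) e i + e K by rewrite big_ord_recr.
exact: (sum_shift_bound h1 h2 (e0 _) (e0 _)).
Qed.

(** On each step the increment of [u] is paired with the sum of its two end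
    values, which gives a difference of squares. *)
Lemma energy_step (s : nat -> R) K u g : L2_continuous Omega T u -> is_weak_dt Omega T u g ->
  (forall i, (i < K)%N -> s i < s i.+1) -> 0 <= s 0%N -> s K <= T ->
  (forall i, (i < K.+1)%N -> H10 (u (s i))) ->
  time_int 0 T (fun t => g t (step s K (fun i => u (s i) + u (s i.+1)) t)) =
  nrm (u (s K)) ^+ 2 - nrm (u (s 0%N)) ^+ 2.
Proof.
move=> cu ug ss s0 sT hu; have [bg _] := ug.
have HF i : (i < K)%N -> H10 (u (s i) + u (s i.+1)).
  by move=> iK; apply: ssD sH _ _; apply: hu => //; exact: ltnW.
rewrite (step_int ss s0 sT HF); last 2 first.
- by move=> i iK; apply: (dual_ev_aeint oO bO bg); exact: HF.
- exact: bochner2_mem bg.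
rewrite (eq_bigr (fun i : 'I_K => nrm (u (s i.+1)) ^+ 2 - nrm (u (s i)) ^+ 2)).
  by rewrite -(big_mkord xpredT (fun i => nrm (u (s i.+1)) ^+ 2 - nrm (u (s i)) ^+ 2)) telescope_sumr.
move=> i _; have iK := ltn_ord i.
rewrite (weak_dt_increment _ (ss i iK) _ cu ug (HF i iK)).
- have Li := H10_L2 (hu i (ltnW iK)); have Lj := H10_L2 (hu i.+1 iK).
  by rewrite !(siDr iS)// !(nrm_sqr oO)// (siC iS Lj Li); lra.
- by apply: le_trans s0 _; exact: (partition_le ss (leq0n i) (ltnW iK)).
- by apply: le_trans sT; exact: (partition_le ss iK (leqnn K)).
Qed.

(** The two nodes around [t] converge to [t], and [u] is continuous with
    values in L^2. *)
Lemma step_values_cvg (s : nat -> nat -> R) u (phi : fct) t :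
  L2_continuous Omega T u -> L2 phi -> 0 < t < T ->
  (forall n i, (i < n)%N -> s n i.+1 - s n i = T / n.+1%:R) ->
  (forall n, 0 < s n 0%N < T / n.+1%:R) -> (forall n, T - T / n.+1%:R < s n n < T) ->
  (forall n i, (i <= n)%N -> t != s n i) ->
  ip phi (step (s n) n (fun i => u (s n i) + u (s n i.+1)) t) @[n --> \oo] -->
  2 * ip phi (u t).
Proof.
move=> cu Lp /andP[t0 tT] hs h0 hT ht; apply/cvgrPdist_le => e e0.
have tI : 0 <= t <= T by rewrite !ltW.
have [Lut ct] := cu t tI; have n0 := sn_ge0 nS Lp.
have k0 : 0 < 2 * (nrm phi + 1) by rewrite mulr_gt0// ltr_wpDl.
move/cvgrPdist_le : ct => /(_ (e / (2 * (nrm phi + 1))) (divr_gt0 e0 k0)).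
rewrite near_withinE => -[del /= del0 hdel].
have ch : T / n.+1%:R @[n --> \oo] --> (0 : R).
  by rewrite -[X in _ --> X](mulr0 T); apply: cvgMr; exact: cvg_harmonic.
near=> n.
have hd : T / n.+1%:R < del by near: n; exact: cvgr_lt ch _ del0.
have hh1 : T / n.+1%:R < t by near: n; exact: cvgr_lt ch _ t0.
have hh2 : T / n.+1%:R < T - t by near: n; apply: cvgr_lt ch _ _; rewrite subr_gt0.
have hp : 0 < T / n.+1%:R by rewrite divr_gt0.
have ss i : (i < n)%N -> s n i < s n i.+1 by move=> iK; rewrite -subr_gt0 hs.
have [i iK ti] : exists2 i, (i < n)%N & s n i < t < s n i.+1.
  apply: partition_find; last exact: ht.
  have /andP[_ u1] := h0 n; have /andP[u2 _] := hT n.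
  rewrite (lt_trans u1 hh1) (lt_trans _ u2)//.
  by rewrite ltrBrDr -ltrBrDl.
rewrite (step_in ss _ iK ti).
have pI j : (j <= n)%N -> 0 <= s n j <= T.
  move=> jn; have /andP[u1 _] := h0 n; have /andP[_ u2] := hT n.
  by rewrite (le_trans (ltW u1) (partition_le ss (leq0n j) jn))
    (le_trans (partition_le ss jn (leqnn n)) (ltW u2)).
have near_t j : (j <= n)%N -> `|t - s n j| < del ->
    L2 (u (s n j)) /\ nrm (u t - u (s n j)) * (2 * (nrm phi + 1)) <= e.
  move=> jn hj; have Lus := (cu _ (pI j jn)).1; split => //.
  have := hdel (s n j) hj; rewrite /= in_itv/= => /(_ (pI j jn)).
  rewrite sub0r normrN => hl; rewrite -ler_pdivlMr//; apply: le_trans hl.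
  apply: le_trans (ler_norm _).
  by rewrite -(snN nS (ssB sL Lut Lus)) opprB.
have hx : s n i.+1 = s n i + T / n.+1%:R by rewrite -(hs n i iK) addrC subrK.
have /andP[ti1 ti2] := ti.
have d1 : `|t - s n i| < del.
  by apply: le_lt_trans hd; rewrite ger0_norm ?subr_ge0 ?(ltW ti1)// lerBlDl -hx ltW.
have d2 : `|t - s n i.+1| < del.
  apply: le_lt_trans hd; rewrite distrC ger0_norm ?subr_ge0 ?(ltW ti2)// hx.
  by rewrite lerBlDr addrC lerD2l ltW.
have [Li bi] := near_t i (ltnW iK) d1.
have [Lj bj] := near_t i.+1 iK d2.
have -> : 2 * ip phi (u t) - ip phi (u (s n i) + u (s n i.+1)) =
    ip phi (u t - u (s n i)) + ip phi (u t - u (s n i.+1)).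
  by rewrite (siDr iS)// !(siBr iS)//; lra.
have c1 := ip_cauchy_schwarz oO Lp (ssB sL Lut Li); have c2 := ip_cauchy_schwarz oO Lp (ssB sL Lut Lj).
have p1 := sn_ge0 nS (ssB sL Lut Li); have p2 := sn_ge0 nS (ssB sL Lut Lj).
apply: le_trans (ler_normD _ _) _; apply: le_trans (lerD c1 c2) _.
move: bi bj p1 p2 n0; move: (nrm phi) (nrm _) (nrm _) => x y z *; nra.
Unshelve. all: by end_near. Qed.

(** Energy is tested along a partition [s_i]: the telescoping sum of
    [|u(s_i)|^2] equals the pairing with the step function of values
    [u(s_i) + u(s_{i+1})].  Strong convergence of these step functions in
    L^2(0,T;H^1_0) is avoided: the equation trades the time derivative for the
    data, where L^2(Omega) continuity suffices, and for the Dirichlet form,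
    which is bounded from one side by Riemann sums of its diagonal. *)
Lemma energy_inequality u g (f : R -> fct) : (0 < d)%N -> Xspace Omega T u -> L2_continuous Omega T u ->
  is_weak_dt Omega T u g -> bochner2 L2 nrm 0 T f ->
  (forall v : R -> fct, Xspace Omega T v -> time_int 0 T (fun t => g t (v t) + gip (u t) (v t)) =
    time_int 0 T (fun t => ip (f t) (v t))) ->
  2 * time_int 0 T (fun t => g t (u t)) <= nrm (u T) ^+ 2 - nrm (u 0) ^+ 2.
Proof.
move=> d0 Xu cu ug bf eqn; have [bg _] := ug; have mI := measurable_ioo 0 T.
pose A := time_int 0 T (fun t => gnrm (u t) ^+ 2).
have iE := Xspace_sqr Xu.
have Hu := bochner2_mem Xu.
(* Partitions with nodes where [u] lies in H^1_0, and with Riemann sums of the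
   squared Dirichlet norm bounded by its integral. *)
have /choice[sig hsig] : forall n : nat, exists sigma, [/\ 0 < sigma < T / n.+1%:R,
    forall i, (i < n.+1)%N -> H10 (u (sigma + i%:R * (T / n.+1%:R))) &
    T / n.+1%:R * \sum_(i < n.+1) gnrm (u (sigma + i%:R * (T / n.+1%:R))) ^+ 2 <= A].
  by move=> n; have [s hs] := riemann_offset n T0 iE Hu; exists s.
pose s (n i : nat) := sig n + i%:R * (T / n.+1%:R).
have hp n : 0 < T / n.+1%:R by rewrite divr_gt0.
have hs n i : s n i.+1 - s n i = T / n.+1%:R by rewrite /s -natr1; ring.
have s0 n : 0 < s n 0%N < T / n.+1%:R.
  by rewrite /s mul0r addr0; have [] := hsig n.
have sTE n : s n n = sig n + (T - T / n.+1%:R).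
  rewrite /s; congr (_ + _); rewrite -[X in _ = X - _](@divfK _ n.+1%:R _)//.
  by rewrite -natr1; ring.
have sT n : T - T / n.+1%:R < s n n < T.
  rewrite sTE; have [/andP[u1 u2] _ _] := hsig n.
  by move: (sig n) (T / _) u1 u2 => x y *; apply/andP; split; lra.
have ss n i : (i < n)%N -> s n i < s n i.+1 by move=> _; rewrite -subr_gt0 hs.
have Hs n i : (i < n.+1)%N -> H10 (u (s n i)) by move=> iN; have [_ h _] := hsig n; exact: h.
pose V n := step (s n) n (fun i => u (s n i) + u (s n i.+1)).
have HF n i : (i < n)%N -> H10 (u (s n i) + u (s n i.+1)).
  by move=> iK; apply: ssD sH _ _; apply: Hs => //; exact: ltnW.
have XV n : Xspace Omega T (V n) by apply: (step_bochner2 _ _ _ gS) => i iK; exact: HF.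
have ia (v : R -> fct) : Xspace Omega T v -> aeint mu `]0, T[ (fun t => g t (v t)).
  by move=> Xv; exact: (bochner2_pairing dS gS (ev_pairing oO bO) bg Xv).
have ib (v : R -> fct) : Xspace Omega T v -> aeint mu `]0, T[ (fun t => gip (u t) (v t)).
  by move=> Xv; exact: (bochner2_pairing gS gS (gip_pairing oO bO) Xu Xv).
have eqn' (v : R -> fct) : Xspace Omega T v -> time_int 0 T (fun t => g t (v t)) +
    time_int 0 T (fun t => gip (u t) (v t)) = time_int 0 T (fun t => ip (f t) (v t)).
  by move=> Xv; rewrite -(eqn _ Xv) /time_int (RintD mI (ia _ Xv) (ib _ Xv)).
(* The equation tested with the step function [V n], whose pairing with the
   time derivative telescopes. *)
have key n : time_int 0 T (fun t => ip (f t) (V n t)) <=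
    nrm (u (s n n)) ^+ 2 - nrm (u (s n 0%N)) ^+ 2 + 2 * A.
  have /andP[s01 _] := s0 n; have /andP[_ sT1] := sT n.
  rewrite -(eqn' _ (XV n)) (energy_step cu ug (ss n) (ltW s01) (ltW sT1) (Hs n)) lerD2l.
  have := gip_step_le Xu (fun i _ => hs n i) (hp n) (ltW s01) (ltW sT1) (Hs n).
  have [_ _] := hsig n; rewrite -/(V n) -/A => h1 h2; apply: le_trans h2 _.
  by rewrite mulr_natl mulr2n lerD2l.
have ch : T / n.+1%:R @[n --> \oo] --> (0 : R).
  by rewrite -[X in _ --> X](mulr0 T); apply: cvgMr; exact: cvg_harmonic.
have cE := nrm_within_continuous cu.
have T00 := ltW T0.
have hT n : T / n.+1%:R <= T by rewrite ler_pdivrMr// ler_peMr// ler1n.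
have c1 : nrm (u (s n 0%N)) @[n --> \oo] --> nrm (u 0).
  apply: (within_seq_cvg (x := fun n => s n 0%N) cE); last 1 first.
  - apply: (squeeze_cvgr _ (cvg_cst 0) ch); apply: nearW => n.
    by have /andP[u1 u2] := s0 n; rewrite !ltW.
  - by move=> n; have /andP[u1 u2] := s0 n; rewrite (ltW u1) (le_trans (ltW u2)).
  - by rewrite lexx.
have c2 : nrm (u (s n n)) @[n --> \oo] --> nrm (u T).
  apply: (within_seq_cvg (x := fun n => s n n) cE); last 1 first.
  - apply: (squeeze_cvgr (f := fun n => T - T / n.+1%:R) (h := fun=> T)); last 2 first.
    + by rewrite -[X in _ --> X]subr0; apply: cvgB ch; exact: cvg_cst.
    + exact: cvg_cst.
    by apply: nearW => n; have /andP[u1 u2] := sT n; rewrite !ltW.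
  - move=> n; have /andP[u1 u2] := sT n; rewrite (ltW u2) andbT.
    by apply: le_trans (ltW u1); rewrite subr_ge0.
  - by rewrite T00 lexx.
have c3 : (nrm (u (s n n)) ^+ 2 - nrm (u (s n 0%N)) ^+ 2 + 2 * A) @[n --> \oo] -->
    nrm (u T) ^+ 2 - nrm (u 0) ^+ 2 + 2 * A.
  by apply: cvgD; [apply: cvgB; rewrite ?expr2; exact: cvgM|exact: cvg_cst].
have [M M0 hM] := within_continuous_bounded cE.
have Lf := bochner2_mem bf.
have ifn : aeint mu `]0, T[ (fun t => nrm (f t)).
  have i2 := bochner2_sqr nS bf.
  apply: (@aeint_le _ _ _ mu _ mI _ (fun t => 1 + nrm (f t) ^+ 2)).
  - exact: (bochner2_nrm nS bf).
  - by apply: aeintD => //; apply: continuous_aeint; exact: cst_continuous.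
  - by apply: aeW => t _; exact: norm_le_1sqr.
have LV n t : L2 (V n t) /\ nrm (V n t) <= 2 * M.
  have [[i iK ti]|no] := pselect (exists2 i, (i < n)%N & s n i < t < s n i.+1); last first.
    rewrite /V step_out; last by move=> i iK; apply/negP => ti; apply: no; exists i.
    by split; [exact: sL.1|rewrite (sn0 nS) mulr_ge0].
  rewrite /V (step_in (ss n) _ iK ti).
  have bd j : (j <= n)%N -> nrm (u (s n j)) <= M.
    move=> jn; apply: le_trans (ler_norm _) _; apply: hM.
    have /andP[u1 _] := s0 n; have /andP[_ u2] := sT n.
    by rewrite (le_trans (ltW u1) (partition_le (ss n) (leq0n j) jn))
      (le_trans (partition_le (ss n) jn (leqnn n)) (ltW u2)).
  split; first exact: H10_L2 (HF n i iK).
  apply: le_trans (snD nS (H10_L2 (Hs n i (ltnW iK))) (H10_L2 (Hs n i.+1 iK))) _.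
  by rewrite mulr_natl mulr2n lerD// bd// ltnW.
have neq : {ae mu, forall t, `]0, T[%classic t -> forall n i, (i <= n)%N -> t != s n i}.
  have h0 n : {ae mu, forall t, `]0, T[%classic t -> forall i : 'I_n.+1, t != s n i}.
    by apply: ae_forall_ord => i; exact: ae_neq.
  have := ae_foralln h0; apply: filterS => t ht tI n i iN.
  exact: (ht n tI (Ordinal (iN : (i < n.+1)%N))).
have [C hC] := ip_H10_pairing oO bO d0.
have ifu (v : R -> fct) : Xspace Omega T v -> aeint mu `]0, T[ (fun t => ip (f t) (v t)).
  by move=> Xv; exact: (bochner2_pairing nS gS hC bf Xv).
(* Only the data term needs a limit inside the integral; L^2 convergence of [V
   n t] at almost every [t] suffices for it. *)
have c4 : time_int 0 T (fun t => ip (f t) (V n t)) @[n --> \oo] -->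
    time_int 0 T (fun t => 2 * ip (f t) (u t)).
  apply: (@Rint_dominated _ _ _ mu `]0, T[%classic (fun n t => ip (f t) (V n t))
    (fun t => 2 * ip (f t) (u t)) (fun t => 2 * M * nrm (f t)) mI _ _ _ _).2.
  - exact: (fun n => aemeas_aeint (ifu (V n) (XV n))).
  - exact: aeintZ.
  - move=> n; apply: (ae_mono _ Lf) => t _ Lft; have [L1 L2'] := LV n t.
    apply: le_trans (ip_cauchy_schwarz oO Lft L1) _; rewrite mulrC.
    by rewrite ler_wpM2r// (sn_ge0 nS Lft).
  - apply: (ae_mono _ (ae_and Lf neq)) => t; rewrite /= in_itv/= => tI [Lft ht].
    by apply: step_values_cvg => // n i _; exact: hs.
have l : time_int 0 T (fun t => 2 * ip (f t) (u t)) <=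
    nrm (u T) ^+ 2 - nrm (u 0) ^+ 2 + 2 * A.
  by apply: (ler_cvg_to c4 c3); apply: nearW; exact: key.
have eu := eqn' u Xu.
have E2 : time_int 0 T (fun t => gip (u t) (u t)) = A.
  apply: Rintegral_ae_congr => //; apply: (ae_mono _ Hu) => t _ hut.
  by rewrite (gnrm_sqr oO bO hut).
move: l; rewrite /time_int (RintZ mI 2 (ifu _ Xu)) -!/(time_int _ _ _) -eu E2 mulrDr lerD2r.
exact.
Qed.

End energy.

(** * Polynomial curves *)

Section curves.
Context (R : realType) (W : lmodType R).
Implicit Types (m : nat) (P : nat -> {poly R}) (w : nat -> W) (t : R) (S : set W) (N : W -> R).

(** Coefficients are arbitrary scalar polynomials, so that monomial expansions
    and Legendre corrections are both instances. *)
Definition curve m P w t : W := \sum_(k < m) (P k).[t] *: w k.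

Definition dcurve m P w t : W := curve m (fun k => (P k)^`()) w t.

Lemma curve_mem S m P w t : subspace_set S -> (forall k, (k < m)%N -> S (w k)) ->
  S (curve m P w t).
Proof. by move=> sS hw; apply: ss_sum => // k _; apply: ssZ => //; exact: hw. Qed.

Lemma curve_recr m P w t : curve m.+1 P w t = curve m P w t + (P m).[t] *: w m.
Proof. by rewrite /curve big_ord_recr. Qed.

(** Reduces the calculus of curves to that of polynomials. *)
Definition curve_pairing (b : W -> W -> R) m P w z : {poly R} :=
  \sum_(k < m) b (w k) z *: P k.

Lemma curve_pairingE S b m P w z t : semi_inner S b -> (forall k, (k < m)%N -> S (w k)) ->
  S z -> b (curve m P w t) z = (curve_pairing b m P w z).[t].
Proof.
move=> hb hw Sz; have [sS _ _ _] := hb.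
rewrite /curve (si_suml hb)//; last by move=> k _; apply: ssZ => //; exact: hw.
rewrite /curve_pairing horner_sum; apply: eq_bigr => k _.
by rewrite (siZl hb)// ?hornerZ 1?mulrC//; exact: hw.
Qed.

Lemma curve_pairing_deriv b m P w z :
  curve_pairing b m (fun k => (P k)^`()) w z = (curve_pairing b m P w z)^`().
Proof. by rewrite /curve_pairing raddf_sum/=; apply: eq_bigr => k _; rewrite derivZ. Qed.

Lemma size_curve_pairing b m P w z q : (forall k, (k < m)%N -> (size (P k) <= q)%N) ->
  (size (curve_pairing b m P w z) <= q)%N.
Proof.
move=> hP; rewrite /curve_pairing; apply: leq_trans (size_sum _ _ _) _.
by apply/bigmax_leqP => k _; apply: leq_trans (size_scale_leq _ _) (hP k (ltn_ord k)).
Qed.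

Lemma nrm_sum_le S N m (f : nat -> R) w : seminormed S N -> (forall k, (k < m)%N -> S (w k)) ->
  0 <= N (\sum_(k < m) f k *: w k) <= \sum_(k < m) `|f k| * N (w k).
Proof.
move=> hN hw; have [sS _ _] := hN.
have memS (r : seq 'I_m) : S (\sum_(k <- r) f k *: w k).
  by apply: ss_sum => // k _; apply: ssZ => //; exact: hw.
rewrite (sn_ge0 hN (memS _)) /=; elim: (index_enum _) => [|k r ih].
  by rewrite !big_nil (sn0 hN).
rewrite !big_cons; have Sk := hw k (ltn_ord k).
apply: le_trans (snD hN (ssZ _ sS Sk) (memS _)) _.
by rewrite (snZ hN _ Sk) lerD2l.
Qed.

Lemma curve_small S N m (X : Type) (F : set_system X) {FF : ProperFilter F}
    (f : nat -> X -> R) w (y : X -> W) : seminormed S N ->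
  (forall k, (k < m)%N -> S (w k)) -> (forall x, y x = \sum_(k < m) f k x *: w k) ->
  (forall k, (k < m)%N -> f k x @[x --> F] --> (0 : R)) -> N (y x) @[x --> F] --> (0 : R).
Proof.
move=> hN hw yE hf.
have cs : (\sum_(k < m) `|f k x| * N (w k)) @[x --> F] --> (0 : R).
  have : (\sum_(k < m) `|f k x| * N (w k)) @[x --> F] --> \sum_(k < m) (0 : R).
    elim: (index_enum _) => [|k r ih].
      by rewrite !big_nil; under eq_fun do rewrite big_nil; exact: cvg_cst.
    rewrite big_cons; under eq_fun do rewrite big_cons; apply: cvgD => //.
    rewrite -[X in _ --> X](mul0r (N (w k))); apply: cvgMl.
    by rewrite -[X in _ --> X](@normr0 _ R); apply: cvg_norm; exact: hf.
  by rewrite big1.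
apply: (squeeze_cvgr _ (cvg_cst 0) cs); apply: nearW => x; rewrite yE.
exact: (nrm_sum_le (fun k => f k x) hN hw).
Qed.

Lemma curve_continuous S N m P w t : seminormed S N -> (forall k, (k < m)%N -> S (w k)) ->
  N (curve m P w s - curve m P w t) @[s --> t] --> (0 : R).
Proof.
move=> hN hw; apply: (@curve_small S N m R (nbhs t) _ (fun k s => (P k).[s] - (P k).[t])) hN hw _ _.
  by move=> s; rewrite /curve -sumrB; apply: eq_bigr => k _; rewrite scalerBl.
move=> k _; rewrite -[X in _ --> X](subrr (P k).[t]); apply: cvgB; last exact: cvg_cst.
exact: continuous_poly.
Qed.

Lemma curve_derivative S N m P w t : seminormed S N -> (forall k, (k < m)%N -> S (w k)) ->
  N (h^-1 *: (curve m P w (t + h) - curve m P w t) - dcurve m P w t) @[h --> 0^'] --> (0 : R).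
Proof.
move=> hN hw.
apply: (@curve_small S N m R (0 : R)^' _
  (fun k h => h^-1 * ((P k).[t + h] - (P k).[t]) - (P k)^`().[t])) hN hw _ _.
  move=> h; rewrite /dcurve /curve -sumrB scaler_sumr -sumrB; apply: eq_bigr => k _.
  by rewrite -scalerBl scalerA -scalerBl.
move=> k _; have [hd ed] := is_derive_horner (P k) t.
rewrite -[X in _ --> X](subrr (P k)^`().[t]); apply: cvgB; last exact: cvg_cst.
move: hd => /cvg_ex[l hl]; have el : l = (P k)^`().[t].
  by rewrite -ed; symmetry; apply: cvg_lim => //; exact: hl.
rewrite -el; move: hl; apply: cvg_trans; apply: near_eq_cvg; apply: nearW => h.
have -> : h%:A = h :> R by exact: mulr1.
by rewrite [t + h]addrC.
Qed.

Lemma poly_curveE (p : {poly R}) q (z : W) t : (size p <= q.+1)%N ->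
  p.[t] *: z = \sum_(k < q.+1) t ^+ k *: (p`_k *: z).
Proof.
move=> sp; rewrite (horner_coef_wide _ sp) scaler_suml; apply: eq_bigr => k _.
by rewrite scalerA mulrC.
Qed.

End curves.

Section limits_in_L2.
Context (R : realType) (d : nat).
Notation fct := ('rV[R]_d -> R).
Variable Omega : set 'rV[R]_d.
Hypothesis oO : open Omega.
Notation L2 := (L2 Omega).
Notation nrm := (nrm Omega).
Notation eqae := (eqae Omega).
Implicit Types (v : R -> fct) (w z : fct).

Let nS := nrm_seminormed oO.
Let sL := L2_subspace oO.

Lemma L2_lim_unique (X : Type) (F : set_system X) {FF : ProperFilter F} (y : X -> fct) w z :
  (\forall x \near F, L2 (y x)) -> L2 w -> L2 z ->
  nrm (y x - w) @[x --> F] --> (0 : R) -> nrm (y x - z) @[x --> F] --> (0 : R) -> eqae w z.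
Proof.
move=> Ly Lw Lz cw cz; apply: (eqae_nrm0 oO Lw Lz).
apply/eqP; rewrite eq_le (sn_ge0 nS (ssB sL Lw Lz)) andbT.
have c : (nrm (y x - w) + nrm (y x - z)) @[x --> F] --> (0 : R).
  by rewrite -[X in _ --> X](addr0 0); exact: cvgD.
rewrite -(cvg_lim _ c)//; apply: limr_ge; first by apply/cvg_ex; exists 0.
apply: filterS Ly => x Lyx.
have -> : w - z = (y x - z) - (y x - w) by rewrite opprB [in RHS]addrC [in RHS]addrA subrK.
by rewrite [leRHS]addrC; exact: (snB nS (ssB sL Lyx Lz) (ssB sL Lyx Lw)).
Qed.

Lemma right_limitP v a w : (\forall t \near a^'+, L2 (v t)) -> L2 w ->
  L2_cvg Omega a^'+ v w ->
  L2 (right_limit Omega v a) /\ eqae (right_limit Omega v a) w.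
Proof.
move=> Lv Lw cw; have [h1 h2] : [set w | L2 w /\ L2_cvg Omega a^'+ v w] (right_limit Omega v a).
  by apply: (@xgetI _ _ _ w).
by split => //; exact: L2_lim_unique Lv h1 Lw h2 cw.
Qed.

Variables (a b : R) (v : R -> fct) (m : nat) (P : nat -> {poly R}) (w : nat -> fct).
Hypothesis ab : a < b.
Hypothesis Lw : forall k, (k < m)%N -> L2 (w k).
Hypothesis hv : forall t, a < t < b -> L2 (v t) /\ eqae (v t) (curve m P w t).

Let Lc t : L2 (curve m P w t). Proof. exact: curve_mem. Qed.

Let near_right : \forall t \near a^'+, a < t < b.
Proof. by near=> t; apply/andP; split; near: t; [exact: nbhs_right_gt|exact: nbhs_right_lt]. Unshelve. all: by end_near. Qed.

Let near_left : \forall t \near b^'-, a < t < b.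
Proof. by near=> t; apply/andP; split; near: t; [exact: nbhs_left_gt|exact: nbhs_left_lt]. Unshelve. all: by end_near. Qed.

Let nrm_sub t z : a < t < b -> L2 z -> nrm (curve m P w t - z) = nrm (v t - z).
Proof.
move=> tab Lz; apply: (nrm_eqae oO); apply: eqaeB; last exact: eqae_refl.
by apply: eqae_sym; exact: (hv tab).2.
Qed.

Lemma right_limit_curve : L2 (right_limit Omega v a) /\
  eqae (right_limit Omega v a) (curve m P w a).
Proof.
apply: right_limitP => //; first by apply: filterS near_right => t /hv[].
have : nrm (curve m P w s - curve m P w a) @[s --> a^'+] --> (0 : R).
  by apply: cvg_at_right_filter; exact: (curve_continuous P a nS Lw).
apply: cvg_trans; apply: near_eq_cvg; apply: filterS near_right => t tab /=.
by rewrite nrm_sub.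
Qed.

Lemma left_limit_curve : L2 (v b) -> L2_cvg Omega b^'- v (v b) -> eqae (v b) (curve m P w b).
Proof.
move=> Lb cb; apply: (@L2_lim_unique _ b^'- _ v) => //.
  by apply: filterS near_left => t /hv[].
have : nrm (curve m P w s - curve m P w b) @[s --> b^'-] --> (0 : R).
  by apply: cvg_at_left_filter; exact: (curve_continuous P b nS Lw).
apply: cvg_trans; apply: near_eq_cvg; apply: filterS near_left => t tab /=.
by rewrite nrm_sub.
Qed.

Lemma strong_dt_curve t : a < t < b ->
  L2 (strong_dt Omega v t) /\ eqae (strong_dt Omega v t) (dcurve m P w t).
Proof.
move=> tab; have Ld : L2 (dcurve m P w t) by exact: curve_mem.
have Lvt := (hv tab).1.
have near0 : \forall h \near (0 : R)^', a < t + h < b.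
  have /andP[ta tb] := tab.
  have e0 : 0 < Num.min (t - a) (b - t) by rewrite lt_min !subr_gt0 ta.
  near=> h; have : `|h| < Num.min (t - a) (b - t).
    by near: h; apply: dnbhs0_lt.
  by rewrite lt_min !ltr_norml => /andP[/andP[h1 h2] /andP[h3 h4]]; apply/andP; split; lra.
have cd : nrm (h^-1 *: (v (t + h) - v t) - dcurve m P w t) @[h --> 0^'] --> (0 : R).
  have := curve_derivative P t nS Lw; apply: cvg_trans; apply: near_eq_cvg.
  apply: filterS near0 => h th /=; apply: (nrm_eqae oO); apply: eqaeB; last exact: eqae_refl.
  by apply: eqaeZ; apply: eqaeB; apply: eqae_sym; [exact: (hv th).2|exact: (hv tab).2].
have [h1 h2] : [set z | L2 z /\
    nrm (h^-1 *: (v (t + h) - v t) - z) @[h --> 0^'] --> (0 : R)] (strong_dt Omega v t).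
  by apply: (@xgetI _ _ _ (dcurve m P w t)).
split => //; apply: (@L2_lim_unique _ (0 : R)^' _ (fun h => h^-1 *: (v (t + h) - v t))) => //.
by apply: filterS near0 => h th; apply: ssZ => //; apply: ssB => //; exact: (hv th).1.
Unshelve. all: by end_near. Qed.

End limits_in_L2.

(** * Continuous piecewise polynomials in time *)

Section piecewise_integrals.
Context (R : realType) (s : nat -> R) (K : nat).
Notation mu := (@lebesgue_measure R).
Hypothesis hs : forall i, (i < K)%N -> s i < s i.+1.
Implicit Types (F : R -> R).

Lemma ae_pieces (P : R -> Prop) :
  (forall j, (j < K)%N -> {ae mu, forall t, `]s j, s j.+1[%classic t -> P t}) ->
  {ae mu, forall t, `]s 0%N, s K[%classic t -> P t}.
Proof.
move=> hP.
have neq : {ae mu, forall t, `]s 0%N, s K[%classic t -> forall i : 'I_K.+1, t != s i}.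
  by apply: ae_forall_ord => i; exact: ae_neq.
have all : {ae mu, forall t, `]s 0%N, s K[%classic t ->
    forall j : 'I_K, `]s j, s j.+1[%classic t -> P t}.
  apply: ae_forall_ord => j; have [N [mN N0 sN]] := hP j (ltn_ord j); exists N; split => //.
  by move=> t /= h; apply: sN => /= h'; apply: h => _; exact: h'.
apply: (ae_mono _ (ae_and neq all)) => t.
rewrite /= in_itv/= => tI [ht hall].
have ht' i : (i <= K)%N -> t != s i by move=> iK; exact: (ht (Ordinal (iK : (i < K.+1)%N))).
have [i iK ti] := partition_find tI ht'.
by apply: (hall (Ordinal iK)); rewrite /= in_itv.
Qed.

Lemma ae_sub_itv a b c d' (P : R -> Prop) : c <= a -> b <= d' ->
  {ae mu, forall t, `]c, d'[%classic t -> P t} -> {ae mu, forall t, `]a, b[%classic t -> P t}.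
Proof. by move=> ca bd; apply: ae_sub; exact: itv_oo_sub. Qed.

Lemma aeint_pieces F : (forall j, (j < K)%N -> aeint mu `]s j, s j.+1[ F) ->
  aeint mu `]s 0%N, s K[ F.
Proof.
move=> hF; have mI := measurable_ioo (s 0%N) (s K).
have sub j : (j < K)%N -> `]s j, s j.+1[%classic `<=` (`]s 0%N, s K[%classic : set R).
  by move=> jK; apply: itv_oo_sub; apply: (partition_le hs) => //; exact: ltnW.
apply: (@aeint_congr _ _ _ mu _ (fun t => \sum_(j < K) \1_(`]s j, s j.+1[%classic) t * F t)).
  apply: ae_pieces => j jK; apply: aeW => t; rewrite /= in_itv/= => tj.
  exact: (step_in hs (fun=> F t : R^o) jK tj).
by apply: aeint_sum => // j _; apply: (aeint_indic mI (measurable_ioo _ _)); [exact: sub|exact: hF].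
Qed.

Lemma time_int_pieces F : (forall j, (j < K)%N -> aeint mu `]s j, s j.+1[ F) ->
  time_int (s 0%N) (s K) F = \sum_(j < K) time_int (s j) (s j.+1) F.
Proof. by move=> hF; apply: (time_int_partition hs); exact: aeint_pieces. Qed.

Lemma time_int_congr a b F G : (forall t, a < t < b -> F t = G t) ->
  time_int a b F = time_int a b G.
Proof. by move=> h; apply: eq_Rintegral => t; rewrite inE/= in_itv/= => /h. Qed.

Lemma aeint_congr_itv a b F G : (forall t, a < t < b -> F t = G t) ->
  aeint mu `]a, b[ F -> aeint mu `]a, b[ G.
Proof. by move=> h; apply: aeint_congr; apply: aeW => t; rewrite /= in_itv/= => /h. Qed.

End piecewise_integrals.

Section piecewise_curves.
Context (R : realType) (d : nat).
Notation fct := ('rV[R]_d -> R).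
Notation mu := (@lebesgue_measure R).
Variable Omega : set 'rV[R]_d.
Hypothesis oO : open Omega.
Hypothesis bO : bounded_set Omega.
Hypothesis d0 : (0 < d)%N.
Notation L2 := (L2 Omega).
Notation H10 := (H10 Omega).
Notation Hm1 := (Hm1 Omega).
Notation ip := (ip Omega).
Notation nrm := (nrm Omega).
Notation gip := (gip Omega).
Notation gnrm := (gnrm Omega).
Notation dual_nrm := (dual_nrm Omega).
Notation eqae := (eqae Omega).
Implicit Types (u : R -> fct) (g : R -> fct -> R) (z : fct) (p : {poly R}).

Let iS := ip_semi_inner oO.
Let nS := nrm_seminormed oO.
Let gS := gnrm_seminormed oO bO.
Let dS := dual_nrm_seminormed oO bO.
Let sL := L2_subspace oO.
Let sH := H10_subspace oO bO.

Lemma Hm1_eqae (g : fct -> R) v w : Hm1 g -> H10 v -> H10 w -> eqae v w -> g v = g w.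
Proof.
move=> hg hv hw vw; apply/eqP; rewrite -subr_eq0 -(Hm1B oO bO hg hv hw) -normr_le0.
apply: le_trans (dual_nrmP oO bO hg (ssB sH hv hw)) _.
have e : eqae (v - w) 0.
  by rewrite -(subrr w); apply: eqaeB => //; exact: eqae_refl.
by rewrite (gnrm_eqae oO e) (sn0 gS) mulr0.
Qed.

Lemma ip_in_Hm1 w : L2 w -> Hm1 (ip w).
Proof. by move=> Lw; have [C _ hC] := ip_Hm1 oO bO d0; have [] := hC w Lw. Qed.

(** A curve [sum_k P_k w_k] inherits the product rule against a function with
    a weak time derivative from the scalar product rule for each [P_k]. *)
Lemma curve_cross a b u g m (P : nat -> {poly R}) (w : nat -> fct) :
  (forall k, (k < m)%N -> H10 (w k)) ->
  {ae mu, forall t, `]a, b[%classic t -> L2 (u t) /\ Hm1 (g t)} -> L2 (u a) -> L2 (u b) ->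
  (forall k, (k < m)%N ->
    aeint mu `]a, b[ (fun t => (P k)^`().[t] * ip (u t) (w k) + (P k).[t] * g t (w k)) /\
    time_int a b (fun t => (P k)^`().[t] * ip (u t) (w k) + (P k).[t] * g t (w k)) =
      (P k).[b] * ip (u b) (w k) - (P k).[a] * ip (u a) (w k)) ->
  aeint mu `]a, b[ (fun t => ip (dcurve m P w t) (u t) + g t (curve m P w t)) /\
  time_int a b (fun t => ip (dcurve m P w t) (u t) + g t (curve m P w t)) =
    ip (u b) (curve m P w b) - ip (u a) (curve m P w a).
Proof.
move=> hw hug La Lb hk; have mI := measurable_ioo a b.
have Lw k : (k < m)%N -> L2 (w k) by move=> km; exact: H10_L2 (hw k km).
pose G t := \sum_(k < m) ((P k)^`().[t] * ip (u t) (w k) + (P k).[t] * g t (w k)).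
have FG : ae_eq mu `]a, b[%classic G (fun t => ip (dcurve m P w t) (u t) + g t (curve m P w t)).
  apply: (ae_mono _ hug) => t _ [Lu hg]; rewrite /G big_split/=; congr (_ + _).
    rewrite /dcurve /curve (si_suml iS)//; last by move=> k _; apply: ssZ => //; exact: Lw.
    apply: eq_bigr => k _; rewrite (siZl iS)//; last exact: Lw.
    by rewrite (siC iS)//; exact: Lw.
  rewrite /curve (Hm1_sum oO bO _ hg); last by move=> k _; apply: (ssZ _ sH); exact: hw.
  by apply: eq_bigr => k _; rewrite (Hm1Z oO bO _ hg)//; exact: hw.
have iG : aeint mu `]a, b[ G by apply: aeint_sum => // k _; exact: (hk k (ltn_ord k)).1.
split; first exact: aeint_congr FG iG.
rewrite /time_int -(Rintegral_ae_congr mI FG) /G Rint_sum//; last first.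
  by move=> k _; exact: (hk k (ltn_ord k)).1.
have E t v : L2 v -> ip v (curve m P w t) = \sum_(k < m) (P k).[t] * ip v (w k).
  move=> Lv; rewrite (siC iS)//; last exact: curve_mem.
  rewrite /curve (si_suml iS)//; last by move=> k _; apply: ssZ => //; exact: Lw.
  apply: eq_bigr => k _; rewrite (siZl iS)//; last exact: Lw.
  by rewrite (siC iS)//; exact: Lw.
by rewrite !E// -sumrB; apply: eq_bigr => k _; exact: (hk k (ltn_ord k)).2.
Qed.

Lemma weak_dt_by_parts_aeint T u g z p a b : 0 <= a -> a < b -> b <= T ->
  L2_continuous Omega T u -> is_weak_dt Omega T u g -> H10 z ->
  aeint mu `]a, b[ (fun t => p^`().[t] * ip (u t) z + p.[t] * g t z).
Proof.
move=> a0 ab bT cu [bg _] hz; have mJ := measurable_ioo a b.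
apply: aeintD => //.
  apply: within_continuous_aeint; apply: within_continuousMl; first exact: continuous_poly.
  exact: (ip_within_continuous oO a0 bT cu (H10_L2 hz)).
have [C C0 hC] := poly_bounded a b p.
apply: (aeint_mul_bounded mJ (K := C)).
- by apply: aemeas_aeint; exact: aeint_poly.
- by move=> t; rewrite /= in_itv/= => /andP[h1 h2]; apply: hC; rewrite !ltW.
- apply: (aeint_subset (measurable_ioo 0 T)); [exact: mJ|exact: itv_oo_sub|].
  exact: (dual_ev_aeint oO bO bg hz).
Qed.

Variables (T : R) (s : nat -> R) (K : nat).
Hypothesis hs : forall i, (i < K)%N -> s i < s i.+1.
Hypothesis s0 : s 0%N = 0.
Hypothesis sT : s K = T.
Variables (y : R -> fct) (m : nat -> nat) (P : nat -> nat -> {poly R}) (w : nat -> nat -> fct).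
Hypothesis hw : forall j k, (j < K)%N -> (k < m j)%N -> H10 (w j k).
Hypothesis Ly : forall t, 0 <= t <= T -> L2 (y t).
Hypothesis hy : forall j t, (j < K)%N -> s j <= t <= s j.+1 ->
  eqae (y t) (curve (m j) (P j) (w j) t).

Let Lw j k : (j < K)%N -> (k < m j)%N -> L2 (w j k).
Proof. by move=> jK km; exact: H10_L2 (hw jK km). Qed.

Let sub j : (j < K)%N -> 0 <= s j /\ s j.+1 <= T.
Proof.
by move=> jK; rewrite -s0 -sT; split; apply: (partition_le hs) => //; exact: ltnW.
Qed.

Let inT j t : (j < K)%N -> s j <= t <= s j.+1 -> 0 <= t <= T.
Proof.
move=> jK /andP[h1 h2]; have [h3 h4] := sub jK.
by rewrite (le_trans h3 h1) (le_trans h2 h4).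
Qed.

(** The derivative on each open piece, embedded into H^-1 through the inner
    product. *)
Definition pwdt (t : R) : fct -> R :=
  step s K (fun j => dcurve (m j) (P j) (fun k => ip (w j k)) t) t.

Lemma pwdt_in j t z : (j < K)%N -> s j < t < s j.+1 -> L2 z ->
  pwdt t z = ip (dcurve (m j) (P j) (w j) t) z.
Proof.
move=> jK tj Lz; rewrite /pwdt (step_in hs _ jK tj) /dcurve /curve fct_sumE.
rewrite (si_suml iS)//; last by move=> k _; apply: ssZ => //; exact: Lw.
by apply: eq_bigr => k _; rewrite (siZl iS)//; exact: Lw.
Qed.

Lemma pwdt_bochner2 : bochner2 Hm1 dual_nrm 0 T pwdt.
Proof.
apply: (bochner2_sum dS) => j _; apply: (bochner2_indic dS); first exact: measurable_ioo.
apply: (bochner2_sum dS) => k _.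
have [C C0 hC] := poly_bounded 0 T (P j k)^`().
apply: (bochner2_cst dS (K := C)).
- apply: continuous_measurable_fun; exact: continuous_poly.
- by move=> t /andP[h1 h2]; apply: hC; rewrite !ltW.
- by apply: ip_in_Hm1; exact: Lw.
Qed.

Let Pz j z := curve_pairing ip (m j) (P j) (w j) z.

Lemma pw_pairing j t z : (j < K)%N -> s j <= t <= s j.+1 -> L2 z -> ip (y t) z = (Pz j z).[t].
Proof.
move=> jK tj Lz; rewrite (ip_eqae oO (hy jK tj) (eqae_refl Omega z)).
by apply: curve_pairingE iS _ Lz => k; exact: Lw.
Qed.

Lemma pwdt_pairing j t z : (j < K)%N -> s j < t < s j.+1 -> L2 z ->
  pwdt t z = (Pz j z)^`().[t].
Proof.
move=> jK tj Lz; rewrite (pwdt_in jK tj Lz) /dcurve.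
rewrite (@curve_pairingE _ _ _ _ _ _ _ _ _ iS)//; last by move=> k; exact: Lw.
by rewrite curve_pairing_deriv.
Qed.

(** Integration by parts on each piece; the boundary terms telescope since [y]
    is continuous at the nodes. *)
Lemma pwdt_is_weak_dt : is_weak_dt Omega T y pwdt.
Proof.
split; first exact: pwdt_bochner2.
move=> psi z [dpsi cpsi supp] /H10_L2 Lz.
have d0' t : is_derive t (1 : R) psi (derive1 psi t).
  by split; [exact: (dpsi 0%N)|rewrite derive1E].
have d1 t : derivable (derive1 psi) t 1 by exact: (dpsi 1%N).
have c0 : continuous psi by move=> t; apply: differentiable_continuous; apply/derivable1_diffP; case: (d0' t).
have c1 : continuous (derive1 psi).
  by move=> t; apply: differentiable_continuous; apply/derivable1_diffP.
have out t : ~ (0 < t < T) -> psi t = 0.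
  move=> h; apply/eqP; apply: contraT => nz; exfalso; apply: h.
  by have := supp t (subset_closure (nz : [set t | psi t != 0] t)); rewrite /= in_itv.
have cpoly p := @continuous_poly R p.
have cM (F G : R -> R) : continuous F -> continuous G -> continuous (fun t => F t * G t).
  by move=> cF cG t; apply: cvgM; [exact: cF|exact: cG].
have a1 j : (j < K)%N -> aeint mu `]s j, s j.+1[ (fun t => derive1 psi t * ip (y t) z).
  move=> jK; apply: (@aeint_congr_itv _ _ _ (fun t => derive1 psi t * (Pz j z).[t])).
    by move=> t /andP[h1 h2]; rewrite (@pw_pairing j)// !ltW.
  by apply: continuous_aeint; exact: cM.
have a2 j : (j < K)%N -> aeint mu `]s j, s j.+1[ (fun t => psi t * pwdt t z).
  move=> jK; apply: (@aeint_congr_itv _ _ _ (fun t => psi t * (Pz j z)^`().[t])).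
    by move=> t tj; rewrite (pwdt_pairing jK tj).
  by apply: continuous_aeint; exact: cM.
have E F : (forall j, (j < K)%N -> aeint mu `]s j, s j.+1[ F) ->
    time_int 0 T F = \sum_(j < K) time_int (s j) (s j.+1) F.
  by move=> /(time_int_pieces hs); rewrite s0 sT.
apply/eqP; rewrite -addr_eq0 (E _ a1) (E _ a2) -big_split/=.
rewrite (eq_bigr (fun j : 'I_K => psi (s j.+1) * ip (y (s j.+1)) z - psi (s j) * ip (y (s j)) z)).
  rewrite -(big_mkord xpredT (fun j => psi (s j.+1) * ip (y (s j.+1)) z - psi (s j) * ip (y (s j)) z)).
  rewrite (telescope_sumr (fun j => psi (s j) * ip (y (s j)) z) (leq0n K)) s0 sT.
  by rewrite (out 0) ?ltxx// (out T) ?ltxx ?andbF// !mul0r subrr.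
move=> j _; have jK := ltn_ord j; have mJ := measurable_ioo (s j) (s j.+1).
rewrite /time_int -(RintD mJ (a1 _ jK) (a2 _ jK)) -/(time_int _ _ _).
have lej := ltW (hs jK).
rewrite (pw_pairing jK (t := s j.+1)) ?lexx ?lej// (pw_pairing jK (t := s j)) ?lexx ?lej//.
have dF t : is_derive t (1 : R) (fun t => psi t * (Pz j z).[t])
    (derive1 psi t * (Pz j z).[t] + psi t * (Pz j z)^`().[t]).
  have [h1 e1] := d0' t; have [h2 e2] := is_derive_horner (Pz j z) t.
  split; first exact: derivableM.
  by rewrite (deriveM h1 h2) e1 e2 addrC; congr (_ + _); exact: mulrC.
have cF : continuous (fun t => derive1 psi t * (Pz j z).[t] + psi t * (Pz j z)^`().[t]).
  by move=> t; apply: cvgD; apply: cM.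
transitivity (time_int (s j) (s j.+1)
  (fun t => derive1 psi t * (Pz j z).[t] + psi t * (Pz j z)^`().[t])).
  apply: time_int_congr => t tj; rewrite (pwdt_pairing jK tj)// (@pw_pairing j)//.
  by have /andP[h1 h2] := tj; rewrite !ltW.
exact: (time_int_FTC lej dF cF).
Qed.

Lemma pw_H10 t : 0 <= t <= T -> (exists2 j, (j < K)%N & s j <= t <= s j.+1) -> H10 (y t).
Proof.
move=> tT [j jK tj]; apply: (H10_eqae oO (Ly tT) (eqae_sym (hy jK tj))).
by apply: curve_mem => // k; exact: hw.
Qed.

Let piece j t : (j < K)%N -> s j < t < s j.+1 -> H10 (y t) /\ H10 (curve (m j) (P j) (w j) t).
Proof.
move=> jK /andP[h1 h2]; have tj : s j <= t <= s j.+1 by rewrite !ltW.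
split; first by apply: pw_H10; [exact: inT tj|exists j].
by apply: curve_mem => // k; exact: hw.
Qed.

Let global_cross u g : 
  {ae mu, forall t, `]0, T[%classic t -> L2 (u t) /\ Hm1 (g t)} ->
  (forall t, 0 <= t <= T -> L2 (u t)) ->
  (forall j, (j < K)%N -> aeint mu `]s j, s j.+1[
     (fun t => ip (dcurve (m j) (P j) (w j) t) (u t) + g t (curve (m j) (P j) (w j) t)) /\
   time_int (s j) (s j.+1)
     (fun t => ip (dcurve (m j) (P j) (w j) t) (u t) + g t (curve (m j) (P j) (w j) t)) =
   ip (u (s j.+1)) (curve (m j) (P j) (w j) (s j.+1)) - ip (u (s j)) (curve (m j) (P j) (w j) (s j))) ->
  time_int 0 T (fun t => pwdt t (u t) + g t (y t)) = ip (u T) (y T) - ip (u 0) (y 0).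
Proof.
move=> hug Lu hj.
have FG j : (j < K)%N -> ae_eq mu `]s j, s j.+1[%classic
    (fun t => ip (dcurve (m j) (P j) (w j) t) (u t) + g t (curve (m j) (P j) (w j) t))
    (fun t => pwdt t (u t) + g t (y t)).
  move=> jK; have [h1 h2] := sub jK.
  apply: (ae_mono _ (ae_sub_itv h1 h2 hug)) => t; rewrite /= in_itv/= => tj [Lut hg].
  have [hyt hct] := piece jK tj; rewrite (pwdt_in jK tj Lut); congr (_ + _).
  apply: Hm1_eqae => //; apply: eqae_sym; apply: (hy jK).
  by have /andP[? ?] := tj; rewrite !ltW.
have ia j : (j < K)%N -> aeint mu `]s j, s j.+1[ (fun t => pwdt t (u t) + g t (y t)).
  by move=> jK; apply: aeint_congr (FG j jK) (hj j jK).1.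
rewrite -[in LHS]s0 -[in LHS]sT (time_int_pieces hs ia).
rewrite (eq_bigr (fun j : 'I_K => ip (u (s j.+1)) (y (s j.+1)) - ip (u (s j)) (y (s j)))).
  rewrite -(big_mkord xpredT (fun j => ip (u (s j.+1)) (y (s j.+1)) - ip (u (s j)) (y (s j)))).
  by rewrite telescope_sumr// s0 sT.
move=> j _; have jK := ltn_ord j; have lej := ltW (hs jK).
rewrite /time_int -(Rintegral_ae_congr (measurable_ioo _ _) (FG j jK)) -/(time_int _ _ _) (hj j jK).2.
have e1 : s j <= s j.+1 <= s j.+1 by rewrite lexx lej.
have e2 : s j <= s j <= s j.+1 by rewrite lexx lej.
by congr (_ - _); apply: (ip_eqae oO (eqae_refl _ _)); apply: eqae_sym; exact: (hy jK).
Qed.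

(** [curve_cross] on each piece; the boundary terms telescope. *)
Lemma pw_cross u g : L2_continuous Omega T u -> is_weak_dt Omega T u g ->
  time_int 0 T (fun t => pwdt t (u t) + g t (y t)) = ip (u T) (y T) - ip (u 0) (y 0).
Proof.
move=> cu ug; have [bg _] := ug.
have Lu t : 0 <= t <= T -> L2 (u t) by move=> tT; exact: (cu t tT).1.
have hug : {ae mu, forall t, `]0, T[%classic t -> L2 (u t) /\ Hm1 (g t)}.
  apply: (ae_mono _ (bochner2_mem bg)) => t; rewrite /= in_itv/= => /andP[h1 h2] hg.
  by split => //; apply: Lu; rewrite !ltW.
apply: global_cross => // j jK; have [a0 bT] := sub jK; have lej := ltW (hs jK).
apply: curve_cross.
- by move=> k; exact: hw.
- exact: ae_sub_itv a0 bT hug.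
- by apply: Lu; apply: (inT jK); rewrite lexx lej.
- by apply: Lu; apply: (inT jK); rewrite lexx lej.
- move=> k km; split; first exact: (weak_dt_by_parts_aeint _ a0 (hs jK) bT cu ug (hw jK km)).
  exact: (weak_dt_by_parts oO bO _ a0 (hs jK) bT cu ug (hw jK km)).
Qed.

Lemma pw_self_cross : time_int 0 T (fun t => pwdt t (y t) + pwdt t (y t)) =
  nrm (y T) ^+ 2 - nrm (y 0) ^+ 2.
Proof.
have T0 : 0 <= T by rewrite -s0 -sT; exact: (partition_le hs).
rewrite !(nrm_sqr oO); try (by apply: Ly; rewrite lexx T0).
have hug : {ae mu, forall t, `]0, T[%classic t -> L2 (y t) /\ Hm1 (pwdt t)}.
  apply: (ae_mono _ (bochner2_mem pwdt_bochner2)) => t; rewrite /= in_itv/= => /andP[h1 h2] hg.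
  by split => //; apply: Ly; rewrite !ltW.
apply: global_cross => // j jK; have [a0 bT] := sub jK; have lej := ltW (hs jK).
apply: curve_cross.
- by move=> k; exact: hw.
- exact: ae_sub_itv a0 bT hug.
- by apply: Ly; apply: (inT jK); rewrite lexx lej.
- by apply: Ly; apply: (inT jK); rewrite lexx lej.
- move=> k km; have Lk := Lw jK km; pose p := P j k * Pz j (w j k).
  have E t : s j < t < s j.+1 -> p^`().[t] =
      (P j k)^`().[t] * ip (y t) (w j k) + (P j k).[t] * pwdt t (w j k).
    move=> tj; rewrite (pwdt_pairing jK tj)// (@pw_pairing j)//.
      by rewrite /p derivM hornerD !hornerM.
    by have /andP[h1 h2] := tj; rewrite !ltW.
  split; first exact: (aeint_congr_itv E) (aeint_poly _ _ _).
  rewrite -(time_int_congr E) time_int_deriv// /p !hornerM.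
  by rewrite (pw_pairing jK (t := s j.+1)) ?lexx ?lej// (pw_pairing jK (t := s j)) ?lexx ?lej.
Qed.

End piecewise_curves.

(** * The reconstruction *)

Lemma products_le_squares (R : realFieldType) (x y z s : R) :
  x * s + y * s + z * s <= x ^+ 2 + y ^+ 2 + z ^+ 2 + s ^+ 2.
Proof.
rewrite -subr_ge0 (_ : _ - _ = (x - s / 2) ^+ 2 + (y - s / 2) ^+ 2 + (z - s / 2) ^+ 2 + (s / 2) ^+ 2).
  by rewrite !addr_ge0 ?sqr_ge0.
by field.
Qed.

Lemma sqr_le_of_mul (R : realFieldType) (x r : R) :
  x ^+ 2 <= 2 * (r * x) -> x ^+ 2 <= 4 * r ^+ 2.
Proof.
have := sqr_ge0 (x - 2 * r).
rewrite (_ : (x - 2 * r) ^+ 2 = x ^+ 2 - 4 * (r * x) + 4 * r ^+ 2); last by ring.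
move: (x ^+ 2) (r * x) (r ^+ 2) => a b e *; lra.
Qed.

Lemma scheme_cancellation (R : realFieldType) (s A a g x : R) : s * s = 1 ->
  A - (- s * s) * a - A - a * (- s * - s) - g * (- s * (s / 2 * x)) = g * x / 2.
Proof.
move=> s2; rewrite [LHS](_ : _ = s * s * (g * x / 2)); last by field.
by rewrite s2 mul1r.
Qed.

Lemma sign_cancellation (R : realFieldType) (s x : R) : s * s = 1 ->
  s * - (s / 2 * x) = - x / 2.
Proof.
move=> s2; rewrite [LHS](_ : _ = s * s * (- x / 2)); last by field.
by rewrite s2 mul1r.
Qed.

(** The discrete part [g] is multiplied by [(k + 1) / (2k + 3) <= 1] times the
    factor of the hypothesis. *)
Lemma coarsening_ratio (R : realFieldType) (t G e g r : R) (k : nat) :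
  0 <= t -> 0 <= g -> G = e + g -> t / (2 * k + 1)%:R * g <= 4 * r ^+ 2 ->
  t * k.+1%:R / ((2 * k + 1)%N%:R * (2 * k + 3)%N%:R) * G <=
  8 * r ^+ 2 + t * k.+1%:R / ((2 * k + 1)%N%:R * (2 * k + 3)%N%:R) * e.
Proof.
move=> t0 g0 ->; rewrite -(natr1 k) (natrD _ (2 * k) 1) (natrD _ (2 * k) 3) (natrM _ 2 k); have k0 : (0 : R) <= k%:R := ler0n _ _.
move: (k%:R : R) k0 => x x0 h; rewrite mulrDr addrC lerD2r.
have -> : t * (x + 1) / ((2 * x + 1) * (2 * x + 3)) * g =
    (t / (2 * x + 1) * g) * ((x + 1) / (2 * x + 3)).
  by field; rewrite !lt0r_neq0//; lra.
have r0 := sqr_ge0 r.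
apply: le_trans (_ : 4 * r ^+ 2 * 1 <= _); last by rewrite mulr1 ler_wpM2r// ler_nat.
apply: ler_pM => //.
- by rewrite !mulr_ge0// invr_ge0; lra.
- by rewrite divr_ge0//; lra.
- by rewrite ler_pdivrMr; lra.
Qed.

Lemma young_product (R : realFieldType) (x y : R) : 2 * (x * y) <= 4 * x ^+ 2 + y ^+ 2 / 4.
Proof.
rewrite -subr_ge0 (_ : _ - _ = (2 * x - y / 2) ^+ 2) ?sqr_ge0//.
by field.
Qed.

(** Young's inequality absorbs a quarter of [x ^+ 2] for each of the two
    products; the remaining half doubles the constants. *)
Lemma oscillation_absorb (R : realFieldType) (x r o e : R) :
  x ^+ 2 <= 2 * (r * x) + e -> e <= 4 * o + x ^+ 2 / 4 -> x ^+ 2 <= 8 * r ^+ 2 + 8 * o.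
Proof.
have := young_product r x; move: (x ^+ 2) (r * x) (r ^+ 2) => a b g *; lra.
Qed.

(** The factor of the conclusion is [(k + 1) / (2k + 1) <= 1] times that of
    the hypothesis. *)
Lemma oscillation_ratio (R : realFieldType) (t G B : R) (k : nat) :
  0 <= t -> 0 <= G -> t / (2 * k.+1 + 1)%:R * G <= B ->
  t * k.+1%:R / ((2 * k + 1)%N%:R * (2 * k + 3)%N%:R) * G <= B.
Proof.
move=> t0 G0; apply: le_trans.
rewrite (_ : (2 * k.+1 + 1)%N = (2 * k + 3)%N); last by lia.
rewrite -(natr1 k) (natrD _ (2 * k) 1) (natrD _ (2 * k) 3) (natrM _ 2 k).
have k0 : (0 : R) <= k%:R := ler0n _ _; move: (k%:R : R) k0 => x x0.
have -> : t * (x + 1) / ((2 * x + 1) * (2 * x + 3)) * G =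
    (t / (2 * x + 3) * G) * ((x + 1) / (2 * x + 1)).
  by field; rewrite !lt0r_neq0//; lra.
rewrite -[leRHS]mulr1; apply: ler_wpM2l.
- by rewrite !mulr_ge0// invr_ge0; lra.
- by rewrite ler_pdivrMr; lra.
Qed.

Section reconstruction_formula.
Context (R : realType) (d : nat).
Notation fct := ('rV[R]_d -> R).
Variables (Omega : set 'rV[R]_d) (T : R) (N : nat) (ts : nat -> R) (q : nat -> nat).
Hypothesis hts : time_partition T N ts.
Implicit Types (v : R -> fct) (j : nat).
Notation rec := (reconstruction Omega N ts q).

Lemma partition_lt j : (j < N)%N -> ts j < ts j.+1.
Proof. by case: hts => _ _; apply. Qed.

Lemma partition_nodes j t : (j < N)%N -> ts j <= t <= ts j.+1 -> 0 <= t <= T.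
Proof.
move=> jN /andP[h1 h2]; have [e0 eT _] := hts.
rewrite -e0 -eT (le_trans (partition_le partition_lt (leq0n j) (ltnW jN)))//=.
by rewrite (le_trans h2)//; apply: (partition_le partition_lt).
Qed.

Definition correction j : {poly R} :=
  ((-1) ^+ q j.+1 / 2) *: (legendreP ts j.+1 (q j.+1) - legendreP ts j.+1 (q j.+1).+1).

Lemma correctionE j t : (j < N)%N -> (correction j).[t] = (-1) ^+ q j.+1 / 2 *
  (legendreI ts j.+1 (q j.+1) t - legendreI ts j.+1 (q j.+1).+1 t).
Proof.
by move=> jN; rewrite hornerZ hornerD hornerN !horner_legendreP//; exact: partition_lt.
Qed.

Lemma correction_right j : (j < N)%N -> (correction j).[ts j.+1] = 0.
Proof.
move=> jN; rewrite correctionE// !legendreI_right ?subrr ?mulr0//; exact: partition_lt.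
Qed.

Lemma correction_left j : (j < N)%N -> (correction j).[ts j] = 1.
Proof.
move=> jN; have lt := partition_lt jN.
rewrite correctionE// (@legendreI_left _ ts j.+1 lt) (@legendreI_left _ ts j.+1 lt).
have E : ((-1) ^+ q j.+1 * (-1) ^+ q j.+1 : R) = 1 by rewrite -expr2 sqrr_sign.
by rewrite exprS; move: E; set s := (-1) ^+ _ => E; field: E.
Qed.

Lemma reconstructionE v t : rec v t = v t +
  \sum_(j < N) ((\1_(`]ts j, ts j.+1]%classic) t : R) * (correction j).[t]) *: jump Omega ts v j.
Proof.
rewrite /reconstruction (big_addn 0 N.+1 1)/= subn1/= big_mkord; congr (_ + _).
apply: eq_bigr => j _; rewrite addn1; congr (_ *: _).
by rewrite (correctionE _ (ltn_ord j)) -mulrA.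
Qed.

Lemma reconstruction_in v j t : (j < N)%N -> ts j < t <= ts j.+1 ->
  rec v t = v t + (correction j).[t] *: jump Omega ts v j.
Proof.
move=> jN tj; rewrite reconstructionE; congr (_ + _); rewrite (bigD1 (Ordinal jN))//=.
rewrite indicE mem_set ?mul1r; last by rewrite /= in_itv.
rewrite big1 ?addr0// => i ij; rewrite indicE memNset ?mul0r ?scale0r//=.
rewrite in_itv/= => ti; have iN := ltn_ord i.
have [/andP[h1 h2] /andP[h3 h4]] := (tj, ti).
case: (ltngtP i j) => h.
- have := partition_le partition_lt h (ltnW jN); lra.
- have := partition_le partition_lt h (ltnW iN); lra.
- by move/eqP: ij; apply; apply: val_inj.
Qed.

Lemma reconstruction0 v : rec v 0 = v 0.
Proof.
rewrite reconstructionE big1 ?addr0// => i _; have [e0 _ _] := hts.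
rewrite indicE memNset ?mul0r ?scale0r//= in_itv/= => /andP[h _].
have : 0 <= ts i by rewrite -e0; apply: (partition_le partition_lt) => //; exact: ltnW.
by rewrite leNgt h.
Qed.

(** The correction vanishes at the right end point of its interval. *)
Lemma reconstruction_node v j : (j <= N)%N -> rec v (ts j) = v (ts j).
Proof.
case: j => [_|j jN]; first by have [-> _ _] := hts; exact: reconstruction0.
rewrite (@reconstruction_in v j)// ?lexx ?partition_lt//.
by rewrite correction_right// scale0r addr0.
Qed.
End reconstruction_formula.

Section discrete_functions.
Context (R : realType) (d : nat).
Notation fct := ('rV[R]_d -> R).
Notation mu := (@lebesgue_measure R).
Variable Omega : set 'rV[R]_d.
Hypothesis oO : open Omega.
Hypothesis bO : bounded_set Omega.
Hypothesis d0 : (0 < d)%N.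
Notation L2 := (L2 Omega).
Notation H10 := (H10 Omega).
Notation Hm1 := (Hm1 Omega).
Notation ip := (ip Omega).
Notation nrm := (nrm Omega).
Notation gip := (gip Omega).
Notation gnrm := (gnrm Omega).
Notation dual_nrm := (dual_nrm Omega).
Notation eqae := (eqae Omega).
Variables (T : R) (N : nat) (ts : nat -> R) (q : nat -> nat) (M : nat -> mesh R d).
Hypothesis T0 : 0 < T.
Hypothesis hts : time_partition T N ts.
Let Vh n := Vh Omega (M n).
Let lt j (jN : (j < N)%N) : ts j < ts j.+1 := partition_lt hts jN.
Let iS := ip_semi_inner oO.
Let nS := nrm_seminormed oO.
Let gI := gip_semi_inner oO bO.
Let gS := gnrm_seminormed oO bO.
Let dS := dual_nrm_seminormed oO bO.
Let sL := L2_subspace oO.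
Let sH := H10_subspace oO bO.

Definition monomials (k : nat) : {poly R} := 'X^k.

Lemma Qspace_curve n a b (V : set fct) v : Qspace Omega n a b V v ->
  exists c : nat -> fct, (forall k, (k < n.+1)%N -> V (c k)) /\
    forall t, a < t < b -> V (v t) /\ eqae (v t) (curve n.+1 monomials c t).
Proof.
move=> [c [Vc hc]]; exists (fun k => c (inord k)); split; first by move=> k _; exact: Vc.
move=> t tI; have [h1 h2] := hc t tI; split => //.
rewrite (_ : curve _ _ _ _ = \sum_(k < n.+1) t ^+ k *: c k) // /curve.
by apply: eq_bigr => k _; rewrite inord_val /monomials hornerXn.
Qed.

Lemma Vht_curves uh : Vht Omega T N ts q M uh -> exists c : nat -> nat -> fct,
  forall j, (j < N)%N -> (forall k, (k < (q j.+1).+1)%N -> Vh j.+1 (c j k)) /\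
    forall t, ts j < t < ts j.+1 ->
      Vh j.+1 (uh t) /\ eqae (uh t) (curve (q j.+1).+1 monomials (c j) t).
Proof.
move=> [_ hQ _ _].
have : forall j, exists c : nat -> fct, (j < N)%N ->
   (forall k, (k < (q j.+1).+1)%N -> Vh j.+1 (c k)) /\
    forall t, ts j < t < ts j.+1 ->
      Vh j.+1 (uh t) /\ eqae (uh t) (curve (q j.+1).+1 monomials c t).
  move=> j; case: (ltnP j N) => jN; last by exists (fun=> 0).
  by have [c hc] := Qspace_curve (hQ j.+1 jN); exists c.
by move=> /choice[c hc]; exists c => j; exact: hc.
Qed.

Variable uh : R -> fct.
Hypothesis huh : Vht Omega T N ts q M uh.
Variable c : nat -> nat -> fct.
Hypothesis hc : forall j, (j < N)%N -> (forall k, (k < (q j.+1).+1)%N -> Vh j.+1 (c j k)) /\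
    forall t, ts j < t < ts j.+1 ->
      Vh j.+1 (uh t) /\ eqae (uh t) (curve (q j.+1).+1 monomials (c j) t).
Notation piece j := (curve (q j.+1).+1 monomials (c j)).
Notation up j := (right_limit Omega uh (ts j)).
Notation J j := (jump Omega ts uh j).

Let VL n v : Vh n v -> L2 v. Proof. by move=> /Vh_H10 /H10_L2. Qed.
Let sV n : subspace_set (Vh n). Proof. exact: Vh_subspace. Qed.
Let hcL j (jN : (j < N)%N) t : ts j < t < ts j.+1 -> L2 (uh t) /\ eqae (uh t) (piece j t).
Proof. by move=> /((hc jN).2 t)[/VL]. Qed.

Let Vpiece j t (jN : (j < N)%N) : Vh j.+1 (piece j t).
Proof. apply: curve_mem; [exact: sV|exact: (hc jN).1]. Qed.

Let Lc j k (jN : (j < N)%N) : (k < (q j.+1).+1)%N -> L2 (c j k).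
Proof. by move=> kq; apply: VL; exact: (hc jN).1. Qed.

Lemma dg_right j : (j < N)%N -> Vh j.+1 (up j) /\ eqae (up j) (piece j (ts j)).
Proof.
move=> jN; have [L e] := right_limit_curve oO (lt jN) (fun k => Lc jN) (hcL jN).
by split => //; apply: (Vh_eqae oO L (eqae_sym e)); exact: Vpiece.
Qed.

Lemma dg_left j : (j < N)%N -> Vh j.+1 (uh (ts j.+1)) /\ eqae (uh (ts j.+1)) (piece j (ts j.+1)).
Proof.
move=> jN; have [_ _ _ /(_ j.+1 jN)[L l]] := huh.
have e := left_limit_curve oO (lt jN) (fun k => Lc jN) (hcL jN) L l.
by split => //; apply: (Vh_eqae oO L (eqae_sym e)); exact: Vpiece.
Qed.

Lemma dg_node_H10 j : (j <= N)%N -> H10 (uh (ts j)).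
Proof.
case: j => [_|j jN]; last by have [/Vh_H10] := dg_left jN.
by have [_ _ /Vh_H10 + _] := huh; have [-> _ _] := hts.
Qed.

Lemma jump_H10 j : (j < N)%N -> H10 (J j).
Proof.
move=> jN; apply: (ssB sH); first exact: dg_node_H10 (ltnW jN).
by have [/Vh_H10] := dg_right jN.
Qed.

(** On each interval the reconstruction is the curve of the discrete function
    with one more term, the correction times the jump. *)
Definition rec_m j := (q j.+1).+2.
Definition rec_P j k : {poly R} := if k == (q j.+1).+1 then correction ts q j else 'X^k.
Definition rec_w j k : fct := if k == (q j.+1).+1 then J j else c j k.

Lemma rec_curve j t : curve (rec_m j) (rec_P j) (rec_w j) t =
  piece j t + (correction ts q j).[t] *: J j.
Proof.
rewrite /rec_m curve_recr /rec_P /rec_w !eqxx; congr (_ + _).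
by rewrite /curve; apply: eq_bigr => k _; rewrite (ltn_eqF (ltn_ord k)).
Qed.

Lemma rec_H10 j k : (j < N)%N -> (k < rec_m j)%N -> H10 (rec_w j k).
Proof.
move=> jN; rewrite /rec_w ltnS leq_eqVlt; case: eqP => [_ _|_ /= kq]; first exact: jump_H10.
by apply: (@Vh_H10 _ _ _ (M j.+1)); exact: (hc jN).1.
Qed.

Notation Iuh := (reconstruction Omega N ts q uh).

(** At the left end point the correction equals one: adding the jump to the
    limit from the right gives back the value from the left. *)
Lemma rec_pieces j t : (j < N)%N -> ts j <= t <= ts j.+1 ->
  eqae (Iuh t) (curve (rec_m j) (rec_P j) (rec_w j) t).
Proof.
move=> jN /andP[]; rewrite le_eqVlt => /orP[/eqP <- _|tj tj'].
  rewrite rec_curve (reconstruction_node _ _ hts)// ?(ltnW jN)// (correction_left _ hts)// scale1r.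
  have [_ e] := dg_right jN.
  rewrite /jump addrC -addrA -[X in eqae X _]addr0; apply: eqaeD; first exact: eqae_refl.
  by rewrite addrC -[X in eqae X _](subrr (up j)); apply: eqaeB => //; exact: eqae_refl.
rewrite rec_curve (reconstruction_in _ _ hts _ jN) ?tj//.
apply: eqaeD; last exact: eqae_refl.
move: tj'; rewrite le_eqVlt => /orP[/eqP ->|tj']; first by have [] := dg_left jN.
by have [] := hcL jN (t := t); rewrite ?tj ?tj'.
Qed.

Lemma rec_L2 t : 0 <= t <= T -> L2 (Iuh t).
Proof.
move=> /andP[t0 tT]; have [e0 eT _] := hts.
have H j : (j <= N)%N -> L2 (Iuh (ts j)).
  by move=> jN; rewrite (reconstruction_node _ _ hts)//; apply: H10_L2; exact: dg_node_H10.
case: (pselect (exists2 i, (i <= N)%N & t = ts i)) => [[i iN ->]|h]; first exact: H.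
have h' i : (i <= N)%N -> t != ts i by move=> iN; apply: contra_notN h => /eqP ->; exists i.
have t0T : ts 0%N < t < ts N.
  by rewrite !lt_neqAle (h' N)// eq_sym h'// e0 eT t0 tT.
have [i iN ti] := partition_find t0T h'.
rewrite (reconstruction_in _ _ hts _ iN); last by have /andP[-> /ltW] := ti.
apply: (ssD sL); first by have [] := hcL iN ti.
by apply: (ssZ _ sL); apply: H10_L2; exact: jump_H10.
Qed.

Lemma rec_Xspace : Xspace Omega T Iuh.
Proof.
have [Xu _ _ _] := huh; rewrite /Xspace (funext (reconstructionE Omega q hts uh)).
apply: (bochner2D gS Xu); apply: (bochner2_sum gS) => i _; have iN := ltn_ord i.
have [C C0 hC] := poly_bounded 0 T (correction ts q i).
apply: (bochner2_cst gS (K := C)); last exact: jump_H10.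
- apply: measurable_funM; first exact: measurable_indic.
  by apply: continuous_measurable_fun; exact: continuous_poly.
- move=> t /andP[h1 h2]; rewrite normrM indicE.
  have h : `|(correction ts q i).[t]| <= C by apply: hC; rewrite !ltW.
  by case: (_ \in _); rewrite ?normr1 ?mul1r ?normr0 ?mul0r.
Qed.

Definition rec_dt := pwdt Omega ts N rec_m rec_P rec_w.

Let ts0 : ts 0%N = 0. Proof. by case: hts. Qed.
Let tsN : ts N = T. Proof. by case: hts. Qed.

Lemma rec_is_weak_dt : is_weak_dt Omega T Iuh rec_dt.
Proof.
exact: (pwdt_is_weak_dt oO bO d0 (partition_lt hts) ts0 tsN rec_H10 rec_pieces).
Qed.

Lemma weak_dt_rec v : Xspace Omega T v ->
  {ae mu, forall t, `]0, T[%classic t -> weak_dt Omega T Iuh t (v t) = rec_dt t (v t)}.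
Proof.
apply: (weak_dt_unique oO bO _ rec_is_weak_dt).
exact: (@xgetPex _ _ [set g | is_weak_dt Omega T Iuh g] (ex_intro _ _ rec_is_weak_dt)).
Qed.

Lemma rec_dtE j t z : (j < N)%N -> ts j < t < ts j.+1 -> L2 z ->
  rec_dt t z = ip (strong_dt Omega uh t) z + (correction ts q j)^`().[t] * ip (J j) z.
Proof.
move=> jN tj Lz; have [Ld e] := strong_dt_curve oO (fun k => Lc jN) (hcL jN) tj.
have LJ : L2 (J j) by apply: H10_L2; exact: jump_H10.
rewrite (ip_eqae oO e (eqae_refl _ z)).
rewrite [LHS](pwdt_in oO (partition_lt hts) _ rec_H10 jN tj Lz).
rewrite /dcurve /rec_m curve_recr /rec_P /rec_w !eqxx.
have Ld' : L2 (curve (q j.+1).+1 (fun k => (monomials k)^`()) (c j) t).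
  by apply: (curve_mem _ _ sL) => k; exact: Lc.
rewrite -(siZl iS)// -(siDl iS)//; last exact: (ssZ _ sL).
congr (ip (_ + _) z); apply: eq_bigr => k _.
by rewrite (ltn_eqF (ltn_ord k)).
Qed.

(** * The residual *)

Variable f : R -> fct.
Hypothesis hf : bochner2 L2 nrm 0 T f.

(** The weak time derivative, which is only determined up to null sets that
    depend on the test function, is replaced by the piecewise one. *)
Definition residual t : fct -> R := fun z => ip (f t) z - rec_dt t z - gip (Iuh t) z.

Let brec : bochner2 Hm1 dual_nrm 0 T rec_dt.
Proof. by case: rec_is_weak_dt. Qed.

Lemma residual_terms v : Xspace Omega T v ->
  [/\ aeint mu `]0, T[ (fun t => ip (f t) (v t)), aeint mu `]0, T[ (fun t => rec_dt t (v t)) &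
      aeint mu `]0, T[ (fun t => gip (Iuh t) (v t))].
Proof.
move=> Xv; have [C hC] := ip_H10_pairing oO bO d0.
split; first exact: (bochner2_pairing nS gS hC hf Xv).
- exact: (bochner2_pairing dS gS (ev_pairing oO bO) brec Xv).
- exact: (bochner2_pairing gS gS (gip_pairing oO bO) rec_Xspace Xv).
Qed.

Lemma residual_aeint v : Xspace Omega T v -> aeint mu `]0, T[ (fun t => residual t (v t)).
Proof.
move=> /residual_terms[h1 h2 h3]; have mI := measurable_ioo 0 T.
by apply: (aeintB mI _ h3); exact: (aeintB mI h1 h2).
Qed.

Lemma residual_Hm1 : {ae mu, forall t, `]0, T[%classic t -> Hm1 (residual t)}.
Proof.
have sM := Hm1_subspace Omega.
apply: (ae_mono _ (ae_and (bochner2_mem hf) (ae_and (bochner2_mem brec) (bochner2_mem rec_Xspace)))).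
move=> t _ [Lf [hd hI]].
apply: (ssB sM); last exact: gip_Hm1.
by apply: (ssB sM); first exact: ip_in_Hm1.
Qed.

(** Bounds the residual norm, a supremum over the unit sphere of [X], by a
    finite number. *)
Lemma residual_majorant : exists2 g : R -> R, aeint mu `]0, T[ g &
  {ae mu, forall t, `]0, T[%classic t -> 0 <= g t /\
     forall z, H10 z -> `|residual t z| <= g t + gnrm z ^+ 2}.
Proof.
have [C C0 hC] := ip_Hm1 oO bO d0; have mI := measurable_ioo 0 T.
have af := bochner2_sqr nS hf; have ad := bochner2_sqr dS brec.
have ai := Xspace_sqr oO bO rec_Xspace.
exists (fun t => C ^+ 2 * nrm (f t) ^+ 2 + dual_nrm (rec_dt t) ^+ 2 + gnrm (Iuh t) ^+ 2).
  by apply: (aeintD mI _ ai); apply: (aeintD mI _ ad); exact: (aeintZ mI _ af).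
apply: (ae_mono _ (ae_and (bochner2_mem hf) (ae_and (bochner2_mem brec) (bochner2_mem rec_Xspace)))).
move=> t _ [Lf [hd hI]]; split.
  by apply: addr_ge0; [apply: addr_ge0|]; rewrite -?exprMn; exact: sqr_ge0.
move=> z Hz; have [hi di] := hC _ Lf.
have b1 := dual_nrmP oO bO hi Hz; have b2 := dual_nrmP oO bO hd Hz.
have b3 := gip_cauchy_schwarz oO bO hI Hz; have g0 := sn_ge0 gS Hz.
have b1' : `|ip (f t) z| <= C * nrm (f t) * gnrm z.
  by apply: (le_trans b1); exact: ler_wpM2r.
apply: le_trans (ler_normB _ _) _.
apply: le_trans (lerD (ler_normB _ _) (lexx _)) _.
apply: le_trans (lerD (lerD b1' b2) b3) _.
by rewrite -exprMn; exact: products_le_squares.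
Qed.

Notation R_ j := (residual_nrm Omega T ts f Iuh j.+1).
Notation Xn v := (Xnrm Omega T v).

Let sub j (jN : (j < N)%N) : 0 <= ts j /\ ts j.+1 <= T.
Proof.
by have lej := ltW (lt jN); split; [have := partition_nodes hts jN (t := ts j)|
  have := partition_nodes hts jN (t := ts j.+1)]; rewrite ?lexx lej => /(_ isT)/andP[].
Qed.

Lemma residualE j v : (j < N)%N -> Xspace Omega T v ->
  intI ts j.+1 (fun t => ip (f t) (v t) - weak_dt Omega T Iuh t (v t) - gip (Iuh t) (v t)) =
  time_int (ts j) (ts j.+1) (fun t => residual t (v t)).
Proof.
move=> jN Xv; have [a0 bT] := sub jN.
apply: (Rintegral_ae_congr (measurable_ioo _ _)).
by apply: (ae_mono _ (ae_sub_itv a0 bT (weak_dt_rec Xv))) => t _ /= ->.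
Qed.

Lemma Xnrm_sqr v : Xn v ^+ 2 = time_int 0 T (fun t => gnrm (v t) ^+ 2).
Proof.
by rewrite sqr_sqrtr//; apply: (Rint_ge0_ae (measurable_ioo _ _)); apply: aeW => t _; exact: sqr_ge0.
Qed.

Lemma residual_nrm_ub : exists B, forall j v, (j < N)%N -> Xspace Omega T v -> Xn v = 1 ->
  intI ts j.+1 (fun t => ip (f t) (v t) - weak_dt Omega T Iuh t (v t) - gip (Iuh t) (v t)) <= B.
Proof.
have [g ag hg] := residual_majorant; have mI := measurable_ioo 0 T.
exists (time_int 0 T g + 1) => j v jN Xv v1; rewrite (residualE jN Xv).
have [a0 bT] := sub jN; have mJ := measurable_ioo (ts j) (ts j.+1).
have agv : aeint mu `]0, T[ (fun t => g t + gnrm (v t) ^+ 2).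
  by apply: (aeintD mI ag); exact: (Xspace_sqr oO bO Xv).
have le : time_int (ts j) (ts j.+1) (fun t => residual t (v t)) <=
    time_int (ts j) (ts j.+1) (fun t => g t + gnrm (v t) ^+ 2).
  apply: (Rint_le mJ).
  - by apply: (aeint_subset mI mJ _ (residual_aeint Xv)); exact: itv_oo_sub.
  - by apply: (aeint_subset mI mJ _ agv); exact: itv_oo_sub.
  - apply: (ae_sub_itv a0 bT); apply: (ae_mono _ (ae_and hg (bochner2_mem Xv))) => t _ [[_ h] Hv].
    exact: le_trans (ler_norm _) (h _ Hv).
apply: le_trans le _.
have ge0 : {ae mu, forall t, `]0, T[%classic t -> 0 <= g t + gnrm (v t) ^+ 2}.
  by apply: (ae_mono _ hg) => t _ [g0 _]; apply: addr_ge0 => //; exact: sqr_ge0.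
apply: le_trans (time_int_sub_le a0 (ltW (lt jN)) bT agv ge0) _.
rewrite /time_int (RintD mI ag (Xspace_sqr oO bO Xv)) -!/(time_int _ _ _).
by rewrite -(Xnrm_sqr v) v1 expr1n.
Qed.

Lemma residual_eq0 j v : (j < N)%N -> Xspace Omega T v -> Xn v = 0 ->
  time_int (ts j) (ts j.+1) (fun t => residual t (v t)) = 0.
Proof.
move=> jN Xv v0; have [a0 bT] := sub jN; have mI := measurable_ioo 0 T.
have : ae_eq mu `]0, T[%classic (fun t => gnrm (v t) ^+ 2) (fun=> 0).
  apply: (Rint_eq0_ae mI (Xspace_sqr oO bO Xv)); first by apply: aeW => t _; exact: sqr_ge0.
  by rewrite -/(time_int _ _ _) -(Xnrm_sqr v) v0 expr0n.
move=> g0.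
have -> : 0 = time_int (ts j) (ts j.+1) (fun=> 0 : R).
  by rewrite time_int_cst ?mulr0// ltW ?lt.
apply: (Rintegral_ae_congr (measurable_ioo _ _)); apply: (ae_sub_itv a0 bT).
apply: (ae_mono _ (ae_and g0 (ae_and residual_Hm1 (bochner2_mem Xv)))) => t _ [/= e [hr hv]].
have := dual_nrmP oO bO hr hv.
have -> : gnrm (v t) = 0 by apply/eqP; rewrite -sqrf_eq0 e.
by rewrite mulr0 normr_le0 => /eqP.
Qed.

(** Homogeneous form of the definition of the residual norm, with the
    degenerate case [Xnrm v = 0] included. *)
Lemma residual_bound j v : (j < N)%N -> Xspace Omega T v ->
  time_int (ts j) (ts j.+1) (fun t => residual t (v t)) <= R_ j * Xn v.
Proof.
move=> jN Xv; have [a0 bT] := sub jN; have mI := measurable_ioo 0 T.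
have [v0|v0] := eqVneq (Xn v) 0; first by rewrite (residual_eq0 jN Xv v0) v0 mulr0.
have vp : 0 < Xn v by rewrite lt_neqAle eq_sym v0 sqrtr_ge0.
pose w t := (Xn v)^-1 *: v t.
have Xw : Xspace Omega T w := bochner2Z gS (Xn v)^-1 Xv.
have w1 : Xn w = 1.
  have E : Xn w ^+ 2 = 1.
    rewrite (Xnrm_sqr w).
    have -> : time_int 0 T (fun t => gnrm (w t) ^+ 2) =
        time_int 0 T (fun t => (Xn v)^-1 ^+ 2 * gnrm (v t) ^+ 2).
      apply: (Rintegral_ae_congr mI); apply: (ae_mono _ (bochner2_mem Xv)) => t _ hv.
      by rewrite /w (snZ gS _ hv) exprMn real_normK ?num_real.
    rewrite /time_int (RintZ mI _ (Xspace_sqr oO bO Xv)) -/(time_int _ _ _) -(Xnrm_sqr v).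
    by rewrite -exprMn mulVf ?expr1n.
  by apply/eqP; rewrite -(eqrXn2 (n := 2)) ?sqrtr_ge0// E expr1n.
rewrite -ler_pdivrMr// mulrC.
have -> : (Xn v)^-1 * time_int (ts j) (ts j.+1) (fun t => residual t (v t)) =
    time_int (ts j) (ts j.+1) (fun t => residual t (w t)).
  have mJ := measurable_ioo (ts j) (ts j.+1).
  rewrite /time_int -(RintZ mJ); last first.
    by apply: (aeint_subset mI mJ _ (residual_aeint Xv)); exact: itv_oo_sub.
  apply: (Rintegral_ae_congr mJ); apply: (ae_sub_itv a0 bT).
  apply: (ae_mono _ (ae_and residual_Hm1 (bochner2_mem Xv))) => t _ [hr hv].
  by rewrite /w (Hm1Z oO bO _ hr hv).
rewrite -(residualE jN Xw); apply: ub_le_sup; last by exists w.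
have [B hB] := residual_nrm_ub; exists B => _ [z [Xz z1] <-]; exact: hB.
Qed.

Let itvT j (jN : (j < N)%N) : `]ts j, ts j.+1[%classic `<=` (`]0, T[%classic : set R).
Proof. by have [a0 bT] := sub jN; exact: itv_oo_sub. Qed.

Lemma residual_test j (p : {poly R}) z : (j < N)%N -> H10 z ->
  time_int (ts j) (ts j.+1) (fun t => residual t (p.[t] *: z)) <=
  R_ j * (Num.sqrt (time_int (ts j) (ts j.+1) (horner (p * p))) * gnrm z).
Proof.
move=> jN Hz; have [a0 bT] := sub jN.
have mI := measurable_ioo 0 T; have mJ := measurable_ioo (ts j) (ts j.+1).
pose v t := (\1_(`]ts j, ts j.+1[%classic) t : R) *: (p.[t] *: z).
have Xv : Xspace Omega T v.
  apply: (bochner2_indic gS mJ); have [C C0 hC] := poly_bounded 0 T p.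
  apply: (bochner2_cst gS (K := C)) => //.
    by apply: continuous_measurable_fun; exact: continuous_poly.
  by move=> t /andP[h1 h2]; apply: hC; rewrite !ltW.
have vE t : ts j < t < ts j.+1 -> v t = p.[t] *: z.
  by move=> tj; rewrite /v indicE mem_set ?scale1r//= in_itv.
have -> : Num.sqrt (time_int (ts j) (ts j.+1) (horner (p * p))) * gnrm z = Xn v.
  have -> : Xn v = Num.sqrt (gnrm z ^+ 2 * time_int (ts j) (ts j.+1) (horner (p * p))).
    congr Num.sqrt; rewrite /time_int -(RintZ mJ _ (aeint_poly _ _ _)).
    rewrite -(Rint_indic mu _ mI mJ (itvT jN)); apply: eq_Rintegral => t _.
    have Hpz : H10 (p.[t] *: z) := ssZ _ sH Hz.
    rewrite /v (snZ gS _ Hpz) (snZ gS _ Hz) indicE !exprMn !real_normK ?num_real// hornerM.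
    by case: (_ \in _); rewrite ?expr1n ?expr0n /= ?mul0r ?mul1r// [RHS]mulrC expr2.
  by rewrite sqrtrM ?sqr_ge0// sqrtr_sqr ger0_norm ?(sn_ge0 gS)// mulrC.
rewrite -(time_int_congr (F := fun t => residual t (v t))); first exact: residual_bound.
by move=> t /vE ->.
Qed.

(** * Local estimates by Legendre test functions *)

Let Dz j z : {poly R} := curve_pairing ip (q j.+1).+1 monomials (c j) z.
Let Sz j z : {poly R} := curve_pairing gip (q j.+1).+1 monomials (c j) z.

Let Hc j k (jN : (j < N)%N) : (k < (q j.+1).+1)%N -> H10 (c j k).
Proof. by move=> kq; apply: (@Vh_H10 _ _ _ (M j.+1)); exact: (hc jN).1. Qed.

Lemma strong_dt_pairing j t z : (j < N)%N -> ts j < t < ts j.+1 -> L2 z ->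
  ip (strong_dt Omega uh t) z = (Dz j z)^`().[t].
Proof.
move=> jN tj Lz; have [_ e] := strong_dt_curve oO (fun k => Lc jN) (hcL jN) tj.
rewrite (ip_eqae oO e (eqae_refl _ z)) /dcurve.
by rewrite (curve_pairingE _ _ iS (fun k => Lc jN) Lz) curve_pairing_deriv.
Qed.

Lemma gip_uh_pairing j t z : (j < N)%N -> ts j < t < ts j.+1 -> H10 z ->
  gip (uh t) z = (Sz j z).[t].
Proof.
move=> jN tj Hz; have [_ e] := hcL jN tj; rewrite (gip_eqae oO e (eqae_refl _ z)).
by rewrite (curve_pairingE _ _ gI (fun k => Hc jN) Hz).
Qed.

Lemma data_aeint j (p : {poly R}) z : (j < N)%N -> H10 z ->
  aeint mu `]ts j, ts j.+1[ (fun t => p.[t] * ip (f t) z).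
Proof.
move=> jN /H10_L2 Lz; have [a0 bT] := sub jN; have mJ := measurable_ioo (ts j) (ts j.+1).
have [C C0 hC] := poly_bounded (ts j) (ts j.+1) p.
apply: (aeint_mul_bounded mJ (K := C)).
- by apply: aemeas_aeint; exact: aeint_poly.
- by move=> t; rewrite /= in_itv/= => /andP[h1 h2]; apply: hC; rewrite !ltW.
- apply: (aeint_subset (measurable_ioo 0 T) mJ (itvT jN)).
  exact: (bochner2_pairing nS nS (ip_pairing oO) hf (bochner2_const _ _ nS Lz)).
Qed.

Notation kap j := (correction ts q j).

Lemma residual_poly j (p : {poly R}) z : (j < N)%N -> H10 z ->
  time_int (ts j) (ts j.+1) (fun t => residual t (p.[t] *: z)) =
  time_int (ts j) (ts j.+1) (fun t => p.[t] * ip (f t) z)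
  - time_int (ts j) (ts j.+1) (horner (((Dz j z)^`() + Sz j z) * p))
  - ip (J j) z * time_int (ts j) (ts j.+1) (horner ((kap j)^`() * p))
  - gip (J j) z * time_int (ts j) (ts j.+1) (horner (kap j * p)).
Proof.
move=> jN Hz; have Lz := H10_L2 Hz; have [a0 bT] := sub jN.
have mJ := measurable_ioo (ts j) (ts j.+1).
rewrite -!time_int_polyZ -!addrA -!opprD -!time_int_polyD /time_int.
rewrite -(RintB mJ (data_aeint _ jN Hz) (aeint_poly _ _ _)).
apply: (Rintegral_ae_congr mJ).
apply: (ae_mono _ (ae_sub_itv a0 bT (ae_and (bochner2_mem hf) residual_Hm1))) => t.
rewrite /= in_itv/= => tj [Lf hr].
have HJ := jump_H10 jN; have Hpz : H10 (p.[t] *: z) := ssZ _ sH Hz.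
have tj' : ts j < t <= ts j.+1 by have /andP[-> /ltW] := tj.
have Hu : H10 (uh t) by have [/Vh_H10] := (hc jN).2 t tj.
rewrite (Hm1Z oO bO _ hr Hz) /residual (rec_dtE jN tj Lz) (strong_dt_pairing jN tj Lz).
rewrite (reconstruction_in _ _ hts _ jN tj') (siDl gI Hu (ssZ _ sH HJ) Hz) (siZl gI _ HJ Hz).
rewrite (gip_uh_pairing jN tj Hz) !(hornerD, hornerM, hornerZ); ring.
Qed.

Hypothesis hscheme : forall n (v : R -> fct), (1 <= n <= N)%N ->
  Qspace Omega (q n) (ts n.-1) (ts n) (Vh n) v ->
  intI ts n (fun t => ip (strong_dt Omega uh t) (v t) + gip (uh t) (v t))
    - ip (jump Omega ts uh n.-1) (right_limit Omega v (ts n.-1)) =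
  intI ts n (fun t => ip (f t) (v t)).

Lemma scheme_poly j (p : {poly R}) z : (j < N)%N -> (size p <= (q j.+1).+1)%N -> Vh j.+1 z ->
  time_int (ts j) (ts j.+1) (horner (((Dz j z)^`() + Sz j z) * p)) - p.[ts j] * ip (J j) z =
  time_int (ts j) (ts j.+1) (fun t => p.[t] * ip (f t) z).
Proof.
move=> jN sp Vz; have Hz := Vh_H10 Vz; have Lz := H10_L2 Hz; have [a0 bT] := sub jN.
have mJ := measurable_ioo (ts j) (ts j.+1).
have Q : Qspace Omega (q j.+1) (ts j) (ts j.+1) (Vh j.+1) (fun t => p.[t] *: z).
  exists (fun k : 'I_(q j.+1).+1 => p`_k *: z); split; first by move=> k; exact: (ssZ _ (sV j.+1)).
  move=> t _; split; first exact: (ssZ _ (sV j.+1)).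
  by rewrite (poly_curveE z t sp); exact: eqae_refl.
have E : forall t, curve 1 (fun=> p) (fun=> z) t = p.[t] *: z.
  by move=> t; rewrite /curve big_ord1.
have [LR eR] : L2 (right_limit Omega (fun t => p.[t] *: z) (ts j)) /\
    eqae (right_limit Omega (fun t => p.[t] *: z) (ts j)) (p.[ts j] *: z).
  rewrite -E; apply: (right_limit_curve oO (lt jN)) => //.
  by move=> t _; rewrite E; split; [exact: (ssZ _ sL)|exact: eqae_refl].
have LJ := H10_L2 (jump_H10 jN).
have := hscheme (n := j.+1) jN Q.
rewrite (ip_eqae oO (eqae_refl _ _) eR) (siZr iS)// => hs.
rewrite (_ : time_int (ts j) (ts j.+1) (horner _) =
  intI ts j.+1 (fun t => ip (strong_dt Omega uh t) (p.[t] *: z) + gip (uh t) (p.[t] *: z))).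
  rewrite hs; apply: (Rintegral_ae_congr mJ).
  apply: (ae_mono _ (ae_sub_itv a0 bT (bochner2_mem hf))) => t _ Lf.
  by rewrite (siZr iS).
apply: time_int_congr => t tj; have [Ld _] := strong_dt_curve oO (fun k => Lc jN) (hcL jN) tj.
have Hu : H10 (uh t) by have [/Vh_H10] := (hc jN).2 t tj.
rewrite (siZr iS)// (siZr gI)// (strong_dt_pairing jN tj Lz) (gip_uh_pairing jN tj Hz).
by rewrite !(hornerD, hornerM); ring.
Qed.

Lemma correction_legendre j : (j < N)%N ->
  [/\ time_int (ts j) (ts j.+1) (horner ((kap j)^`() * legendreP ts j.+1 (q j.+1))) =
        - (-1) ^+ q j.+1,
      time_int (ts j) (ts j.+1) (horner (kap j * legendreP ts j.+1 (q j.+1))) =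
        (-1) ^+ q j.+1 / 2 * ((ts j.+1 - ts j) / (2 * q j.+1 + 1)%:R),
      time_int (ts j) (ts j.+1) (horner (kap j * legendreP ts j.+1 (q j.+1).+1)) =
        - ((-1) ^+ q j.+1 / 2 * ((ts j.+1 - ts j) / (2 * (q j.+1).+1 + 1)%:R)) &
      time_int (ts j) (ts j.+1) (horner (kap j * kap j)) =
        (ts j.+1 - ts j) * (q j.+1).+1%:R / ((2 * q j.+1 + 1)%N%:R * (2 * q j.+1 + 3)%N%:R)].
Proof.
move=> jN; have ab := lt jN : ts j.+1.-1 < ts j.+1; set n := q j.+1.
set L := legendreP ts j.+1.
have nn k : time_int (ts j) (ts j.+1) (horner (L k * L k)) = (ts j.+1 - ts j) / (2 * k + 1)%:R.
  rewrite -(int_legendre_sqr ab k) /intI; apply: time_int_congr => t _.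
  by rewrite hornerM !horner_legendreP.
have orth : time_int (ts j) (ts j.+1) (horner (L n * L n.+1)) = 0.
  by rewrite (int_legendreP_poly ab)//; exact: size_legendreP.
have orth' : time_int (ts j) (ts j.+1) (horner (L n.+1 * L n)) = 0.
  by rewrite mulrC.
set s : R := (-1) ^+ n.
have s2 : s * s = 1 by rewrite -expr2 sqrr_sign.
have kE : kap j = (s / 2) *: (L n - L n.+1) by [].
split.
- rewrite kE derivZ -scalerAl time_int_polyZ (int_legendre_deriv ab).
  by rewrite mulrN divfK.
- by rewrite kE -scalerAl time_int_polyZ mulrBl time_int_polyB orth' nn subr0.
- by rewrite kE -scalerAl time_int_polyZ mulrBl time_int_polyB orth nn sub0r mulrN.
- rewrite kE -scalerAl -scalerAr !time_int_polyZ mulrBl !mulrBr !time_int_polyB orth orth' !nn.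
  rewrite mulrA (_ : s / 2 * (s / 2) = s * s / 4); last by field.
  rewrite s2 !natrD !natrM -!natr1 !mulrDr.
  have n0 : (0 : R) <= n%:R by rewrite ler0n.
  by field; rewrite !lt0r_neq0 //; lra.
Qed.


Lemma legendreP_left j k : (j < N)%N -> (legendreP ts j.+1 k).[ts j] = (-1) ^+ k.
Proof.
move=> jN; have ab := lt jN : ts j.+1.-1 < ts j.+1.
by rewrite (horner_legendreP ab); exact: (legendreI_left ab).
Qed.

Lemma legendreP_sqr_int j k : (j < N)%N ->
  time_int (ts j) (ts j.+1) (horner (legendreP ts j.+1 k * legendreP ts j.+1 k)) =
  (ts j.+1 - ts j) / (2 * k + 1)%:R.
Proof.
move=> jN; have ab := lt jN : ts j.+1.-1 < ts j.+1.
rewrite -(int_legendre_sqr ab k); apply: time_int_congr => t _.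
by rewrite hornerM !horner_legendreP.
Qed.

Let tau0 j k : (j < N)%N -> 0 <= (ts j.+1 - ts j) / (2 * k + 1)%:R.
Proof. by move=> jN; rewrite divr_ge0 ?ler0n// subr_ge0 ltW// lt. Qed.

(** For the Legendre polynomial of degree [q], the derivative of the
    correction contributes minus the jump term of the scheme, so that only the
    elliptic term is left. *)
Lemma residual_test_scheme j z : (j < N)%N -> Vh j.+1 z ->
  (ts j.+1 - ts j) / (2 * q j.+1 + 1)%:R * gip (J j) z <=
  2 * (R_ j * (Num.sqrt ((ts j.+1 - ts j) / (2 * q j.+1 + 1)%:R) * gnrm z)).
Proof.
move=> jN Vz; have Hz := Vh_H10 Vz; set s : R := (-1) ^+ q j.+1.
have s2 : s * s = 1 by rewrite -expr2 sqrr_sign.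
set p := (- s) *: legendreP ts j.+1 (q j.+1).
have sp : (size p <= (q j.+1).+1)%N.
  by apply: leq_trans (size_scale_leq _ _) _; exact: size_legendreP.
have [k1 k2 _ _] := correction_legendre jN.
have := residual_test p jN Hz; rewrite (residual_poly p jN Hz) -(scheme_poly jN sp Vz).
have -> : time_int (ts j) (ts j.+1) (horner ((kap j)^`() * p)) = - s * - s.
  by rewrite -scalerAr time_int_polyZ k1.
have -> : time_int (ts j) (ts j.+1) (horner (kap j * p)) =
    - s * (s / 2 * ((ts j.+1 - ts j) / (2 * q j.+1 + 1)%:R)).
  by rewrite -scalerAr time_int_polyZ k2.
have -> : time_int (ts j) (ts j.+1) (horner (p * p)) = (ts j.+1 - ts j) / (2 * q j.+1 + 1)%:R.
  by rewrite -scalerAl -scalerAr !time_int_polyZ (legendreP_sqr_int _ jN) mulrA mulrNN s2 mul1r.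
have -> : p.[ts j] = - s * s by rewrite hornerZ (legendreP_left _ jN).
rewrite scheme_cancellation// ler_pdivrMr ?ltr0n// => h.
by rewrite mulrC [X in _ <= X]mulrC.
Qed.

Variable P : nat -> fct -> fct.
Hypothesis hP : forall n, (1 <= n <= N)%N -> elliptic_projection Omega (Vh n) (P n).
Notation w j := (uh (ts j)).
Notation eC j := (eta_C Omega ts q P uh j.+1).
Notation tau j := (ts j.+1 - ts j).

Lemma gnrm_pythagoras e z : H10 e -> H10 z -> gip e z = 0 ->
  gnrm (e + z) ^+ 2 = gnrm e ^+ 2 + gnrm z ^+ 2.
Proof.
move=> He Hz ez; have := siDD gI He Hz; rewrite ez mulr0 addr0 => E.
apply: (etrans (gnrm_sqr oO bO (ssD sH He Hz)) (etrans E _)).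
by rewrite -(gnrm_sqr oO bO He) -(gnrm_sqr oO bO Hz).
Qed.

(** The jump is the coarsening error plus a discrete function, orthogonal to
    it for the Dirichlet form by definition of the elliptic projection. *)
Lemma jump_split j : (j < N)%N -> Vh j.+1 (P j.+1 (w j) - up j) /\
  gip (J j) (P j.+1 (w j) - up j) = gnrm (P j.+1 (w j) - up j) ^+ 2 /\
  gnrm (J j) ^+ 2 = gnrm (w j - P j.+1 (w j)) ^+ 2 + gnrm (P j.+1 (w j) - up j) ^+ 2.
Proof.
move=> jN; have Hw := dg_node_H10 (ltnW jN); have [VP oP] := hP (n := j.+1) jN Hw.
have [Vu _] := dg_right jN; set z := P j.+1 (w j) - up j.
have Vz : Vh j.+1 z := ssB (sV j.+1) VP Vu.
have Hz := Vh_H10 Vz; have HP := Vh_H10 VP; set e := w j - P j.+1 (w j).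
have He : H10 e := ssB sH Hw HP.
have JE : J j = e + z by rewrite /jump /e /z addrA subrK.
have ez : gip e z = 0 by rewrite /e (siBl gI Hw HP Hz) (oP _ Vz) subrr.
rewrite JE; split => //; split.
  by rewrite (siDl gI He Hz Hz) ez add0r (gnrm_sqr oO bO Hz).
exact: gnrm_pythagoras.
Qed.

Lemma discrete_jump_bound j : (j < N)%N ->
  tau j / (2 * q j.+1 + 1)%:R * gnrm (P j.+1 (w j) - up j) ^+ 2 <= 4 * R_ j ^+ 2.
Proof.
move=> jN; have [Vz [zE _]] := jump_split jN.
have := residual_test_scheme jN Vz; rewrite zE.
have t0 := tau0 (q j.+1) jN.
move: (gnrm _) => g; rewrite -{1 3}(sqr_sqrtr t0) -!exprMn; exact: sqr_le_of_mul.
Qed.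

Lemma reconstruction_error j : (j < N)%N ->
  intI ts j.+1 (fun t => gnrm (uh t - Iuh t) ^+ 2) =
  tau j * (q j.+1).+1%:R / ((2 * q j.+1 + 1)%N%:R * (2 * q j.+1 + 3)%N%:R) * gnrm (J j) ^+ 2.
Proof.
move=> jN; have [_ _ _ <-] := correction_legendre jN; rewrite mulrC -time_int_polyZ.
apply: time_int_congr => t tj; have tj' : ts j < t <= ts j.+1 by have /andP[-> /ltW] := tj.
rewrite (reconstruction_in _ _ hts _ jN tj') opprD addrA subrr add0r -scaleNr.
by rewrite (snZ gS _ (jump_H10 jN)) exprMn real_normK ?num_real// hornerZ hornerM sqrrN mulrC expr2.
Qed.

Lemma coarsening_branch j : (j < N)%N ->
  intI ts j.+1 (fun t => gnrm (uh t - Iuh t) ^+ 2) <= 8 * R_ j ^+ 2 + eC j ^+ 2.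
Proof.
move=> jN; have t0 : 0 <= tau j by rewrite subr_ge0 ltW// lt.
rewrite (reconstruction_error jN).
have -> : eC j ^+ 2 = tau j * (q j.+1).+1%:R / ((2 * q j.+1 + 1)%N%:R * (2 * q j.+1 + 3)%N%:R) *
    gnrm (w j - P j.+1 (w j)) ^+ 2.
  by rewrite /eta_C exprMn; congr (_ * _); apply: sqr_sqrtr; rewrite divr_ge0// mulr_ge0// ler0n.
have [_ [_ E]] := jump_split jN.
exact: (coarsening_ratio t0 (sqr_ge0 _) E (discrete_jump_bound jN)).
Qed.

Variable ftau : R -> fct.
Hypothesis hftau : temporal_data_approx Omega N ts q f ftau.
Notation eO j := (eta_osc Omega ts f ftau j.+1).

Lemma data_error_bochner2 j : (j < N)%N ->
  bochner2 L2 nrm (ts j) (ts j.+1) (fun t => f t - ftau t).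
Proof.
move=> jN; have [a0 bT] := sub jN.
have [/Qspace_curve[e [Le he]] _] := hftau (n := j.+1) jN.
apply: (bochner2B nS); first exact: bochner2_sub a0 bT hf.
have bc : bochner2 L2 nrm (ts j) (ts j.+1) (curve (q j.+1).+1 monomials e).
  apply: (bochner2_sum nS) => k _; have [C C0 hC] := poly_bounded (ts j) (ts j.+1) (monomials k).
  apply: (bochner2_cst nS (K := C)).
  - by apply: continuous_measurable_fun; exact: continuous_poly.
  - by move=> t /andP[h1 h2]; apply: hC; rewrite !ltW.
  - exact: Le.
apply: (bochner2_congr nS _ _ bc); apply: aeW => t; rewrite /= in_itv/= => /he[Lt et] //.
rewrite (nrm_eqae oO (_ : eqae _ 0)) ?(sn0 nS)//.
by rewrite -[X in eqae _ X](subrr (ftau t)); apply: eqaeB; [exact: eqae_sym|exact: eqae_refl].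
Qed.

Lemma data_error_dual j : (j < N)%N ->
  aeint mu `]ts j, ts j.+1[ (fun t => dual_nrm (ip (f t - ftau t)) ^+ 2).
Proof.
move=> jN; have bd := data_error_bochner2 jN; have mJ := measurable_ioo (ts j) (ts j.+1).
have [C C0 hC] := ip_Hm1 oO bO d0.
have dC v : L2 v -> 0 <= dual_nrm (ip v) <= C * nrm v.
  by move=> /hC[hv ->]; rewrite (dual_nrm_ge0 oO bO hv).
have am : aemeas mu `]ts j, ts j.+1[ (fun t => dual_nrm (ip (f t - ftau t))).
  apply: (bochner2_comp nS (Phi := fun v => dual_nrm (ip v)) (C := C)) bd => x y Lx Ly.
  have [hx _] := hC _ Lx; have [hy _] := hC _ Ly; have [hxy le] := hC _ (ssB sL Lx Ly).
  apply: le_trans (sn_dist dS hx hy) _; apply: le_trans le.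
  apply: (dual_nrm_le oO bO (ssB (Hm1_subspace Omega) hx hy)); last exact: (dual_nrm_ge0 oO bO hxy).
  move=> v Hv; have Lv := H10_L2 Hv; apply: le_trans (dual_nrmP oO bO hxy Hv).
  by rewrite (siBl iS Lx Ly Lv).
apply: (aeint_le mJ _ (aeintZ mJ (C ^+ 2) (bochner2_sqr nS bd))).
  rewrite (_ : (fun t => _) = (fun t => dual_nrm (ip (f t - ftau t)) * dual_nrm (ip (f t - ftau t)))).
    exact: aemeasM.
  by apply/funext => t; rewrite expr2.
apply: (ae_mono _ (bochner2_mem bd)) => t _ /dC/andP[h0 h].
by rewrite ger0_norm ?sqr_ge0// -exprMn ler_sqr// nnegrE (le_trans h0).
Qed.

Lemma data_error_test j (p : {poly R}) z : (j < N)%N -> L2 z ->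
  aeint mu `]ts j, ts j.+1[ (fun t => ip (f t - ftau t) (p.[t] *: z)).
Proof.
move=> jN Lz; apply: (bochner2_pairing nS nS (ip_pairing oO) (data_error_bochner2 jN)).
have [C C0 hC] := poly_bounded (ts j) (ts j.+1) p.
apply: (bochner2_cst nS (K := C)) => //.
- by apply: continuous_measurable_fun; exact: continuous_poly.
- by move=> t /andP[h1 h2]; apply: hC; rewrite !ltW.
Qed.

(** For the Legendre polynomial of degree [q + 1], all polynomials of degree
    at most [q] drop out by orthogonality, among them the temporal
    approximation of the data. *)
Lemma residual_test_jump j (s := (-1) ^+ q j.+1 : R) : (j < N)%N ->
  tau j / (2 * (q j.+1).+1 + 1)%:R * gnrm (J j) ^+ 2 <=
  2 * (R_ j * (Num.sqrt (tau j / (2 * (q j.+1).+1 + 1)%:R) * gnrm (J j)))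
  - 2 * time_int (ts j) (ts j.+1) (fun t => ip (f t - ftau t)
      ((s *: legendreP ts j.+1 (q j.+1).+1).[t] *: J j)).
Proof.
move=> jN; have HJ := jump_H10 jN; have LJ := H10_L2 HJ; have [a0 bT] := sub jN.
have ab := lt jN : ts j.+1.-1 < ts j.+1.
have s2 : s * s = 1 by rewrite -expr2 sqrr_sign.
set L := legendreP ts j.+1 (q j.+1).+1.
have [_ _ k3 _] := correction_legendre jN.
have := residual_test (s *: L) jN HJ; rewrite (residual_poly _ jN HJ).
have orth (p : {poly R}) : (size p <= (q j.+1).+1)%N ->
    time_int (ts j) (ts j.+1) (horner (p * (s *: L))) = 0.
  by move=> sp; rewrite -scalerAr time_int_polyZ (int_legendreP_poly ab sp) mulr0.
have sderiv (p : {poly R}) m : (size p <= m)%N -> (size p^`() <= m.-1)%N.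
  move=> sp; have [->|p0] := eqVneq p 0; first by rewrite deriv0 size_poly0.
  by have := lt_size_deriv p0; lia.
rewrite [X in _ - X - _ - _]orth; last first.
  apply: leq_trans (size_polyD _ _) _; rewrite geq_max; apply/andP; split.
    apply: leq_trans (sderiv _ (q j.+1).+2 _) _ => //.
    by apply: size_curve_pairing => k kq; rewrite size_polyXn ltnW.
  by apply: size_curve_pairing => k kq; rewrite size_polyXn.
rewrite orth; last first.
  apply: leq_trans (sderiv _ (q j.+1).+2 _) _ => //.
  apply: leq_trans (size_scale_leq _ _) _; apply: leq_trans (size_polyD _ _) _.
  rewrite size_polyN geq_max; apply/andP; split; last exact: size_legendreP.
  by apply: leq_trans (size_legendreP _ _ _) _.
have -> : time_int (ts j) (ts j.+1) (horner (s *: L * (s *: L))) = tau j / (2 * (q j.+1).+1 + 1)%:R.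
  by rewrite -scalerAl -scalerAr !time_int_polyZ (legendreP_sqr_int _ jN) mulrA s2 mul1r.
have -> : time_int (ts j) (ts j.+1) (horner (kap j * (s *: L))) =
    - (tau j / (2 * (q j.+1).+1 + 1)%:R) / 2.
  rewrite -scalerAr time_int_polyZ k3 -/s.
  exact: sign_cancellation.
have mJ := measurable_ioo (ts j) (ts j.+1).
have [/Qspace_curve[e [Le he]] _] := hftau (n := j.+1) jN.
have sE : (size (curve_pairing ip (q j.+1).+1 monomials e (J j)) <= (q j.+1).+1)%N.
  by apply: size_curve_pairing => k kq; rewrite size_polyXn.
set D := time_int _ _ (fun t => ip _ _).
have -> : time_int (ts j) (ts j.+1) (fun t => (s *: L).[t] * ip (f t) (J j)) = D.
  rewrite -[RHS]addr0 -(orth _ sE) /D /time_int -RintD//; last 2 first.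
  - exact: data_error_test.
  - exact: aeint_poly.
  apply: (Rintegral_ae_congr mJ).
  apply: (ae_mono _ (ae_sub_itv a0 bT (bochner2_mem hf))) => t; rewrite /= in_itv/= => tj Lf.
  have [Lt et] := he t tj.
  rewrite (siZr iS)//; last exact: (ssB sL).
  rewrite (siBl iS)// hornerM -(curve_pairingE _ _ iS Le LJ) -(ip_eqae oO et (eqae_refl _ (J j))).
  by ring.
rewrite !mulr0 !subr0 -(gnrm_sqr oO bO HJ).
move: D (tau j / _) (R_ j * _) (gnrm _ ^+ 2) => D x r g *; lra.
Qed.

Lemma data_error_bound j (p : {poly R}) z : (j < N)%N -> H10 z ->
  - 2 * time_int (ts j) (ts j.+1) (fun t => ip (f t - ftau t) (p.[t] *: z)) <=
  4 * time_int (ts j) (ts j.+1) (fun t => dual_nrm (ip (f t - ftau t)) ^+ 2) +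
  time_int (ts j) (ts j.+1) (horner (p * p)) * gnrm z ^+ 2 / 4.
Proof.
move=> jN Hz; have mJ := measurable_ioo (ts j) (ts j.+1); have Lz := H10_L2 Hz.
have a1 := data_error_test p jN Lz; have a2 := data_error_dual jN.
have a3 := aeint_poly (ts j) (ts j.+1) ((gnrm z ^+ 2 / 4) *: (p * p)).
rewrite -mulrA [_ * (_ / 4)]mulrC -time_int_polyZ /time_int -(RintZ mJ _ a1) -(RintZ mJ _ a2).
rewrite -(RintD mJ (aeintZ mJ _ a2) a3).
apply: (Rint_le mJ (aeintZ mJ _ a1) (aeintD mJ (aeintZ mJ _ a2) a3)).
apply: (ae_mono _ (bochner2_mem (data_error_bochner2 jN))) => t _ Lt.
have [C C0 hC] := ip_Hm1 oO bO d0; have [hd _] := hC _ Lt.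
have := dual_nrmP oO bO hd (ssZ p.[t] sH Hz); rewrite (snZ gS _ Hz) => h.
rewrite hornerZ hornerM.
have -> : gnrm z ^+ 2 / 4 * (p.[t] * p.[t]) = (`|p.[t]| * gnrm z) ^+ 2 / 4.
  by rewrite exprMn real_normK ?num_real//; field.
apply: le_trans (young_product _ _); apply: le_trans (ler_norm _) _.
have n2 : `|(-2 : R)| = 2 by rewrite normrN ger0_norm.
by rewrite normrM n2 ler_pM2l.
Qed.

Lemma oscillation_branch j : (j < N)%N ->
  intI ts j.+1 (fun t => gnrm (uh t - Iuh t) ^+ 2) <= 8 * R_ j ^+ 2 + 8 * eO j ^+ 2.
Proof.
move=> jN; have t0 : 0 <= tau j by rewrite subr_ge0 ltW// lt.
rewrite (reconstruction_error jN); apply: (oscillation_ratio t0 (sqr_ge0 _)).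
have HJ := jump_H10 jN; have := residual_test_jump jN.
set s : R := (-1) ^+ _; have s2 : s * s = 1 by rewrite -expr2 sqrr_sign.
set p := s *: _; set D := time_int _ _ _.
set X := tau j / _; have X0 : 0 <= X := tau0 (q j.+1).+1 jN.
have mJ := measurable_ioo (ts j) (ts j.+1).
have pp : time_int (ts j) (ts j.+1) (horner (p * p)) = X.
  by rewrite -scalerAl -scalerAr !time_int_polyZ (legendreP_sqr_int _ jN) mulrA s2 mul1r.
have bD : - 2 * D <= 4 * eO j ^+ 2 + (Num.sqrt X * gnrm (J j)) ^+ 2 / 4.
  rewrite exprMn (sqr_sqrtr X0) -pp.
  have -> : eO j ^+ 2 = time_int (ts j) (ts j.+1) (fun t => dual_nrm (ip (f t - ftau t)) ^+ 2).
    rewrite /eta_osc; apply: sqr_sqrtr; apply: (Rint_ge0_ae mJ).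
    by apply: aeW => t _; exact: sqr_ge0.
  exact: data_error_bound.
have -> : X * gnrm (J j) ^+ 2 = (Num.sqrt X * gnrm (J j)) ^+ 2 by rewrite exprMn (sqr_sqrtr X0).
by rewrite -mulNr => h; exact: oscillation_absorb h bD.
Qed.

Lemma local_estimate j : (j < N)%N ->
  intI ts j.+1 (fun t => gnrm (uh t - Iuh t) ^+ 2) <=
  8 * R_ j ^+ 2 + Num.min (eC j ^+ 2) (8 * eO j ^+ 2).
Proof.
move=> jN; rewrite minEle; case: ifP => _; first exact: coarsening_branch.
exact: oscillation_branch.
Qed.

End discrete_functions.

(** * The error seen through the residual *)

Lemma sqr_le_bound (R : rcfType) (x Q : R) : 0 <= Q -> (x ^+ 2 <= Q) = (`|x| <= Num.sqrt Q).
Proof.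
by move=> Q0; rewrite -(ler_sqr (x := `|x|)) ?nnegrE ?sqrtr_ge0// sqr_sqrtr// real_normK ?num_real.
Qed.

Lemma residual_swap (R : realFieldType) (x a b c e g : R) :
  x * (a - b - c - (e - b + (g - c))) = - (x * e + x * g - x * a).
Proof. by ring. Qed.

Lemma energy_balance (R : realFieldType) (duu duI dIu dII uT u0 IT I0 cT c0 eT e0 : R) :
  2 * duu <= uT - u0 -> 2 * dII = IT - I0 -> dIu + duI = cT - c0 ->
  eT = uT - 2 * cT + IT -> e0 = u0 - 2 * c0 + I0 -> 0 <= e0 ->
  2 * (duu - duI - (dIu - dII)) <= eT.
Proof. lra. Qed.

Lemma square_expansion (R : realFieldType) (x y z : R) : - (x * y) <= z ->
  0 <= x ^+ 2 + 2 * z + y ^+ 2.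
Proof.
move=> h; have := sqr_ge0 (x - y).
rewrite (_ : (x - y) ^+ 2 = x ^+ 2 - 2 * (x * y) + y ^+ 2); last by ring.
move: h; move: (x * y) (x ^+ 2) (y ^+ 2) => a b e *; lra.
Qed.

Lemma assembled_balance (R : realFieldType) (dd ge gV ee eV VV S nT : R) :
  0 <= dd + 2 * (ge - gV) + (ee - 2 * eV + VV) -> gV + eV = S -> VV <= S ->
  2 * ge <= nT -> S <= dd + ee + nT.
Proof. lra. Qed.

(** Suprema are taken one index at a time, the other indices being frozen at
    arbitrary elements. *)
Lemma sum_sqr_sup (R : realType) K (S : nat -> set R) (Y : R) :
  (forall j, (j < K)%N -> S j !=set0) ->
  (forall r : nat -> R, (forall j, (j < K)%N -> S j (r j)) -> \sum_(j < K) r j ^+ 2 <= Y) ->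
  \sum_(j < K) sup (S j) ^+ 2 <= Y.
Proof.
elim: K Y => [|K IH] Y ne hS.
  by have := hS (fun=> 0); rewrite !big_ord0; apply.
rewrite big_ord_recr/=.
have step r : S K r -> \sum_(j < K) sup (S j) ^+ 2 <= Y - r ^+ 2.
  move=> Sr; apply: IH => [j jK|r' hr']; first by apply: ne; exact: ltnW.
  rewrite lerBrDr; have := hS (fun j => if (j < K)%N then r' j else r).
  rewrite big_ord_recr/= ltnn (eq_bigr (fun j : 'I_K => r' j ^+ 2)) => [|j _]; last by rewrite ltn_ord.
  apply=> j; case: (ltnP j K) => jK jK1; first exact: hr'.
  by have -> : j = K by apply/eqP; rewrite eqn_leq jK -ltnS jK1.
have [r0 Sr0] := ne K (ltnSn K).
rewrite -lerBrDl; set Q := Y - _.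
have hQ r : S K r -> r ^+ 2 <= Q by move=> /step; rewrite /Q; lra.
have Q0 : 0 <= Q := le_trans (sqr_ge0 r0) (hQ _ Sr0).
have hQ' r : S K r -> - Num.sqrt Q <= r <= Num.sqrt Q.
  by move=> /hQ; rewrite sqr_le_bound// ler_norml.
rewrite sqr_le_bound// ler_norml; apply/andP; split.
  have /andP[h _] := hQ' _ Sr0; apply: le_trans h _.
  by apply: ub_le_sup => //; exists (Num.sqrt Q) => r /hQ'/andP[].
by apply: ge_sup; [exists r0|move=> r /hQ'/andP[]].
Qed.

Section weak_derivative_operations.
Context (R : realType) (d : nat).
Notation fct := ('rV[R]_d -> R).
Notation mu := (@lebesgue_measure R).
Variable Omega : set 'rV[R]_d.
Hypothesis oO : open Omega.
Hypothesis bO : bounded_set Omega.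
Hypothesis d0 : (0 < d)%N.
Variable T : R.
Notation L2 := (L2 Omega).
Notation H10 := (H10 Omega).
Notation Hm1 := (Hm1 Omega).
Notation ip := (ip Omega).
Notation nrm := (nrm Omega).
Notation gip := (gip Omega).
Notation gnrm := (gnrm Omega).
Notation dual_nrm := (dual_nrm Omega).
Notation eqae := (eqae Omega).
Implicit Types (u v : R -> fct) (g h : R -> fct -> R) (w : fct).
Let iS := ip_semi_inner oO.
Let nS := nrm_seminormed oO.
Let gS := gnrm_seminormed oO bO.
Let dS := dual_nrm_seminormed oO bO.

Lemma weak_dtP u g : is_weak_dt Omega T u g -> is_weak_dt Omega T u (weak_dt Omega T u).
Proof. by move=> ug; apply: (@xgetPex _ _ [set g | is_weak_dt Omega T u g]); exists g. Qed.

Lemma time_test_mul_aeint psi G : time_test T psi -> aeint mu `]0, T[ G ->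
  aeint mu `]0, T[ (fun t => psi t * G t) /\ aeint mu `]0, T[ (fun t => derive1 psi t * G t).
Proof.
move=> [dpsi _ _] aG; have mI := measurable_ioo 0 T.
have c0 : continuous psi.
  by move=> t; apply: differentiable_continuous; apply/derivable1_diffP; exact: (dpsi 0%N).
have c1 : continuous (derive1 psi).
  by move=> t; apply: differentiable_continuous; apply/derivable1_diffP; exact: (dpsi 1%N).
have cm (F : R -> R) : continuous F -> aeint mu `]0, T[ (fun t => F t * G t).
  move=> cF; have [K K0 hK] : exists2 K : R, 0 <= K & forall x, 0 <= x <= T -> `|F x| <= K.
    by apply: within_continuous_bounded; exact: continuous_subspaceT.
  apply: (aeint_mul_bounded mI (K := K)) => //.
  - by apply: aemeas_aeint; exact: continuous_aeint.
  - by move=> t; rewrite /= in_itv/= => /andP[h1 h2]; apply: hK; rewrite !ltW.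
by split; exact: cm.
Qed.

Lemma Xspace_ip u w : Xspace Omega T u -> L2 w -> aeint mu `]0, T[ (fun t => ip (u t) w).
Proof.
move=> Xu Lw; have [C hC] := ip_H10_pairing oO bO d0.
apply: aeint_congr (bochner2_pairing nS gS hC (bochner2_const 0 T nS Lw) Xu).
apply: (ae_mono _ (bochner2_mem Xu)) => t _ /H10_L2 Lt; exact: (siC iS).
Qed.

Lemma is_weak_dtB u v g h : Xspace Omega T u -> Xspace Omega T v ->
  is_weak_dt Omega T u g -> is_weak_dt Omega T v h ->
  is_weak_dt Omega T (fun t => u t - v t) (fun t => g t - h t).
Proof.
move=> Xu Xv [bg hg] [bh hh]; split; first exact: (bochner2B dS).
move=> psi w tpsi Hw; have Lw := H10_L2 Hw; have mI := measurable_ioo 0 T.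
have [_ a1] := time_test_mul_aeint tpsi (Xspace_ip Xu Lw).
have [_ a2] := time_test_mul_aeint tpsi (Xspace_ip Xv Lw).
have [a3 _] := time_test_mul_aeint tpsi (dual_ev_aeint oO bO bg Hw).
have [a4 _] := time_test_mul_aeint tpsi (dual_ev_aeint oO bO bh Hw).
transitivity (time_int 0 T (fun t => derive1 psi t * ip (u t) w) -
              time_int 0 T (fun t => derive1 psi t * ip (v t) w)).
  rewrite /time_int -(RintB mI a1 a2); apply: (Rintegral_ae_congr mI).
  apply: (ae_mono _ (ae_and (bochner2_mem Xu) (bochner2_mem Xv))) => t _ [/H10_L2 Lu /H10_L2 Lv].
  by rewrite (siBl iS Lu Lv Lw) mulrBr.
have -> : time_int 0 T (fun t => psi t * (g t - h t) w) =
    time_int 0 T (fun t => psi t * g t w) - time_int 0 T (fun t => psi t * h t w).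
  by rewrite /time_int -(RintB mI a3 a4); apply: eq_Rintegral => t _; rewrite -mulrBr.
by rewrite (hg _ _ tpsi Hw) (hh _ _ tpsi Hw) opprK opprB addrC.
Qed.

Lemma weak_dt_congr u v : (forall t, 0 < t < T -> eqae (u t) (v t)) ->
  weak_dt Omega T u = weak_dt Omega T v.
Proof.
move=> uv; rewrite /weak_dt; congr (xget _ _); apply/funext => g; apply/propext.
have E (psi : R -> R) w : time_int 0 T (fun t => derive1 psi t * ip (u t) w) =
    time_int 0 T (fun t => derive1 psi t * ip (v t) w).
  by apply: time_int_congr => t /uv e; rewrite (ip_eqae oO e (eqae_refl _ w)).
by split=> -[bg hg]; split => // psi w tpsi Hw; rewrite -(hg _ _ tpsi Hw) E.
Qed.

Lemma Ynrm_congr u v : 0 <= T -> (forall t, 0 <= t <= T -> eqae (u t) (v t)) ->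
  Ynrm Omega T u = Ynrm Omega T v.
Proof.
move=> T0 uv; have uv' t : 0 < t < T -> eqae (u t) (v t).
  by move=> /andP[h1 h2]; apply: uv; rewrite !ltW.
have TT : 0 <= T <= T by rewrite T0 lexx.
have eT : nrm (u T) = nrm (v T) := nrm_eqae oO (uv T TT).
have E : time_int 0 T (fun t => dual_nrm (weak_dt Omega T u t) ^+ 2 + gnrm (u t) ^+ 2) =
    time_int 0 T (fun t => dual_nrm (weak_dt Omega T v t) ^+ 2 + gnrm (v t) ^+ 2).
  by rewrite (weak_dt_congr uv'); apply: time_int_congr => t /uv' /(gnrm_eqae oO) ->.
exact: (f_equal (fun x => Num.sqrt x) (f_equal2 (fun x y => x + y ^+ 2) E eT)).
Qed.

(** A function that is continuous in time does not contribute to the jump. *)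
Lemma jump_right_limit (ts : nat -> R) u v j a w : ts j = a ->
  L2 (u a) -> L2 (v a) -> L2 w -> (\forall t \near a^'+, L2 (u t) /\ L2 (v t)) ->
  L2_cvg Omega a^'+ u (u a) -> L2_cvg Omega a^'+ v w ->
  eqae (jump Omega ts (u - v) j) (- (v a - w)).
Proof.
move=> <- {a}; set a := ts j => Lu Lv Lw nL hu hv; have sL := L2_subspace oO.
have LD : L2 (u a - w) := ssB sL Lu Lw.
have [Lr er] : L2 (right_limit Omega (u - v) a) /\ eqae (right_limit Omega (u - v) a) (u a - w).
  apply: right_limitP => //.
    by apply: filterS nL => t [Lt Lt']; exact: (ssB sL).
  apply: (@squeeze_cvgr _ _ _ _ (fun=> 0) (fun t => nrm (u t - u a) + nrm (v t - w))).
  - apply: filterS nL => t [Lt Lt'].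
    have -> : (u - v) t - (u a - w) = (u t - u a) - (v t - w).
      by rewrite [LHS](_ : _ = (u t - v t) - (u a - w))// !opprD !opprK addrACA.
    have L1 := ssB sL Lt Lu; have L2' := ssB sL Lt' Lw.
    by rewrite (sn_ge0 nS (ssB sL L1 L2')) (snB nS L1 L2').
  - exact: cvg_cst.
  - by rewrite -[X in _ --> X](addr0 (0 : R)); exact: cvgD hu hv.
have E : - (v a - w) = (u a - v a) - (u a - w) by rewrite !opprB [RHS]addrC addrA subrK.
by rewrite E; apply: eqaeB => //; exact: eqae_refl.
Qed.

Lemma L2_continuous_right u a b : 0 <= a -> a < b -> b <= T -> L2_continuous Omega T u ->
  L2_cvg Omega a^'+ u (u a) /\ (\forall t \near a^'+, L2 (u t)).
Proof.
move=> a0 ab bT cu.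
have nr : \forall t \near a^'+, 0 <= t <= T.
  near=> t; apply/andP; split; near: t.
    by apply: filterS (nbhs_right_gt a) => t /ltW; exact: le_trans.
  by apply: filterS (nbhs_right_lt ab) => t /ltW h; exact: le_trans h bT.
split; last by apply: filterS nr => t /cu[].
have aT : 0 <= a <= T by rewrite a0 (le_trans (ltW ab)).
have [_ l] := cu a aT.
apply: cvg_trans l; apply: cvg_app => A; rewrite /within/= => hA.
rewrite /at_right /within /=.
have h1 : \forall t \near a^'+, 0 <= t <= T -> A t.
  have hA' : \forall t \near a, 0 <= t <= T -> A t.
    have hA2 : nbhs a (fun t => `[0, T]%classic t -> A t) := hA.
    by apply: filterS hA2 => t h ht; apply: h; rewrite /= in_itv.
  by rewrite /at_right near_withinE; apply: filterS hA' => t h _.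
by apply: filterS2 nr h1 => t ht /(_ ht).
Unshelve. all: by end_near.
Qed.
End weak_derivative_operations.

Section error_estimate.
Context (R : realType) (d : nat).
Notation fct := ('rV[R]_d -> R).
Notation mu := (@lebesgue_measure R).
Variable Omega : set 'rV[R]_d.
Hypothesis oO : open Omega.
Hypothesis bO : bounded_set Omega.
Hypothesis d0 : (0 < d)%N.
Notation L2 := (L2 Omega).
Notation H10 := (H10 Omega).
Notation Hm1 := (Hm1 Omega).
Notation ip := (ip Omega).
Notation nrm := (nrm Omega).
Notation gip := (gip Omega).
Notation gnrm := (gnrm Omega).
Notation dual_nrm := (dual_nrm Omega).
Notation eqae := (eqae Omega).
Variables (T : R) (N : nat) (ts : nat -> R) (q : nat -> nat) (M : nat -> mesh R d).
Hypothesis T0 : 0 < T.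
Hypothesis hts : time_partition T N ts.
Let lt j (jN : (j < N)%N) : ts j < ts j.+1 := partition_lt hts jN.
Let iS := ip_semi_inner oO.
Let nS := nrm_seminormed oO.
Let gI := gip_semi_inner oO bO.
Let gS := gnrm_seminormed oO bO.
Let dS := dual_nrm_seminormed oO bO.
Let sL := L2_subspace oO.
Let sH := H10_subspace oO bO.
Variable uh : R -> fct.
Hypothesis huh : Vht Omega T N ts q M uh.
Variable c : nat -> nat -> fct.
Hypothesis hc : forall j, (j < N)%N ->
  (forall k, (k < (q j.+1).+1)%N -> Vh Omega (M j.+1) (c j k)) /\
    forall t, ts j < t < ts j.+1 ->
      Vh Omega (M j.+1) (uh t) /\ eqae (uh t) (curve (q j.+1).+1 (@monomials R) (c j) t).
Variable f : R -> fct.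
Hypothesis hf : bochner2 L2 nrm 0 T f.
Variable u : R -> fct.
Hypothesis Xu : Xspace Omega T u.
Hypothesis cu : L2_continuous Omega T u.
Notation du := (weak_dt Omega T u).
Hypothesis hdu : is_weak_dt Omega T u du.
Hypothesis hweak : forall v : R -> fct, Xspace Omega T v ->
  time_int 0 T (fun t => du t (v t) + gip (u t) (v t)) = time_int 0 T (fun t => ip (f t) (v t)).
Notation Iuh := (reconstruction Omega N ts q uh).
Notation up j := (right_limit Omega uh (ts j)).
Notation J j := (jump Omega ts uh j).
Notation dI := (rec_dt Omega N ts q uh c).
Notation res := (residual Omega N ts q uh c f).
Notation err := (fun t => u t - Iuh t).

Let ts0 : ts 0%N = 0. Proof. by case: hts. Qed.
Let tsN : ts N = T. Proof. by case: hts. Qed.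
Let XI : Xspace Omega T Iuh := rec_Xspace oO bO hts huh hc.
Let hdI : is_weak_dt Omega T Iuh dI := rec_is_weak_dt oO bO d0 hts huh hc.
Let Xerr : Xspace Omega T err := bochner2B gS Xu XI.
Notation G := (weak_dt Omega T err).

Lemma err_is_weak_dt : is_weak_dt Omega T err (fun t => du t - dI t).
Proof. exact: (is_weak_dtB oO bO d0 Xu XI hdu hdI). Qed.

Lemma weak_dt_err v : Xspace Omega T v ->
  {ae mu, forall t, `]0, T[%classic t -> G t (v t) = du t (v t) - dI t (v t)}.
Proof. exact: (weak_dt_unique oO bO (weak_dtP err_is_weak_dt) err_is_weak_dt). Qed.

Let bG : bochner2 Hm1 dual_nrm 0 T G. Proof. by case: (weak_dtP err_is_weak_dt). Qed.
Let bdu : bochner2 Hm1 dual_nrm 0 T du. Proof. by case: hdu. Qed.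
Let bdI : bochner2 Hm1 dual_nrm 0 T dI. Proof. by case: hdI. Qed.

Let ev_aeint g v : bochner2 Hm1 dual_nrm 0 T g -> Xspace Omega T v ->
  aeint mu `]0, T[ (fun t => g t (v t)).
Proof. by move=> bg Xv; exact: (bochner2_pairing dS gS (ev_pairing oO bO) bg Xv). Qed.
Let gip_aeint v z : Xspace Omega T v -> Xspace Omega T z ->
  aeint mu `]0, T[ (fun t => gip (v t) (z t)).
Proof. by move=> Xv Xz; exact: (bochner2_pairing gS gS (gip_pairing oO bO) Xv Xz). Qed.

(** The weak formulation, tested with [v] cut off to the interval, exchanges
    the data for [u]. *)
Lemma residual_is_error j v : (j < N)%N -> Xspace Omega T v ->
  time_int (ts j) (ts j.+1) (fun t => res t (v t)) =
  time_int (ts j) (ts j.+1) (fun t => G t (v t) + gip (err t) (v t)).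
Proof.
move=> jN Xv; have mI := measurable_ioo 0 T; have mJ := measurable_ioo (ts j) (ts j.+1).
have sub : `]ts j, ts j.+1[%classic `<=` (`]0, T[%classic : set R).
  apply: itv_oo_sub; rewrite -?ts0 -?tsN; apply: (partition_le (partition_lt hts)) => //; exact: ltnW.
pose z t := (\1_(`]ts j, ts j.+1[%classic) t : R) *: v t.
have Xz : Xspace Omega T z := bochner2_indic gS mJ Xv.
have aA := aeintD mI (ev_aeint bG Xv) (gip_aeint Xerr Xv).
have aB := residual_aeint oO bO d0 hts huh hc hf Xv.
apply/eqP; rewrite -subr_eq0 /time_int -(RintB mJ); last 2 first.
- exact: (aeint_subset mI mJ sub aB).
- exact: (aeint_subset mI mJ sub aA).
have [C hC] := ip_H10_pairing oO bO d0.
have a1 := aeintD mI (ev_aeint bdu Xz) (gip_aeint Xu Xz).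
have a2 : aeint mu `]0, T[ (fun t => ip (f t) (z t)) := bochner2_pairing nS gS hC hf Xz.
have := hweak Xz => /eqP; rewrite -subr_eq0 /time_int -(RintB mI a1 a2) => /eqP hz.
rewrite -(Rint_indic mu _ mI mJ sub); apply/eqP.
transitivity (\int[mu]_(t in `]0, T[) (- (du t (z t) + gip (u t) (z t) - ip (f t) (z t)))); last first.
  by rewrite (RintN mI (aeintB mI a1 a2)) hz oppr0.
apply: (Rintegral_ae_congr mI).
apply: (ae_mono _ (ae_and (weak_dt_err Xv) (ae_and (bochner2_mem Xv) (ae_and (bochner2_mem XI)
  (ae_and (bochner2_mem Xu) (ae_and (bochner2_mem hf) (bochner2_mem bdu))))))) => t _.
move=> [eG [Hv [HI [Hu [Lf Hd]]]]]; have Hz := ssZ (\1_(`]ts j, ts j.+1[%classic) t : R) sH Hv.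
rewrite /z (Hm1Z oO bO _ Hd Hv) (siZr gI _ Hv Hu) (siZr iS _ (H10_L2 Hv) Lf) eG /residual.
by rewrite (siBl gI Hu HI Hv); exact: residual_swap.
Qed.

Let pw_u := pw_cross oO bO (partition_lt hts) ts0 tsN (rec_H10 oO bO hts huh hc)
  (fun t h => rec_L2 oO bO hts huh hc h) (rec_pieces oO bO hts huh hc) cu hdu.
Let pw_I := pw_self_cross oO bO d0 (partition_lt hts) ts0 tsN (rec_H10 oO bO hts huh hc)
  (fun t h => rec_L2 oO bO hts huh hc h) (rec_pieces oO bO hts huh hc).

(** The energy inequality for [u] alone, the product rule for [u] with the
    reconstruction, and the one for the reconstruction with itself. *)
Lemma error_energy : 2 * time_int 0 T (fun t => G t (err t)) <= nrm (err T) ^+ 2.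
Proof.
have mI := measurable_ioo 0 T.
have b1 := ev_aeint bdu Xu; have b2 := ev_aeint bdu XI.
have b3 := ev_aeint bdI Xu; have b4 := ev_aeint bdI XI.
have eu := energy_inequality oO bO T0 d0 Xu cu hdu hf hweak.
have eI : 2 * time_int 0 T (fun t => dI t (Iuh t)) = nrm (Iuh T) ^+ 2 - nrm (Iuh 0) ^+ 2.
  rewrite -pw_I -/dI /time_int (RintD mI b4 b4); ring.
have ex : time_int 0 T (fun t => dI t (u t)) + time_int 0 T (fun t => du t (Iuh t)) =
    ip (u T) (Iuh T) - ip (u 0) (Iuh 0).
  by rewrite -pw_u -/dI /time_int (RintD mI b3 b2).
have -> : time_int 0 T (fun t => G t (err t)) =
    time_int 0 T (fun t => du t (u t)) - time_int 0 T (fun t => du t (Iuh t))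
    - (time_int 0 T (fun t => dI t (u t)) - time_int 0 T (fun t => dI t (Iuh t))).
  rewrite /time_int -(RintB mI b1 b2) -(RintB mI b3 b4) -(RintB mI (aeintB mI b1 b2) (aeintB mI b3 b4)).
  apply: (Rintegral_ae_congr mI).
  apply: (ae_mono _ (ae_and (weak_dt_err Xerr) (ae_and (bochner2_mem XI)
    (ae_and (bochner2_mem Xu) (ae_and (bochner2_mem bdI) (bochner2_mem bdu)))))) => t _.
  by move=> [-> [HI [Hu [hI hd]]]]; rewrite (Hm1B oO bO hd Hu HI) (Hm1B oO bO hI Hu HI).
have TT : 0 <= T <= T by rewrite lexx ltW.
have OT : 0 <= (0 : R) <= T by apply/andP; split; rewrite ?lexx// ltW.
have [LuT _] := cu TT; have [Lu0 _] := cu OT.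
have LIT := rec_L2 oO bO hts huh hc TT; have LI0 := rec_L2 oO bO hts huh hc OT.
have n1 := siBB iS LuT LIT; have n0 := siBB iS Lu0 LI0.
have p0 := si_ge0 iS (ssB sL Lu0 LI0).
move: eu eI ex n1 n0 p0.
rewrite -(nrm_sqr oO LuT) -(nrm_sqr oO LIT) -(nrm_sqr oO Lu0) -(nrm_sqr oO LI0).
rewrite -(nrm_sqr oO (ssB sL LuT LIT)) -(nrm_sqr oO (ssB sL Lu0 LI0)).
exact: energy_balance.
Qed.

Let piece_bnd j (jN : (j < N)%N) : 0 <= ts j /\ ts j.+1 <= T.
Proof. by rewrite -ts0 -tsN; split; apply: (partition_le (partition_lt hts)) => //; exact: ltnW. Qed.

Let piece_sub j (jN : (j < N)%N) : `]ts j, ts j.+1[%classic `<=` (`]0, T[%classic : set R).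
Proof. by have [h1 h2] := piece_bnd jN; exact: itv_oo_sub. Qed.

(** One test function on the whole time interval, carrying a multiple of the
    local test function of each interval. *)
Definition assemble (r : nat -> R) (v : nat -> R -> fct) (t : R) : fct :=
  \sum_(j < N) r j *: ((\1_(`]ts j, ts j.+1[%classic) t : R) *: v j t).

Lemma assemble_in r v j t : (j < N)%N -> ts j < t < ts j.+1 -> assemble r v t = r j *: v j t.
Proof.
move=> jN tj; rewrite /assemble -(step_in (partition_lt hts) (fun j => r j *: v j t) jN tj).
by apply: eq_bigr => i _; rewrite scalerA mulrC -scalerA.
Qed.

Section assembled.
Variables (r : nat -> R) (v : nat -> R -> fct).
Hypothesis Xv : forall j, (j < N)%N -> Xspace Omega T (v j).
Notation V := (assemble r v).

Lemma assemble_Xspace : Xspace Omega T V.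
Proof.
apply: (bochner2_sum gS) => j _; apply: (bochner2Z gS).
by apply: (bochner2_indic gS (measurable_ioo _ _)); exact: Xv.
Qed.

Lemma assemble_residual :
  time_int 0 T (fun t => G t (V t) + gip (err t) (V t)) =
  \sum_(j < N) r j * time_int (ts j) (ts j.+1) (fun t => res t (v j t)).
Proof.
have XV := assemble_Xspace; have mI := measurable_ioo 0 T.
have aV := aeintD mI (ev_aeint bG XV) (gip_aeint Xerr XV).
rewrite -{1}ts0 -{1}tsN (time_int_partition (partition_lt hts)) ?ts0 ?tsN//.
apply: eq_bigr => j _; have jN := ltn_ord j; have [h1 h2] := piece_bnd jN.
have mJ := measurable_ioo (ts j) (ts j.+1).
rewrite (residual_is_error jN (Xv jN)) /time_int -(RintZ mJ); last first.
  apply: (aeint_subset mI mJ (piece_sub jN)).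
  exact: (aeintD mI (ev_aeint bG (Xv jN)) (gip_aeint Xerr (Xv jN))).
apply: (Rintegral_ae_congr mJ).
apply: (ae_mono _ (ae_sub_itv h1 h2 (ae_and (bochner2_mem bG)
  (ae_and (bochner2_mem Xerr) (bochner2_mem (Xv jN)))))) => t.
rewrite /= in_itv/= => tj [hG [He Hv]].
by rewrite (assemble_in _ _ jN tj) (Hm1Z oO bO _ hG Hv) (siZr gI _ Hv He) mulrDr.
Qed.

Lemma assemble_norm : (forall j, (j < N)%N -> Xnrm Omega T (v j) = 1) ->
  time_int 0 T (fun t => gnrm (V t) ^+ 2) <= \sum_(j < N) r j ^+ 2.
Proof.
move=> v1; have XV := assemble_Xspace; have mI := measurable_ioo 0 T.
have aV := Xspace_sqr oO bO XV.
rewrite -{1}ts0 -{1}tsN (time_int_partition (partition_lt hts)) ?ts0 ?tsN//.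
apply: ler_sum => j _; have jN := ltn_ord j; have [h1 h2] := piece_bnd jN.
have mJ := measurable_ioo (ts j) (ts j.+1).
have aj := Xspace_sqr oO bO (Xv jN).
have -> : time_int (ts j) (ts j.+1) (fun t => gnrm (V t) ^+ 2) =
    r j ^+ 2 * time_int (ts j) (ts j.+1) (fun t => gnrm (v j t) ^+ 2).
  rewrite /time_int -(RintZ mJ _ (aeint_subset mI mJ (piece_sub jN) aj)).
  apply: (Rintegral_ae_congr mJ).
  apply: (ae_mono _ (ae_sub_itv h1 h2 (bochner2_mem (Xv jN)))) => t.
  rewrite /= in_itv/= => tj Hv.
  by rewrite (assemble_in _ _ jN tj) (snZ gS _ Hv) exprMn real_normK ?num_real.
rewrite -[leRHS]mulr1; apply: ler_wpM2l; first exact: sqr_ge0.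
rewrite -[leRHS](expr1n _ 2) -(v1 j jN) (Xnrm_sqr Omega T (v j)).
by apply: (time_int_sub_le h1 (ltW (lt jN)) h2 aj); apply: aeW => t _; exact: sqr_ge0.
Qed.
End assembled.

Lemma Ynrm_sqr : Ynrm Omega T err ^+ 2 =
  time_int 0 T (fun t => dual_nrm (G t) ^+ 2) + time_int 0 T (fun t => gnrm (err t) ^+ 2)
  + nrm (err T) ^+ 2.
Proof.
have mI := measurable_ioo 0 T.
rewrite /Ynrm sqr_sqrtr; last first.
  apply: addr_ge0; last exact: sqr_ge0.
  by apply: (Rint_ge0_ae mI); apply: aeW => t _; apply: addr_ge0; exact: sqr_ge0.
by rewrite /time_int (RintD mI (bochner2_sqr dS bG) (Xspace_sqr oO bO Xerr)).
Qed.

(** Expansion of [0 <= dual_nrm G ^+ 2 + 2 * G (err - V) + gnrm (err - V) ^+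
    2], where [G] is the time derivative of the error and [V] is assembled
    from the local test functions; [error_energy] bounds [G (err)]. *)
Lemma assembled_bound (r : nat -> R) :
  (forall j, (j < N)%N -> exists v, [/\ Xspace Omega T v, Xnrm Omega T v = 1 &
     time_int (ts j) (ts j.+1) (fun t => res t (v t)) = r j]) ->
  \sum_(j < N) r j ^+ 2 <= Ynrm Omega T err ^+ 2.
Proof.
move=> hr; have mI := measurable_ioo 0 T.
have : forall j, exists v : R -> fct, (j < N)%N -> [/\ Xspace Omega T v, Xnrm Omega T v = 1 &
     time_int (ts j) (ts j.+1) (fun t => res t (v t)) = r j].
  by move=> j; case: (ltnP j N) => [/hr[v hv]|_]; [exists v|exists (fun=> 0)].
move=> /choice[v hv].
have Xv j : (j < N)%N -> Xspace Omega T (v j) by case/hv.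
have nV := assemble_norm r Xv (fun j jN => let: And3 _ h _ := hv j jN in h).
have rV := assemble_residual r Xv; have XV := assemble_Xspace r Xv.
set V := assemble r v in nV rV XV.
have aGe := ev_aeint bG Xerr; have aGV := ev_aeint bG XV; have aeV := gip_aeint Xerr XV.
have ad := bochner2_sqr dS bG; have ae := Xspace_sqr oO bO Xerr; have aV := Xspace_sqr oO bO XV.
have rE : time_int 0 T (fun t => G t (V t)) + time_int 0 T (fun t => gip (err t) (V t)) =
    \sum_(j < N) r j ^+ 2.
  rewrite /time_int -(RintD mI aGV aeV) -/(time_int _ _ _) rV; apply: eq_bigr => j _.
  by have [_ _ ->] := hv j (ltn_ord j); rewrite expr2.
have key : 0 <= time_int 0 T (fun t => dual_nrm (G t) ^+ 2)
    + 2 * (time_int 0 T (fun t => G t (err t)) - time_int 0 T (fun t => G t (V t)))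
    + (time_int 0 T (fun t => gnrm (err t) ^+ 2) - 2 * time_int 0 T (fun t => gip (err t) (V t))
       + time_int 0 T (fun t => gnrm (V t) ^+ 2)).
  have a1 := aeintB mI aGe aGV; have a2 := aeintZ mI 2 a1; have a3 := aeintD mI ad a2.
  have b1 := aeintZ mI 2 aeV; have b2 := aeintB mI ae b1; have b3 := aeintD mI b2 aV.
  rewrite /time_int -(RintB mI aGe aGV) -(RintZ mI 2 a1) -(RintD mI ad a2).
  rewrite -(RintZ mI 2 aeV) -(RintB mI ae b1) -(RintD mI b2 aV) -(RintD mI a3 b3).
  apply: (Rint_ge0_ae mI).
  apply: (ae_mono _ (ae_and (bochner2_mem bG) (ae_and (bochner2_mem Xerr) (bochner2_mem XV)))).
  move=> t _ [hG [He HV]]; have Hz := ssB sH He HV.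
  have := dual_nrmP oO bO hG Hz; rewrite (Hm1B oO bO hG He HV) ler_norml => /andP[h _].
  have E : gnrm (err t - V t) ^+ 2 = gnrm (err t) ^+ 2 - 2 * gip (err t) (V t) + gnrm (V t) ^+ 2.
    apply: (etrans (gnrm_sqr oO bO Hz) (etrans (siBB gI He HV) _)).
    by rewrite -(gnrm_sqr oO bO He) -(gnrm_sqr oO bO HV).
  rewrite -E; exact: square_expansion h.
rewrite Ynrm_sqr; exact: (assembled_balance key rE nV error_energy).
Qed.

Lemma residual_sum :
  \sum_(j < N) residual_nrm Omega T ts f Iuh j.+1 ^+ 2 <= Ynrm Omega T err ^+ 2.
Proof.
pose E := [set v | Xspace Omega T v /\ Xnrm Omega T v = 1].
have [E0|/set0P[v0 Ev0]] := eqVneq E set0.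
  rewrite big1 ?sqr_ge0// => j _.
  by rewrite /residual_nrm -/E E0 image_set0 sup0 expr0n.
pose S j := [set intI ts j.+1 (fun t => ip (f t) (v t) - weak_dt Omega T Iuh t (v t)
  - gip (Iuh t) (v t)) | v in E].
apply: (@sum_sqr_sup _ N S) => [j jN|r hr]; first by eexists; exists v0.
apply: assembled_bound => j jN; have [v [Xv v1] <-] := hr j jN.
by exists v; split => //; rewrite -(residualE oO bO d0 hts huh hc f jN Xv).
Qed.

Lemma jump_error j : (j < N)%N -> eqae (jump Omega ts (u - uh) j) (- J j).
Proof.
move=> jN; have [h1 h2] := piece_bnd jN; have ab := lt jN.
have Lup : L2 (up j) := H10_L2 (Vh_H10 (dg_right oO bO hts hc jN).1).
have hc' t : ts j < t < ts j.+1 -> L2 (uh t) /\ eqae (uh t) (curve (q j.+1).+1 (@monomials R) (c j) t).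
  by move=> /((hc jN).2)[/Vh_H10 /H10_L2].
have Lc k : (k < (q j.+1).+1)%N -> L2 (c j k) by move=> /((hc jN).1)/Vh_H10/H10_L2.
have [ru nu] := L2_continuous_right h1 ab h2 cu.
have nj : \forall t \near (ts j)^'+, ts j < t < ts j.+1.
  near=> t; apply/andP; split; near: t; [exact: nbhs_right_gt|exact: nbhs_right_lt].
have jT : 0 <= ts j <= T by rewrite h1 (le_trans (ltW ab)).
apply: (jump_right_limit oO erefl) => //.
- by case: (cu jT).
- by apply: H10_L2; exact: (dg_node_H10 oO bO hts huh hc (ltnW jN)).
- by apply: filterS2 nu nj => t Lt /hc'[].
have cc : nrm (curve (q j.+1).+1 (@monomials R) (c j) s -
    curve (q j.+1).+1 (@monomials R) (c j) (ts j)) @[s --> (ts j)^'+] --> (0 : R).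
  by apply: cvg_at_right_filter; exact: (curve_continuous _ _ nS Lc).
apply: cvg_trans cc; apply: near_eq_cvg; apply: filterS nj => t /hc'[_ e].
apply: (nrm_eqae oO); apply: eqaeB; first exact: eqae_sym.
by apply: eqae_sym; exact: (dg_right oO bO hts hc jN).2.
Unshelve. all: by end_near.
Qed.

(** The jumps of [u - uh] are the opposites of those of [uh]. *)
Lemma reconstruction_error_eqae t : 0 <= t <= T ->
  eqae (reconstruction Omega N ts q (u - uh) t) (err t).
Proof.
move=> /andP[t0 tT]; have [[j jN tj]|nt] := pselect (exists2 j, (j < N)%N & ts j < t <= ts j.+1).
  rewrite (reconstruction_in _ _ hts _ jN tj) (reconstruction_in _ _ hts _ jN tj).
  have -> : u t - (uh t + (correction ts q j).[t] *: J j) =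
      (u - uh) t + (correction ts q j).[t] *: (- J j) by rewrite opprD addrA scalerN.
  apply: eqaeD; first exact: eqae_refl.
  by apply: eqaeZ; exact: jump_error.
have node j : (j <= N)%N -> t = ts j -> eqae (reconstruction Omega N ts q (u - uh) t) (err t).
  by move=> jN ->; rewrite !(reconstruction_node _ _ hts)//; exact: eqae_refl.
have [[j jN tj]|hn] := pselect (exists2 j, (j <= N)%N & t = ts j); first exact: node jN tj.
have h j : (j <= N)%N -> t != ts j by move=> jN; apply: contra_notN hn => /eqP ->; exists j.
have tI : ts 0%N < t < ts N by rewrite !lt_neqAle (h N)// eq_sym h// ts0 tsN t0 tT.
have [i iN ti] := partition_find tI h; exfalso; apply: nt; exists i => //.
by have /andP[-> /ltW] := ti.
Qed.

Lemma EYnrm_sqr : EYnrm Omega T N ts q (u - uh) ^+ 2 =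
  Ynrm Omega T err ^+ 2 + \sum_(j < N) intI ts j.+1 (fun t => gnrm (uh t - Iuh t) ^+ 2).
Proof.
have mI := measurable_ioo 0 T; have [Xuh _ _ _] := huh.
have XD : Xspace Omega T (fun t => uh t - Iuh t) := bochner2B gS Xuh XI.
have eY : Ynrm Omega T (reconstruction Omega N ts q (u - uh)) = Ynrm Omega T err.
  exact: (Ynrm_congr oO (ltW T0) reconstruction_error_eqae).
have eX : Xnrm Omega T (u - uh - reconstruction Omega N ts q (u - uh)) ^+ 2 =
    \sum_(j < N) intI ts j.+1 (fun t => gnrm (uh t - Iuh t) ^+ 2).
  rewrite /Xnrm sqr_sqrtr; last first.
    by apply: (Rint_ge0_ae mI); apply: aeW => t _; exact: sqr_ge0.
  rewrite -(time_int_partition (partition_lt hts)) ?ts0 ?tsN; last exact: (Xspace_sqr oO bO XD).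
  apply: (Rintegral_ae_congr mI); apply: (ae_mono _ (bochner2_mem XD)) => t.
  rewrite /= in_itv/= => /andP[/ltW t1 /ltW t2] HD.
  have tT : 0 <= t <= T by rewrite t1.
  have e : eqae ((u - uh - reconstruction Omega N ts q (u - uh)) t) (- (uh t - Iuh t)).
    have -> : - (uh t - Iuh t) = (u t - uh t) - (u t - Iuh t).
      by rewrite !opprB [RHS]addrC addrA subrK.
    apply: eqaeB; first exact: eqae_refl.
    exact: reconstruction_error_eqae.
  by rewrite (gnrm_eqae oO e) (snN gS HD).
rewrite -eX -eY /EYnrm; apply: sqr_sqrtr.
by apply: addr_ge0; exact: sqr_ge0.
Qed.
End error_estimate.

Lemma global_balance (R : realFieldType) (Y E S I : R) : E <= 8 * S + I -> S <= Y ->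
  Y + E <= 9 * Y + I.
Proof. lra. Qed.

Theorem theorem5p1
  (R : realType) (d : nat) (hd : (1 <= d <= 3)%N)
  (Omega : set 'rV[R]_d) (hOmega : polyhedral_lipschitz_domain Omega)
  (T : R) (hT : 0 < T)
  (f : R -> 'rV[R]_d -> R) (hf : bochner2 (L2 Omega) (nrm Omega) 0 T f)
  (u0 : 'rV[R]_d -> R) (hu0 : L2 Omega u0)
  (N : nat) (ts : nat -> R) (hts : time_partition T N ts) (q : nat -> nat)
  (kappa : R) (M : nat -> mesh R d) (Mref : nat -> mesh R d)
  (hM : forall n, (n <= N)%N ->
     [/\ matching_simplicial Omega (M n), shape_regular kappa (M n) &
         forall K : 'I_(ncell (M n)), (1 <= mdeg K)%N])
  (hMref : forall n, (1 <= n <= N)%N ->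
     [/\ matching_simplicial Omega (Mref n), shape_regular kappa (Mref n),
         refines (Mref n) (M n.-1), refines (Mref n) (M n) &
         forall v w, Vh Omega (M n.-1) v -> Vh Omega (M n) w ->
           Vh Omega (Mref n) (v + w)])
  (u : R -> 'rV[R]_d -> R) (hu : weak_solution Omega T f u0 u)
  (piu0 : 'rV[R]_d -> R) (hpiu0 : Vh Omega (M 0%N) piu0)
  (uh : R -> 'rV[R]_d -> R)
  (huh : numerical_solution Omega T N ts q M f piu0 uh)
  (ftau : R -> 'rV[R]_d -> R)
  (hftau : temporal_data_approx Omega N ts q f ftau)
  (P : nat -> ('rV[R]_d -> R) -> 'rV[R]_d -> R)
  (hP : forall n, (1 <= n <= N)%N ->
     elliptic_projection Omega (Vh Omega (M n)) (P n)) :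
  let Iuh := reconstruction Omega N ts q uh in
  let indicator n := Num.min (eta_C Omega ts q P uh n ^+ 2)
                             (8 * eta_osc Omega ts f ftau n ^+ 2) in
  (forall n, (1 <= n <= N)%N ->
     intI ts n (fun t => gnrm Omega (uh t - Iuh t) ^+ 2)
       <= 8 * residual_nrm Omega T ts f Iuh n ^+ 2 + indicator n) /\
  (Ynrm Omega T (u - Iuh) ^+ 2 <= EYnrm Omega T N ts q (u - uh) ^+ 2 /\
   EYnrm Omega T N ts q (u - uh) ^+ 2
     <= 9 * Ynrm Omega T (u - Iuh) ^+ 2
        + \sum_(1 <= n < N.+1) indicator n).
Proof.
move=> Iuh indicator.
have oO : open Omega by case: hOmega.
have bO : bounded_set Omega by case: hOmega.
have d0 : (0 < d)%N by case/andP: hd.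
have [huV _ hscheme] := huh; have [[Xu cu hdu] _ hweak] := hu.
have [c hc] := Vht_curves huV.
have hdu' : is_weak_dt Omega T u (weak_dt Omega T u) by case: hdu => g /weak_dtP.
have local j (jN : (j < N)%N) :
    intI ts j.+1 (fun t => gnrm Omega (uh t - Iuh t) ^+ 2)
    <= 8 * residual_nrm Omega T ts f Iuh j.+1 ^+ 2 + indicator j.+1 :=
  local_estimate oO bO d0 hT hts huV hc hf hscheme hP hftau jN.
have EY := EYnrm_sqr oO bO hT hts huV hc cu.
have SR := residual_sum oO bO d0 hT hts huV hc hf Xu cu hdu' hweak.
split; first by case=> // n /andP[_]; exact: local.
split.
  rewrite EY lerDl; apply: sumr_ge0 => j _; apply: (Rint_ge0_ae (measurable_ioo _ _)).
  by apply: aeW => t _; exact: sqr_ge0.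
have -> : \sum_(1 <= n < N.+1) indicator n = \sum_(j < N) indicator j.+1.
  by rewrite big_add1 /= big_mkord.
have LS : \sum_(j < N) intI ts j.+1 (fun t => gnrm Omega (uh t - Iuh t) ^+ 2) <=
    8 * (\sum_(j < N) residual_nrm Omega T ts f Iuh j.+1 ^+ 2) + \sum_(j < N) indicator j.+1.
  rewrite mulr_sumr -big_split/=.
  by apply: ler_sum => j _; exact: local.
rewrite EY; exact: (global_balance LS SR).
Qed.
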